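(* Let $g$ be an HCMU metric on a compact Riemann surface $M$ with character 1-form $\omega$. Suppose the Gauss curvature of $g$ is $K$, with maximum $K_1$ and minimum $K_2$. Denote $p=p(K)=-\frac13(K-K_1)(K-K_2)(K+K_1+K_2)$, so that $g=4p\,\omega\bar\omega$, and denote $M^{*}=M\setminus\{\text{zeros and poles of }\omega\}$. Let $\mathbb{Q}^3_c$ be the 3-dimensional space form of constant sectional curvature $c$. For any point $P\in M^{*}$, there exist a neighborhood $U\subseteq M^{*}$ of $P$ and an isometric immersion $F:U\to\mathbb{Q}^3_c$ which is a Weingarten surface without umbilical points if and only if there exists a real constant $A$ such that the mean curvature $H$ of $F$ satisfies $$H'=\frac{p-2p'(H^{2}-K+c)}{2\left[pH\pm\sqrt{p^{2}(H^{2}-K+c)-A^{2}}\,\right]},$$ where $'$ denotes $\frac{d}{dK}$.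
   Context: HCMU metrics. Let $M$ be a compact Riemann surface and $P_1,\dots,P_N\in M$. A conformal metric $g$ on $M\setminus\{P_1,\dots,P_N\}$, locally $g=e^{2\varphi}|dz|^2$, is called an HCMU metric on $M$ if its Gauss curvature $K$ is not constant and satisfies $K_{,zz}=0$ (the $zz$-component of the second-order covariant derivative of $K$ vanishes); equivalently, $\nabla K:=\sqrt{-1}\,e^{-2\varphi}K_{\bar z}\frac{\partial}{\partial z}$ is a holomorphic vector field on $M\setminus\{P_1,\dots,P_N\}$. HCMU metrics are always assumed to have finite area $\int dg<+\infty$ and finite Calabi energy $\int K^2\,dg<+\infty$. The field $\nabla K$ is actually a meromorphic vector field on $M$; the character 1-form $\omega$ of $g$ is the dual meromorphic 1-form defined by $\omega(\nabla K)=\frac{\sqrt{-1}}{4}$. The curvature $K$ extends continuously to $M$. Its maximum $K_1$ and minimum $K_2$ satisfy $K_1>0$, $K_1>K_2>-(K_1+K_2)$ if all singularities of $g$ are conical, and $K_1>0$, $K_2=-\frac12K_1$ if some singularities are cusps. With $p(K)$ as in the claim, away from the singularities and the smooth extremal points of $K$, one has $\frac{dK}{p(K)}=\omega+\bar\omega$ and $g=4p(K)\,\omega\bar\omega$; in a local coordinate $z$ with $\omega=dz$, $\omega\bar\omega$ is $|dz|^2$. For an isometric immersion $F:U\to\mathbb{Q}^3_c$ with metric $g=e^{u}|dz|^2$, $z=x+\sqrt{-1}y$, and second fundamental form $h_{11}dx^2+2h_{12}dxdy+h_{22}dy^2$, the mean curvature is $H=\frac{1}{2e^{u}}(h_{11}+h_{22})$.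 The surface is a Weingarten surface if $dK\wedge dH=0$. A point is umbilical if the second fundamental form is proportional to the metric there, i.e. $H^2-K+c=0$.
   Formalization: H is a smooth function of K with H²−K+c>0; the equation is required for K near but not at K(P), with positive radicand there (excluding p²(H²−K+c)=A² identically, which gives no immersion); the sign ± may switch at K(P) if the radicand vanishes there. *)

(* Defs.v *)
From HB Require Import structures.
From mathcomp Require Export all_boot all_order all_algebra.
From mathcomp Require Export complex.
From mathcomp Require Export all_classical all_reals all_analysis.
Export Order.TTheory GRing.Theory Num.Theory numFieldNormedType.Exports.

Set Implicit Arguments.
Unset Strict Implicit.
Unset Printing Implicit Defensive.

Local Open Scope classical_set_scope.
Local Open Scope ring_scope.
Local Open Scope complex_scope.

(* [^o] gives access to the topology and to complex differentiation: for
   [f : cplx R -> cplx R], [derivable f z 1] is complex differentiability. *)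
Notation cplx R := ((R[i])^o).

Definition dx (R : realType) (f : cplx R -> R) (z : cplx R) : R :=
  derive1 (fun t : R => f (z + (t +i* 0))) 0.

Definition dy (R : realType) (f : cplx R -> R) (z : cplx R) : R :=
  derive1 (fun t : R => f (z + (0 +i* t))) 0.

Fixpoint Cn (R : realType) (n : nat) (D : set (cplx R)) (f : cplx R -> R) : Prop :=
  (forall z, D z -> {for z, continuous f}) /\
  (if n is m.+1 then
     (forall z, D z ->
        derivable (fun t : R => f (z + (t +i* 0))) 0 1 /\
        derivable (fun t : R => f (z + (0 +i* t))) 0 1) /\
     Cn m D (dx f) /\ Cn m D (dy f)
   else True).

(* Meant for open [D]. *)
Definition smooth_on (R : realType) (D : set (cplx R)) (f : cplx R -> R) : Prop :=
  forall n, Cn n D f.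

(* Wirtinger derivatives: (d/dx - i d/dy)/2 and (d/dx + i d/dy)/2 applied to
   u + iv. *)
Definition dz (R : realType) (f : cplx R -> cplx R) (z : cplx R) : cplx R :=
  let u w := complex.Re (f w) in let v w := complex.Im (f w) in
  ((dx u z + dy v z) / 2) +i* ((dx v z - dy u z) / 2).

Definition dzbar (R : realType) (f : cplx R -> cplx R) (z : cplx R) : cplx R :=
  let u w := complex.Re (f w) in let v w := complex.Im (f w) in
  ((dx u z - dy v z) / 2) +i* ((dx v z + dy u z) / 2).

Definition cofr (R : realType) (f : cplx R -> R) : cplx R -> cplx R :=
  fun w => (f w)%:C.

Definition sqmod (R : realType) (w : cplx R) : R :=
  complex.Re w ^+ 2 + complex.Im w ^+ 2.

Definition holomorphic_at (R : realType) (f : cplx R -> cplx R) (z : cplx R) : Prop :=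
  \forall w \near z, derivable f w 1.

Definition zero_at (R : realType) (f : cplx R -> cplx R) (z : cplx R) : Prop :=
  holomorphic_at f z /\ f z = 0.

(* A pole of order n > 0; the value of [f] at [z] itself is irrelevant. *)
Definition pole_at (R : realType) (f : cplx R -> cplx R) (z : cplx R) : Prop :=
  exists (n : nat) (g : cplx R -> cplx R),
    [/\ (0 < n)%N, holomorphic_at g z, g z <> 0 &
        \forall w \near z^', (w - z) ^+ n * f w = g w].

Record chart (R : realType) (M : topologicalType) := Chart {
  cdom : set M;
  cmap : M -> cplx R;
  cinv : cplx R -> M;
  cdom_open : open cdom;
  cimg_open : open (cmap @` cdom);
  cmap_cont : forall x, cdom x -> {for x, continuous cmap};
  cinv_cont : forall z, (cmap @` cdom) z -> {for z, continuous cinv};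
  cmapK : forall x, cdom x -> cinv (cmap x) = x
}.

Record compact_riemann_surface (R : realType) (M : topologicalType) := RiemannSurface {
  chart_index : Type;
  charts : chart_index -> chart R M;
  rs_hausdorff : hausdorff_space M;
  rs_compact : compact [set: M];
  rs_connected : connected [set: M];
  charts_cover : forall x, exists i, cdom (charts i) x;
  charts_holo : forall i j x, cdom (charts i) x -> cdom (charts j) x ->
    derivable (cmap (charts j) \o cinv (charts i)) (cmap (charts i) x) 1
}.

Arguments charts {R M} c _.

Section OnSurface.
Context (R : realType) (M : topologicalType) (X : compact_riemann_surface R M).
Local Notation I := (chart_index X).
Local Notation dom i := (cdom (charts X i)).
Local Notation coord i := (cmap (charts X i)).
Local Notation point i := (cinv (charts X i)).

Definition transition_deriv (i j : I) (x : M) : cplx R :=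
  derive1 (coord j \o point i) (coord i x).

(* The metric is exp(2 phi_i) |dz_i|^2 in the chart i, off the set S. *)
Definition conformal_metric (S : set M) (phi : I -> cplx R -> R) : Prop :=
  (forall i, smooth_on (coord i @` (dom i `\` S)) (phi i)) /\
  (forall i j x, dom i x -> dom j x -> ~ S x ->
     expR (2 * phi i (coord i x)) =
     expR (2 * phi j (coord j x)) * sqmod (transition_deriv i j x)).

Definition gauss_curvature (phi : cplx R -> R) (z : cplx R) : R :=
  - expR (- 2 * phi z) * (dx (dx phi) z + dy (dy phi) z).

(* K_{,zz}; the only Christoffel symbol of e^{2 phi}|dz|^2 that enters is
   Gamma^z_{zz} = 2 phi_z. *)
Definition cov_zz (phi K : cplx R -> R) (z : cplx R) : cplx R :=
  dz (dz (cofr K)) z - 2 * dz (cofr phi) z * dz (cofr K) z.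

(* The coefficient of d/dz in the vector field nabla K. *)
Definition nabla (phi K : cplx R -> R) (z : cplx R) : cplx R :=
  'i * (expR (- 2 * phi z))%:C * dzbar (cofr K) z.

Definition cplx_of_pair (p : R * R) : cplx R := p.1 +i* p.2.

(* The integral of f >= 0 over M \ S for the area element
   dg = e^{2 phi} dx dy: the supremum, over finite families of pairwise
   disjoint Borel pieces of M \ S each lying in a chart, of the sum of the
   integrals over the pieces. *)
Definition surface_integral (S : set M) (phi : I -> cplx R -> R) (f : M -> R) : \bar R :=
  ereal_sup [set s : \bar R |
    exists (n : nat) (idx : 'I_n -> I) (B : 'I_n -> set (R * R)),
      [/\ forall k, measurable (B k),
          forall k, cplx_of_pair @` B k `<=` coord (idx k) @` (dom (idx k) `\` S),
          trivIset [set: 'I_n]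
            (fun k => (point (idx k) \o cplx_of_pair) @` B k) &
          s = (\sum_(k < n)
             \int[(lebesgue_measure \x lebesgue_measure)]_(q in B k)
               (f (point (idx k) (cplx_of_pair q)) *
                expR (2 * phi (idx k) (cplx_of_pair q)))%:E)%E]].

(* [K] is the Gauss curvature, extended continuously to the singular set. *)
Record HCMU (S : set M) (phi : I -> cplx R -> R) (K : M -> R) : Prop := MkHCMU {
  hcmu_sing : finite_set S;
  hcmu_metric : conformal_metric S phi;
  hcmu_cont : continuous K;
  hcmu_curv : forall i x, dom i x -> ~ S x ->
    K x = gauss_curvature (phi i) (coord i x);
  hcmu_nonconst : exists x y, [/\ ~ S x, ~ S y & K x <> K y];
  hcmu_eq : forall i x, dom i x -> ~ S x ->
    cov_zz (phi i) (K \o point i) (coord i x) = 0;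
  hcmu_area : (surface_integral S phi (fun=> 1%R) < +oo)%E;
  hcmu_energy : (surface_integral S phi (fun x => (K x ^+ 2)%R) < +oo)%E
}.

(* The form is w_i dz_i in the chart i; at a pole the value of w_i carries no
   information. *)
Definition meromorphic_form (w : I -> cplx R -> cplx R) : Prop :=
  (forall i x, dom i x ->
     holomorphic_at (w i) (coord i x) \/ pole_at (w i) (coord i x)) /\
  (forall i j x, dom i x -> dom j x ->
     ~ pole_at (w i) (coord i x) -> ~ pole_at (w j) (coord j x) ->
     w i (coord i x) = w j (coord j x) * transition_deriv i j x).

Definition character_form (S : set M) (phi : I -> cplx R -> R) (K : M -> R)
    (w : I -> cplx R -> cplx R) : Prop :=
  meromorphic_form w /\
  (forall i x, dom i x -> ~ S x -> ~ pole_at (w i) (coord i x) ->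
     w i (coord i x) * nabla (phi i) (K \o point i) (coord i x) = 'i / 4).

Definition Mstar (w : I -> cplx R -> cplx R) : set M :=
  [set x | forall i, dom i x ->
     ~ zero_at (w i) (coord i x) /\ ~ pole_at (w i) (coord i x)].

End OnSurface.

(* Q^3_0 is the hyperplane {u_3 = 0} of Euclidean R^4; for c > 0, Q^3_c is the
   sphere <u,u> = 1/c of Euclidean R^4; for c < 0 it is the upper sheet of the
   hyperboloid <u,u> = 1/c in Lorentzian R^4. *)
Definition sform (R : realType) (c : R) (u v : 'rV[R]_4) : R :=
  \sum_(k < 4)
    (if (k == ord_max) && (c < 0) then -1 else 1) * (u 0 k * v 0 k).

Definition space_form (R : realType) (c : R) : set 'rV[R]_4 :=
  [set u : 'rV[R]_4 | if c == 0 then u 0 ord_max = 0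
           else sform c u u = c^-1 /\ (c < 0 -> 0 < u 0 ord_max)].

Definition tangent (R : realType) (c : R) (u v : 'rV[R]_4) : Prop :=
  if c == 0 then v 0 ord_max = 0 else sform c u v = 0.

Definition vdx (R : realType) (f : cplx R -> 'rV[R]_4) (z : cplx R) : 'rV[R]_4 :=
  \row_k dx (fun w => f w 0 k) z.

Definition vdy (R : realType) (f : cplx R -> 'rV[R]_4) (z : cplx R) : 'rV[R]_4 :=
  \row_k dy (fun w => f w 0 k) z.

Section Immersions.
Context (R : realType) (M : topologicalType) (X : compact_riemann_surface R M).
Local Notation I := (chart_index X).
Local Notation dom i := (cdom (charts X i)).
Local Notation coord i := (cmap (charts X i)).
Local Notation point i := (cinv (charts X i)).

Definition smooth_map (U : set M) (F : M -> 'rV[R]_4) : Prop :=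
  forall i k, smooth_on (coord i @` (dom i `&` U)) (fun z => F (point i z) 0 k).

(* A point of S may be a removable singularity of the metric, hence lie in U;
   there only the immersion condition is imposed, and the isometry condition
   follows by continuity for the extended metric. *)
Definition isometric_immersion (S : set M) (phi : I -> cplx R -> R) (c : R)
    (U : set M) (F : M -> 'rV[R]_4) : Prop :=
  [/\ smooth_map U F,
      forall x, U x -> space_form c (F x),
      forall i x, U x -> dom i x ->
        let Fx := vdx (F \o point i) (coord i x) in
        let Fy := vdy (F \o point i) (coord i x) in
        forall a b : R, a *: Fx + b *: Fy = 0 -> a = 0 /\ b = 0 &
      forall i x, U x -> dom i x -> ~ S x ->
        let Fx := vdx (F \o point i) (coord i x) in
        let Fy := vdy (F \o point i) (coord i x) in
        [/\ sform c Fx Fx = expR (2 * phi i (coord i x)),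
            sform c Fy Fy = expR (2 * phi i (coord i x)) &
            sform c Fx Fy = 0]].

Definition unit_normal (c : R) (U : set M) (F nu : M -> 'rV[R]_4) : Prop :=
  smooth_map U nu /\
  forall i x, U x -> dom i x ->
    [/\ tangent c (F x) (nu x),
        sform c (nu x) (nu x) = 1,
        sform c (nu x) (vdx (F \o point i) (coord i x)) = 0 &
        sform c (nu x) (vdy (F \o point i) (coord i x)) = 0].

(* Since nu is tangent to Q^3_c, the ambient second derivatives of F in R^4
   give the second fundamental form of F in Q^3_c. *)
Definition h11 (c : R) (F nu : M -> 'rV[R]_4) (i : I) (x : M) : R :=
  sform c (vdx (vdx (F \o point i)) (coord i x)) (nu x).

Definition h12 (c : R) (F nu : M -> 'rV[R]_4) (i : I) (x : M) : R :=
  sform c (vdy (vdx (F \o point i)) (coord i x)) (nu x).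

Definition h22 (c : R) (F nu : M -> 'rV[R]_4) (i : I) (x : M) : R :=
  sform c (vdy (vdy (F \o point i)) (coord i x)) (nu x).

(* The factor e^u of the induced metric e^u |dz|^2. *)
Definition conformal_factor (c : R) (F : M -> 'rV[R]_4) (i : I) (x : M) : R :=
  sform c (vdx (F \o point i) (coord i x)) (vdx (F \o point i) (coord i x)).

Definition is_mean_curvature (c : R) (U : set M) (F nu : M -> 'rV[R]_4)
    (H : M -> R) : Prop :=
  forall i x, U x -> dom i x ->
    H x = (h11 c F nu i x + h22 c F nu i x) / (2 * conformal_factor c F i x).

Definition umbilical (c : R) (F nu : M -> 'rV[R]_4) (i : I) (x : M) : Prop :=
  exists l : R, [/\ h11 c F nu i x = l * conformal_factor c F i x,
                    h12 c F nu i x = 0 &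
                    h22 c F nu i x = l * conformal_factor c F i x].

(* dK /\ dH = 0 on U. *)
Definition weingarten (U : set M) (K H : M -> R) : Prop :=
  forall i x, U x -> dom i x ->
    dx (K \o point i) (coord i x) * dy (H \o point i) (coord i x) -
    dy (K \o point i) (coord i x) * dx (H \o point i) (coord i x) = 0.

End Immersions.

Definition pcubic (R : realType) (K1 K2 k : R) : R :=
  - 3^-1 * (k - K1) * (k - K2) * (k + K1 + K2).

Definition radicand (R : realType) (K1 K2 c A : R) (h : R -> R) (k : R) : R :=
  pcubic K1 K2 k ^+ 2 * (h k ^+ 2 - k + c) - A ^+ 2.

(* The sign is + for [s = false] and - for [s = true]. *)
Definition mc_ode (R : realType) (K1 K2 c A : R) (s : bool) (h : R -> R) (k : R) : Prop :=
  let p := pcubic K1 K2 k in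
  let p' := derive1 (pcubic K1 K2) k in
  let D := p * h k + (-1) ^+ s * Num.sqrt (radicand K1 K2 c A h k) in
  [/\ 0 < radicand K1 K2 c A h k,
      D != 0 &
      derive1 h k = (p - 2 * p' * (h k ^+ 2 - k + c)) / (2 * D)].

(* [h] is, near [k0], a smooth solution H(K) with H^2 - K + c > 0.  The value
   k0 may be an isolated one at which the right-hand side is singular
   (vanishing radicand, where the sign of the square root may switch, or
   vanishing denominator), so the equation is required for k <> k0; when the
   right-hand side is regular at k0, it holds there as well by continuity.
   A positive radicand for k <> k0 excludes the functions H with
   p^2 (H^2 - K + c) = A^2 identically, for which the square root degenerates. *)
Definition mc_solution (R : realType) (K1 K2 c A : R) (h : R -> R) (k0 : R) : Prop :=
  [/\ \forall k \near k0, forall n, derivable (derive1n n h) k 1,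
      \forall k \near k0, 0 < h k ^+ 2 - k + c &
      exists s s' : bool,
        [/\ \forall k \near k0^'-, mc_ode K1 K2 c A s h k,
            \forall k \near k0^'+, mc_ode K1 K2 c A s' h k &
            s = s' \/ radicand K1 K2 c A h k0 = 0]].

(* Main.v *)
(* Normal form of the metric. In a chart, e^{2 phi} / (4 |w|^2) is a cubic
   polynomial of K with leading coefficient -1/3, the same one on the whole
   connected surface. It vanishes at the poles of omega, hence at the extrema of
   K, which by the mean value property are poles; so it is p. Thus
   dK = p (omega + conj omega) and g = 4 p omega conj(omega) near each point of
   M*, across the removable singularities too.

   Let X, Y be the frame dual to (Re omega, Im omega). With 2 a = h11 - h22 and
   b = - h12 in this frame, Codazzi reads Y a + X b = 0, X a - Y b = 4 p X H,
   Gauss reads a^2 + b^2 = 16 p^2 (H^2 - K + c), and the Weingarten condition is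
   Y H = 0, that is H = h(K). Then [X, Y] = 0 forces b to be constant, the
   alternative h' = 2 C (h^2 - K + c) being excluded by elimination. Writing
   b = 4 A, what is left is a' = 4 p h' and a^2 = 16 (p^2 (h^2 - K + c) - A^2),
   which is the equation for H', the square root being - a / 4 up to sign.

   Conversely, such an a makes the Gauss-Weingarten system X E = U(K) E,
   Y E = V(K) E integrable. If dy = Im omega, it is solved by
   E = Phi(K) Ups(y) E0 with Phi' = U Phi / (2 p) and Ups' = V(K0) Ups, because
   V Phi = Phi V(K0). *)

(* The form is only known to be complex differentiable and the metric only off a finite set that may
   meet [Mstar]. So identities are proved on punctured squares first; Cauchy's formula with one
   exceptional point, continuity and limits of derivatives carry them across the centre. Why b is
   constant: let t be the angular speed of a + i b along Y and G = 4 p X H / (a^2 + b^2).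
   Commutation of X and Y expresses a X G through functions of K; applying Y gives b t X G = 0,
   hence t X G = 0. Where t is not 0, G is a constant C, which is the Riccati alternative. Two
   further derivatives give two polynomial equations for 1 / (h^2 - K + c), whose resultant, a
   polynomial in 1 / K, is nonzero at 1 / K = 0. The sign of the root can switch only where a
   vanishes. Such values of K are isolated: at an accumulation point a and h minus its value would
   be flat, and with them a nonzero polynomial in K. In the converse direction the factorisation of
   the frame replaces the integration of an overdetermined system by two ordinary linear
   equations. *)
Require Import Defs.
From mathcomp Require Import ring lra.

Set Implicit Arguments.
Unset Strict Implicit.
Unset Printing Implicit Defensive.

Local Open Scope classical_set_scope.
Local Open Scope ring_scope.
Local Open Scope complex_scope.

(** * Calculus on the line and in the plane *)

Notation isd f x d := (is_derive (x : _) (1 : _) f d).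

Section RealLine.
Context {R : realType}.
Implicit Types (f g df : R -> R) (x d e : R).

(** The first-order estimate multiplied out by [|h|]: no quotient is left and [h = 0] is allowed, so
    errors can be added and composed. *)
Lemma isdP f x d : is_derive x 1 f d <->
  forall e, 0 < e -> exists2 dl, 0 < dl & forall h, `|h| < dl ->
    `|f (x + h) - f x - d * h| <= e * `|h|.
Proof.
split=> [[df <-] e e0|H].
  move: df; rewrite /derivable => /cvgrPdist_le /(_ e e0) /=.
  rewrite -/('D_1 f x) near_withinE near_simpl.
  rewrite /prop_near1 nbhs_ballP => -[dl /= dl0 H]; exists dl => // h hd.
  have [->|h0] := eqVneq h 0; first by rewrite addr0 subrr mulr0 subrr !normr0 mulr0.
  have := H h; rewrite /ball /= sub0r normrN => /(_ hd h0).
  rewrite [h *: 1]mulr1 (addrC h) => {}H.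
  rewrite -ler_pdivrMr ?normr_gt0 // -normf_div.
  rewrite (_ : _ / h = - ('D_1 f x - h^-1 *: (f (x + h) - f x))) ?normrN //.
  by rewrite /GRing.scale /=; field.
suff H1 : h^-1 *: ((f \o shift x) (h *: 1) - f x) @[h --> 0^'] --> d.
  by apply: DeriveDef; [apply: cvgP H1 | apply: cvg_lim].
apply/cvgrPdist_le => e e0; have [dl dl0 {}H] := H e e0.
rewrite near_withinE; exists dl => //= h; rewrite /ball /= sub0r normrN => hd h0.
rewrite [h *: 1]mulr1 (addrC h).
rewrite (_ : d - _ = - ((f (x + h) - f x - d * h) / h)); last first.
  by rewrite /GRing.scale /=; field.
by rewrite normrN normf_div ler_pdivrMr ?normr_gt0 // H.
Qed.

Lemma isd_uniq f x d1 d2 : is_derive x 1 f d1 -> is_derive x 1 f d2 -> d1 = d2.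
Proof. by move=> [_ <-] [_ <-]. Qed.

Lemma isd_derive1 f x d : is_derive x 1 f d -> derive1 f x = d.
Proof. by move=> [_ <-]; rewrite derive1E. Qed.

Lemma derivable_isd f x : derivable f x 1 -> is_derive x 1 f (derive1 f x).
Proof. by rewrite derive1E => /derivableP. Qed.

Lemma isd_cont f x d : is_derive x 1 f d -> {for x, continuous f}.
Proof. by move=> [/derivable1_diffP /differentiable_continuous]. Qed.

Lemma isd_eq f x d d' : is_derive x 1 f d -> d = d' -> is_derive x 1 f d'.
Proof. by move=> H <-. Qed.

Lemma isdD f g x a b : is_derive x 1 f a -> is_derive x 1 g b ->
  is_derive x 1 (fun t => f t + g t) (a + b).
Proof. by move=> Hf Hg; exact: is_deriveD. Qed.

Lemma isdN f x a : is_derive x 1 f a -> is_derive x 1 (fun t => - f t) (- a).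
Proof. by move=> Hf; exact: is_deriveN. Qed.

Lemma isdB f g x a b : is_derive x 1 f a -> is_derive x 1 g b ->
  is_derive x 1 (fun t => f t - g t) (a - b).
Proof. by move=> Hf Hg; exact: is_deriveB. Qed.

Lemma isdM f g x a b : is_derive x 1 f a -> is_derive x 1 g b ->
  is_derive x 1 (fun t => f t * g t) (a * g x + f x * b).
Proof.
move=> Hf Hg; have := @is_deriveM _ _ f g x 1 a b Hf Hg.
by move=> H; apply: isd_eq H _; rewrite /GRing.scale /=; ring.
Qed.

Lemma isd_cst (a x : R) : is_derive x 1 (fun=> a) 0.
Proof. exact: is_derive_cst. Qed.

Lemma isd_id x : is_derive x 1 (fun t : R => t) 1.
Proof. exact: is_derive_id. Qed.

Lemma isd_comp f g x a b : is_derive (g x) 1 f a -> is_derive x 1 g b ->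
  is_derive x 1 (fun t => f (g t)) (a * b).
Proof. by move=> Hf Hg; exact: is_derive1_comp. Qed.

Lemma isd_inv f x a : f x != 0 -> is_derive x 1 f a ->
  is_derive x 1 (fun t => (f t)^-1) (- a / f x ^+ 2).
Proof.
by move=> f0 Hf; apply: isd_eq (is_deriveV f0 Hf) _; rewrite /GRing.scale /=; field.
Qed.

Lemma isd_near f g x a : (\forall t \near x, f t = g t) ->
  is_derive x 1 f a -> is_derive x 1 g a.
Proof. exact: near_eq_is_derive. Qed.

Lemma isd_ext f g x a : f =1 g -> is_derive x 1 f a -> is_derive x 1 g a.
Proof. by move=> /funext ->. Qed.

Lemma near_itvP (A : set R) x : (\forall t \near x, A t) <->
  exists2 e, 0 < e & forall t, `|t - x| < e -> A t.
Proof.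
rewrite /prop_near1 nbhs_ballP; split=> -[e /= e0 H]; exists e => // t.
  by move=> te; apply: H; rewrite /ball /= distrC.
by rewrite /ball /= distrC; exact: H.
Qed.

Lemma contP f x : {for x, continuous f} <->
  forall e, 0 < e -> exists2 dl, 0 < dl & forall t, `|t - x| < dl -> `|f t - f x| < e.
Proof.
split=> [/cvgrPdist_lt H e /H|H].
  by move=> /near_itvP [dl dl0 {}H]; exists dl => // t /H; rewrite distrC.
apply/cvgrPdist_lt => e /H [dl dl0 {}H]; apply/near_itvP.
by exists dl => // t /H; rewrite distrC.
Qed.

Lemma within_cont f (a b : R) : (forall x, a <= x <= b -> {for x, continuous f}) ->
  {within `[a, b], continuous f}.
Proof.
move=> H; apply: continuous_in_subspaceT => x; rewrite inE /= in_itv /= => /H //.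
Qed.

Lemma mvt_cont f df a b : a < b -> (forall x, a < x < b -> is_derive x 1 f (df x)) ->
  (forall x, a <= x <= b -> {for x, continuous f}) ->
  exists2 c, a < c < b & f b - f a = df c * (b - a).
Proof.
move=> ab H C; have H' x : x \in `]a, b[ -> is_derive x 1 f (df x).
  by rewrite in_itv /=; exact: H.
have [c] := MVT ab H' (within_cont C).
by rewrite in_itv /= => ? ?; exists c.
Qed.

Lemma mvt f df a b : a < b -> (forall x, a <= x <= b -> is_derive x 1 f (df x)) ->
  exists2 c, a < c < b & f b - f a = df c * (b - a).
Proof.
move=> ab H; apply: mvt_cont => // x xab; last exact: isd_cont (H x xab).
by apply: H; move/andP: xab => [/ltW -> /ltW ->].
Qed.

Lemma mvt_dist f df x y : (forall t, `|t - x| <= `|y - x| -> is_derive t 1 f (df t)) ->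
  exists2 c, `|c - x| <= `|y - x| & f y - f x = df c * (y - x).
Proof.
move=> H; have [xy|yx|<-] := ltgtP x y; last by exists x; rewrite ?subrr ?mulr0.
  have [|c /andP[c1 c2] E] := @mvt f df x y xy.
    by move=> t /andP[t1 t2]; apply: H; rewrite !ger0_norm ?subr_ge0 ?(ltW xy) // lerB.
  by exists c => //; rewrite !ger0_norm ?subr_ge0 ?ltW //; lra.
have [|c /andP[c1 c2] E] := @mvt f df y x yx.
  move=> t /andP[t1 t2]; apply: H; rewrite !ler0_norm ?subr_le0 ?(ltW yx) //; lra.
exists c; last by rewrite -opprB E -mulrN opprB.
by rewrite !ler0_norm ?subr_le0 ?ltW //; lra.
Qed.

Lemma isd0_cst f x y : (forall t, `|t - x| <= `|y - x| -> is_derive t 1 f 0) -> f y = f x.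
Proof.
move=> H; have [c _ E] := mvt_dist H.
by apply/eqP; rewrite -subr_eq0 E mul0r.
Qed.

(** Mean value theorem on each side of [x]. It carries differential equations across an isolated
    point at which they are not yet known. *)
Lemma isd_lim f df x : {for x, continuous f} -> {for x, continuous df} ->
  (\forall t \near x^', is_derive (t : R) 1 f (df t)) -> is_derive x 1 f (df x).
Proof.
move=> cf /contP cdf; rewrite near_withinE => /near_itvP [r r0 Hr].
apply/isdP => e e0; have [s s0 Hs] := cdf e e0.
exists (Num.min r s); rewrite ?lt_min ?r0 // => h; rewrite lt_min => /andP[hr hs].
have [->|h0] := eqVneq h 0; first by rewrite addr0 subrr mulr0 subrr !normr0 mulr0.
(* The derivative is known only off [x], so [x] may be an endpoint of the interval but not an
   interior point; at the endpoint continuity is enough. *)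
have key : exists2 c, `|c - x| <= `|h| & f (x + h) - f x = df c * h.
  have C t : `|t - x| <= `|h| -> {for t, continuous f}.
    move=> th; have [->//|tx] := eqVneq t x.
    by have := Hr t (le_lt_trans th hr) tx; exact: isd_cont.
  have [h1|h1] := ltP 0 h.
    have hn := gtr0_norm h1.
    have [|t /andP[t1 t2]|t /andP[t1 t2]|c /andP[c1 c2] E] := @mvt_cont f df x (x + h).
    - by lra.
    - by apply: Hr; [rewrite gtr0_norm ?subr_gt0 //; lra|rewrite gt_eqF].
    - apply: C; rewrite hn ger0_norm ?subr_ge0 //; lra.
    exists c; first by rewrite hn gtr0_norm ?subr_gt0 //; lra.
    by rewrite E; congr (_ * _); ring.
  have {}h1 : h < 0 by rewrite lt_neqAle h0.
  have [|t /andP[t1 t2]|t /andP[t1 t2]|c /andP[c1 c2] E] := @mvt_cont f df (x + h) x.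
  - by lra.
  - apply: Hr; last by rewrite lt_eqF.
    rewrite ltr0_norm ?subr_lt0 //; rewrite ltr0_norm // in hr; lra.
  - apply: C; rewrite (ltr0_norm h1) ler0_norm ?subr_le0 //; lra.
  exists c; first by rewrite (ltr0_norm h1) ltr0_norm ?subr_lt0 //; lra.
  by rewrite -opprB E -mulrN; congr (_ * _); ring.
have [c cx ->] := key; rewrite -mulrBl normrM ler_wpM2r // ltW // Hs //.
exact: le_lt_trans cx hs.
Qed.

End RealLine.

(** * Partial derivatives, smoothness and differentiability in the plane *)

Section Plane.
Context {R : realType}.
Implicit Types (z : cplx R) (f g : cplx R -> R) (D : set (cplx R)).

Lemma nbhs_boxP z (A : set (cplx R)) : nbhs z A <->
  exists2 e : R, 0 < e & forall a b, `|a| < e -> `|b| < e -> A (z + (a +i* b)).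
Proof.
rewrite nbhs_ballP; split.
  (* The radius of a ball is a complex number; being positive it is real. The half-side [e / 2]
     keeps the square inside the ball. *)
  case=> -[e e'] /=; rewrite ltcE /= => /andP[/eqP e'0 e0] H.
  exists (e / 2) => [|a b ha hb]; first by rewrite divr_gt0.
  apply: H; rewrite /ball /= opprD addNKr normrN normc_def ltcE /= e'0 eqxx /=.
  have h2 : a ^+ 2 + b ^+ 2 < e ^+ 2.
    have := ltr_norml a (e / 2); rewrite ha => /esym/andP[? ?].
    have := ltr_norml b (e / 2); rewrite hb => /esym/andP[? ?]. nra.
  rewrite -(ltr_pXn2r (n := 2)) ?nnegrE ?sqrtr_ge0 ?(ltW e0) //.
  by rewrite sqr_sqrtr ?addr_ge0 ?sqr_ge0.
case=> e e0 H; exists (e%:C); first by rewrite /= ltcE /= eqxx.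
move=> w /=; rewrite /ball /= distrC normc_def ltcE /= eqxx /= => hw.
rewrite -(subrK z w) addrC (_ : w - z = complex.Re (w - z) +i* complex.Im (w - z));
  last by case: (w - z).
have h (u v : R) : `|u| <= Num.sqrt (u ^+ 2 + v ^+ 2).
  by rewrite -sqrtr_sqr ler_wsqrtr // lerDl sqr_ge0.
by apply: H; apply: le_lt_trans hw; [exact: h|rewrite [X in Num.sqrt X]addrC; exact: h].
Qed.

Lemma ccontP z f : {for z, continuous f} <->
  forall e, 0 < e -> exists2 dl, 0 < dl & forall a b, `|a| < dl -> `|b| < dl ->
    `|f (z + (a +i* b)) - f z| < e.
Proof.
split=> [/cvgrPdist_lt H e /H|H].
  by move=> /nbhs_boxP [dl dl0 {}H]; exists dl => // a b ha hb; rewrite distrC H.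
apply/(@cvgrPdist_lt _ _ _ _ (nbhs_filter z)) => e /H [dl dl0 {}H]; apply/nbhs_boxP.
by exists dl => // a b ha hb; rewrite distrC H.
Qed.

Lemma ccontD z f g : {for z, continuous f} -> {for z, continuous g} ->
  {for z, continuous (fun w => f w + g w)}.
Proof. by move=> Hf Hg; exact: (@cvgD _ _ _ _ (nbhs_filter z)). Qed.

Lemma ccontM z f g : {for z, continuous f} -> {for z, continuous g} ->
  {for z, continuous (fun w => f w * g w)}.
Proof. by move=> Hf Hg; exact: (@cvgM _ _ _ (nbhs_filter z)). Qed.

Lemma ccont_comp z f (h : R -> R) : {for z, continuous f} -> {for f z, continuous h} ->
  {for z, continuous (fun w => h (f w))}.
Proof. by move=> Hf Hh; exact: (@continuous_comp _ _ _ f h). Qed.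

Lemma ccont_near z f g : (\forall w \near z, f w = g w) -> {for z, continuous f} ->
  {for z, continuous g}.
Proof.
move=> fg /ccontP Hf; have e : f z = g z := nbhs_singleton fg.
move/nbhs_boxP: fg => [d d0 fg]; apply/ccontP => r /Hf [d' d'0 H].
exists (Num.min d d') => [|a b]; rewrite ?lt_min ?d0 // => /andP[a1 a2] /andP[b1 b2].
by rewrite -fg // -e; exact: H.
Qed.

Definition pd f z (p q : R) :=
  is_derive (0 : R) 1 (fun t : R => f (z + (t +i* 0))) p /\
  is_derive (0 : R) 1 (fun t : R => f (z + (0 +i* t))) q.

Lemma addc0 z : z + (0 +i* 0) = z.
Proof. exact: addr0. Qed.

Lemma pd_dx f z p q : pd f z p q -> dx f z = p.
Proof. by case=> /isd_derive1. Qed.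

Lemma pd_dy f z p q : pd f z p q -> dy f z = q.
Proof. by case=> _ /isd_derive1. Qed.

Lemma pd_eq f z p q p' q' : pd f z p q -> p = p' -> q = q' -> pd f z p' q'.
Proof. by move=> H <- <-. Qed.

Lemma pd_uniq f z p q p' q' : pd f z p q -> pd f z p' q' -> p = p' /\ q = q'.
Proof. by move=> [A B] [A' B']; split; [apply: isd_uniq A A'|apply: isd_uniq B B']. Qed.

Lemma pdD f g z p q p' q' : pd f z p q -> pd g z p' q' ->
  pd (fun w => f w + g w) z (p + p') (q + q').
Proof. by move=> [A B] [A' B']; split; apply: isdD. Qed.

Lemma pdN f z p q : pd f z p q -> pd (fun w => - f w) z (- p) (- q).
Proof. by move=> [A B]; split; apply: isdN. Qed.

Lemma pdB f g z p q p' q' : pd f z p q -> pd g z p' q' ->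
  pd (fun w => f w - g w) z (p - p') (q - q').
Proof. by move=> [A B] [A' B']; split; apply: isdB. Qed.

Lemma pdM f g z p q p' q' : pd f z p q -> pd g z p' q' ->
  pd (fun w => f w * g w) z (p * g z + f z * p') (q * g z + f z * q').
Proof.
move=> [A B] [A' B']; split.
  by apply: isd_eq (isdM A A') _; rewrite addc0.
by apply: isd_eq (isdM B B') _; rewrite addc0.
Qed.

Lemma pd_cst (a : R) z : pd (fun=> a) z 0 0.
Proof. by split; exact: isd_cst. Qed.

Lemma pd_comp f z p q (h : R -> R) d : is_derive (f z) 1 h d -> pd f z p q ->
  pd (fun w => h (f w)) z (d * p) (d * q).
Proof.
move=> H [A B]; split.
  by apply: (isd_comp (f := h)) A; rewrite addc0.
by apply: (isd_comp (f := h)) B; rewrite addc0.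
Qed.

Lemma near_shift_re z (A : set (cplx R)) : (\forall w \near z, A w) ->
  \forall t \near (0 : R), A (z + (t +i* 0)).
Proof.
move/nbhs_boxP => [e e0 H]; apply/near_itvP; exists e => // t.
by rewrite subr0 => te; apply: H; rewrite ?normr0.
Qed.

Lemma near_shift_im z (A : set (cplx R)) : (\forall w \near z, A w) ->
  \forall t \near (0 : R), A (z + (0 +i* t)).
Proof.
move/nbhs_boxP => [e e0 H]; apply/near_itvP; exists e => // t.
by rewrite subr0 => te; apply: H; rewrite ?normr0.
Qed.

Lemma pd_near f g z p q : (\forall w \near z, f w = g w) -> pd f z p q -> pd g z p q.
Proof.
move=> fg [A B]; split; [move: A|move: B]; apply: isd_near.
  exact: (@near_shift_re z (fun w => f w = g w)).
exact: (@near_shift_im z (fun w => f w = g w)).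
Qed.

Lemma pd_Re z : pd (fun w => complex.Re w) z 1 0.
Proof.
case: z => a b; split.
  have -> : (fun t : R => complex.Re ((a +i* b : cplx R) + (t +i* 0))) = (fun t => a + t) by [].
  by apply: isd_eq (isdD (isd_cst a 0) (isd_id 0)) _; rewrite add0r.
have -> : (fun t : R => complex.Re ((a +i* b : cplx R) + (0 +i* t))) = (fun t => a + 0) by [].
exact: isd_cst.
Qed.

Lemma pd_Im z : pd (fun w => complex.Im w) z 0 1.
Proof.
case: z => a b; split.
  have -> : (fun t : R => complex.Im ((a +i* b : cplx R) + (t +i* 0))) = (fun t => b + 0) by [].
  exact: isd_cst.
have -> : (fun t : R => complex.Im ((a +i* b : cplx R) + (0 +i* t))) = (fun t => b + t) by [].
by apply: isd_eq (isdD (isd_cst b 0) (isd_id 0)) _; rewrite add0r.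
Qed.

Lemma ccont_Re z : {for z, continuous (fun w : cplx R => complex.Re w)}.
Proof.
apply/ccontP => e e0; exists e => // a b ha hb.
by case: z => x y /=; rewrite addrC addKr.
Qed.

Lemma ccont_Im z : {for z, continuous (fun w : cplx R => complex.Im w)}.
Proof.
apply/ccontP => e e0; exists e => // a b ha hb.
by case: z => x y /=; rewrite addrC addKr.
Qed.

Lemma ccont_cst (a : R) z : {for z, continuous (fun _ : cplx R => a)}.
Proof. by apply/ccontP => e e0; exists 1 => // c b _ _; rewrite subrr normr0. Qed.

Lemma open_near D z : open D -> D z -> \forall w \near z, D w.
Proof. by move=> oD Dz; exact: open_nbhs_nbhs. Qed.

Lemma dx_near f g z : (\forall w \near z, f w = g w) -> dx f z = dx g z.
Proof.
move=> fg; rewrite /dx !derive1E; apply: near_eq_derive.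
exact: (@near_shift_re z (fun w => f w = g w)).
Qed.

Lemma dy_near f g z : (\forall w \near z, f w = g w) -> dy f z = dy g z.
Proof.
move=> fg; rewrite /dy !derive1E; apply: near_eq_derive.
exact: (@near_shift_im z (fun w => f w = g w)).
Qed.

(** [Cn] only tests the points of its domain, and [dx f] and [dy f] do not depend on that domain;
    hence the sets [E] may be arbitrary. *)
Lemma Cn_local n D f : (forall z, D z -> exists2 E : set (cplx R), E z & Cn n E f) -> Cn n D f.
Proof.
elim: n f => [|n IH] f H.
  by split=> // z /H [E Ez [cE _]]; exact: cE.
split=> [z /H [E Ez [cE _]]|]; first exact: cE.
split=> [z /H [E Ez [_ [dE _]]]|]; first exact: dE.
by split; apply: IH => z /H [E Ez [_ [_ [? ?]]]]; exists E.
Qed.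

Lemma Cn_sub n D E f : E `<=` D -> Cn n D f -> Cn n E f.
Proof. by move=> ED H; apply: Cn_local => z /ED Dz; exists D. Qed.

Lemma Cn_ext n D f g : open D -> (forall z, D z -> f z = g z) -> Cn n D f -> Cn n D g.
Proof.
move=> oD; elim: n f g => [|n IH] f g fg.
  case=> cf _; split=> // z Dz; apply: (@ccont_near _ f); last exact: cf.
  by apply: filterS (open_near oD Dz).
have nfg z : D z -> \forall w \near z, f w = g w.
  by move=> Dz; apply: filterS (open_near oD Dz).
case=> cf [df [cx cy]]; split=> [z Dz|].
  by apply: (@ccont_near _ f); [exact: nfg|exact: cf].
split=> [z Dz|].
  have [d1 d2] := df _ Dz; split.
    by apply: near_eq_derivable d1; apply: (@near_shift_re z (fun w => f w = g w)); exact: nfg.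
  by apply: near_eq_derivable d2; apply: (@near_shift_im z (fun w => f w = g w)); exact: nfg.
split; first by apply: IH cx => z /nfg; exact: dx_near.
by apply: IH cy => z /nfg; exact: dy_near.
Qed.

Lemma smooth_local D f : (forall z, D z -> exists2 E : set (cplx R), E z & smooth_on E f) ->
  smooth_on D f.
Proof. by move=> H n; apply: Cn_local => z /H [E Ez sE]; exists E. Qed.

Lemma smooth_sub D E f : E `<=` D -> smooth_on D f -> smooth_on E f.
Proof. by move=> ED H n; exact: Cn_sub ED (H n). Qed.

Lemma smooth_ext D f g : open D -> (forall z, D z -> f z = g z) ->
  smooth_on D f -> smooth_on D g.
Proof. by move=> oD fg H n; exact: Cn_ext oD fg (H n). Qed.

Lemma smooth_cont D f z : smooth_on D f -> D z -> {for z, continuous f}.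
Proof. by move=> /(_ 0) [cf _]; exact: cf. Qed.

Lemma smooth_pd D f z : smooth_on D f -> D z -> pd f z (dx f z) (dy f z).
Proof.
move=> /(_ 1%N) [_ [df _]] /df [d1 d2].
by split; [exact: (derivable_isd d1)|exact: (derivable_isd d2)].
Qed.

Lemma smooth_dx D f : smooth_on D f -> smooth_on D (dx f).
Proof. by move=> sf n; have [_ [_ []]] := sf n.+1. Qed.

Lemma smooth_dy D f : smooth_on D f -> smooth_on D (dy f).
Proof. by move=> sf n; have [_ [_ []]] := sf n.+1. Qed.

(** Induction on the order, for the whole class at once: continuous functions closed under both
    partial derivatives are smooth. Derivatives need to lie in the class only up to equality on [D],
    which is why [D] is open. *)
Lemma smooth_class D (C : (cplx R -> R) -> Prop) : open D ->
  (forall f, C f -> (forall z, D z -> {for z, continuous f}) /\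
     exists gx gy, [/\ C gx, C gy & forall z, D z -> pd f z (gx z) (gy z)]) ->
  forall f, C f -> smooth_on D f.
Proof.
move=> oD H f Cf n; elim: n f Cf => [|n IH] f Cf; have [cf [gx [gy [Cx Cy pf]]]] := H _ Cf.
  by split.
split; first exact: cf.
split=> [z /pf [[d1 _] [d2 _]]|]; first exact: (conj d1 d2).
split; [apply: Cn_ext oD _ (IH _ Cx)|apply: Cn_ext oD _ (IH _ Cy)] => z /pf pz.
  by rewrite (pd_dx pz).
by rewrite (pd_dy pz).
Qed.

Definition sm1 (h : R -> R) (k : R) : Prop := forall n, derivable (derive1n n h) k 1.

Lemma sm1_isd h k : sm1 h k -> is_derive k 1 h (derive1 h k).
Proof. by move=> /(_ 0%N); exact: derivable_isd. Qed.

Lemma sm1_derive1 h k : sm1 h k -> sm1 (derive1 h) k.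
Proof. by move=> H n; have := H n.+1; rewrite /derive1n iterSr. Qed.

(** Terms in unknown functions [G], with smooth coefficients and with outer functions smooth at the
    values taken. Differentiation does not leave the class as soon as the derivatives of the
    unknowns are such terms. *)
Inductive sclass D (G : (cplx R -> R) -> Prop) : (cplx R -> R) -> Prop :=
| scG f of G f : sclass D G f
| scS f of smooth_on D f : sclass D G f
| scD f g of sclass D G f & sclass D G g : sclass D G (fun z => f z + g z)
| scM f g of sclass D G f & sclass D G g : sclass D G (fun z => f z * g z)
| scC h f of (forall z, D z -> sm1 h (f z)) & sclass D G f : sclass D G (fun z => h (f z)).

(** Bootstrap for first-order systems. It serves [K], whose differential is p(K) times a smooth
    form, and the entries of the moving frame. *)
Lemma sclass_smooth D G : open D ->
  (forall f, G f -> (forall z, D z -> {for z, continuous f}) /\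
     exists gx gy, [/\ sclass D G gx, sclass D G gy & forall z, D z -> pd f z (gx z) (gy z)]) ->
  forall f, sclass D G f -> smooth_on D f.
Proof.
move=> oD HG; apply: smooth_class => // f; elim=> {f}.
- by move=> f /HG.
- move=> f sf; split=> [z|]; first exact: smooth_cont sf.
  exists (dx f), (dy f); split=> [||z]; try (apply: scS).
  + exact: smooth_dx.
  + exact: smooth_dy.
  + exact: smooth_pd.
- move=> f g Cf [cf [fx [fy [Cfx Cfy pf]]]] Cg [cg [gx [gy [Cgx Cgy pg]]]]; split.
    by move=> z Dz; apply: ccontD; [exact: cf|exact: cg].
  exists (fun z => fx z + gx z), (fun z => fy z + gy z); split=> [||z Dz]; try exact: scD.
  by apply: pdD; [exact: pf|exact: pg].
- move=> f g Cf [cf [fx [fy [Cfx Cfy pf]]]] Cg [cg [gx [gy [Cgx Cgy pg]]]]; split.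
    by move=> z Dz; apply: ccontM; [exact: cf|exact: cg].
  exists (fun z => fx z * g z + f z * gx z), (fun z => fy z * g z + f z * gy z).
  split=> [||z Dz]; try by apply: scD; exact: scM.
  by apply: pdM; [exact: pf|exact: pg].
- move=> h f Hh Cf [cf [fx [fy [Cfx Cfy pf]]]]; split.
    move=> z Dz; apply: ccont_comp; first exact: cf.
    exact: isd_cont (sm1_isd (Hh _ Dz)).
  have Ch : sclass D G (fun z => derive1 h (f z)).
    by apply: (@scC _ _ (derive1 h) f) Cf => z Dz; exact: sm1_derive1 (Hh _ Dz).
  exists (fun z => derive1 h (f z) * fx z), (fun z => derive1 h (f z) * fy z).
  split=> [||z Dz]; try exact: scM.
  by apply: pd_comp; [exact: sm1_isd (Hh _ Dz)|exact: pf].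
Qed.

Lemma sclass0_smooth D f : open D -> sclass D (fun=> False) f -> smooth_on D f.
Proof. by move=> oD; apply: sclass_smooth. Qed.

Lemma smoothD D f g : open D -> smooth_on D f -> smooth_on D g ->
  smooth_on D (fun z => f z + g z).
Proof. by move=> oD sf sg; apply: sclass0_smooth => //; apply: scD; exact: scS. Qed.

Lemma smoothM D f g : open D -> smooth_on D f -> smooth_on D g ->
  smooth_on D (fun z => f z * g z).
Proof. by move=> oD sf sg; apply: sclass0_smooth => //; apply: scM; exact: scS. Qed.

Lemma smooth_comp D h f : open D -> (forall z, D z -> sm1 h (f z)) -> smooth_on D f ->
  smooth_on D (fun z => h (f z)).
Proof. by move=> oD sh sf; apply: sclass0_smooth => //; apply: scC => //; exact: scS. Qed.

Lemma smooth_cst D (a : R) : open D -> smooth_on D (fun=> a).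
Proof.
move=> oD; apply: (@smooth_class _ (fun f => exists a, f = fun=> a)) => //; last by exists a.
move=> f [b ->]; split=> [z _|]; first exact: ccont_cst.
exists (fun=> 0), (fun=> 0); split; try by exists 0.
by move=> z _; exact: pd_cst.
Qed.

Lemma smoothN D f : open D -> smooth_on D f -> smooth_on D (fun z => - f z).
Proof.
move=> oD sf; apply: smooth_ext (smoothM oD (smooth_cst (-1) oD) sf) => // z _.
by rewrite mulN1r.
Qed.

Lemma smoothB D f g : open D -> smooth_on D f -> smooth_on D g ->
  smooth_on D (fun z => f z - g z).
Proof. by move=> oD sf sg; apply: smoothD => //; exact: smoothN. Qed.

Lemma smooth_Re D : open D -> smooth_on D (fun z => complex.Re z).
Proof.
move=> oD; apply: (@smooth_class _ (fun f => f = (fun z => complex.Re z) \/ exists a, f = fun=> a)) => //.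
  move=> f [->|[a ->]].
    split=> [z _|]; first exact: ccont_Re.
    exists (fun=> 1), (fun=> 0); split; [by right; eexists|by right; eexists|].
    by move=> z _; exact: pd_Re.
  split=> [z _|]; first exact: ccont_cst.
  exists (fun=> 0), (fun=> 0); split; [by right; eexists|by right; eexists|].
  by move=> z _; exact: pd_cst.
by left.
Qed.

Definition box z (e : R) : set (cplx R) :=
  [set w | `|complex.Re (w - z)| < e /\ `|complex.Im (w - z)| < e].

Lemma boxP z e a b : `|a| < e -> `|b| < e -> box z e (z + (a +i* b)).
Proof. by case: z => x y; rewrite /box /= !(addrC _ (- _)) !addKr. Qed.

Lemma boxE z e w : box z e w -> exists a b, [/\ `|a| < e, `|b| < e & w = z + (a +i* b)].
Proof.
move=> [h1 h2]; exists (complex.Re (w - z)), (complex.Im (w - z)); split=> //.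
by rewrite addrC -[LHS](subrK z); congr (_ + _); case: (w - z).
Qed.

Lemma box_center z e : 0 < e -> box z e z.
Proof. by move=> e0; rewrite /box /= subrr /= normr0. Qed.

Lemma addc_re_im z (a b c d : R) : z + (a +i* b) + (c +i* d) = z + ((a + c) +i* (b + d)).
Proof. by rewrite -addrA. Qed.

Lemma box_open z e : open (box z e).
Proof.
rewrite openE => w /boxE [a [b [ha hb ->]]]; apply/nbhs_boxP.
exists (Num.min (e - `|a|) (e - `|b|)); first by rewrite lt_min !subr_gt0 ha.
move=> c d; rewrite !lt_min => /andP[c1 c2] /andP[d1 d2]; rewrite addc_re_im; apply: boxP.
  by apply: le_lt_trans (ler_normD _ _) _; lra.
by apply: le_lt_trans (ler_normD _ _) _; lra.
Qed.

Lemma near_boxP z (A : set (cplx R)) : (\forall w \near z, A w) <->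
  exists2 e : R, 0 < e & box z e `<=` A.
Proof.
split=> [/nbhs_boxP [e e0 H]|[e e0 H]].
  by exists e => // w /boxE [a [b [ha hb ->]]]; exact: H.
by apply/nbhs_boxP; exists e => // a b ha hb; apply: H; exact: boxP.
Qed.

Lemma box_sub z e e' : e <= e' -> box z e `<=` box z e'.
Proof. by move=> ee w [h1 h2]; split; apply: lt_le_trans ee. Qed.

Lemma pd_line_re f z (s t p q : R) : pd f (z + (s +i* t)) p q ->
  is_derive s 1 (fun u : R => f (z + (u +i* t))) p.
Proof.
case=> H _.
have H' : is_derive (s - s) 1 (fun v : R => f (z + (s +i* t) + (v +i* 0))) p by rewrite subrr.
have {}H' := isd_comp (g := fun u => u - s) H' (isdB (isd_id s) (isd_cst s s)).
apply: isd_eq (isd_ext _ H') _; last by rewrite subr0 mulr1.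
by move=> u /=; rewrite addc_re_im addr0 [s + _]addrC subrK.
Qed.

Lemma pd_line_im f z (s t p q : R) : pd f (z + (s +i* t)) p q ->
  is_derive t 1 (fun u : R => f (z + (s +i* u))) q.
Proof.
case=> _ H.
have H' : is_derive (t - t) 1 (fun v : R => f (z + (s +i* t) + (0 +i* v))) q by rewrite subrr.
have {}H' := isd_comp (g := fun u => u - t) H' (isdB (isd_id t) (isd_cst t t)).
apply: isd_eq (isd_ext _ H') _; last by rewrite subr0 mulr1.
by move=> u /=; rewrite addc_re_im addr0 [t + _]addrC subrK.
Qed.

Opaque dx dy.

Lemma schwarz D f z : open D -> smooth_on D f -> D z -> dy (dx f) z = dx (dy f) z.
Proof.
move=> oD sf Dz; apply/eqP; rewrite -subr_eq0 -normr_le0; apply/ler_addgt0Pr => e e0.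
rewrite add0r.
have e2 : 0 < e / 2 by rewrite divr_gt0.
have /ccontP /(_ _ e2) [d1 d10 H1] := smooth_cont (smooth_dy (smooth_dx sf)) Dz.
have /ccontP /(_ _ e2) [d2 d20 H2] := smooth_cont (smooth_dx (smooth_dy sf)) Dz.
have /near_boxP [d3 d30 H3] := open_near oD Dz.
(* Half the minimum, so that the closed square of side [h] stays where each mixed derivative varies
   by less than [e / 2]. *)
pose h := Num.min d1 (Num.min d2 d3) / 2.
have : 0 < Num.min d1 (Num.min d2 d3) by rewrite !lt_min d10 d20.
move=> m0; have h0 : 0 < h by rewrite divr_gt0.
have hm : h < Num.min d1 (Num.min d2 d3) by rewrite ltr_pdivrMr // ltr_pMr // ltr1n.
move: hm; rewrite !lt_min => /and3P[h1 h2 h3].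
have inD s t : 0 <= s <= h -> 0 <= t <= h -> D (z + (s +i* t)).
  move=> /andP[s0 sh] /andP[t0 th]; apply: H3; apply: boxP; rewrite ger0_norm //; lra.
(* The second difference over this square is evaluated by the mean value theorem in both orders. *)
pose Q := f (z + (h +i* h)) - f (z + (h +i* 0)) - f (z + (0 +i* h)) + f (z + (0 +i* 0)).
have hI : 0 <= h <= h by rewrite ltW /=.
have zI : 0 <= (0 : R) <= h by rewrite lexx ltW.
have [s1 [t1 [s1h t1h E1]]] : exists s t, [/\ 0 < s < h, 0 < t < h & Q = dy (dx f) (z + (s +i* t)) * h * h].
  have [|s sh E] := @mvt _ (fun s => f (z + (s +i* h)) - f (z + (s +i* 0)))
    (fun s => dx f (z + (s +i* h)) - dx f (z + (s +i* 0))) 0 h h0.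
    by move=> s sh; apply: isdB; apply: pd_line_re; apply: smooth_pd sf _; exact: inD.
  have [|t th E'] := @mvt _ (fun t => dx f (z + (s +i* t))) (fun t => dy (dx f) (z + (s +i* t))) 0 h h0.
    move=> t th; apply: pd_line_im; apply: smooth_pd (smooth_dx sf) _.
    by apply: inD => //; case/andP: sh => ? ?; rewrite !ltW.
  exists s, t; split; [exact: sh|exact: th|]; rewrite /= !subr0 in E E'; rewrite -E' -E /Q; ring.
have [s2 [t2 [s2h t2h E2]]] : exists s t, [/\ 0 < s < h, 0 < t < h & Q = dx (dy f) (z + (s +i* t)) * h * h].
  have [|t th E] := @mvt _ (fun t => f (z + (h +i* t)) - f (z + (0 +i* t)))
    (fun t => dy f (z + (h +i* t)) - dy f (z + (0 +i* t))) 0 h h0.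
    by move=> t th; apply: isdB; apply: pd_line_im; apply: smooth_pd sf _; exact: inD.
  have [|s sh E'] := @mvt _ (fun s => dy f (z + (s +i* t))) (fun s => dx (dy f) (z + (s +i* t))) 0 h h0.
    move=> s sh; apply: pd_line_re; apply: smooth_pd (smooth_dy sf) _.
    by apply: inD => //; case/andP: th => ? ?; rewrite !ltW.
  exists s, t; split; [exact: sh|exact: th|]; rewrite /= !subr0 in E E'; rewrite -E' -E /Q; ring.
case/andP: s1h => s1p s1h; case/andP: s2h => s2p s2h.
case/andP: t1h => t1p t1h; case/andP: t2h => t2p t2h.
have := H1 s1 t1; rewrite (gtr0_norm s1p) (gtr0_norm t1p).
move=> /(_ (lt_trans s1h h1) (lt_trans t1h h1)) A.
have := H2 s2 t2; rewrite (gtr0_norm s2p) (gtr0_norm t2p).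
move=> /(_ (lt_trans s2h h2) (lt_trans t2h h2)) B.
have E : dy (dx f) (z + (s1 +i* t1)) = dx (dy f) (z + (s2 +i* t2)).
  have cancel (Q' x y : R) : Q' = x * h * h -> Q' = y * h * h -> x = y.
    by move=> -> /mulIf; rewrite gt_eqF // => /(_ isT) /mulIf; rewrite gt_eqF // => /(_ isT).
  exact: (cancel _ _ _ E1 E2).
rewrite -E in B; rewrite distrC in A; rewrite -(subrKA (dy (dx f) (z + (s1 +i* t1)))).
apply: le_trans (ler_normD _ _) _; rewrite [leRHS](splitr e).
apply: lerD; [exact: ltW A|exact: ltW B].
Qed.

Definition diff_at f z (p q : R) := forall e, 0 < e -> exists2 dl, 0 < dl &
  forall a b, `|a| < dl -> `|b| < dl ->
    `|f (z + (a +i* b)) - f z - (p * a + q * b)| <= e * (`|a| + `|b|).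

Lemma pd_diff f fx fy z : (\forall w \near z, pd f w (fx w) (fy w)) ->
  {for z, continuous fx} -> {for z, continuous fy} -> diff_at f z (fx z) (fy z).
Proof.
move=> /near_boxP [r r0 H] /ccontP cx /ccontP cy e e0.
have [d1 d10 H1] := cx _ e0; have [d2 d20 H2] := cy _ e0.
exists (Num.min r (Num.min d1 d2)); first by rewrite !lt_min r0 d10.
move=> a b; rewrite !lt_min => /and3P[ar a1 a2] /and3P[br b1 b2].
(* The increment is split into a vertical leg up to height [b] and a horizontal leg of length [a];
   each varies one coordinate only. *)
have [|s sa E] := @mvt_dist _ (fun s => f (z + (s +i* b))) (fun s => fx (z + (s +i* b))) 0 a.
  move=> t; rewrite !subr0 => ta; apply: pd_line_re; apply: H; apply: boxP => //.
  exact: le_lt_trans ta ar.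
have [|t tb E'] := @mvt_dist _ (fun t => f (z + (0 +i* t))) (fun t => fy (z + (0 +i* t))) 0 b.
  move=> t; rewrite !subr0 => tb; apply: pd_line_im; apply: H; apply: boxP; rewrite ?normr0 //.
  exact: le_lt_trans tb br.
rewrite !subr0 in E E' sa tb.
have -> : f (z + (a +i* b)) - f z - (fx z * a + fy z * b) =
    (fx (z + (s +i* b)) - fx z) * a + (fy (z + (0 +i* t)) - fy z) * b.
  rewrite -{2}(addc0 z); lra.
apply: le_trans (ler_normD _ _) _; rewrite !normrM mulrDr; apply: lerD; rewrite ler_wpM2r //.
  by apply/ltW/H1 => //; exact: le_lt_trans sa a1.
by apply/ltW/H2; rewrite ?normr0 //; exact: le_lt_trans tb b2.
Qed.

Lemma smooth_diff D f z : open D -> smooth_on D f -> D z -> diff_at f z (dx f z) (dy f z).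
Proof.
move=> oD sf Dz; apply: (@pd_diff f (dx f) (dy f) z).
- by apply: filterS (open_near oD Dz) => w; exact: smooth_pd.
- exact: smooth_cont (smooth_dx sf) Dz.
- exact: smooth_cont (smooth_dy sf) Dz.
Qed.

Lemma diff_curve f (c1 c2 : R -> R) (t p q d1 d2 : R) :
  diff_at f (c1 t +i* c2 t) p q -> is_derive t 1 c1 d1 -> is_derive t 1 c2 d2 ->
  is_derive t 1 (fun s => f (c1 s +i* c2 s)) (p * d1 + q * d2).
Proof.
move=> H /isdP H1 /isdP H2; apply/isdP => e e0.
(* [M] bounds the increment of the curve by [M * |h|] once its linear errors are at most [|h|]; [N]
   collects the coefficients of these errors. Each of the two sources of error costs half of [e]. *)
pose M := `|d1| + `|d2| + 2.
have M0 : 0 < M by rewrite /M ltr_wpDl // addr_ge0.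
pose e1 := e / 2 / M; have e10 : 0 < e1 by rewrite !divr_gt0.
pose N := `|p| + `|q| + 1; have N0 : 0 < N by rewrite /N ltr_wpDl // addr_ge0.
pose e2 := Num.min 1 (e / 2 / N); have e20 : 0 < e2 by rewrite lt_min ltr01 !divr_gt0.
have [r r0 Hr] := H _ e10; have [r1 r10 Hr1] := H1 _ e20; have [r2 r20 Hr2] := H2 _ e20.
exists (Num.min (r / M) (Num.min r1 r2)); first by rewrite !lt_min r10 r20 divr_gt0.
move=> h; rewrite !lt_min => /and3P[hM h1 h2].
pose a := c1 (t + h) - c1 t; pose b := c2 (t + h) - c2 t.
have Ea := Hr1 _ h1; have Eb := Hr2 _ h2.
have e21 : e2 <= 1 by rewrite ge_min lexx.
have hM' : `|h| * M < r by rewrite -ltr_pdivlMr.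
have h0 := normr_ge0 h.
have na : `|a| <= (`|d1| + 1) * `|h|.
  have -> : a = d1 * h + (a - d1 * h) by ring.
  apply: le_trans (ler_normD _ _) _; rewrite normrM mulrDl lerD2l.
  by apply: le_trans Ea _; rewrite ler_wpM2r.
have nb : `|b| <= (`|d2| + 1) * `|h|.
  have -> : b = d2 * h + (b - d2 * h) by ring.
  apply: le_trans (ler_normD _ _) _; rewrite normrM mulrDl lerD2l.
  by apply: le_trans Eb _; rewrite ler_wpM2r.
have n1 := normr_ge0 d1; have n2 := normr_ge0 d2.
have ar : `|a| < r by apply: le_lt_trans hM'; rewrite /M; nra.
have br : `|b| < r by apply: le_lt_trans hM'; rewrite /M; nra.
have E := Hr _ _ ar br.
have Ec : (c1 t +i* c2 t) + (a +i* b) = c1 (t + h) +i* c2 (t + h).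
  by apply/eqP; rewrite eq_complex /= /a /b; apply/andP; split; apply/eqP; ring.
rewrite Ec in E.
have -> : f (c1 (t + h) +i* c2 (t + h)) - f (c1 t +i* c2 t) - (p * d1 + q * d2) * h =
  (f (c1 (t + h) +i* c2 (t + h)) - f (c1 t +i* c2 t) - (p * a + q * b)) +
  (p * (a - d1 * h) + q * (b - d2 * h)) by ring.
apply: le_trans (ler_normD _ _) _.
have B1 : e1 * (`|a| + `|b|) <= e / 2 * `|h|.
  apply: (@le_trans _ _ (e1 * (M * `|h|))); last by rewrite mulrA divfK ?gt_eqF.
  by apply: ler_wpM2l; [exact: ltW|rewrite /M; lra].
have B2 : `|p * (a - d1 * h) + q * (b - d2 * h)| <= e / 2 * `|h|.
  apply: le_trans (ler_normD _ _) _; rewrite !normrM.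
  apply: (@le_trans _ _ (N * (e2 * `|h|))).
    have np := normr_ge0 p; have nq := normr_ge0 q; rewrite /N.
    rewrite 2!mulrDl -[leLHS]addr0; apply: lerD; last by rewrite mul1r mulr_ge0 // ltW.
    by apply: lerD; apply: ler_wpM2l.
  rewrite mulrA ler_wpM2r // mulrC -ler_pdivlMr // /e2 ge_min lexx orbT //.
lra.
Qed.

Lemma isd_aff (x u t : R) : is_derive t 1 (fun s : R => x + s * u) u.
Proof.
by apply: isd_eq (isdD (isd_cst x t) (isdM (isd_id t) (isd_cst u t))) _; ring.
Qed.

Lemma diff_line f z (t u v p q : R) : diff_at f (z + ((t * u) +i* (t * v))) p q ->
  is_derive t 1 (fun s => f (z + ((s * u) +i* (s * v)))) (p * u + q * v).
Proof.
case: z => x y H.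
exact: (@diff_curve f (fun s => x + s * u) (fun s => y + s * v) t p q u v H
  (isd_aff x u t) (isd_aff y v t)).
Qed.

End Plane.

(** * Cauchy's formula and removable singularities *)

Section Primitive.
Context {R : realType}.
Implicit Types (f g G : R -> R) (a b x s t e : R).

Lemma ex_primitive_open f a b : a < b -> (forall x, {for x, continuous f}) ->
  exists G, forall x, a < x < b -> is_derive x 1 G (f x).
Proof.
move=> ab cf.
have fi : (@lebesgue_measure R).-integrable `[a, b] (EFin \o f).
  apply: continuous_compact_integrable; first exact: segment_compact.
  exact: continuous_subspaceT.
exists (fun x => \int[@lebesgue_measure R]_(t in [set` `[a, x]]) (f t))%R => x /andP[ax xb].
by have [d <-] := continuous_FTC1_closed xb fi ax (cf x); exact: derivable_isd.
Qed.

(** Retraction onto [a, b]. Composing with it extends a function from the segment to the line and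
    keeps two-sided continuity at the ends. *)
Definition clamp a b x := Num.max a (Num.min b x).

Lemma clamp_id a b x : a <= x <= b -> clamp a b x = x.
Proof. by move=> /andP[ax xb]; rewrite /clamp min_r // max_r. Qed.

Lemma clamp_in a b x : a <= b -> a <= clamp a b x <= b.
Proof. by move=> ab; rewrite /clamp le_max lexx /= ge_max ab ge_min lexx. Qed.

Lemma clamp_dist a b x y : `|clamp a b x - clamp a b y| <= `|x - y|.
Proof.
have hmin u v : `|Num.min b u - Num.min b v| <= `|u - v|.
  have := ler_norm (u - v); have := ler_norm (- (u - v)); rewrite normrN ler_norml.
  rewrite /Num.min; case: (ltP b u) => h1; case: (ltP b v) => h2; lra.
have hmax u v : `|Num.max a u - Num.max a v| <= `|u - v|.
  have := ler_norm (u - v); have := ler_norm (- (u - v)); rewrite normrN ler_norml.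
  rewrite /Num.max; case: (ltP a u) => h1; case: (ltP a v) => h2; lra.
exact: le_trans (hmax _ _) (hmin _ _).
Qed.

Lemma clamp_cont a b f : a <= b -> (forall x, a <= x <= b -> {for x, continuous f}) ->
  forall x, {for x, continuous (f \o clamp a b)}.
Proof.
move=> ab cf x; apply/contP => e e0.
have /contP /(_ e e0) [d d0 H] := cf _ (clamp_in x ab).
by exists d => // t tx; apply: H; exact: le_lt_trans (clamp_dist _ _ _ _) tx.
Qed.

Lemma ex_primitive f a b : a <= b -> (forall x, a <= x <= b -> {for x, continuous f}) ->
  exists G, forall x, a <= x <= b -> is_derive x 1 G (f x).
Proof.
(* The larger interval makes the derivative two-sided at [a] and [b]. *)
move=> ab cf; have [||G HG] := @ex_primitive_open (f \o clamp a b) (a - 1) (b + 1).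
- by lra.
- exact: clamp_cont.
exists G => x xab; have := HG x; rewrite /= clamp_id //; apply.
by case/andP: xab => *; apply/andP; lra.
Qed.

(** The integral as the increment of any primitive, 0 if there is none. Its rules then reduce to
    rules for derivatives. *)
Definition int01 f : R := xget 0 [set v | exists2 G,
  forall s, 0 <= s <= 1 -> is_derive s 1 G (f s) & v = G 1 - G 0].

Lemma isd0_segment f a b : a <= b -> (forall s, a < s < b -> is_derive s 1 f 0) ->
  (forall s, a <= s <= b -> {for s, continuous f}) -> f b = f a.
Proof.
rewrite le_eqVlt => /orP[/eqP -> //|ab] H C.
have [c _ E] := mvt_cont ab (fun s hs => H s hs) C.
by apply/eqP; rewrite -subr_eq0 E mul0r.
Qed.

Lemma prim_diff f a b G1 G2 : a <= b -> (forall s, a <= s <= b -> is_derive s 1 G1 (f s)) ->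
  (forall s, a <= s <= b -> is_derive s 1 G2 (f s)) -> G1 b - G1 a = G2 b - G2 a.
Proof.
move=> ab H1 H2; suff : G1 b - G2 b = G1 a - G2 a by lra.
have H s : a <= s <= b -> is_derive s 1 (fun s => G1 s - G2 s) 0.
  by move=> hs; apply: isd_eq (isdB (H1 _ hs) (H2 _ hs)) (subrr _).
apply: (isd0_segment (f := fun s => G1 s - G2 s) ab) => s hs; last exact: isd_cont (H s hs).
by apply: H; case/andP: hs => *; rewrite !ltW.
Qed.

Lemma int01E f G : (forall s, 0 <= s <= 1 -> is_derive s 1 G (f s)) -> int01 f = G 1 - G 0.
Proof.
move=> HG; rewrite /int01; case: xgetP => [v -> [G' HG' ->]|/(_ (G 1 - G 0)) []].
  exact: (prim_diff ler01 HG' HG).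
by exists G.
Qed.

Definition cont01 f := forall s, 0 <= s <= 1 -> {for s, continuous f}.

Lemma int01_ex f : cont01 f -> exists2 G, forall s, 0 <= s <= 1 -> is_derive s 1 G (f s)
  & int01 f = G 1 - G 0.
Proof. by move=> /(ex_primitive ler01) [G HG]; exists G => //; exact: int01E. Qed.

Lemma int01_ext f g : cont01 f -> (forall s, 0 <= s <= 1 -> f s = g s) -> int01 f = int01 g.
Proof.
move=> /int01_ex [G HG ->] fg.
have H s : 0 <= s <= 1 -> is_derive s 1 G (g s) by move=> hs; rewrite -fg //; exact: HG.
by rewrite (int01E H).
Qed.

Lemma int01D f g : cont01 f -> cont01 g -> int01 (fun s => f s + g s) = int01 f + int01 g.
Proof.
move=> /int01_ex [F HF ->] /int01_ex [G HG ->].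
have H s : 0 <= s <= 1 -> is_derive s 1 (fun s => F s + G s) (f s + g s).
  by move=> hs; apply: isdD; [exact: HF|exact: HG].
rewrite (int01E H); ring.
Qed.

Lemma int01Z f a : cont01 f -> int01 (fun s => a * f s) = a * int01 f.
Proof.
move=> /int01_ex [F HF ->].
have H s : 0 <= s <= 1 -> is_derive s 1 (fun s => a * F s) (a * f s).
  move=> hs; apply: isd_eq (isdM (isd_cst a s) (HF _ hs)) _; ring.
rewrite (int01E H); ring.
Qed.

Lemma int01_cst a : int01 (fun=> a) = a.
Proof.
have H s : 0 <= s <= 1 -> is_derive s 1 (fun s => s * a) a.
  by move=> _; apply: isd_eq (isdM (isd_id s) (isd_cst a s)) _; ring.
rewrite (int01E H); ring.
Qed.

Lemma int01_bound f e : cont01 f -> (forall s, 0 <= s <= 1 -> `|f s| <= e) -> `|int01 f| <= e.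
Proof.
move=> /int01_ex [F HF ->] H; have [c /andP[c0 c1] ->] := mvt ltr01 HF.
by rewrite subr0 mulr1; apply: H; rewrite !ltW.
Qed.

Lemma contD f g x : {for x, continuous f} -> {for x, continuous g} ->
  {for x, continuous (fun t => f t + g t)}.
Proof. by move=> Hf Hg; exact: cvgD. Qed.

Lemma contM f g x : {for x, continuous f} -> {for x, continuous g} ->
  {for x, continuous (fun t => f t * g t)}.
Proof. by move=> Hf Hg; exact: cvgM. Qed.

Lemma cont_cst a x : {for x, continuous (fun _ : R => a)}.
Proof. exact: cvg_cst. Qed.

Lemma cont01D f g : cont01 f -> cont01 g -> cont01 (fun s => f s + g s).
Proof. by move=> Hf Hg s hs; apply: contD; [exact: Hf|exact: Hg]. Qed.

Lemma cont01Z f a : cont01 f -> cont01 (fun s => a * f s).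
Proof. by move=> Hf s hs; apply: contM; [exact: cont_cst|exact: Hf]. Qed.

(** The mean value theorem in [t] turns the first-order error into an increment of [g'] times [h],
    which the last hypothesis bounds for all [s] at once. *)
Lemma int01_leibniz (g g' : R -> R -> R) t0 dl : 0 < dl ->
  (forall t, `|t - t0| < dl -> forall s, 0 <= s <= 1 -> is_derive t 1 (g ^~ s) (g' t s)) ->
  (forall t, `|t - t0| < dl -> cont01 (g t)) -> cont01 (g' t0) ->
  (forall e, 0 < e -> exists2 d, 0 < d &
     forall t, `|t - t0| < d -> forall s, 0 <= s <= 1 -> `|g' t s - g' t0 s| <= e) ->
  is_derive t0 1 (fun t => int01 (g t)) (int01 (g' t0)).
Proof.
move=> dl0 H cg cg' U; apply/isdP => e e0; have [d d0 Hd] := U e e0.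
exists (Num.min dl d); first by rewrite lt_min dl0.
move=> h; rewrite lt_min => /andP[h1 h2].
have c0 : cont01 (g t0) by apply: cg; rewrite subrr normr0.
have c1 : cont01 (g (t0 + h)) by apply: cg; rewrite addrC addKr.
have -> : int01 (g (t0 + h)) - int01 (g t0) - int01 (g' t0) * h =
    int01 (fun s => g (t0 + h) s + ((-1) * g t0 s + (- h) * g' t0 s)).
  rewrite int01D //; last by apply: cont01D; exact: cont01Z.
  rewrite int01D; [|exact: cont01Z|exact: cont01Z]; rewrite !int01Z //; ring.
apply: int01_bound; first by apply: cont01D => //; apply: cont01D; exact: cont01Z.
move=> s hs; have [|c cx E] := @mvt_dist _ (g ^~ s) (g' ^~ s) t0 (t0 + h).
  move=> t; rewrite [t0 + h]addrC addrK => th; apply: H => //.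
  exact: le_lt_trans th h1.
rewrite [t0 + h - t0]addrAC subrr add0r in E cx.
have -> : g (t0 + h) s + (-1 * g t0 s + - h * g' t0 s) = (g' c s - g' t0 s) * h.
  by rewrite mulrBl -E /=; ring.
rewrite normrM ler_wpM2r //; apply: Hd => //; exact: le_lt_trans cx h2.
Qed.

End Primitive.

(** * Integrals depending on a parameter *)

Section Joint.
Context {R : realType} {T : topologicalType}.
Implicit Types (g h : T -> R -> R) (z : T) (s : R).

Definition jcont g z s := {for (z, s), continuous (fun q : T * R => g q.1 q.2)}.

Lemma jcontD g h z s : jcont g z s -> jcont h z s -> jcont (fun w t => g w t + h w t) z s.
Proof. by move=> Hg Hh; exact: (@cvgD _ _ _ _ (nbhs_filter (z, s)) _ _ _ _ Hg Hh). Qed.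

Lemma jcontM g h z s : jcont g z s -> jcont h z s -> jcont (fun w t => g w t * h w t) z s.
Proof. by move=> Hg Hh; exact: (@cvgM _ _ _ (nbhs_filter (z, s)) _ _ _ _ Hg Hh). Qed.

Lemma jcont_comp g (f : R -> R) z s : jcont g z s -> {for g z s, continuous f} ->
  jcont (fun w t => f (g w t)) z s.
Proof. by move=> Hg Hf; exact: (@continuous_comp _ _ _ (fun q : T * R => g q.1 q.2) f _ Hg Hf). Qed.

Lemma jcont_fst (f : T -> R) z s : {for z, continuous f} -> jcont (fun w _ => f w) z s.
Proof.
move=> Hf; apply: (@continuous_comp _ _ _ (fun q : T * R => q.1) f) => //.
exact: cvg_fst.
Qed.

Lemma jcont_snd (f : R -> R) z s : {for s, continuous f} -> jcont (fun _ t => f t) z s.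
Proof.
move=> /contP Hf; apply/(@cvgrPdist_lt _ _ _ _ (nbhs_filter (z, s))) => e e0.
have [d d0 Hd] := Hf e e0; exists (setT, [set t | `|t - s| < d]).
  by split; [exact: (@filterT _ (nbhs z))|apply/near_itvP; exists d].
by move=> [w t] /= [_ td]; rewrite distrC; exact: Hd.
Qed.

Lemma jcont_near g z s e : jcont g z s -> 0 < e ->
  exists2 A : set T, nbhs z A & exists2 d, 0 < d &
    forall w t, A w -> `|t - s| < d -> `|g w t - g z s| < e.
Proof.
move=> /(@cvgrPdist_lt _ _ _ _ (nbhs_filter (z, s))) /[apply] -[[A B] /= [nA nB] H].
have /near_itvP [d d0 Hd] : \forall t \near s, B t by exact: nB.
exists A => //; exists d => // w t Aw td; rewrite distrC.
by apply: (H (w, t)); split => //=; exact: Hd.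
Qed.

Lemma jcont_r g z s : jcont g z s -> {for s, continuous (g z)}.
Proof.
move=> H; apply/contP => e e0; have [A nA [d d0 Hd]] := jcont_near H e0.
by exists d => // t td; apply: Hd => //; exact: nbhs_singleton.
Qed.

(** Compactness of [0, 1] makes the estimates of joint continuity uniform in [s]. *)
Lemma jcont_tube g z : (forall s, 0 <= s <= 1 -> jcont g z s) ->
  forall e, 0 < e -> \forall w \near z, forall s, 0 <= s <= 1 -> `|g w s - g z s| < e.
Proof.
move=> H e e0; have /compact_near_coveringP C := @segment_compact R 0 1.
have H' s : `[0, 1]%classic s -> \forall s' \near s & w \near nbhs z, `|g w s' - g z s'| < e.
  rewrite /= in_itv /= => hs; have e2 : 0 < e / 2 by rewrite divr_gt0.
  have [A nA [d d0 Hd]] := jcont_near (H _ hs) e2.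
  exists ([set t | `|t - s| < d], A).
    by split => //; apply/near_itvP; exists d.
  move=> [t w] /= [td Aw]; have h1 := Hd _ _ Aw td; have h2 := Hd _ _ (nbhs_singleton nA) td.
  rewrite -(subrKA (g z s)); apply: le_lt_trans (ler_normD _ _) _.
  by rewrite (distrC (g z s)) [ltRHS](splitr e); exact: ltrD.
have N := C T (nbhs z) (fun w s => `|g w s - g z s| < e) (nbhs_filter z) H'.
apply: (@filterS _ _ (nbhs_filter z) _ _ _ N) => w hw s hs.
by apply: hw; rewrite /= in_itv.
Qed.

Lemma int01_cont g z : (\forall w \near z, cont01 (g w)) -> (forall s, 0 <= s <= 1 -> jcont g z s) ->
  {for z, continuous (fun w => int01 (g w))}.
Proof.
move=> nC H; apply/(@cvgrPdist_lt _ _ _ _ (nbhs_filter z)) => e e0.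
have e2 : 0 < e / 2 by rewrite divr_gt0.
have N := @filterI _ _ (nbhs_filter z) _ _ nC (jcont_tube H e2).
apply: (@filterS _ _ (nbhs_filter z) _ _ _ N) => w [cw Hw].
have cz := nbhs_singleton nC.
have -> : int01 (g z) - int01 (g w) = int01 (fun s => g z s + (-1) * g w s).
  by rewrite int01D ?int01Z //; [ring|exact: cont01Z].
apply: (@le_lt_trans _ _ (e / 2)); last by rewrite ltr_pdivrMr // ltr_pMr // ltr1n.
apply: int01_bound; first by apply: cont01D => //; exact: cont01Z.
by move=> s hs; rewrite mulN1r distrC ltW // Hw.
Qed.

End Joint.

Section Leibniz.
Context {R : realType}.
Implicit Types (D : set (cplx R)).

Lemma int01_isd (g g' : R -> R -> R) (t0 dl : R) : 0 < dl ->
  (forall t, `|t - t0| < dl -> forall s, 0 <= s <= 1 -> is_derive t 1 (g ^~ s) (g' t s)) ->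
  (forall t, `|t - t0| < dl -> cont01 (g t)) ->
  (forall s, 0 <= s <= 1 -> jcont g' t0 s) ->
  is_derive t0 1 (fun t => int01 (g t)) (int01 (g' t0)).
Proof.
move=> dl0 H cg jg; apply: (int01_leibniz dl0 H cg).
  by move=> s hs; exact: jcont_r (jg s hs).
move=> e e0; have /near_itvP [d d0 Hd] := jcont_tube jg e0.
by exists d => // t td s hs; apply/ltW/Hd.
Qed.

Lemma jcont_line (g : cplx R -> R -> R) (c : R -> cplx R) t s :
  jcont g (c t) s -> {for t, continuous c} -> jcont (fun u => g (c u)) t s.
Proof.
move=> Hg Hc; apply/(@cvgrPdist_lt _ _ _ _ (nbhs_filter (t, s))) => e e0.
have [A nA [d d0 Hd]] := jcont_near Hg e0.
exists ([set u | A (c u)], [set u | `|u - s| < d]).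
  by split; [exact: Hc|apply/near_itvP; exists d].
by move=> [u v] /= [Au uv]; rewrite distrC; exact: Hd.
Qed.

Lemma cont_line_re (z : cplx R) t : {for t, continuous (fun u : R => z + (u +i* 0))}.
Proof.
move=> A /nbhs_boxP [e e0 H]; apply/near_itvP; exists e => // u ut.
rewrite /= ; have -> : z + (u +i* 0) = z + (t +i* 0) + ((u - t) +i* 0).
  by rewrite addc_re_im addr0 [t + _]addrC subrK.
by apply: H; rewrite ?normr0.
Qed.

Lemma cont_line_im (z : cplx R) t : {for t, continuous (fun u : R => z + (0 +i* u))}.
Proof.
move=> A /nbhs_boxP [e e0 H]; apply/near_itvP; exists e => // u ut.
rewrite /= ; have -> : z + (0 +i* u) = z + (0 +i* t) + (0 +i* (u - t)).
  by rewrite addc_re_im addr0 [t + _]addrC subrK.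
by apply: H; rewrite ?normr0.
Qed.

Lemma int01_pd D (g gx gy : cplx R -> R -> R) z : open D ->
  (forall w s, D w -> 0 <= s <= 1 -> jcont g w s) ->
  (forall w s, D w -> 0 <= s <= 1 -> jcont gx w s) ->
  (forall w s, D w -> 0 <= s <= 1 -> jcont gy w s) ->
  (forall w s, D w -> 0 <= s <= 1 -> pd (g ^~ s) w (gx w s) (gy w s)) -> D z ->
  pd (fun w => int01 (g w)) z (int01 (gx z)) (int01 (gy z)).
Proof.
move=> oD jg jx jy Hp Dz; have /near_boxP [r r0 Hr] := open_near oD Dz.
have D1 t : `|t - 0| < r -> D (z + (t +i* 0)).
  by rewrite subr0 => tr; apply: Hr; apply: boxP; rewrite ?normr0.
have D2 t : `|t - 0| < r -> D (z + (0 +i* t)).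
  by rewrite subr0 => tr; apply: Hr; apply: boxP; rewrite ?normr0.
split.
  rewrite -[X in int01 (gx X)](addc0 z).
  apply: (@int01_isd (fun t => g (z + (t +i* 0))) (fun t => gx (z + (t +i* 0))) 0 r r0).
  - by move=> t tr s hs; exact: (pd_line_re (f := g ^~ s) (Hp _ _ (D1 _ tr) hs)).
  - by move=> t tr s hs; exact: jcont_r (jg _ _ (D1 _ tr) hs).
  move=> s hs; apply: (@jcont_line gx (fun t => z + (t +i* 0))); last exact: cont_line_re.
  by apply: jx => //; rewrite addc0.
rewrite -[X in int01 (gy X)](addc0 z).
apply: (@int01_isd (fun t => g (z + (0 +i* t))) (fun t => gy (z + (0 +i* t))) 0 r r0).
- by move=> t tr s hs; exact: (pd_line_im (f := g ^~ s) (Hp _ _ (D2 _ tr) hs)).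
- by move=> t tr s hs; exact: jcont_r (jg _ _ (D2 _ tr) hs).
move=> s hs; apply: (@jcont_line gy (fun t => z + (0 +i* t))); last exact: cont_line_im.
by apply: jy => //; rewrite addc0.
Qed.

(** [smooth_class] for parameter integrals: differentiation under the integral sign transfers the
    closure of the integrands to the integrals. *)
Lemma int01_smooth D (C : (cplx R -> R -> R) -> Prop) : open D ->
  (forall g, C g -> (forall w s, D w -> 0 <= s <= 1 -> jcont g w s) /\
    exists gx gy, [/\ C gx, C gy &
      forall w s, D w -> 0 <= s <= 1 -> pd (g ^~ s) w (gx w s) (gy w s)]) ->
  forall g, C g -> smooth_on D (fun z => int01 (g z)).
Proof.
move=> oD H g Cg; apply: (@smooth_class _ D (fun f => exists2 g, C g & f = fun z => int01 (g z))) => //.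
  move=> _ [{}g {}Cg ->]; have [jg [gx [gy [Cx Cy Hp]]]] := H g Cg; split=> [z Dz|].
    apply: int01_cont; last by move=> s; exact: jg.
    by apply: filterS (open_near oD Dz) => w Dw s hs; exact: jcont_r (jg _ _ Dw hs).
  exists (fun z => int01 (gx z)), (fun z => int01 (gy z)); split; [by exists gx|by exists gy|].
  have [jx _] := H gx Cx; have [jy _] := H gy Cy.
  by move=> z; exact: int01_pd.
by exists g.
Qed.

End Leibniz.

(** * Smooth functions of one real variable *)

Section Smooth1.
Context {R : realType}.
Implicit Types (h : R -> R) (I : set R) (x : R).

Lemma sm1_class I (C : (R -> R) -> Prop) : open I ->
  (forall h, C h -> exists2 h', C h' & forall x, I x -> is_derive x 1 h (h' x)) ->
  forall h, C h -> forall x, I x -> sm1 h x.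
Proof.
move=> oI H h Ch x Ix n.
have [g Cg Hg] : exists2 g, C g & forall x, I x -> derive1n n h x = g x.
  elim: n => [|n [g Cg Hg]]; first by exists h.
  have [g' Cg' Hg'] := H _ Cg; exists g' => // y Iy; rewrite derive1nS.
  apply: isd_derive1; apply: (isd_near (f := g)); last exact: Hg'.
  by apply: filterS (open_nbhs_nbhs (conj oI Iy)) => t /Hg.
have [g' Cg' Hg'] := H _ Cg.
apply: near_eq_derivable (ex_derive (is_derive := Hg' _ Ix)).
by apply: filterS (open_nbhs_nbhs (conj oI Ix)) => t /Hg.
Qed.

Lemma isdX h x d n : is_derive x 1 h d ->
  is_derive x 1 (fun t => h t ^+ n) (n%:R * h x ^+ n.-1 * d).
Proof.
move=> H; elim: n => [|n IH]; first by rewrite !mul0r; exact: isd_cst.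
have {}IH := isdM H IH.
apply: isd_eq (isd_ext _ IH) _; first by move=> t; rewrite exprS.
by case: n {IH} => [|n] /=; rewrite ?expr0 ?exprS -?natr1; ring.
Qed.

Lemma sm1_inv x : x != 0 -> sm1 (fun t => t^-1) x.
Proof.
move=> x0; have o0 : open [set t : R | t != 0].
  rewrite openE => t /= t0; apply/near_itvP; exists `|t|; rewrite ?normr_gt0 // => u ut.
  by apply: contraTneq ut => ->; rewrite sub0r normrN ltxx.
apply: (@sm1_class _ (fun h => exists a n, h = fun t => a * t^-1 ^+ n) o0) => //.
- move=> _ [a [n ->]]; exists (fun t => - a * n%:R * t^-1 ^+ n.+1).
    by exists (- a * n%:R), n.+1.
  move=> t /= t0; have D := isd_inv t0 (isd_id t).
  have D2 : is_derive (t^-1) 1 (fun u : R => u ^+ n) (n%:R * t^-1 ^+ n.-1).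
    by apply: isd_eq (isdX n (isd_id _)) _; rewrite mulr1.
  apply: isd_eq (isdM (isd_cst a t) (isd_comp (f := fun u => u ^+ n) D2 D)) _.
  rewrite mul0r add0r; case: n {D2} => [|n] /=; first by rewrite !mul0r !mulr0 mul0r.
  by rewrite -[(t ^+ 2)^-1]exprVn !exprS; ring.
- by exists 1, 1%N; apply/funext => t; rewrite mul1r expr1.
Qed.

Lemma sm1_expR x : sm1 expR x.
Proof.
apply: (@sm1_class setT (fun h => h = expR)) => //; first exact: openT.
by move=> _ ->; exists expR => // t _; exact: is_derive_expR.
Qed.

Lemma smooth_inv (D : set (cplx R)) f : open D -> smooth_on D f -> (forall z, D z -> f z != 0) ->
  smooth_on D (fun z => (f z)^-1).
Proof.
by move=> oD sf f0; apply: (smooth_comp (h := fun t => t^-1)) => // z /f0; exact: sm1_inv.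
Qed.

(** A function on [I] is viewed as a function of the real part on a strip. Smoothness passes both
    ways, so closure rules proved in the plane serve on the line. *)
Definition strip I : set (cplx R) := [set z | I (complex.Re z)].

Lemma strip_open I : open I -> open (strip I).
Proof.
move=> oI; rewrite openE => z Iz; have : \forall x \near complex.Re z, I x.
  exact: open_nbhs_nbhs.
move/near_itvP => [e e0 H]; apply/nbhs_boxP; exists e => // a b ha hb.
by apply: H; case: z {Iz} => x y /=; rewrite addrC addKr.
Qed.

Lemma sm1_smooth I h : open I -> (forall x, I x -> sm1 h x) ->
  smooth_on (strip I) (fun z => h (complex.Re z)).
Proof.
move=> oI sh; have oS := strip_open oI.
by apply: (smooth_comp (h := h)); [|move=> z; exact: sh|exact: smooth_Re].
Qed.

Lemma derive1_shift h x : derive1 (fun t => h (x + t)) 0 = derive1 h x.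
Proof.
rewrite /derive1; set F := (fun _ => _); set G := (fun _ => _).
suff -> : F = G by [].
by apply/funext => t; rewrite /F /G !addr0 (addrC x).
Qed.

Lemma smooth_sm1 I h : smooth_on (strip I) (fun z => h (complex.Re z)) ->
  forall x, I x -> sm1 h x.
Proof.
have E x (g : R -> R) : (fun t : R => g (complex.Re ((x +i* 0 : cplx R) + (t +i* 0)))) = (fun t => g (x + t)).
  by apply/funext => t.
have d1 (g : R -> R) x : derivable (fun t => g (x + t)) 0 1 -> derivable g x 1.
  move=> D; have H := derivable_isd D.
  have H' : is_derive (x - x) 1 (fun t => g (x + t)) (derive1 (fun t => g (x + t)) 0) by rewrite subrr.
  have {}H' := isd_comp (g := fun u => u - x) H' (isdB (isd_id x) (isd_cst x x)).
  by have [] := isd_ext (g := g) _ H' => // t /=; rewrite addrC subrK.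
move=> H x Ix n; elim: n h H => [|n IH] g H.
  have [_ [/(_ (x +i* 0) Ix) [D _] _]] := H 1%N.
  by apply: d1; rewrite -E.
rewrite /derive1n iterSr; apply: IH.
have -> : (fun z => derive1 g (complex.Re z)) = dx (fun z => g (complex.Re z)); last exact: smooth_dx.
by apply/funext => -[u v]; rewrite /dx -derive1_shift.
Qed.

End Smooth1.

(** * Cauchy's formula with an exceptional point *)

Section Cauchy.
Context {R : realType}.

Lemma near_neq (z w : cplx R) : w <> z -> \forall w' \near w, w' <> z.
Proof.
move=> wz; have N (f : cplx R -> R) : f (z - w) != 0 -> exists2 e, 0 < e & ~ (`|f (z - w)| < e).
  by move=> h; exists `|f (z - w)|; rewrite ?normr_gt0 ?ltxx.
have [E|/N[e e0 He]] := eqVneq (complex.Re (z - w)) 0; last first.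
  by apply/near_boxP; exists e => // w' [h _] E; apply: He; rewrite -E.
have [E'|/N[e e0 He]] := eqVneq (complex.Im (z - w)) 0; last first.
  by apply/near_boxP; exists e => // w' [_ h] E'; apply: He; rewrite -E'.
case: wz; apply/esym/subr0_eq; apply/eqP; rewrite eq_complex.
by apply/andP; split; apply/eqP.
Qed.

Lemma jcont_cplx (T : topologicalType) (u v : T -> R -> R) (f : cplx R -> R) t s :
  jcont u t s -> jcont v t s -> {for (u t s +i* v t s), continuous f} ->
  jcont (fun t s => f (u t s +i* v t s)) t s.
Proof.
move=> ju jv /ccontP cf; apply/(@cvgrPdist_lt _ _ _ _ (nbhs_filter (t, s))) => e e0.
have [d d0 Hd] := cf e e0.
have [A nA [d1 d10 H1]] := jcont_near ju d0; have [B nB [d2 d20 H2]] := jcont_near jv d0.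
exists (A `&` B, [set x | `|x - s| < Num.min d1 d2]).
  split; first exact: (@filterI _ _ (nbhs_filter t)).
  by apply/near_itvP; exists (Num.min d1 d2); rewrite ?lt_min ?d10.
move=> [w x] /= [[Aw Bw]]; rewrite lt_min => /andP[x1 x2]; rewrite distrC.
have -> : u w x +i* v w x = (u t s +i* v t s) + ((u w x - u t s) +i* (v w x - v t s)) :> cplx R.
  by apply/eqP; rewrite eq_complex /=; apply/andP; split; apply/eqP; ring.
by apply: Hd; [exact: H1|exact: H2].
Qed.

Section Formula.
Variables (z0 : cplx R) (r : R) (a : cplx R).
Hypothesis r0 : 0 < r.
Hypothesis ha : box z0 (r / 2) a.

Let x0 := complex.Re z0.
Let y0 := complex.Im z0.
Let a1 := complex.Re a.
Let a2 := complex.Im a.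

Definition rho1 (r s : R) := r * cos (s * (pi *+ 2)).
Definition rho2 (r s : R) := r * sin (s * (pi *+ 2)).

Lemma rho_sqr s : rho1 r s ^+ 2 + rho2 r s ^+ 2 = r ^+ 2.
Proof. by rewrite !exprMn -mulrDr cos2Dsin2 mulr1. Qed.

Lemma rho_le s : `|rho1 r s| <= r /\ `|rho2 r s| <= r.
Proof.
have E := rho_sqr s; have p1 := sqr_ge0 (rho1 r s); have p2 := sqr_ge0 (rho2 r s).
by split; rewrite -(ler_pXn2r (n := 2)) ?nnegrE ?(ltW r0) // real_normK ?num_real //; lra.
Qed.

Lemma isd_rho (s : R) : is_derive s 1 (rho1 r) (- (pi *+ 2) * rho2 r s) /\
  is_derive s 1 (rho2 r) ((pi *+ 2) * rho1 r s).
Proof.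
have L : is_derive s 1 (fun s => s * (pi *+ 2)) (pi *+ 2 : R).
  by apply: isd_eq (isdM (isd_id s) (isd_cst (pi *+ 2) s)) _; ring.
split; [apply: isd_eq (isdM (isd_cst r s) (isd_comp (f := cos) (is_derive_cos _) L)) _|
        apply: isd_eq (isdM (isd_cst r s) (isd_comp (f := sin) (is_derive_sin _) L)) _];
  rewrite /rho1 /rho2; ring.
Qed.

(** [pt1 + i pt2] moves from [a] at t = 0 to the point of parameter [s] on the circle about [z0] at
    t = 1: a homotopy shrinking the circle to [a]. *)
Definition pt1 t s := a1 + t * (x0 + rho1 r s - a1).
Definition pt2 t s := a2 + t * (y0 + rho2 r s - a2).

Lemma ha12 : `|a1 - x0| < r / 2 /\ `|a2 - y0| < r / 2.
Proof. by move: ha; rewrite /box /a1 /a2 /x0 /y0; case: (a) (z0) => ? ? [? ?]. Qed.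

(** [t] ranges beyond [0, 1] so that continuity in [t] is two-sided at the ends. There |1 - t| and
    |t| are at most 2, whence the distance bound 2 (r / 2) + 2 r < 4 r. *)
Lemma pt_box t s : - 1 < t < 2 -> box z0 (4 * r) (pt1 t s +i* pt2 t s).
Proof.
move=> /andP[t1 t2]; have [h1 h2] := ha12; have [k1 k2] := rho_le s.
have t3 : `|1 - t| <= 2 by rewrite ler_norml; lra.
have t4 : `|t| <= 2 by rewrite ler_norml; lra.
have N (u v : R) : `|u| < r / 2 -> `|v| <= r -> `|(1 - t) * u + t * v| < 4 * r.
  move=> hu hv; apply: le_lt_trans (ler_normD _ _) _; rewrite !normrM.
  apply: (@le_lt_trans _ _ (2 * (r / 2) + 2 * r)); last by have := r0; lra.
  by apply: lerD; apply: ler_pM => //; exact: ltW.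
rewrite /box /= (_ : complex.Re (_ - _) = (1 - t) * (a1 - x0) + t * rho1 r s); last first.
  by rewrite /pt1 /x0; case: z0 => * /=; ring.
rewrite (_ : complex.Im (_ - _) = (1 - t) * (a2 - y0) + t * rho2 r s); last first.
  by rewrite /pt2 /y0; case: z0 => * /=; ring.
by split; apply: N.
Qed.

Let d := Num.sqrt ((a1 - x0) ^+ 2 + (a2 - y0) ^+ 2).
(** The only [t] in (0, 1) at which the homotopy can pass through [z0]: comparing moduli gives (1 -
    t) d = t r, with [d] the distance from [a] to [z0]. *)
Let tau := d / (d + r).

Lemma d_ge0 : 0 <= d. Proof. exact: sqrtr_ge0. Qed.

Lemma tau_itv : 0 <= tau <= 1.
Proof.
have dr : 0 < d + r by rewrite ltr_wpDl // d_ge0.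
rewrite /tau divr_ge0 ?d_ge0 ?(ltW dr) //= ler_pdivrMr // mul1r lerDl; exact: ltW.
Qed.

Lemma pt_neq t s : 0 < t < 1 -> t != tau -> (pt1 t s +i* pt2 t s : cplx R) <> z0.
Proof.
move=> /andP[t0 t1] tt; rewrite (_ : z0 = x0 +i* y0); last by rewrite /x0 /y0; case: z0.
case=> e1 e2; case/negP: tt; apply/eqP.
have f1 : (1 - t) * (a1 - x0) = - (t * rho1 r s) by move: e1; rewrite /pt1; lra.
have f2 : (1 - t) * (a2 - y0) = - (t * rho2 r s) by move: e2; rewrite /pt2; lra.
have E : ((1 - t) * d) ^+ 2 = (t * r) ^+ 2.
  rewrite exprMn sqr_sqrtr ?addr_ge0 ?sqr_ge0 // mulrDr -!exprMn f1 f2.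
  by rewrite !sqrrN !exprMn -mulrDr -!exprMn -/(rho1 r s) -/(rho2 r s) rho_sqr exprMn.
have {}E : (1 - t) * d = t * r.
  apply/eqP; rewrite -(eqrXn2 (n := 2)) ?E // ?mulr_ge0 ?d_ge0 ?subr_ge0 //; exact: ltW.
have dr : d + r != 0 by rewrite gt_eqF // ltr_wpDl // d_ge0.
by rewrite /tau; apply: (mulIf dr); rewrite divfK //; lra.
Qed.

Lemma jcont_pt1 (t s : R) : jcont pt1 t s.
Proof.
apply: (@jcontD R R (fun _ _ => a1) (fun t s : R => t * (x0 + rho1 r s - a1))).
  apply: (@jcont_fst R R (fun=> a1) t s); exact: cont_cst.
apply: (@jcontM R R (fun t _ => t) (fun _ s => x0 + rho1 r s - a1)).
  by apply: (@jcont_fst R R id); exact: isd_cont (isd_id _).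
apply: (@jcont_snd R R (fun s => x0 + rho1 r s - a1)).
exact: isd_cont (isdB (isdD (isd_cst x0 s) (isd_rho s).1) (isd_cst a1 s)).
Qed.

Lemma jcont_pt2 (t s : R) : jcont pt2 t s.
Proof.
apply: (@jcontD R R (fun _ _ => a2) (fun t s : R => t * (y0 + rho2 r s - a2))).
  apply: (@jcont_fst R R (fun=> a2) t s); exact: cont_cst.
apply: (@jcontM R R (fun t _ => t) (fun _ s => y0 + rho2 r s - a2)).
  by apply: (@jcont_fst R R id); exact: isd_cont (isd_id _).
apply: (@jcont_snd R R (fun s => y0 + rho2 r s - a2)).
exact: isd_cont (isdB (isdD (isd_cst y0 s) (isd_rho s).2) (isd_cst a2 s)).
Qed.

Variables (f1 f2 c1 c2 : cplx R -> R).
Hypothesis cf1 : forall w, box z0 (4 * r) w -> {for w, continuous f1}.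
Hypothesis cf2 : forall w, box z0 (4 * r) w -> {for w, continuous f2}.
Hypothesis cc1 : forall w, box z0 (4 * r) w -> w <> z0 -> {for w, continuous c1}.
Hypothesis cc2 : forall w, box z0 (4 * r) w -> w <> z0 -> {for w, continuous c2}.
Hypothesis pf1 : forall w, box z0 (4 * r) w -> w <> z0 -> pd f1 w (c1 w) (- c2 w).
Hypothesis pf2 : forall w, box z0 (4 * r) w -> w <> z0 -> pd f2 w (c2 w) (c1 w).

Definition denom s := (x0 + rho1 r s - a1) ^+ 2 + (y0 + rho2 r s - a2) ^+ 2.
(** [ker1 + i ker2] is rho / (zeta - a) with zeta = z0 + rho, the Cauchy kernel dzeta / (2 pi i
    (zeta - a)) in the parameter [s]. *)
Definition ker1 s := (rho1 r s * (x0 + rho1 r s - a1) + rho2 r s * (y0 + rho2 r s - a2)) / denom s.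
Definition ker2 s := (rho2 r s * (x0 + rho1 r s - a1) - rho1 r s * (y0 + rho2 r s - a2)) / denom s.

Lemma denom_gt0 s : 0 < denom s.
Proof.
rewrite lt_neqAle addr_ge0 ?sqr_ge0 // andbT eq_sym paddr_eq0 ?sqr_ge0 //.
apply/negP; rewrite !sqrf_eq0 => /andP[/eqP e1 /eqP e2].
have E := rho_sqr s; have [h1 h2] := ha12.
have N (u v : R) : u + v = 0 -> `|u| < r / 2 -> v ^+ 2 < (r / 2) ^+ 2.
  move=> /eqP; rewrite addrC addr_eq0 => /eqP -> h; rewrite sqrrN -(real_normK (num_real u)).
  by rewrite ltr_pXn2r ?nnegrE ?normr_ge0 // ltW // divr_gt0.
have := N (a1 - x0) (- rho1 r s); have := N (a2 - y0) (- rho2 r s); rewrite !sqrrN.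
move=> /(_ _ h2) A /(_ _ h1) B; have {}A := A _; have {}B := B _.
have := r0; have : rho1 r s ^+ 2 < (r / 2) ^+ 2 by apply: B; lra.
have : rho2 r s ^+ 2 < (r / 2) ^+ 2 by apply: A; lra.
nra.
Qed.

Lemma cont_ker s : {for s, continuous ker1} /\ {for s, continuous ker2}.
Proof.
have [d1 d2] := isd_rho s; have b1 := isdB (isdD (isd_cst x0 s) d1) (isd_cst a1 s).
have b2 := isdB (isdD (isd_cst y0 s) d2) (isd_cst a2 s).
have dn : is_derive s 1 denom _ := isdD (isdX 2 b1) (isdX 2 b2).
have di := isd_inv (lt0r_neq0 (denom_gt0 s)) dn.
split; first exact: isd_cont (isdM (isdD (isdM d1 b1) (isdM d2 b2)) di).
exact: isd_cont (isdM (isdB (isdM d2 b1) (isdM d1 b2)) di).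
Qed.

(** The real part of f times the kernel along the homotopy. In its [t]-derivative [phi'] the inner
    derivative zeta - a cancels the denominator and leaves Re (f' rho). *)
Let phi t s := f1 (pt1 t s +i* pt2 t s) * ker1 s - f2 (pt1 t s +i* pt2 t s) * ker2 s.
Let phi' t s := c1 (pt1 t s +i* pt2 t s) * rho1 r s - c2 (pt1 t s +i* pt2 t s) * rho2 r s.

Lemma jcontN (T : topologicalType) (g : T -> R -> R) z s : jcont g z s -> jcont (fun w t => - g w t) z s.
Proof. by move=> Hg; exact: (@cvgN _ _ _ _ (nbhs_filter (z, s)) _ _ Hg). Qed.

Lemma jcont_phi t s : - 1 < t < 2 -> jcont phi t s.
Proof.
move=> ht; have [k1 k2] := cont_ker s.
apply: jcontD; last apply: jcontN; apply: jcontM; try exact: jcont_snd.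
  by apply: jcont_cplx; [exact: jcont_pt1|exact: jcont_pt2|apply: cf1; exact: pt_box].
by apply: jcont_cplx; [exact: jcont_pt1|exact: jcont_pt2|apply: cf2; exact: pt_box].
Qed.

Lemma near_box_neq w : box z0 (4 * r) w -> w <> z0 -> \forall v \near w, box z0 (4 * r) v /\ v <> z0.
Proof.
move=> bw wz; apply: (@filterI _ _ (nbhs_filter w)); last exact: near_neq.
by apply: open_near => //; exact: box_open.
Qed.

Lemma isd_pt (s t : R) : is_derive t 1 (fun t => pt1 t s) (x0 + rho1 r s - a1) /\
  is_derive t 1 (fun t => pt2 t s) (y0 + rho2 r s - a2).
Proof. by split; exact: isd_aff. Qed.

Lemma diff_f w : box z0 (4 * r) w -> w <> z0 ->
  diff_at f1 w (c1 w) (- c2 w) /\ diff_at f2 w (c2 w) (c1 w).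
Proof.
move=> bw wz; split.
  apply: (@pd_diff _ f1 c1 (fun v => - c2 v)).
  - by apply: (@filterS _ _ (nbhs_filter w) _ _ _ (near_box_neq bw wz)) => v [? ?]; exact: pf1.
  - exact: cc1.
  - by apply: (ccont_comp (h := fun t => - t)); [exact: cc2|exact: isd_cont (isdN (isd_id _))].
apply: (@pd_diff _ f2 c2 c1); [|exact: cc2|exact: cc1].
by apply: (@filterS _ _ (nbhs_filter w) _ _ _ (near_box_neq bw wz)) => v [? ?]; exact: pf2.
Qed.

Lemma isd_phi (t s : R) : 0 < t < 1 -> t != tau -> is_derive t 1 (phi ^~ s) (phi' t s).
Proof.
move=> ht tt; have ht' : - 1 < t < 2 by case/andP: ht => *; apply/andP; lra.
have [D1 D2] := diff_f (pt_box s ht') (pt_neq ht tt); have [p1 p2] := isd_pt s t.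
have E1 := @diff_curve R f1 (pt1^~ s) (pt2^~ s) t _ _ _ _ D1 p1 p2.
have E2 := @diff_curve R f2 (pt1^~ s) (pt2^~ s) t _ _ _ _ D2 p1 p2.
apply: isd_eq (isdB (isdM E1 (isd_cst (ker1 s) t)) (isdM E2 (isd_cst (ker2 s) t))) _.
rewrite /phi' /ker1 /ker2; have := lt0r_neq0 (denom_gt0 s); rewrite /denom => n0.
by field.
Qed.

(** Along the closed curve of parameter [t] the [s]-derivative of f is 2 pi i t f' rho. So Re (f'
    rho) is, up to the factor 2 pi t, the derivative of Im f, which is periodic in [s]. *)
Lemma int_phi' (t : R) : 0 < t < 1 -> t != tau -> int01 (phi' t) = 0.
Proof.
move=> ht tt; have ht' : - 1 < t < 2 by case/andP: ht => *; apply/andP; lra.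
have t0 : t != 0 by case/andP: ht => h _; rewrite gt_eqF.
have pi0 : (pi *+ 2 : R) != 0 by rewrite mulrn_eq0 /= gt_eqF // pi_gt0.
have H (s : R) : 0 <= s <= 1 -> is_derive s 1
    (fun s => (t * (pi *+ 2))^-1 * f2 (pt1 t s +i* pt2 t s)) (phi' t s).
  move=> _; have [_ D2] := diff_f (pt_box s ht') (pt_neq ht tt).
  have [r1 r2] := isd_rho s.
  have q1 : is_derive s 1 (fun s => pt1 t s) (t * (- (pi *+ 2) * rho2 r s)).
    apply: isd_eq (isdD (isd_cst a1 s) (isdM (isd_cst t s)
      (isdB (isdD (isd_cst x0 s) r1) (isd_cst a1 s)))) _; ring.
  have q2 : is_derive s 1 (fun s => pt2 t s) (t * ((pi *+ 2) * rho1 r s)).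
    apply: isd_eq (isdD (isd_cst a2 s) (isdM (isd_cst t s)
      (isdB (isdD (isd_cst y0 s) r2) (isd_cst a2 s)))) _; ring.
  apply: isd_eq (isdM (isd_cst _ s) (diff_curve D2 q1 q2)) _.
  move: pi0; rewrite /phi' /=; move: (pi *+ 2 : R) => tp tp0; field; by rewrite tp0 t0.
have P : pt1 t 1 = pt1 t 0 /\ pt2 t 1 = pt2 t 0.
  by rewrite /pt1 /pt2 /rho1 /rho2 mul1r mul0r cos2pi sin2pi cos0 sin0.
by rewrite (int01E H) P.1 P.2 subrr.
Qed.

(** The integral of [phi t] is continuous in [t] with zero derivative off [tau], so it is constant
    on [0, tau] and on [tau, 1]. Its value at t = 1 is the circle integral, at t = 0 the value at
    [a] times the kernel integral. *)
Lemma cauchy_re : int01 (fun s => f1 ((x0 + rho1 r s) +i* (y0 + rho2 r s)) * ker1 s -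
    f2 ((x0 + rho1 r s) +i* (y0 + rho2 r s)) * ker2 s) =
  f1 a * int01 ker1 - f2 a * int01 ker2.
Proof.
have ck1 : cont01 ker1 by move=> s _; have [] := cont_ker s.
have ck2 : cont01 ker2 by move=> s _; have [] := cont_ker s.
have cp (t : R) : - 1 < t < 2 -> cont01 (phi t).
  move=> ht s _; exact: (jcont_r (jcont_phi ht)).
have C (t : R) : 0 <= t <= 1 -> {for t, continuous (fun t => int01 (phi t))}.
  move=> /andP[h0 h1]; apply: int01_cont; last by move=> s _; apply: jcont_phi; apply/andP; lra.
  apply/near_itvP; exists 1 => // u; rewrite ltr_norml => /andP[u1 u2].
  by apply: cp; apply/andP; lra.
have D (t : R) : 0 < t < 1 -> t != tau -> is_derive t 1 (fun t => int01 (phi t)) 0.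
  move=> /[dup] ht /andP[h0 h1] tt; rewrite -(int_phi' ht tt).
  pose m := Num.min t (Num.min (1 - t) `|t - tau|).
  have m0 : 0 < m by rewrite !lt_min h0 subr_gt0 h1 normr_gt0 subr_eq0.
  have hm u : `|u - t| < m -> 0 < u < 1 /\ u != tau.
    rewrite !lt_min => /and3P[u1 u2 u3]; split.
      by move: u1 u2; rewrite !ltr_norml => /andP[? ?] /andP[? ?]; apply/andP; lra.
    by apply: contraTneq u3 => ->; rewrite distrC ltxx.
  apply: (int01_isd m0) => [u /hm [hu ut] s _|u /hm [/andP[? ?] _]|s _].
  - exact: isd_phi.
  - by apply: cp; apply/andP; lra.
  have ht' : - 1 < t < 2 by apply/andP; lra.
  have [r1 r2] := isd_rho s; have bw := pt_box s ht'; have wz := @pt_neq t s ht tt.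
  apply: jcontD; last apply: jcontN; apply: jcontM;
    try (apply: jcont_snd; [exact: isd_cont r1]); try (apply: jcont_snd; [exact: isd_cont r2]).
    by apply: jcont_cplx; [exact: jcont_pt1|exact: jcont_pt2|exact: cc1].
  by apply: jcont_cplx; [exact: jcont_pt1|exact: jcont_pt2|exact: cc2].
have [T0 T1] := andP tau_itv.
have E1 : int01 (phi tau) = int01 (phi 0).
  apply: (isd0_segment (f := fun t => int01 (phi t)) T0) => t /andP[t1 t2].
    by apply: D; [apply/andP; lra|rewrite lt_eqF].
  by apply: C; apply/andP; lra.
have E2 : int01 (phi 1) = int01 (phi tau).
  apply: (isd0_segment (f := fun t => int01 (phi t)) T1) => t /andP[t1 t2].
    by apply: D; [apply/andP; lra|rewrite gt_eqF].
  by apply: C; apply/andP; lra.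
have F1 : int01 (phi 1) = int01 (fun s => f1 ((x0 + rho1 r s) +i* (y0 + rho2 r s)) * ker1 s -
    f2 ((x0 + rho1 r s) +i* (y0 + rho2 r s)) * ker2 s).
  apply: int01_ext; first by apply: cp; apply/andP; lra.
  have e (u v : R) : u + 1 * (v - u) = v by ring.
  by move=> s _; rewrite /phi /pt1 /pt2 !e.
rewrite -F1 E2 E1.
have -> : int01 (phi 0) = int01 (fun s => f1 a * ker1 s + (- f2 a) * ker2 s).
  apply: int01_ext; first by apply: cp; apply/andP; lra.
  move=> s _; rewrite /phi /pt1 /pt2 !mul0r !addr0 mulNr.
  by rewrite (_ : a1 +i* a2 = a) //; rewrite /a1 /a2; case: (a).
by rewrite int01D ?int01Z //; [ring|exact: cont01Z|exact: cont01Z].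
Qed.

End Formula.

Section CauchySmooth.
Variables (z0 : cplx R) (r : R).
Hypothesis r0 : 0 < r.

Let x0 := complex.Re z0.
Let y0 := complex.Im z0.

(** Integrands that contain the Cauchy kernels and are closed under partial derivatives in [z]:
    differentiating the inverse of [denom] only produces polynomial factors and further inverses. *)
Inductive kclass : (cplx R -> R -> R) -> Prop :=
| kpsi psi of (forall s, {for s, continuous psi}) : kclass (fun _ s => psi s)
| kre : kclass (fun z _ => complex.Re z)
| kim : kclass (fun z _ => complex.Im z)
| kinv : kclass (fun z s => (denom z0 r z s)^-1)
| kadd g h of kclass g & kclass h : kclass (fun z s => g z s + h z s)
| kmul g h of kclass g & kclass h : kclass (fun z s => g z s * h z s).

Lemma cont_rho s : {for s, continuous (rho1 r)} /\ {for s, continuous (rho2 r)}.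
Proof. by have [d1 d2] := isd_rho r s; split; [exact: isd_cont d1|exact: isd_cont d2]. Qed.

Lemma kcst a : kclass (fun _ _ => a).
Proof. by apply: (@kpsi (fun=> a)) => s; exact: cont_cst. Qed.

Lemma krho1 : kclass (fun _ s => rho1 r s).
Proof. by apply: kpsi => s; have [] := cont_rho s. Qed.

Lemma krho2 : kclass (fun _ s => rho2 r s).
Proof. by apply: kpsi => s; have [] := cont_rho s. Qed.

Definition ku1 (z : cplx R) s := x0 + rho1 r s + (- 1) * complex.Re z.
Definition ku2 (z : cplx R) s := y0 + rho2 r s + (- 1) * complex.Im z.

Lemma kclass_u1 : kclass ku1.
Proof. exact: kadd (kadd (kcst x0) krho1) (kmul (kcst (- 1)) kre). Qed.

Lemma kclass_u2 : kclass ku2.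
Proof. exact: kadd (kadd (kcst y0) krho2) (kmul (kcst (- 1)) kim). Qed.

Lemma denomE z s : denom z0 r z s = ku1 z s ^+ 2 + ku2 z s ^+ 2.
Proof. by rewrite /denom /ku1 /ku2 !mulN1r. Qed.

Lemma kclass_spec g : kclass g ->
  (forall w s, box z0 (r / 2) w -> 0 <= s <= 1 -> jcont g w s) /\
  exists gx gy, [/\ kclass gx, kclass gy &
    forall w s, box z0 (r / 2) w -> 0 <= s <= 1 -> pd (g ^~ s) w (gx w s) (gy w s)].
Proof.
have jre w s : @jcont R (cplx R) (fun z _ => complex.Re z) w s.
  by apply: (jcont_fst (f := fun z : cplx R => complex.Re z)); exact: ccont_Re.
have jim w s : @jcont R (cplx R) (fun z _ => complex.Im z) w s.
  by apply: (jcont_fst (f := fun z : cplx R => complex.Im z)); exact: ccont_Im.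
have jpsi psi w s : {for s, continuous psi} -> @jcont R (cplx R) (fun _ t => psi t) w s.
  exact: jcont_snd.
have jcst a w s : @jcont R (cplx R) (fun _ _ => a) w s.
  by apply: (jpsi (fun=> a)); exact: cont_cst.
elim=> {g} [psi cpsi||||g h _ [jg [gx [gy [kgx kgy pg]]]] _ [jh [hx [hy [khx khy ph]]]]
  |g h kg [jg [gx [gy [kgx kgy pg]]]] kh [jh [hx [hy [khx khy ph]]]]].
- split=> [w s _ _|]; first exact: jpsi.
  by exists (fun _ _ => 0), (fun _ _ => 0); split; [exact: kcst|exact: kcst|move=> w s _ _; exact: pd_cst].
- split=> [w s _ _|]; first exact: jre.
  by exists (fun _ _ => 1), (fun _ _ => 0); split; [exact: kcst|exact: kcst|move=> w s _ _; exact: pd_Re].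
- split=> [w s _ _|]; first exact: jim.
  by exists (fun _ _ => 0), (fun _ _ => 1); split; [exact: kcst|exact: kcst|move=> w s _ _; exact: pd_Im].
- split=> [w s bw _|].
    apply: (jcont_comp (f := fun t => t^-1)); last first.
      by apply: isd_cont (isd_inv _ (isd_id _)); exact: lt0r_neq0 (denom_gt0 r0 bw s).
    have [c1 c2] := cont_rho s.
    have j1 : jcont ku1 w s.
      apply: jcontD; first by apply: jcontD; [exact: jcst|exact: jpsi].
      by apply: jcontM; [exact: jcst|exact: jre].
    have j2 : jcont ku2 w s.
      apply: jcontD; first by apply: jcontD; [exact: jcst|exact: jpsi].
      by apply: jcontM; [exact: jcst|exact: jim].
    have -> : denom z0 r = (fun z s => ku1 z s * ku1 z s + ku2 z s * ku2 z s).
      by apply/funext => z; apply/funext => t; rewrite denomE !expr2.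
    by apply: jcontD; apply: jcontM.
  exists (fun z s => 2 * (denom z0 r z s)^-1 * (denom z0 r z s)^-1 * ku1 z s),
         (fun z s => 2 * (denom z0 r z s)^-1 * (denom z0 r z s)^-1 * ku2 z s); split.
  + exact: kmul (kmul (kmul (kcst 2) kinv) kinv) kclass_u1.
  + exact: kmul (kmul (kmul (kcst 2) kinv) kinv) kclass_u2.
  move=> w s bw _; have n0 := lt0r_neq0 (denom_gt0 r0 bw s).
  have p1 : pd (ku1 ^~ s) w (- 1) 0.
    by apply: pd_eq (pdD (pd_cst (x0 + rho1 r s) w) (pdM (pd_cst (- 1) w) (pd_Re w))) _ _; ring.
  have p2 : pd (ku2 ^~ s) w 0 (- 1).
    by apply: pd_eq (pdD (pd_cst (y0 + rho2 r s) w) (pdM (pd_cst (- 1) w) (pd_Im w))) _ _; ring.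
  have P := pdD (pdM p1 p1) (pdM p2 p2).
  have E : denom z0 r ^~ s = (fun z => ku1 z s * ku1 z s + ku2 z s * ku2 z s).
    by apply/funext => z; rewrite denomE !expr2.
  rewrite -E in P; have I := @isd_inv R (fun t => t) (denom z0 r w s) 1 n0 (isd_id _).
  by apply: pd_eq (pd_comp (h := fun t => t^-1) I P) _ _; field.
- split=> [w s bw hs|]; first by apply: jcontD; [exact: jg|exact: jh].
  exists (fun z s => gx z s + hx z s), (fun z s => gy z s + hy z s); split; [exact: kadd|exact: kadd|].
  by move=> w s bw hs; apply: pdD; [exact: pg|exact: ph].
split=> [w s bw hs|]; first by apply: jcontM; [exact: jg|exact: jh].
exists (fun z s => gx z s * h z s + g z s * hx z s), (fun z s => gy z s * h z s + g z s * hy z s).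
split; [exact: kadd (kmul kgx kh) (kmul kg khx)|exact: kadd (kmul kgy kh) (kmul kg khy)|].
by move=> w s bw hs; apply: pdM; [exact: pg|exact: ph].
Qed.

Lemma kclass_smooth g : kclass g -> smooth_on (box z0 (r / 2)) (fun z => int01 (g z)).
Proof. by apply: int01_smooth; [exact: box_open|exact: kclass_spec]. Qed.

Lemma kclass_ker1 : kclass (ker1 z0 r).
Proof.
have -> : ker1 z0 r = (fun z s => (rho1 r s * ku1 z s + rho2 r s * ku2 z s) * (denom z0 r z s)^-1).
  by apply/funext => z; apply/funext => s; rewrite /ker1 /ku1 /ku2 !mulN1r.
exact: kmul (kadd (kmul krho1 kclass_u1) (kmul krho2 kclass_u2)) kinv.
Qed.

Lemma kclass_ker2 : kclass (ker2 z0 r).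
Proof.
have -> : ker2 z0 r = (fun z s => (rho2 r s * ku1 z s + (- 1) * (rho1 r s * ku2 z s)) * (denom z0 r z s)^-1).
  by apply/funext => z; apply/funext => s; rewrite /ker2 /ku1 /ku2 !mulN1r.
exact: kmul (kadd (kmul krho2 kclass_u1) (kmul (kcst (- 1)) (kmul krho1 kclass_u2))) kinv.
Qed.

Lemma rho_box s : box z0 (4 * r) ((x0 + rho1 r s) +i* (y0 + rho2 r s)).
Proof.
have [k1 k2] := rho_le r0 s; rewrite /box /= /x0 /y0; case: z0 => u v /=.
by rewrite !(addrC _ (- _)) !addKr; have h := r0; split; [apply: le_lt_trans k1 _|apply: le_lt_trans k2 _]; lra.
Qed.

Lemma cont_circle (f : cplx R -> R) : (forall w, box z0 (4 * r) w -> {for w, continuous f}) ->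
  forall s : R, {for s, continuous (fun s : R => f ((x0 + rho1 r s) +i* (y0 + rho2 r s)))}.
Proof.
move=> cf s; have [c1 c2] := cont_rho s.
apply: (@jcont_r R R (fun _ s => f ((x0 + rho1 r s) +i* (y0 + rho2 r s))) 0).
apply: (@jcont_cplx R (fun _ s => x0 + rho1 r s) (fun _ s => y0 + rho2 r s)).
- by apply: (@jcont_snd R R (fun s => x0 + rho1 r s)); apply: contD => //; exact: cont_cst.
- by apply: (@jcont_snd R R (fun s => y0 + rho2 r s)); apply: contD => //; exact: cont_cst.
- by apply: cf; exact: rho_box.
Qed.

(* Removable singularity: the Cauchy formula on a circle around [z0] only uses
   continuity at [z0]; dividing by the Cauchy integral of the constant [1]
   spares computing the latter. *)
Lemma cauchy_smooth (f1 f2 c1 c2 : cplx R -> R) :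
  (forall w, box z0 (4 * r) w -> {for w, continuous f1} /\ {for w, continuous f2}) ->
  (forall w, box z0 (4 * r) w -> w <> z0 -> {for w, continuous c1} /\ {for w, continuous c2}) ->
  (forall w, box z0 (4 * r) w -> w <> z0 -> pd f1 w (c1 w) (- c2 w) /\ pd f2 w (c2 w) (c1 w)) ->
  exists2 e, 0 < e & smooth_on (box z0 e) f1 /\ smooth_on (box z0 e) f2.
Proof.
move=> cf cc pf.
have cf1 w : box z0 (4 * r) w -> {for w, continuous f1} by move=> /cf [].
have cf2 w : box z0 (4 * r) w -> {for w, continuous f2} by move=> /cf [].
have cc1 w : box z0 (4 * r) w -> w <> z0 -> {for w, continuous c1} by move=> h /(cc _ h) [].
have cc2 w : box z0 (4 * r) w -> w <> z0 -> {for w, continuous c2} by move=> h /(cc _ h) [].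
pose g1 s := f1 ((x0 + rho1 r s) +i* (y0 + rho2 r s)).
pose g2 s := f2 ((x0 + rho1 r s) +i* (y0 + rho2 r s)).
have kg1 : kclass (fun _ s => g1 s) by apply: kpsi; exact: cont_circle.
have kg2 : kclass (fun _ s => g2 s) by apply: kpsi; exact: cont_circle.
pose N1 z := int01 (fun s => g1 s * ker1 z0 r z s + (- 1) * (g2 s * ker2 z0 r z s)).
pose N2 z := int01 (fun s => g2 s * ker1 z0 r z s + g1 s * ker2 z0 r z s).
pose C1 z := int01 (ker1 z0 r z).
pose C2 z := int01 (ker2 z0 r z).
have sN1 : smooth_on (box z0 (r / 2)) N1.
  apply: (kclass_smooth (g := fun z s => g1 s * ker1 z0 r z s + (- 1) * (g2 s * ker2 z0 r z s))).
  exact: kadd (kmul kg1 kclass_ker1) (kmul (kcst (- 1)) (kmul kg2 kclass_ker2)).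
have sN2 : smooth_on (box z0 (r / 2)) N2.
  apply: (kclass_smooth (g := fun z s => g2 s * ker1 z0 r z s + g1 s * ker2 z0 r z s)).
  exact: kadd (kmul kg2 kclass_ker1) (kmul kg1 kclass_ker2).
have sC1 : smooth_on (box z0 (r / 2)) C1 := kclass_smooth kclass_ker1.
have sC2 : smooth_on (box z0 (r / 2)) C2 := kclass_smooth kclass_ker2.
have E1 z : box z0 (r / 2) z -> N1 z = f1 z * C1 z - f2 z * C2 z.
  move=> bz; rewrite -(@cauchy_re z0 r z r0 bz f1 f2 c1 c2) //.
  - by rewrite /N1; congr int01; apply/funext => s; rewrite mulN1r.
  - by move=> w bw /(pf _ bw) [].
  - by move=> w bw /(pf _ bw) [].
(* The real formula applied to - i f, whose real and imaginary parts are [f2] and [- f1]. *)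
have E2 z : box z0 (r / 2) z -> N2 z = f2 z * C1 z + f1 z * C2 z.
  move=> bz; have := @cauchy_re z0 r z r0 bz f2 (fun w => - f1 w) c2 (fun w => - c1 w).
  rewrite /N2 /C1 /C2 -(mulNr (- f1 z)) opprK => <- //.
  - by congr int01; apply/funext => s; rewrite mulNr opprK.
  - by move=> w bw; apply: (ccont_comp (h := fun t => - t)); [exact: cf1|exact: isd_cont (isdN (isd_id _))].
  - by move=> w bw wz; apply: (ccont_comp (h := fun t => - t)); [exact: cc1|exact: isd_cont (isdN (isd_id _))].
  - by move=> w bw /(pf _ bw) [_]; rewrite opprK.
  - by move=> w bw /(pf _ bw) [/pdN + _]; rewrite opprK.
have oB : open (box z0 (r / 2)) := @box_open R z0 (r / 2).
have bz0 : box z0 (r / 2) z0 by apply: box_center; rewrite divr_gt0.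
(* As complex numbers N = f C, so f = N conj(C) / |C|^2. For z = [z0] the kernel is identically 1,
   so |C|^2 is close to 1 nearby. *)
pose q z := C1 z * C1 z + C2 z * C2 z.
have sq : smooth_on (box z0 (r / 2)) q by apply: smoothD => //; apply: smoothM.
have q1 : q z0 = 1.
  have dE s : denom z0 r z0 s = r ^+ 2 by rewrite /denom -(rho_sqr r s) !(addrC _ (rho1 _ _)) !(addrC _ (rho2 _ _)) !addrK.
  have rr : r ^+ 2 != 0 by rewrite expf_neq0 // gt_eqF.
  have -> : q z0 = 1 * 1 + 0 * 0; last by ring.
  rewrite /q /C1 /C2; have -> : ker1 z0 r z0 = fun=> 1.
    apply/funext => s; rewrite /ker1 dE !(addrC _ (rho1 _ _)) !(addrC _ (rho2 _ _)) !addrK -!expr2 rho_sqr.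
    by rewrite divff.
  have -> : ker2 z0 r z0 = fun=> 0.
    apply/funext => s; rewrite /ker2 !(addrC _ (rho1 _ _)) !(addrC _ (rho2 _ _)) !addrK.
    by rewrite (mulrC (rho1 _ _)) subrr mul0r.
  by rewrite !int01_cst.
have /ccontP /(_ (1 / 2)) [|e e0 He] := smooth_cont sq bz0; first by rewrite divr_gt0.
have q0 z : box z0 e z -> q z != 0.
  move=> /boxE [a [b [ha hb ->]]]; have := He a b ha hb; rewrite q1 ltr_norml => /andP[h _].
  by rewrite gt_eqF //; lra.
pose e' := Num.min e (r / 2); have e'0 : 0 < e' by rewrite lt_min e0 divr_gt0.
have be z : box z0 e' z -> box z0 e z /\ box z0 (r / 2) z.
  by move=> bz; split; apply: box_sub bz; rewrite ge_min lexx ?orbT.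
have sB f : smooth_on (box z0 (r / 2)) f -> smooth_on (box z0 e') f.
  by apply: smooth_sub => z /be [].
have oE : open (box z0 e') := @box_open R z0 e'.
have sqi : smooth_on (box z0 e') (fun z => (q z)^-1).
  by apply: smooth_inv => //; [exact: sB|move=> z /be [/q0]].
exists e' => //; split.
  apply: (@smooth_ext _ _ (fun z => (N1 z * C1 z + N2 z * C2 z) * (q z)^-1)) => //.
    move=> z /be [/q0 qz bz]; rewrite E1 // E2 //; move: qz; rewrite /q => qz; field.
    exact: qz.
  by apply: smoothM => //; apply: smoothD => //; apply: smoothM => //; exact: sB.
apply: (@smooth_ext _ _ (fun z => (N2 z * C1 z - N1 z * C2 z) * (q z)^-1)) => //.
  move=> z /be [/q0 qz bz]; rewrite E1 // E2 //; move: qz; rewrite /q => qz; field.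
  exact: qz.
by apply: smoothM => //; apply: smoothB => //; apply: smoothM => //; exact: sB.
Qed.

End CauchySmooth.

End Cauchy.

(** * An overdetermined system without solutions *)

Ltac isd_tac := lazymatch goal with
  | |- is_derive ?x _ (fun=> ?c) _ => notypeclasses refine (isd_cst c x)
  | |- is_derive ?x _ (fun t => t) _ => notypeclasses refine (isd_id x)
  | |- is_derive _ _ (fun t => @?g t + @?h t) _ =>
      notypeclasses refine (isdD (f := g) (g := h) _ _); isd_tac
  | |- is_derive _ _ (fun t => - @?g t) _ => notypeclasses refine (isdN (f := g) _); isd_tac
  | |- is_derive _ _ (fun t => @?g t * @?h t) _ =>
      notypeclasses refine (isdM (f := g) (g := h) _ _); isd_tac
  | |- is_derive _ _ (fun t => @?g t ^+ ?n) _ =>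
      notypeclasses refine (isdX (h := g) n _); isd_tac
  | |- _ => try eassumption
  end.

Ltac isd_auto := notypeclasses refine (isd_eq _ _); [isd_tac|cbv beta delta [Datatypes.id]].

Section Elimination.
Variables (A : comNzRingType) (k p P : A).

(* Coefficients, as polynomials in the variable [f] with [q = p + P f], of the
   first two derivatives of [f F / q ^ 3], [F = q^2 (1 - 3 k f) + 2 k^2 q -
   3 k p f q + 4 k^2 P f], for the derivation [q d/dk] sending [k, f, p, P]
   to [q, - 4 k f, - 2 k q, 3 p q] (up to factors [f] and powers of [q]). *)
Definition el1 : seq A := [::
  2 * k * p ^+ 3;
  - 9 * p ^+ 4 + 18 * k * p ^+ 2 * P + 36 * k ^+ 2 * p ^+ 3 + 8 * k ^+ 3 * p * P;
  - 30 * p ^+ 3 * P + 30 * k * p * P ^+ 2 + 27 * k * p ^+ 4 + 24 * k ^+ 2 * p ^+ 2 * P + 56 * k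
    ^+ 3 * P ^+ 2;
  - 36 * p ^+ 2 * P ^+ 2 + 14 * k * P ^+ 3 + 63 * k * p ^+ 3 * P;
  - 18 * p * P ^+ 3 + 45 * k * p ^+ 2 * P ^+ 2 + 12 * k ^+ 2 * P ^+ 3;
  - 3 * P ^+ 4 + 9 * k * p * P ^+ 3].

Definition el2 : seq A := [::
  2 * p ^+ 4 - 12 * k ^+ 2 * p ^+ 3;
  20 * p ^+ 3 * P + 234 * k * p ^+ 4 - 132 * k ^+ 2 * p ^+ 2 * P - 336 * k ^+ 3 * p ^+ 3 - 48 *
    k ^+ 4 * p * P;
  48 * p ^+ 2 * P ^+ 2 - 63 * p ^+ 5 + 846 * k * p ^+ 3 * P - 180 * k ^+ 2 * p * P ^+ 2 - 360 *
    k ^+ 2 * p ^+ 4 - 144 * k ^+ 3 * p ^+ 2 * P - 464 * k ^+ 4 * P ^+ 2;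
  44 * p * P ^+ 3 - 216 * p ^+ 4 * P + 1110 * k * p ^+ 2 * P ^+ 2 + 189 * k * p ^+ 5 - 60 * k ^+
    2 * P ^+ 3 - 1278 * k ^+ 2 * p ^+ 3 * P + 240 * k ^+ 3 * p * P ^+ 2;
  14 * P ^+ 4 - 270 * p ^+ 3 * P ^+ 2 + 618 * k * p * P ^+ 3 + 459 * k * p ^+ 4 * P - 1170 * k
    ^+ 2 * p ^+ 2 * P ^+ 2 - 192 * k ^+ 3 * P ^+ 3;
  - 144 * p ^+ 2 * P ^+ 3 + 120 * k * P ^+ 4 + 351 * k * p ^+ 3 * P ^+ 2 - 270 * k ^+ 2 * p * P
    ^+ 3;
  - 27 * p * P ^+ 4 + 81 * k * p ^+ 2 * P ^+ 3 - 18 * k ^+ 2 * P ^+ 4].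

End Elimination.

Lemma el_morph (A B : comNzRingType) (h : {rmorphism A -> B}) (k p P : A) :
  map h (el1 k p P) = el1 (h k) (h p) (h P) /\ map h (el2 k p P) = el2 (h k) (h p) (h P).
Proof.
by split; [congr [:: _; _; _; _; _; _]|congr [:: _; _; _; _; _; _; _]]; ring.
Qed.

Section ElReal.
Context {R : realType}.
Implicit Types (k f p P a b t : R).

(** Weighted homogeneity, with weights 1, 2, 3, -1 for [k], [p], [P], [f]. It reduces to [k = 1],
    the dependence on [k] passing into the other arguments. *)
Lemma el_scale k f p P : k != 0 ->
  (Poly (el1 k p P)).[f] = k ^+ 7 * (Poly (el1 1 (p / k ^+ 2) (P / k ^+ 3))).[k * f] /\
  (Poly (el2 k p P)).[f] = k ^+ 8 * (Poly (el2 1 (p / k ^+ 2) (P / k ^+ 3))).[k * f].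
Proof. by move=> k0; rewrite !horner_Poly /=; split; field. Qed.

(** [p / k^2] and [P / k^3] as polynomials in t = 1 / k, where p = a - k^2 and P = 3 a k + 3 b -
    k^3. At t = 0 both are -1, whatever [a] and [b] are. *)
Definition el_p a : {poly R} := a%:P * 'X ^+ 2 - 1.
Definition el_P a b : {poly R} := 3 * a%:P * 'X ^+ 2 + 3 * b%:P * 'X ^+ 3 - 1.

Definition el_1 a b := Poly (el1 1 (el_p a) (el_P a b)).
Definition el_2 a b := Poly (el2 1 (el_p a) (el_P a b)).

Lemma el_map (h : {rmorphism {poly R} -> R}) a b :
  map_poly h (el_1 a b) = Poly (el1 1 (h (el_p a)) (h (el_P a b))) /\
  map_poly h (el_2 a b) = Poly (el2 1 (h (el_p a)) (h (el_P a b))).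
Proof.
rewrite /el_1 /el_2 !map_Poly_id0 ?rmorph0 //.
by have [-> ->] := el_morph h 1 (el_p a) (el_P a b); rewrite rmorph1.
Qed.

Lemma el_pE a b t : horner_eval t (el_p a) = a * t ^+ 2 - 1 /\
  horner_eval t (el_P a b) = 3 * a * t ^+ 2 + 3 * b * t ^+ 3 - 1.
Proof.
rewrite /horner_eval /el_p /el_P !(hornerD, hornerN, hornerM, hornerXn, hornerX, hornerC).
by split; ring.
Qed.

Lemma el_eval a b t f :
  (el_1 a b).[f%:P].[t] = (Poly (el1 1 (a * t ^+ 2 - 1) (3 * a * t ^+ 2 + 3 * b * t ^+ 3 - 1))).[f] /\
  (el_2 a b).[f%:P].[t] = (Poly (el2 1 (a * t ^+ 2 - 1) (3 * a * t ^+ 2 + 3 * b * t ^+ 3 - 1))).[f].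
Proof.
have E (Q : {poly {poly R}}) : Q.[f%:P].[t] = (map_poly (horner_eval t) Q).[f].
  by rewrite -[f in RHS](hornerC f t) -/(horner_eval t _) horner_map.
rewrite !E; have [-> ->] := el_map (horner_eval t) a b.
by have [<- <-] := el_pE a b t.
Qed.

Definition el1_0 : seq R := [:: -2; -55; -1; 13; 15; 6].
Definition el2_0 : seq R := [:: 14; 674; 457; -277; -535; -357; -72].

Lemma el_at0 a b :
  map_poly (horner_eval 0) (el_1 a b) = Poly el1_0 /\ map_poly (horner_eval 0) (el_2 a b) = Poly el2_0.
Proof.
have [-> ->] := el_map (horner_eval (0 : R)) a b.
have [e1 e2] := el_pE a b 0.
have {}e1 : horner_eval 0 (el_p a) = - 1 by rewrite e1; ring.
have {}e2 : horner_eval 0 (el_P a b) = - 1 by rewrite e2; ring.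
rewrite -[X in el1 1 X _]/(horner_eval 0 (el_p a)) -[X in el2 1 X _]/(horner_eval 0 (el_p a)).
rewrite -[X in el1 1 _ X]/(horner_eval 0 (el_P a b)) -[X in el2 1 _ X]/(horner_eval 0 (el_P a b)) e1 e2.
suff [-> ->] : el1 1 (- 1) (- 1) = el1_0 /\ el2 1 (- 1) (- 1) = el2_0 by [].
split; rewrite /el1 /el2 /el1_0 /el2_0.
  by congr [:: _; _; _; _; _; _]; ring.
by congr [:: _; _; _; _; _; _; _]; ring.
Qed.

Lemma Poly6 (a0 a1 a2 a3 a4 a5 : R) : Poly [:: a0; a1; a2; a3; a4; a5] =
  a0%:P + a1%:P * 'X + a2%:P * 'X ^+ 2 + a3%:P * 'X ^+ 3 + a4%:P * 'X ^+ 4 + a5%:P * 'X ^+ 5.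
Proof. by rewrite /= !cons_poly_def; ring. Qed.

Lemma Poly7 (a0 a1 a2 a3 a4 a5 a6 : R) : Poly [:: a0; a1; a2; a3; a4; a5; a6] =
  a0%:P + a1%:P * 'X + a2%:P * 'X ^+ 2 + a3%:P * 'X ^+ 3 + a4%:P * 'X ^+ 4 + a5%:P * 'X ^+ 5
  + a6%:P * 'X ^+ 6.
Proof. by rewrite /= !cons_poly_def; ring. Qed.

(** Integer Bezout cofactors certifying that the two polynomials at t = 0 are coprime. Grouping the
    digits by thousands keeps the numerals small. *)
Definition el_U : {poly R} := - ((((42 * 1000 + 902) * 1000 + 686) * 1000 + 383) * 1000 + 410)
  - ((((30 * 1000 + 764) * 1000 + 900) * 1000 + 866) * 1000 + 836) * 'X
  + ((((16 * 1000 + 497) * 1000 + 19) * 1000 + 45) * 1000 + 741) * 'X ^+ 2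
  + ((((33 * 1000 + 965) * 1000 + 929) * 1000 + 299) * 1000 + 330) * 'X ^+ 3
  + ((((23 * 1000 + 150) * 1000 + 993) * 1000 + 505) * 1000 + 903) * 'X ^+ 4
  + ((((4 * 1000 + 710) * 1000 + 874) * 1000 + 998) * 1000 + 168) * 'X ^+ 5.

Definition el_V : {poly R} := - ((((3 * 1000 + 590) * 1000 + 13) * 1000 + 150) * 1000 + 398)
  - (((107 * 1000 + 763) * 1000 + 532) * 1000 + 355) * 'X
  + (((806 * 1000 + 459) * 1000 + 612) * 1000 + 232) * 'X ^+ 2
  + (((964 * 1000 + 174) * 1000 + 372) * 1000 + 395) * 'X ^+ 3
  + (((392 * 1000 + 572) * 1000 + 916) * 1000 + 514) * 'X ^+ 4.

Definition el_G : R := ((((35 * 1000 + 545) * 1000 + 188) * 1000 + 661) * 1000 + 248).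

Lemma el_bezout : el_U * Poly el1_0 + el_V * Poly el2_0 = el_G%:P.
Proof. by rewrite Poly6 Poly7 /el_U /el_V /el_G; ring. Qed.

Lemma el_coprime : coprimep (Poly el1_0) (Poly el2_0).
Proof.
apply/Bezout_coprimepP; exists (el_U, el_V) => /=; rewrite el_bezout polyC_eqp1.
by rewrite gt_eqF // /el_G; lra.
Qed.

Lemma poly_eq0_itv (r : {poly R}) (x y : R) : x < y ->
  (forall k, x < k < y -> r.[k] = 0) -> r = 0.
Proof.
move=> xy H; pose n := size r.
pose g (i : nat) := x + (y - x) * (i.+1%:R / n.+1%:R).
have n0 : 0 < n.+1%:R :> R by rewrite ltr0n.
have d0 : 0 < y - x by rewrite subr_gt0.
apply: (@roots_geq_poly_eq0 _ r [seq g i | i <- iota 0 n]).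
- apply/allP => _ /mapP [i + ->]; rewrite mem_iota add0n => /= ilt.
  have h0 : 0 < i.+1%:R / n.+1%:R :> R by rewrite divr_gt0 // ltr0n.
  have h1 : i.+1%:R / n.+1%:R < 1 :> R by rewrite ltr_pdivrMr // mul1r ltr_nat.
  have h2 : (y - x) * (i.+1%:R / n.+1%:R) < y - x by rewrite -[ltRHS]mulr1 ltr_pM2l.
  apply/eqP/H; rewrite /g; apply/andP; split; last by rewrite -ltrBrDl.
  by rewrite ltrDl mulr_gt0.
- rewrite map_inj_uniq ?iota_uniq // => i j /addrI /(mulfI (lt0r_neq0 d0)).
  by move=> /(mulIf (invr_neq0 (lt0r_neq0 n0))) /eqP; rewrite eqr_nat eqSS => /eqP.
- by rewrite size_map size_iota.
Qed.

Lemma horner_comb (P1 P2 U V : {poly {poly R}}) (r x : {poly R}) t :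
  r%:P = U * P1 + V * P2 -> P1.[x].[t] = 0 -> P2.[x].[t] = 0 -> r.[t] = 0.
Proof.
move=> E H1 H2; rewrite -(hornerC r x) E hornerD !hornerM hornerD !hornerM H1 H2.
by rewrite !mulr0 addr0.
Qed.

(** A common root for every [k] in an interval makes the resultant, a polynomial in 1 / k, vanish on
    an interval and so identically. At 1 / k = 0 it becomes the resultant of two coprime
    polynomials, which is not 0. *)
Lemma el_no_common (f : R -> R) a b x y : x < y -> (forall k, x < k < y -> k != 0) ->
  (forall k, x < k < y ->
    (Poly (el1 k (a - k ^+ 2) (3 * a * k + 3 * b - k ^+ 3))).[f k] = 0 /\
    (Poly (el2 k (a - k ^+ 2) (3 * a * k + 3 * b - k ^+ 3))).[f k] = 0) -> False.
Proof.
move=> xy k0 H.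
have [E1 E2] := el_at0 a b.
have S1 : size (Poly el1_0) = 6%N.
  by rewrite (@PolyK _ 1) //= /el1_0 /= gt_eqF //; lra.
have S2 : size (Poly el2_0) = 7%N.
  by rewrite (@PolyK _ 1) //= /el2_0 /= lt_eqF //; lra.
(* The leading coefficients do not drop at t = 0; only then does the resultant commute with this
   specialisation. *)
have T1 : size (el_1 a b) = 6%N.
  apply/eqP; rewrite eqn_leq size_Poly /= -S1 -E1; exact: size_poly.
have T2 : size (el_2 a b) = 7%N.
  apply/eqP; rewrite eqn_leq size_Poly /= -S2 -E2; exact: size_poly.
have L1 : horner_eval 0 (lead_coef (el_1 a b)) != 0.
  rewrite lead_coefE T1 -coef_map /= E1 -[5%N]/(6.-1) -S1 -lead_coefE lead_coef_eq0.
  by rewrite -size_poly_eq0 S1.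
have L2 : horner_eval 0 (lead_coef (el_2 a b)) != 0.
  rewrite lead_coefE T2 -coef_map /= E2 -[6%N]/(7.-1) -S2 -lead_coefE lead_coef_eq0.
  by rewrite -size_poly_eq0 S2.
have s1 : (1 < size (el_1 a b))%N by rewrite T1.
have s2 : (1 < size (el_2 a b))%N by rewrite T2.
have [uv _ Euv] := resultant_in_ideal s1 s2.
have Z (t : R) : (exists2 k, x < k < y & t = k^-1) -> (resultant (el_1 a b) (el_2 a b)).[t] = 0.
  move=> [k hk ->]; have kn := k0 _ hk; have [H1 H2] := H _ hk.
  have [F1 F2] := el_eval a b k^-1 (k * f k).
  have [G1 G2] := el_scale (f k) (a - k ^+ 2) (3 * a * k + 3 * b - k ^+ 3) kn.
  have e1 : (a - k ^+ 2) / k ^+ 2 = a * k^-1 ^+ 2 - 1 by field.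
  have e2 : (3 * a * k + 3 * b - k ^+ 3) / k ^+ 3 = 3 * a * k^-1 ^+ 2 + 3 * b * k^-1 ^+ 3 - 1 by field.
  rewrite e1 e2 in G1 G2; rewrite H1 in G1; rewrite H2 in G2.
  have {}G1 : (el_1 a b).[(k * f k)%:P].[k^-1] = 0.
    rewrite F1; move/esym/eqP: G1; rewrite mulf_eq0 => /orP[|/eqP //].
    by rewrite expf_eq0 /= (negPf kn).
  have {}G2 : (el_2 a b).[(k * f k)%:P].[k^-1] = 0.
    rewrite F2; move/esym/eqP: G2; rewrite mulf_eq0 => /orP[|/eqP //].
    by rewrite expf_eq0 /= (negPf kn).
  exact: horner_comb Euv G1 G2.
have R0 : resultant (el_1 a b) (el_2 a b) = 0.
  (* An endpoint of the interval may be 0, so only the half away from 0 is inverted. *)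
  pose m := (x + y) / 2.
  have hm : x < m < y by rewrite /m; apply/andP; lra.
  have [m0|m0] := ltP 0 m.
    have y0 : 0 < y by case/andP: hm => *; lra.
    apply: (@poly_eq0_itv _ y^-1 m^-1); first by rewrite ltf_pV2 // (andP hm).2.
    move=> t /andP[t1 t2]; have t0 : 0 < t by apply: lt_trans t1; rewrite invr_gt0.
    apply: Z; exists t^-1; last by rewrite invrK.
    have h1 : m < t^-1 by rewrite -(invrK m) ltf_pV2 ?posrE ?invr_gt0.
    have h2 : t^-1 < y by rewrite -(invrK y) ltf_pV2 ?posrE ?invr_gt0.
    by apply/andP; split => //; apply: lt_trans h1; case/andP: hm.
  have {}m0 : m < 0 by rewrite lt_neqAle m0 k0.
  have x0 : x < 0 by case/andP: hm => *; lra.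
  apply: (@poly_eq0_itv _ m^-1 x^-1); first by rewrite ltf_nV2 ?negrE // (andP hm).1.
  move=> t /andP[t1 t2]; have t0 : t < 0 by apply: lt_trans t2 _; rewrite invr_lt0.
  apply: Z; exists t^-1; last by rewrite invrK.
  have h1 : t^-1 < m by rewrite -(invrK m) ltf_nV2 ?negrE ?invr_lt0.
  have h2 : x < t^-1 by rewrite -(invrK x) ltf_nV2 ?negrE ?invr_lt0.
  by apply/andP; split => //; apply: lt_trans h1 _; case/andP: hm.
have := map_resultant L1 L2; rewrite R0 rmorph0 E1 E2 => /esym/eqP.
rewrite resultant_eq0; have := el_coprime; rewrite /coprimep => /eqP ->.
by rewrite ltnn.
Qed.

(* [e] stands for [1 / (h^2 - k + c)] and [u] for [4 C h]: no function [h] of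
   the curvature satisfies both [h' = 2 C (h^2 - k + c)] and the equation
   expressing that the argument of the Hopf differential may vary. *)
Lemma riccati_exclusion (e e' : R -> R) a b m x y : x < y ->
  (forall k, x < k < y -> e k != 0 /\ is_derive k 1 e (e' k)) ->
  (forall k, x < k < y ->
     (a - k ^+ 2 + (a * k + b - k ^+ 3 / 3) * e k) * e' k = - 4 * k * e k) ->
  (forall k, x < k < y -> is_derive k 1 (fun k => e k - e' k / e k) (m / e k)) -> False.
Proof.
move=> xy He Hq Hu.
(* Away from [k = 0] the equation for [e'] forces [q != 0], and the scaling by powers of [k] is
   allowed. *)
have [x' [y' [xy' sub k0]]] : exists x' y', [/\ x' < y',
    forall k, x' < k < y' -> x < k < y & forall k, x' < k < y' -> k != 0].
  have [y0|y0] := ltP 0 y.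
    exists (Num.max x 0), y; split; first by rewrite gt_max xy.
      by move=> k; rewrite gt_max => /andP[/andP[-> _] ->].
    by move=> k; rewrite gt_max => /andP[/andP[_ k0] _]; rewrite gt_eqF.
  exists x, y; split=> // k /andP[_ ky]; rewrite lt_eqF //; exact: lt_le_trans ky y0.
(* The factor 3 clears the coefficient 1 / 3 of the cubic: [P] is three times it, and [q] is the
   bracket in the equation for [e']. *)
pose f k := e k / 3.
pose p k := a - k ^+ 2.
pose P k := 3 * a * k + 3 * b - k ^+ 3.
pose q k := p k + P k * f k.
have hq k : x' < k < y' -> q k * e' k = - 4 * k * e k.
  by move=> /sub /Hq <-; rewrite /q /p /P /f; field.
have q0 k : x' < k < y' -> q k != 0.
  move=> hk; apply/negP => /eqP qk; have := hq k hk; rewrite qk mul0r => /esym/eqP.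
  have [e0 _] := He _ (sub _ hk); rewrite !mulf_eq0 (negPf e0) (negPf (k0 _ hk)) !orbF oppr_eq0.
  by rewrite pnatr_eq0.
have f0 k : x' < k < y' -> f k != 0.
  move=> hk; have [e0 _] := He _ (sub _ hk).
  by rewrite /f mulf_neq0 // invr_neq0 // pnatr_eq0.
have df (k : R) : x' < k < y' -> is_derive k 1 f (- 4 * k * f k / q k).
  move=> hk; have [e0 de] := He _ (sub _ hk); have nq := q0 _ hk.
  apply: isd_eq (isdM de (isd_cst (3^-1) k)) _.
  have -> : e' k = - 4 * k * e k / q k by rewrite -hq // mulrC mulKf.
  by rewrite mulr0 addr0 /f; field.
have dp (k : R) : is_derive k 1 p (- 2 * k).
  by apply: isd_eq (isdB (isd_cst a k) (isdX 2 (isd_id k))) _; rewrite /=; ring.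
have dP (k : R) : is_derive k 1 P (3 * p k).
  rewrite /P; isd_auto.
  by rewrite /p /=; ring.
pose Q k := - 2 * k * q k + 3 * p k * q k * f k - 4 * k * f k * P k.
have dq (k : R) : x' < k < y' -> is_derive k 1 q (Q k / q k).
  move=> hk; have nq := q0 _ hk; apply: isd_eq (isdD (dp k) (isdM (dP k) (df k hk))) _.
  by rewrite /Q; field.
have near_itv k : x' < k < y' -> \forall t \near k, x' < t < y'.
  move=> /andP[h1 h2]; apply/near_itvP; exists (Num.min (k - x') (y' - k)).
    by rewrite lt_min !subr_gt0 h1.
  by move=> t; rewrite lt_min !ltr_norml => /andP[/andP[? ?] /andP[? ?]]; apply/andP; lra.
pose F k := q k ^+ 2 * (1 - 3 * k * f k) - k * Q k.
(* Since e' / e = - 4 k / q, the function in the third hypothesis is 3 f + 4 k / q. Clearing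
   denominators in its derivative isolates the constant [m]. *)
have FE k : x' < k < y' -> f k * F k / q k ^+ 3 = m / 12.
  move=> hk; have nq := q0 _ hk; have nf := f0 _ hk.
  have D1 : is_derive k 1 (fun t => 3 * f t + 4 * t / q t) (m / (3 * f k)).
    have -> : m / (3 * f k) = m / e k by congr (_ / _); rewrite /f; field.
    apply: (isd_near _ (Hu _ (sub _ hk))).
    apply: filterS (near_itv _ hk) => t ht; have nqt := q0 _ ht.
    have [e0 _] := He _ (sub _ ht).
    have -> : e' t = - 4 * t * e t / q t by rewrite -hq // mulrC mulKf.
    by rewrite /f; field; rewrite ?e0 ?nqt.
  have D2 : is_derive k 1 (fun t => 3 * f t + 4 * t / q t)
      (3 * (- 4 * k * f k / q k) + (4 / q k - 4 * k * (Q k / q k) / q k ^+ 2)).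
    have d1 := df k hk; have d2 := isd_inv nq (dq k hk).
    isd_auto; by field.
  have E := isd_uniq D1 D2.
  have -> : m = 3 * f k * (m / (3 * f k)) by field.
  by rewrite E /F; field.
(* One derivative removes [m] and gives [el1 = 0]; differentiating this along the graph of [f] gives
   [el2 = 0]. *)
have Fd (k : R) : x' < k < y' -> is_derive k 1 (fun t => f t * F t / q t ^+ 3)
    (f k * (Poly (el1 k (p k) (P k))).[f k] / q k ^+ 5).
  move=> hk; have nq := q0 _ hk; have d1 := df k hk; have d2 := dq k hk.
  have d3 := dp k; have d4 := dP k.
  have q30 : q k ^+ 3 != 0 by rewrite expf_neq0.
  have d5 := @isd_inv R (fun t => q t ^+ 3) k _ q30 (isdX 3 d2).
  rewrite /F /Q; isd_auto.
  by rewrite horner_Poly /= /Q; move: nq; rewrite /q => nq; field.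
have L1 k : x' < k < y' -> (Poly (el1 k (p k) (P k))).[f k] = 0.
  move=> hk; have E : f k * (Poly (el1 k (p k) (P k))).[f k] / q k ^+ 5 = 0.
    apply: isd_uniq (Fd k hk) _.
    apply: (isd_near _ (isd_cst (m / 12) k)).
    by apply: filterS (near_itv _ hk) => t ht; rewrite FE.
  have q5 : (q k ^+ 5)^-1 != 0 by rewrite invr_neq0 // expf_neq0 // q0.
  apply: (mulfI (f0 _ hk)); rewrite mulr0; apply: (mulIf q5); rewrite mul0r; exact: E.
have L2 k : x' < k < y' -> (Poly (el2 k (p k) (P k))).[f k] = 0.
  move=> hk; have nq := q0 _ hk; have d1 := df k hk; have d3 := dp k; have d4 := dP k.
  have D : is_derive k 1 (fun t => (Poly (el1 t (p t) (P t))).[f t])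
      ((Poly (el2 k (p k) (P k))).[f k] / q k).
    apply: (isd_ext (f := fun t => horner_rec (el1 t (p t) (P t)) (f t))).
      by move=> t; rewrite horner_Poly.
    rewrite /el1 /horner_rec; isd_auto.
    by rewrite horner_Poly /=; move: nq; rewrite /q => nq; field.
  have E : (Poly (el2 k (p k) (P k))).[f k] / q k = 0.
    apply: isd_uniq D _; apply: (isd_near _ (isd_cst 0 k)).
    by apply: filterS (near_itv _ hk) => t ht; rewrite L1.
  by apply: (mulIf (invr_neq0 nq)); rewrite mul0r; exact: E.
by apply: (@el_no_common f a b x' y') => // k hk; split; [exact: L1|exact: L2].
Qed.

End ElReal.

(** * Linear differential equations *)

Section LinearODE.
Context {R : realType}.

Lemma half_pow_le (m : nat) : (1 / 2 : R) ^+ m <= m.+1%:R^-1.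
Proof.
rewrite div1r exprVn lef_pV2 ?posrE ?ltr0n // ?exprn_gt0 //.
by rewrite -natrX ler_nat; exact: ltn_expl.
Qed.

Lemma half_pow_small (c e : R) : 0 < e -> exists N, forall m, (N <= m)%N -> c * (1 / 2) ^+ m < e.
Proof.
move=> e0; have [c0|c0] := leP c 0.
  exists 0%N => m _; apply: le_lt_trans e0.
  by rewrite mulr_le0_ge0 // exprn_ge0 // divr_ge0.
have [N HN] : exists N : nat, c / e < N%:R.
  by exists (Num.bound (c / e)); apply: archi_boundP; rewrite divr_ge0 // ltW.
exists N => m Nm; apply: (@le_lt_trans _ _ (c * m.+1%:R^-1)).
  by rewrite ler_wpM2l ?half_pow_le // ltW.
rewrite ltr_pdivrMr ?ltr0n // mulrC -ltr_pdivrMr //.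
by apply: lt_le_trans HN _; rewrite ler_nat ltnW.
Qed.

Lemma half_pow_eq0 (c x : R) : (forall m, `|x| <= c * (1 / 2) ^+ m) -> x = 0.
Proof.
move=> H; apply/eqP; rewrite -normr_eq0 eq_le normr_ge0 andbT leNgt; apply/negP => x0.
by have [N /(_ N (leqnn N))] := half_pow_small c x0; rewrite ltNge H.
Qed.

Lemma half_pow_cvg (u : nat -> R) (c : R) :
  (forall m, `|u m.+1 - u m| <= c * (1 / 2) ^+ m) ->
  exists l, forall m, `|l - u m| <= 2 * c * (1 / 2) ^+ m.
Proof.
move=> H.
have T m p : `|u (m + p)%N - u m| <= 2 * c * ((1 / 2) ^+ m - (1 / 2) ^+ (m + p)).
  elim: p => [|p IH]; first by rewrite addn0 !subrr normr0 mulr0.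
  rewrite addnS -(subrKA (u (m + p)%N)); apply: le_trans (ler_normD _ _) _.
  have := H (m + p)%N; move: IH; rewrite exprS.
  move: (`|_|) (`|_|) ((1 / 2 : R) ^+ m) ((1 / 2 : R) ^+ (m + p)) => a b c1 c2; lra.
have c0 : 0 <= c by have := H 0%N; rewrite expr0 mulr1; exact: le_trans.
have T' m p : `|u (m + p)%N - u m| <= 2 * c * (1 / 2) ^+ m.
  apply: le_trans (T m p) _; rewrite ler_wpM2l ?mulr_ge0 //.
  by rewrite gerBl exprn_ge0 // divr_ge0.
have cu : cvg (u @ \oo).
  apply/cauchy_cvgP/cauchy_ballP => e e0.
  have [N HN] := half_pow_small (4 * c) e0.
  exists ([set x | exists2 n, (N <= n)%N & x = u n], [set x | exists2 n, (N <= n)%N & x = u n]).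
    by split; exists N => // n Nn; exists n.
  move=> [_ _] /= [[i Ni ->] [j Nj ->]]; rewrite /ball /=.
  rewrite -(subrKA (u N)); apply: le_lt_trans (ler_normD _ _) _; rewrite (distrC (u N)).
  have := T' N (i - N)%N; have := T' N (j - N)%N; rewrite !subnKC //.
  have := HN N (leqnn N); move: (`|_|) (`|_|) ((1 / 2 : R) ^+ N) => a b c1; lra.
exists (lim (u @ \oo)) => m.
have cl : `|u n - u m| @[n --> \oo] --> `|lim (u @ \oo) - u m|.
  by apply: cvg_norm; apply: cvgB => //; exact: cvg_cst.
rewrite -(cvg_lim _ cl) //; apply: limr_le; first exact: cvgP cl.
near=> n; have mn : (m <= n)%N by near: n; exists m.
by rewrite -(subnKC mn); exact: T'.
Unshelve. all: by end_near. Qed.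

Lemma cont_sum (I : Type) (r : seq I) (F : I -> R -> R) (k : R) :
  (forall i, {for k, continuous (F i)}) -> {for k, continuous (fun t => \sum_(i <- r) F i t)}.
Proof.
move=> H; elim: r => [|i r IH].
  rewrite (_ : (fun _ => _) = fun=> 0); first exact: cont_cst.
  by apply/funext => t; rewrite big_nil.
rewrite (_ : (fun _ => _) = fun t => F i t + \sum_(i <- r) F i t); first by apply: contD.
by apply/funext => t; rewrite big_cons.
Qed.

Variables (n : nat) (A : 'I_n -> 'I_n -> R -> R) (k0 d M : R).
Hypothesis d0 : 0 < d.
Hypothesis M0 : 0 <= M.
Hypothesis cA : forall i j k, `|k - k0| <= d -> {for k, continuous (A i j)}.
Hypothesis bA : forall i j k, `|k - k0| <= d -> `|A i j k| <= M.
Hypothesis small : n%:R * M * d <= 1 / 2.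

(** With [n M d] at most 1 / 2, one Picard step halves the distance of two families that agree at
    [k0]. *)
Lemma sum_bound (k B : R) (z : 'I_n -> R) i : `|k - k0| <= d -> (forall j, `|z j| <= B) ->
  `|\sum_j A i j k * z j| * d <= B * (1 / 2).
Proof.
move=> hk hz.
have B0 : 0 <= B := le_trans (normr_ge0 _) (hz i).
apply: (@le_trans _ _ ((\sum_(j < n) M * B) * d)).
  rewrite ler_wpM2r ?(ltW d0) //; apply: le_trans (ler_norm_sum _ _ _) _.
  by apply: ler_sum => j _; rewrite normrM ler_pM // bA.
rewrite sumr_const card_ord -mulr_natl; have := small; nra.
Qed.

Definition cfam (y : 'I_n -> R -> R) := forall i k, `|k - k0| <= d -> {for k, continuous (y i)}.

(** The continuity hypothesis stands under the existential, so that choice yields a total operator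
    which can be iterated. *)
Lemma picard_step (y0 : 'I_n -> R) (y : 'I_n -> R -> R) : exists y' : 'I_n -> R -> R, cfam y ->
  [/\ cfam y', forall i, y' i k0 = y0 i &
      forall i k, `|k - k0| <= d -> is_derive k 1 (y' i) (\sum_j A i j k * y j k)].
Proof.
have [cy|ncy] := pselect (cfam y); last by exists y.
have P i : exists G : R -> R, G k0 = y0 i /\
    forall k, `|k - k0| <= d -> is_derive k 1 G (\sum_j A i j k * y j k).
  have [||G HG] := @ex_primitive R (fun k => \sum_j A i j k * y j k) (k0 - d) (k0 + d).
  - by have := d0; lra.
  - move=> k hk; have hk' : `|k - k0| <= d by rewrite ler_norml; lra.
    by apply: cont_sum => j; apply: contM; [exact: cA|exact: cy].
  exists (fun k => y0 i + (G k - G k0)); split; first by rewrite subrr addr0.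
  move=> k; rewrite ler_norml => hk.
  have HGk := HG k; apply: isd_eq (isdD (isd_cst (y0 i) k) (isdB (HGk _) (isd_cst (G k0) k))) _; last by ring.
  by apply/andP; lra.
have [y' Hy'] := choice P; exists y' => _; split=> [i k hk|i|i k hk].
- exact: isd_cont ((Hy' i).2 k hk).
- exact: (Hy' i).1.
- exact: ((Hy' i).2 k hk).
Qed.

Lemma linear_ode (y0 : 'I_n -> R) : exists y : 'I_n -> R -> R, (forall i, y i k0 = y0 i) /\
  forall i (k : R), `|k - k0| < d -> is_derive k 1 (y i) (\sum_j A i j k * y j k).
Proof.
have [S HS] := choice (picard_step y0).
pose Y := fix Y m := if m is m'.+1 then S (Y m') else (fun i _ => y0 i).
have cY m : cfam (Y m).
  elim: m => [i k _|m /HS [] //]; exact: cont_cst.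
have dY m i (k : R) : `|k - k0| <= d -> is_derive k 1 (Y m.+1 i) (\sum_j A i j k * Y m j k).
  by have [_ _] := HS _ (cY m); apply.
have Y0 m i : Y m i k0 = y0 i by case: m => [|m] //=; have [_ + _] := HS _ (cY m).
have ball_sub (c k : R) : `|k - k0| <= d -> `|c - k0| <= `|k - k0| -> `|c - k0| <= d.
  by move=> h1 h2; exact: le_trans h2 h1.
pose B := \sum_j `|y0 j| + 1.
have yB j : `|y0 j| <= B.
  by rewrite /B (bigD1 j) //= -addrA lerDl addr_ge0 // sumr_ge0.
have B0 : 0 <= B by rewrite addr_ge0 // sumr_ge0.
have diff m i k : `|k - k0| <= d -> `|Y m.+1 i k - Y m i k| <= B * (1 / 2) ^+ m.
  elim: m i k => [|m IH] i k hk.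
    have [c hc E] := mvt_dist (fun t ht => dY 0%N i t (ball_sub _ _ hk ht)).
    rewrite -[Y 0%N i k]/(y0 i) -(Y0 1%N i) E normrM expr0 mulr1.
    have := sum_bound i (ball_sub _ _ hk hc) yB => /= H.
    apply: (@le_trans _ _ (B * (1 / 2))); last by lra.
    by apply: le_trans H; rewrite ler_wpM2l.
  have D (t : R) : `|t - k0| <= `|k - k0| -> is_derive t 1 (fun t => Y m.+2 i t - Y m.+1 i t)
      (\sum_j A i j t * (Y m.+1 j t - Y m j t)).
    move=> /(ball_sub _ _ hk) ht; apply: isd_eq (isdB (dY m.+1 i t ht) (dY m i t ht)) _.
    by rewrite -sumrB; apply: eq_bigr => j _; rewrite mulrBr.
  have [c hc E] := mvt_dist D; move: E; rewrite !Y0 subrr subr0 => ->; rewrite normrM.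
  have H := sum_bound i (ball_sub _ _ hk hc) (fun j => IH j c (ball_sub _ _ hk hc)).
  have -> : B * (1 / 2) ^+ m.+1 = B * (1 / 2) ^+ m * (1 / 2) by rewrite exprSr; ring.
  by apply: le_trans H; rewrite ler_wpM2l.
have lim_ex i (k : R) : exists l, `|k - k0| <= d -> forall m, `|l - Y m i k| <= 2 * B * (1 / 2) ^+ m.
  have [hk|hk] := pselect (`|k - k0| <= d); last by exists 0.
  by have [l Hl] := half_pow_cvg (fun m => diff m i k hk); exists l.
have [y Hy] : exists y : 'I_n -> R -> R, forall i (k : R), `|k - k0| <= d ->
    forall m, `|y i k - Y m i k| <= 2 * B * (1 / 2) ^+ m.
  have [y' Hy'] := choice (fun ik : 'I_n * R => lim_ex ik.1 ik.2).
  by exists (fun i k => y' (i, k)) => i k; exact: (Hy' (i, k)).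
(* The limit is clamped because the Picard operator requires two-sided continuity on the closed
   interval. *)
pose z i k := y i (clamp (k0 - d) (k0 + d) k).
have zE i (k : R) : `|k - k0| <= d -> z i k = y i k.
  by rewrite ler_norml => hk; rewrite /z clamp_id //; lra.
have kd : k0 - d <= k0 + d by have := d0; lra.
have hin x : `|clamp (k0 - d) (k0 + d) x - k0| <= d.
  by have := clamp_in x kd; rewrite ler_norml; lra.
have cz : cfam z.
  move=> i k _; apply/contP => e e0.
  have e3 : 0 < e / 3 by rewrite divr_gt0.
  have [N /(_ N (leqnn N)) HN] := half_pow_small (2 * B) e3.
  have cY' x : k0 - d <= x <= k0 + d -> {for x, continuous (Y N i)}.
    by move=> hx; apply: cY; rewrite ler_norml; lra.
  have /contP /(_ _ e3) [r r0 Hr] := clamp_cont kd cY' (x := k).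
  exists r => // t tk; have := Hr t tk; rewrite /= /z.
  have := Hy i _ (hin t) N; have := Hy i _ (hin k) N; move: HN.
  move: (clamp _ _ t) (clamp _ _ k) => u v; move: (2 * B * _) => c.
  rewrite !ltr_norml !ler_norml; lra.
have [cz' z'0 dz'] := HS z cz; exists (S z); split=> // i k hk.
(* The limit and its image under the Picard operator both lie within a geometric error of the same
   iterate, for every [m]; so the limit is a fixed point. *)
suff E j (t : R) : `|t - k0| <= d -> S z j t = z j t.
  apply: isd_eq (dz' i k (ltW hk)) _; apply: eq_bigr => j _.
  by rewrite E // ltW.
move=> ht; apply/subr0_eq; apply: (@half_pow_eq0 (2 * B)) => m.
have D (x : R) : `|x - k0| <= `|t - k0| -> is_derive x 1 (fun x => S z j x - Y m.+1 j x)
    (\sum_l A j l x * (z l x - Y m l x)).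
  move=> /(ball_sub _ _ ht) hx; apply: isd_eq (isdB (dz' j x hx) (dY m j x hx)) _.
  by rewrite -sumrB; apply: eq_bigr => l _; rewrite mulrBr.
have [c hc E] := mvt_dist D; move: E; rewrite z'0 Y0 subrr subr0 => E.
have hz l (x : R) : `|x - k0| <= d -> `|z l x - Y m l x| <= 2 * B * (1 / 2) ^+ m.
  by move=> hx; rewrite zE // Hy.
have H := sum_bound j (ball_sub _ _ ht hc) (fun l => hz l c (ball_sub _ _ ht hc)).
rewrite -(subrKA (Y m.+1 j t)); apply: le_trans (ler_normD _ _) _; rewrite E normrM.
have H2 := Hy j t ht m.+1; rewrite distrC -(zE j t ht) in H2.
have H1 : `|\sum_l A j l c * (z l c - Y m l c)| * `|t - k0| <= 2 * B * (1 / 2) ^+ m * (1 / 2).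
  by apply: le_trans H; rewrite ler_wpM2l.
have -> : 2 * B * (1 / 2) ^+ m = 2 * B * (1 / 2) ^+ m * (1 / 2) + 2 * B * (1 / 2) ^+ m.+1.
  by rewrite exprSr; field.
exact: lerD.
Qed.

End LinearODE.

(** * The local cubic relation between the metric and the curvature *)

Section ComplexDerivative.
Context {R : realType}.
Implicit Types (z d : cplx R) (f g : cplx R -> cplx R).

Lemma normc_ge (a b : R) : `|a| <= Normc.normc (a +i* b) /\ `|b| <= Normc.normc (a +i* b).
Proof. by rewrite /= -!sqrtr_sqr; split; apply: ler_wsqrtr; nra. Qed.

Lemma cplx_norm_le (a b : R) : `|a +i* b : R[i]| <= (`|a| + `|b|)%:C.
Proof.
rewrite normc_def lecR /= -(ger0_norm (addr_ge0 (normr_ge0 a) (normr_ge0 b))) -sqrtr_sqr.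
apply: ler_wsqrtr; rewrite -(real_normK (num_real a)) -(real_normK (num_real b)).
have := normr_ge0 a; have := normr_ge0 b; nra.
Qed.

Lemma cderiv_diff f z : derivable f z 1 ->
  let d := derive1 f z in
  diff_at (fun w => complex.Re (f w)) z (complex.Re d) (- complex.Im d) /\
  diff_at (fun w => complex.Im (f w)) z (complex.Im d) (complex.Re d).
Proof.
move=> df d.
suff H (e : R) : 0 < e -> exists2 dl : R, 0 < dl & forall a b, `|a| < dl -> `|b| < dl ->
    `|f (z + (a +i* b)) - f z - d * (a +i* b)| <= (e * (`|a| + `|b|))%:C.
  split=> e e0; have [dl dl0 Hd] := H e e0; exists dl => // a b ha hb; have := Hd a b ha hb.
    clear; move: (f _) (f _) d => [u v] [u' v'] [d1 d2] /=; simpc.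
    move=> /(le_trans (normc_ge _ _).1); congr (`|_| <= _); ring.
  clear; move: (f _) (f _) d => [u v] [u' v'] [d1 d2] /=; simpc.
  move=> /(le_trans (normc_ge _ _).2); congr (`|_| <= _); ring.
move=> e0; have eC : 0 < (e%:C : R[i]) by rewrite ltcR.
move: df; rewrite /derivable => /cvgrPdist_le /(_ _ eC).
rewrite -/('D_1 f z) -derive1E -/d near_withinE => /nbhs_boxP [r r0 Hr]; exists r => // a b ha hb.
have := Hr a b ha hb; rewrite add0r.
have [->|n0] := eqVneq (a +i* b : cplx R) 0.
  by move=> _; rewrite addr0 mulr0 !subrr normr0 lecR mulr_ge0 ?addr_ge0 ?(ltW e0).
move: (a +i* b : cplx R) (cplx_norm_le a b) n0 => h hh n0 /(_ isT).
rewrite /= [h *: 1]mulr1 (addrC h) => H.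
apply: le_trans (_ : e%:C * `|h| <= _); last first.
  by rewrite rmorphM; apply: ler_wpM2l hh; exact: ltW.
rewrite -ler_pdivrMr ?normr_gt0 // -normf_div.
rewrite (_ : _ / h = - (d - h^-1 *: (f (z + h) - f z))); first by rewrite normrN.
by rewrite /GRing.scale /=; field.
Qed.

Lemma diff_pd (f : cplx R -> R) z (p q : R) : diff_at f z p q -> pd f z p q.
Proof.
move=> H; split; apply/isdP => e e0; have [dl dl0 Hd] := H e e0; exists dl => // h hd.
  have := Hd h 0 hd; rewrite !normr0 => /(_ dl0).
  by rewrite add0r addc0 mulr0 !addr0.
have := Hd 0 h _ hd; rewrite !normr0 => /(_ dl0).
by rewrite add0r addc0 mulr0 !add0r.
Qed.

Lemma diff_cont (f : cplx R -> R) z (p q : R) : diff_at f z p q -> {for z, continuous f}.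
Proof.
move=> H; apply/ccontP => e e0; have [dl dl0 Hd] := H 1 ltr01.
pose C := `|p| + `|q| + 2.
have C0 : 0 < C by rewrite /C; have := normr_ge0 p; have := normr_ge0 q; lra.
exists (Num.min dl (e / (2 * C))); first by rewrite lt_min dl0 divr_gt0 // mulr_gt0.
move=> a b; rewrite !lt_min => /andP[a1 a2] /andP[b1 b2].
have := Hd a b a1 b1; rewrite mul1r => H1.
have H2 : `|p * a + q * b| <= `|p| * `|a| + `|q| * `|b|.
  by apply: le_trans (ler_normD _ _) _; rewrite !normrM.
have H3 : `|f (z + (a +i* b)) - f z| <= `|f (z + (a +i* b)) - f z - (p * a + q * b)| + `|p * a + q * b|.
  by rewrite -{1}(subrK (p * a + q * b) (f (z + (a +i* b)) - f z)); exact: ler_normD.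
rewrite !ltr_pdivlMr ?mulr_gt0 // in a2 b2.
move: H1 H2 H3 a2 b2 C0; rewrite /C; clear.
have := normr_ge0 p; have := normr_ge0 q; have := normr_ge0 a; have := normr_ge0 b.
move: (`|a|) (`|b|) (`|p|) (`|q|) => a' b' p' q'. move: (`|_|) (`|_|) (`|_|) => n1 n2 n3.
nra.
Qed.

Lemma cderiv_pd f z : derivable f z 1 -> let d := derive1 f z in
  pd (fun w => complex.Re (f w)) z (complex.Re d) (- complex.Im d) /\
  pd (fun w => complex.Im (f w)) z (complex.Im d) (complex.Re d).
Proof. by move=> /cderiv_diff [/diff_pd ? /diff_pd ?]. Qed.

Lemma cderiv_cont f z : derivable f z 1 ->
  {for z, continuous (fun w => complex.Re (f w))} /\ {for z, continuous (fun w => complex.Im (f w))}.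
Proof. by move=> /cderiv_diff [/diff_cont ? /diff_cont ?]. Qed.

Lemma holo_ccont f z : holomorphic_at f z -> {for z, continuous f}.
Proof.
by move=> /nbhs_singleton df; apply: differentiable_continuous; apply/derivable1_diffP.
Qed.

Lemma cont_powr_num (K : numFieldType) (z u : K^o) n : {for u, continuous (fun v : K^o => (v - z) ^+ n)}.
Proof.
have F := nbhs_filter u.
elim: n => [|n IH]; first exact: (@cst_continuous K^o K^o (1 : K^o) u).
rewrite (_ : (fun v => _) = (fun v : K^o => (v - z) * (v - z) ^+ n)); last first.
  by apply/funext => x; rewrite exprS.
apply: (@cvgM K K^o _ F) => //.
apply: (@cvgB K K^o _ _ F (fun v => v) (fun=> z)); first exact: cvg_id.
exact: (@cst_continuous K^o K^o z u).
Qed.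

Lemma cvg_powr (z u : cplx R) n : {for u, continuous (fun v : cplx R => (v - z) ^+ n)}.
Proof. exact: cont_powr_num. Qed.

(** If [f] were continuous, (u - z)^n f(u) would tend to 0, whereas it tends to g(z). *)
Lemma pole_not_cont f z : pole_at f z -> ~ {for z, continuous f}.
Proof.
move=> [n [g [n0 /holo_ccont cg g0 E]]] cf; apply: g0.
have A : g u @[u --> z^'] --> g z by exact: cvg_within_filter cg.
have B : (u - z) ^+ n * f u @[u --> z^'] --> (z - z) ^+ n * f z.
  apply: cvg_within_filter; apply: (@cvgM _ _ _ (nbhs_filter z)) cf.
  exact: cvg_powr.
rewrite subrr expr0n eqn0Ngt n0 mul0r in B.
have C : g u @[u --> z^'] --> (0 : cplx R).
  by refine (cvg_trans _ B); exact: (@near_eq_cvg _ _ _ _ _ _ E).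
exact: (cvg_unique _ A C).
Qed.

(** Off the centre [f] is g divided by a power, hence continuous, which excludes a pole. *)
Lemma pole_isolated f z : pole_at f z -> \forall u \near z^', ~ pole_at f u.
Proof.
move=> [n [g [n0 hg g0 E]]]; rewrite near_withinE in E *.
have /near_boxP [r r0 Hr] : \forall u \near z, derivable g u 1 /\ (u != z -> (u - z) ^+ n * f u = g u).
  exact: (@filterI _ _ (nbhs_filter z)).
apply/near_boxP; exists r => // u bu uz /pole_not_cont; apply.
have nuz : \forall v \near u, v <> z by apply: near_neq; apply/eqP.
have o : open (box z r) := @box_open R z r.
have nE : \forall v \near u, g v * ((v - z) ^+ n)^-1 = f v.
  apply: (@filterS2 _ _ (nbhs_filter u) _ _ _ _ nuz (open_near o bu)) => v /eqP vz /Hr [_ /(_ vz) <-].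
  by rewrite mulrAC mulfV ?mul1r // expf_neq0 // subr_eq0.
rewrite /prop_for /continuous_at -(nbhs_singleton nE).
apply: (@cvg_trans _ ((g v * ((v - z) ^+ n)^-1) @[v --> u])).
  exact: (@near_eq_cvg _ _ _ (nbhs_filter u) _ _ nE).
apply: (@cvgM _ _ _ (nbhs_filter u)).
  by apply: differentiable_continuous; apply/derivable1_diffP; have [] := Hr u bu.
apply: (@cvgV _ _ _ (nbhs_filter u)); first by rewrite expf_neq0 // subr_eq0.
exact: cvg_powr.
Qed.

End ComplexDerivative.

(** * First integrals of the curvature equation *)

Section LocalEquations.
Context {R : realType}.
Implicit Types (z W : cplx R) (phi k : cplx R -> R) (D : set (cplx R)).

Lemma complex_eqE (a b c d : R) : (a +i* b : R[i]) = c +i* d -> a = c /\ b = d.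
Proof. by case. Qed.

Lemma sqmod_eq0 W : (sqmod W == 0) = (W == 0).
Proof.
case: W => a b; rewrite /sqmod /= paddr_eq0 ?sqr_ge0 // !sqrf_eq0 eq_complex.
by [].
Qed.

Lemma sqmod_ge0 W : 0 <= sqmod W.
Proof. by rewrite addr_ge0 // sqr_ge0. Qed.

Lemma sqmodM W V : sqmod (W * V) = sqmod W * sqmod V.
Proof. by case: W V => a b [c d]; rewrite /sqmod; simpc => /=; ring. Qed.

Lemma dzbar_cofr k z : dzbar (cofr k) z = (dx k z / 2) +i* (dy k z / 2).
Proof.
rewrite /dzbar /cofr /= -/k.
have [d1 d2] : dx (fun=> 0 : R) z = 0 /\ dy (fun=> 0 : R) z = 0.
  by split; [exact: (pd_dx (pd_cst 0 z))|exact: (pd_dy (pd_cst 0 z))].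
by rewrite d1 d2 subr0 add0r.
Qed.

Lemma dz_cofr k z : dz (cofr k) z = (dx k z / 2) +i* (- dy k z / 2).
Proof.
rewrite /dz /cofr /=.
have [d1 d2] : dx (fun=> 0 : R) z = 0 /\ dy (fun=> 0 : R) z = 0.
  by split; [exact: (pd_dx (pd_cst 0 z))|exact: (pd_dy (pd_cst 0 z))].
by rewrite d1 d2 addr0 sub0r.
Qed.

(** The duality between form and field in real terms: dK = q (omega + conj omega) with q = e^(2 phi)
    / (4 |W|^2). It also shows that the form cannot vanish where it is regular and the metric is
    defined. *)
Lemma nabla_eq phi k z W : W * nabla phi k z = 'i / 4 ->
  [/\ sqmod W != 0,
   dx k z = 2 * (expR (2 * phi z) / (4 * sqmod W)) * complex.Re W &
   dy k z = - (2 * (expR (2 * phi z) / (4 * sqmod W)) * complex.Im W)].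
Proof.
rewrite /nabla dzbar_cofr => H.
have {}H : W * ((expR (- 2 * phi z))%:C * ((dx k z / 2) +i* (dy k z / 2))) = 4^-1 :> R[i].
  by apply: (mulfI (neq0Ci _)); rewrite -H; ring.
rewrite mulNr expRN in H.
have e0 := expR_gt0 (2 * phi z); move: (expR _) (dx k z) (dy k z) H e0 => e p q H e0.
have {}H : W * ((p / 2) +i* (q / 2)) = (e / 4)%:C :> R[i].
  rewrite rmorphM /= (fmorphV (real_complex R)) /= rmorph_nat -H fmorphV /=; field.
  by rewrite -(rmorph0 (real_complex R)) (inj_eq (@complexI R)) gt_eqF.
case: W H => a b; simpc => /complex_eqE [h1 h2].
have s0 : a ^+ 2 + b ^+ 2 != 0.
  apply/negP => /eqP s0; have [/eqP] : a = 0 /\ b = 0.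
    by split; apply/eqP; rewrite -sqrf_eq0 eq_le sqr_ge0 andbT; nra.
  by move=> /eqP a0 b0; move: h1 e0; rewrite a0 b0 !mul0r subr0; lra.
have E1 : (a ^+ 2 + b ^+ 2) * p = e / 2 * a.
  have := congr1 ( *%R a) h1; have := congr1 ( *%R b) h2; clear; lra.
have E2 : (a ^+ 2 + b ^+ 2) * q = - (e / 2 * b).
  have := congr1 ( *%R b) h1; have := congr1 ( *%R a) h2; clear; lra.
rewrite /sqmod /=; split => //.
  by apply: (mulfI s0); rewrite E1; field.
by apply: (mulfI s0); rewrite E2; field.
Qed.

Lemma cov_eq D phi k z : open D -> smooth_on D phi -> smooth_on D k -> D z -> cov_zz phi k z = 0 ->
  dx (dx k) z - dy (dy k) z = 2 * (dx phi z * dx k z - dy phi z * dy k z) /\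
  dy (dx k) z = dx phi z * dy k z + dy phi z * dx k z.
Proof.
move=> oD sphi sk Dz; rewrite /cov_zz (_ : dz (cofr k) = fun w => (dx k w / 2) +i* (- dy k w / 2)); last first.
  by apply/funext => w; exact: dz_cofr.
rewrite dz_cofr /dz /=.
have px := pdM (smooth_pd (smooth_dx sk) Dz) (pd_cst 2^-1 z).
have py := pdM (pdN (smooth_pd (smooth_dy sk) Dz)) (pd_cst 2^-1 z).
rewrite (pd_dx px) (pd_dy px) (pd_dx py) (pd_dy py) -(schwarz oD sk Dz).
move: (dx (dx k) z) (dy (dx k) z) (dy (dy k) z) (dx k z) (dy k z) (dx phi z) (dy phi z).
clear => xx xy yy x y fx fy; rewrite -[2]/(2%:R) -(rmorph_nat (real_complex R)); simpc => /complex_eqE [].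
by move=> h1 h2; split; lra.
Qed.

Lemma isd0_between (f : R -> R) a b :
  (forall t, Num.min a b <= t <= Num.max a b -> is_derive (t : R) 1 f 0) -> f a = f b.
Proof.
have [ab|ba] := leP a b => H.
  by apply/esym; apply: isd0_segment => // s hs; [apply: H|apply: isd_cont (H s hs)]; case/andP: hs => *; apply/andP; split; apply: ltW.
by apply: isd0_segment; [exact: ltW|move=> s hs; apply: H|move=> s hs; apply: isd_cont (H s hs)]; case/andP: hs => *; apply/andP; split; apply: ltW.
Qed.

(** Each point of the punctured square is joined to z0 + (r / 2)(1 + i) by segments parallel to the
    axes that avoid the centre. *)
Lemma punct_const (f : cplx R -> R) z0 (r : R) : 0 < r ->
  (forall z, box z0 r z -> z <> z0 -> pd f z 0 0) ->
  forall z z', box z0 r z -> z <> z0 -> box z0 r z' -> z' <> z0 -> f z = f z'.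
Proof.
move=> r0 H.
have bet (b x : R) : `|b| < r -> Num.min (r / 2) b <= x <= Num.max (r / 2) b -> `|x| < r.
  by rewrite !ltr_norml; have [h|h] := leP (r / 2) b; lra.
have N0 (a b : R) : a != 0 \/ b != 0 -> z0 + (a +i* b) <> z0.
  by move=> ab /eqP; rewrite -subr_eq0 addrC addKr eq_complex /= => /andP[/eqP a0 /eqP b0]; case: ab; rewrite ?a0 ?b0 eqxx.
have h2 : `|r / 2| < r by rewrite gtr0_norm; lra.
have r2 : r / 2 != 0 by rewrite gt_eqF // divr_gt0.
have hor (a b : R) : b != 0 -> `|a| < r -> `|b| < r -> f (z0 + ((r / 2) +i* b)) = f (z0 + (a +i* b)).
  move=> b0 ha hb; apply: (@isd0_between (fun s => f (z0 + (s +i* b)))) => t ht.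
  apply: pd_line_re (H _ _ _); [apply: boxP => //; exact: bet ha ht|apply: N0; by right].
have ver (a b : R) : a != 0 -> `|a| < r -> `|b| < r -> f (z0 + (a +i* (r / 2))) = f (z0 + (a +i* b)).
  move=> a0 ha hb; apply: (@isd0_between (fun s => f (z0 + (a +i* s)))) => t ht.
  apply: pd_line_im (H _ _ _); [apply: boxP => //; exact: bet hb ht|apply: N0; by left].
suff M z : box z0 r z -> z <> z0 -> f z = f (z0 + ((r / 2) +i* (r / 2))).
  by move=> z z' bz nz bz' nz'; rewrite M // (M z').
move=> /boxE [a [b [ha hb ->]]] nz; have [b0|b0] := eqVneq b 0.
  have a0 : a != 0 by apply/eqP => a0; apply: nz; rewrite a0 b0 addr0.
  by rewrite -(ver a b) // (hor a (r / 2)).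
by rewrite -(hor a b) // (ver (r / 2) b).
Qed.

Definition lapl k z : R := dx (dx k) z + dy (dy k) z.

Section CurvatureODE.
Variables (D : set (cplx R)) (phi k : cplx R -> R).
Hypothesis oD : open D.
Hypothesis sphi : smooth_on D phi.
Hypothesis sk : smooth_on D k.
Hypothesis curv : forall z, D z -> k z = gauss_curvature phi z.
Hypothesis cov : forall z, D z -> cov_zz phi k z = 0.

Let E z := expR (- 2 * phi z).

Lemma pd_E z : D z -> pd E z (- 2 * dx phi z * E z) (- 2 * dy phi z * E z).
Proof.
move=> Dz; have := pd_comp (is_derive_expR (- 2 * phi z)) (pdM (pd_cst (- 2) z) (smooth_pd sphi Dz)).
by move=> H; apply: pd_eq H _ _; rewrite /E; ring.
Qed.

(** By K_,zz = 0 the Hessian of K is a multiple of the metric, so the squared gradient norm has a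
    differential proportional to dK. *)
Lemma pd_gradnorm z : D z ->
  pd (fun w => E w * (dx k w ^+ 2 + dy k w ^+ 2)) z (E z * lapl k z * dx k z) (E z * lapl k z * dy k z).
Proof.
move=> Dz; have pE := pd_E Dz.
have px := smooth_pd (smooth_dx sk) Dz; have py := smooth_pd (smooth_dy sk) Dz.
have := pdM pE (pdD (pdM px px) (pdM py py)) => H.
have [c1 c2] := cov_eq oD sphi sk Dz (cov Dz).
have S := schwarz oD sk Dz.
move: H S c1 c2; rewrite /lapl; clear.
generalize (E z) (dx k z) (dy k z) (dx phi z) (dy phi z).
generalize (dx (dx k) z) (dy (dx k) z) (dx (dy k) z) (dy (dy k) z).
move=> xx yx xy yy e kx ky px py H S c1 c2; apply: pd_eq H _ _.
  by rewrite -S c2 (_ : xx = yy + 2 * (px * kx - py * ky)); [ring|rewrite -c1 addrC subrK].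
by rewrite c2 (_ : xx = yy + 2 * (px * kx - py * ky)); [ring|rewrite -c1 addrC subrK].
Qed.

(** Differentiating K_,zz = 0 gives relations among the third derivatives of K; they bring in the
    Laplacian of [phi], which the curvature formula replaces by K. The metric Laplacian plus K^2 is
    thus a first integral. *)
Lemma pd_scal z : D z -> pd (fun w => E w * lapl k w + k w ^+ 2) z 0 0.
Proof.
move=> Dz; have pE := pd_E Dz.
have sxx := smooth_dx (smooth_dx sk); have syy := smooth_dy (smooth_dy sk).
have sxy := smooth_dy (smooth_dx sk).
have pk := smooth_pd sk Dz.
have H := pdD (pdM pE (pdD (smooth_pd sxx Dz) (smooth_pd syy Dz))) (pdM pk pk).
have nD : \forall w \near z, D w := open_near oD Dz.
have px := smooth_pd (smooth_dx sk) Dz; have py := smooth_pd (smooth_dy sk) Dz.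
have fx := smooth_pd (smooth_dx sphi) Dz; have fy := smooth_pd (smooth_dy sphi) Dz.
have C1 : \forall w \near z, dx (dx k) w - dy (dy k) w = 2 * (dx phi w * dx k w - dy phi w * dy k w).
  by apply: filterS nD => w Dw; have [] := cov_eq oD sphi sk Dw (cov Dw).
have C2 : \forall w \near z, dy (dx k) w = dx phi w * dy k w + dy phi w * dx k w.
  by apply: filterS nD => w Dw; have [] := cov_eq oD sphi sk Dw (cov Dw).
have [a1 a2] := pd_uniq (pd_near C1 (pdB (smooth_pd sxx Dz) (smooth_pd syy Dz)))
  (pdM (pd_cst 2 z) (pdB (pdM fx px) (pdM fy py))).
have [b1 b2] := pd_uniq (pd_near C2 (smooth_pd sxy Dz)) (pdD (pdM fx py) (pdM fy px)).
have S1 := schwarz oD (smooth_dx sk) Dz.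
have S2 := schwarz oD (smooth_dy sk) Dz.
have S3 : dy (dy (dx k)) z = dy (dx (dy k)) z.
  by apply: dy_near; apply: filterS nD => w Dw; exact: schwarz Dw.
have Sp := schwarz oD sphi Dz.
have Sk := schwarz oD sk Dz.
have cv := curv Dz; rewrite /gauss_curvature -/(E z) in cv.
have [c1 c2] := (nbhs_singleton C1, nbhs_singleton C2).
move: H a1 a2 b1 b2 S1 S2 S3 Sp Sk cv c1 c2; clear; rewrite /lapl.
generalize (E z), (k z), (dx k z), (dy k z), (dx phi z), (dy phi z).
generalize (dx (dx phi) z), (dy (dx phi) z), (dx (dy phi) z), (dy (dy phi) z).
generalize (dx (dx (dx k)) z), (dy (dx (dx k)) z), (dx (dy (dx k)) z), (dy (dy (dx k)) z).
generalize (dx (dx (dy k)) z), (dy (dx (dy k)) z), (dx (dy (dy k)) z), (dy (dy (dy k)) z).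
generalize (dx (dx k) z), (dy (dx k) z), (dx (dy k) z), (dy (dy k) z).
move=> xx yx xy yy xxy yxy xyy yyy xxx yxx xyx yyx pxx pyx pxy pyy e kk kx ky px py.
move=> H a1 a2 b1 b2 S1 S2 S3 Sp Sk cv c1 c2; apply: pd_eq H _ _.
  have f1 : xxx = xyy + (pxx * kx + px * xx - (pxy * ky + py * xy)) * 2 by move: a1; clear; lra.
  by rewrite f1 -S2 -S3 b2 cv -Sk c2 -Sp (_ : xx = yy + 2 * (px * kx - py * ky)); [ring|rewrite -c1 addrC subrK].
have f1 : yyy = yxx - (pyx * kx + px * yx - (pyy * ky + py * yy)) * 2 by move: a2; clear; lra.
by rewrite f1 S1 b1 cv -Sk c2 -Sp (_ : xx = yy + 2 * (px * kx - py * ky)); [ring|rewrite -c1 addrC subrK].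
Qed.

End CurvatureODE.

(** The metric Laplacian being s - K^2 with s constant, the squared gradient norm has differential
    (s - K^2) dK, and it differs from a cubic in K by a constant. *)
Lemma local_cubic z0 (r : R) phi k : 0 < r -> let D := box z0 r `&` [set w | w <> z0] in
  smooth_on D phi -> smooth_on D k ->
  (forall z, D z -> k z = gauss_curvature phi z) -> (forall z, D z -> cov_zz phi k z = 0) ->
  exists a b : R, forall z, D z ->
    expR (- 2 * phi z) * (dx k z ^+ 2 + dy k z ^+ 2) = - k z ^+ 3 / 3 + a * k z + b.
Proof.
move=> r0 D sphi sk cv cz.
have oD : open D.
  rewrite openE => w [bw wz]; apply: (@filterI _ _ (nbhs_filter w)); last exact: near_neq.
  exact: open_near (@box_open R z0 r) bw.
pose z1 : cplx R := z0 + ((r / 2) +i* 0).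
have D1 : D z1.
  split; first by apply: boxP; rewrite ?normr0 // gtr0_norm ?divr_gt0 //; lra.
  move=> /eqP; rewrite -subr_eq0 addrC addKr eq_complex /= => /andP[/eqP]; lra.
pose s z := expR (- 2 * phi z) * lapl k z + k z ^+ 2.
pose q z := expR (- 2 * phi z) * (dx k z ^+ 2 + dy k z ^+ 2).
exists (s z1), (q z1 - (- k z1 ^+ 3 / 3 + s z1 * k z1)) => z Dz.
have sE w : D w -> s w = s z1.
  move=> [bw wz]; apply: (punct_const r0 _ bw wz D1.1 D1.2) => v bv vz.
  exact: (pd_scal oD sphi sk cv cz (conj bv vz)).
suff : q z - (- k z ^+ 3 / 3 + s z1 * k z) = q z1 - (- k z1 ^+ 3 / 3 + s z1 * k z1).
  by move=> <-; rewrite [RHS]addrC subrK.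
have H w : D w -> pd (fun z => q z - (- k z ^+ 3 / 3 + s z1 * k z)) w 0 0.
  move=> Dw; have pk := smooth_pd sk Dw.
  have c : is_derive (k w) 1 (fun t : R => - t ^+ 3 / 3 + s z1 * t) (- k w ^+ 2 + s z1).
    by isd_auto; field.
  have e : expR (- 2 * phi w) * lapl k w = s z1 - k w ^+ 2 by rewrite -(sE w Dw) /s addrK.
  have := pdB (pd_gradnorm oD sphi sk cz Dw) (pd_comp c pk); rewrite e => G.
  by apply: pd_eq G _ _; ring.
case: Dz => bz nz.
exact: (@punct_const _ z0 r r0 (fun w bw nw => H w (conj bw nw)) z z1 bz nz D1.1 D1.2).
Qed.

End LocalEquations.

Section Charts.
Context (R : realType) (M : topologicalType) (X : compact_riemann_surface R M).
Local Notation I := (chart_index X).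
Local Notation dom i := (cdom (charts X i)).
Local Notation coord i := (cmap (charts X i)).
Local Notation point i := (cinv (charts X i)).
Implicit Types (i j : I) (x y : M).

Lemma chart_near_point i x (P : set M) : dom i x -> (\forall y \near x, P y) ->
  \forall z \near coord i x, P (point i z).
Proof.
move=> dx nP; have im : (coord i @` dom i) (coord i x) by exists x.
by have := cinv_cont im; apply; rewrite cmapK.
Qed.

Lemma chart_near_coord i x (P : set (cplx R)) : dom i x -> (\forall z \near coord i x, P z) ->
  \forall y \near x, P (coord i y).
Proof. by move=> dx nP; have := cmap_cont dx; apply. Qed.

Lemma near_dom i x : dom i x -> \forall y \near x, dom i y.
Proof. by move=> dx; apply: open_nbhs_nbhs; split=> //; exact: cdom_open. Qed.

Lemma chart_imgP i z : (coord i @` dom i) z -> dom i (point i z) /\ coord i (point i z) = z.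
Proof. by case=> y dy <-; rewrite cmapK. Qed.

Lemma chart_near_img i x : dom i x -> \forall z \near coord i x,
  dom i (point i z) /\ coord i (point i z) = z.
Proof.
move=> dx; have im : (coord i @` dom i) (coord i x) by exists x.
apply: filterS (open_nbhs_nbhs (conj (@cimg_open R M (charts X i)) im)) => z; exact: chart_imgP.
Qed.

Lemma chart_box i x (P : set M) : dom i x -> (\forall y \near x, P y) -> exists2 r : R, 0 < r &
  forall z, box (coord i x) r z -> [/\ dom i (point i z), coord i (point i z) = z & P (point i z)].
Proof.
move=> dx nP; apply/near_boxP.
apply: (@filterS2 _ _ (nbhs_filter (coord i x)) _ _ _ _ (chart_near_img dx) (chart_near_point dx nP)).
by move=> z [].
Qed.

Lemma finite_near (S : set M) x : finite_set S -> \forall y \near x, y <> x -> ~ S y.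
Proof.
move=> fS; have cl : closed (S `\ x).
  have /accessible_finite_set_closed := hausdorff_accessible (rs_hausdorff X).
  by apply; exact: finite_setD.
have : open (~` (S `\ x)) by exact: closed_openC.
move=> o; have : \forall y \near x, (~` (S `\ x)) y.
  by apply: open_nbhs_nbhs; split=> // -[_ /(_ erefl)].
by apply: filterS => y H yx Sy; apply: H; split.
Qed.

Lemma neq_near x y : y <> x -> \forall v \near y, v <> x.
Proof.
move=> yx; have : \forall v \near y, v <> y -> ~ [set x] v by exact: finite_near (finite_set1 x).
by apply: filterS => v H vx; apply: (H _ vx) => vy; apply: yx; rewrite -vy.
Qed.

End Charts.

Lemma qf_field (R : realType) (e u v : R) : 0 < e -> u ^+ 2 + v ^+ 2 != 0 ->
  e / (4 * (u ^+ 2 + v ^+ 2)) = e^-1 * ((2 * (e / (4 * (u ^+ 2 + v ^+ 2))) * u) ^+ 2 +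
    (- (2 * (e / (4 * (u ^+ 2 + v ^+ 2))) * v)) ^+ 2).
Proof. by move=> e0 uv; field; rewrite uv gt_eqF. Qed.

Lemma qf_scale (R : realType) (e T v : R) : 0 < e * T -> e * T / (4 * (v * T)) = e / (4 * v).
Proof.
move=> eT; have T0 : T != 0 by apply/eqP => T0; move: eT; rewrite T0 mulr0 ltxx.
by have [->|v0] := eqVneq v 0; [rewrite mul0r !mulr0 invr0 !mulr0|field; rewrite T0 v0].
Qed.

(** * One cubic for the whole surface *)

Section Package.
Context (R : realType) (M : topologicalType) (X : compact_riemann_surface R M).
Context (S : set M) (phi : chart_index X -> cplx R -> R) (K : M -> R)
    (w : chart_index X -> cplx R -> cplx R).
Hypotheses (hg : HCMU S phi K) (hw : character_form S phi K w).
Local Notation I := (chart_index X).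
Local Notation dom i := (cdom (charts X i)).
Local Notation coord i := (cmap (charts X i)).
Local Notation point i := (cinv (charts X i)).
Implicit Types (i j : I) (x y : M).

Definition punct (z0 : cplx R) (r : R) := box z0 r `&` [set z | z <> z0].

Lemma punct_open z0 r : open (punct z0 r).
Proof.
rewrite openE => u [bu uz]; apply: (@filterI _ _ (nbhs_filter u)); last exact: near_neq.
exact: open_near (@box_open R z0 r) bu.
Qed.

Lemma no_pole_near i x : dom i x -> \forall z \near coord i x, z <> coord i x -> ~ pole_at (w i) z.
Proof.
move=> dx; have [h|h] := hw.1.1 i x dx.
  have /near_boxP [r r0 Hr] := h; apply/near_boxP; exists r => // z bz _ /pole_not_cont; apply.
  by apply: differentiable_continuous; apply/derivable1_diffP; exact: Hr.
have := pole_isolated h; rewrite near_withinE; apply: filterS => z H /eqP; exact: H.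
Qed.

(** The factor q with g = 4 q omega conj(omega) and dK = q (omega + conj omega). It does not depend
    on the chart, as the Jacobian factors cancel. *)
Definition qf i z := expR (2 * phi i z) / (4 * sqmod (w i z)).

(** What can be had around an arbitrary point, be it singular, a pole or neither, once the centre is
    removed. *)
Record punctured i x (r : R) : Prop := Punctured {
  pk_gt0 : 0 < r;
  pk_img : forall z, box (coord i x) r z -> dom i (point i z) /\ coord i (point i z) = z;
  pk_sing : forall z, punct (coord i x) r z -> ~ S (point i z);
  pk_pole : forall z, punct (coord i x) r z -> ~ pole_at (w i) z;
  pk_holo : forall z, punct (coord i x) r z -> holomorphic_at (w i) z;
  pk_phi : smooth_on (punct (coord i x) r) (phi i);
  pk_K : smooth_on (punct (coord i x) r) (K \o point i);
  pk_w : forall z, punct (coord i x) r z -> sqmod (w i z) != 0;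
  pk_pd : forall z, punct (coord i x) r z ->
    pd (K \o point i) z (2 * qf i z * complex.Re (w i z)) (- (2 * qf i z * complex.Im (w i z)))
}.

Lemma ex_punctured i x (P : set (cplx R)) : dom i x -> (\forall z \near coord i x, P z) ->
  exists2 r, punctured i x r & box (coord i x) r `<=` P.
Proof.
move=> dix nP.
have [r1 r10 H1] := chart_box dix (finite_near X x (hcmu_sing hg)).
have /near_boxP [r2 r20 H2] := no_pole_near dix.
have /near_boxP [r3 r30 H3] := nP.
pose r := Num.min r1 (Num.min r2 r3).
have r0 : 0 < r by rewrite !lt_min r10 r20.
have s1 z : box (coord i x) r z -> box (coord i x) r1 z by apply: box_sub; rewrite ge_min lexx.
have s2 z : box (coord i x) r z -> box (coord i x) r2 z by apply: box_sub; rewrite !ge_min lexx orbT.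
have s3 z : box (coord i x) r z -> box (coord i x) r3 z by apply: box_sub; rewrite !ge_min lexx !orbT.
have im z : box (coord i x) r z -> dom i (point i z) /\ coord i (point i z) = z.
  by move=> /s1 /H1 [].
have sg z : punct (coord i x) r z -> ~ S (point i z).
  move=> [bz nz]; have [d e n] := H1 z (s1 z bz); apply: n => E; apply: nz.
  by rewrite -e E.
have np z : punct (coord i x) r z -> ~ pole_at (w i) z by case=> /s2 /H2.
have hol z : punct (coord i x) r z -> holomorphic_at (w i) z.
  move=> pz; have [d e] := im z pz.1.
  by have := hw.1.1 i _ d; rewrite e => -[|/(np z pz)].
have sub : punct (coord i x) r `<=` coord i @` (dom i `\` S).
  by move=> z pz; have [d e] := im z pz.1; exists (point i z) => //; split=> //; exact: sg.
have sphi := smooth_sub sub ((hcmu_metric hg).1 i).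
have o := @punct_open (coord i x) r.
have cK z : punct (coord i x) r z -> (K \o point i) z = gauss_curvature (phi i) z.
  by move=> pz; have [d e] := im z pz.1; rewrite /= (hcmu_curv hg d (sg z pz)) e.
(* [K] is only assumed continuous; off [S] it is smooth as the curvature of the smooth function
   [phi]. *)
have sK : smooth_on (punct (coord i x) r) (K \o point i).
  apply: (smooth_ext o (f := gauss_curvature (phi i))); first by move=> z /cK.
  apply: smoothM => //; last by apply: smoothD => //; [exact: smooth_dx (smooth_dx _)|exact: smooth_dy (smooth_dy _)].
  apply: smoothN => //; apply: (smooth_comp (h := expR)) => //; first by move=> z _; exact: sm1_expR.
  by apply: smoothM => //; exact: smooth_cst.
have N z : punct (coord i x) r z -> [/\ sqmod (w i z) != 0,
    dx (K \o point i) z = 2 * qf i z * complex.Re (w i z) &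
    dy (K \o point i) z = - (2 * qf i z * complex.Im (w i z))].
  move=> pz; have [d e] := im z pz.1; apply: nabla_eq.
  by have := hw.2 i _ d (sg z pz); rewrite e; apply; exact: np.
exists r; last by move=> z /s3; exact: H3.
split=> // z pz; first by have [] := N z pz.
by have [_ <- <-] := N z pz; exact: smooth_pd pz.
Qed.

Definition cub (a b k : R) := - k ^+ 3 / 3 + a * k + b.

Lemma ex_cubic i x r : punctured i x r -> exists a b : R, forall z, punct (coord i x) r z ->
  qf i z = cub a b (K (point i z)).
Proof.
move=> pk.
have cK z : punct (coord i x) r z -> (K \o point i) z = gauss_curvature (phi i) z.
  by move=> pz; have [d e] := pk_img pk pz.1; rewrite /= (hcmu_curv hg d (pk_sing pk pz)) e.
have cz z : punct (coord i x) r z -> cov_zz (phi i) (K \o point i) z = 0.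
  by move=> pz; have [d e] := pk_img pk pz.1; have := hcmu_eq hg d (pk_sing pk pz); rewrite e.
have [a [b H]] := local_cubic (pk_gt0 pk) (pk_phi pk) (pk_K pk) cK cz.
exists a, b => z pz; rewrite -[RHS](H z pz); have P := pk_pd pk pz; rewrite (pd_dx P) (pd_dy P) mulNr expRN.
exact: (qf_field (expR_gt0 _) (pk_w pk pz)).
Qed.

Lemma qf_chart i j x : dom i x -> dom j x -> ~ S x -> ~ pole_at (w i) (coord i x) ->
  ~ pole_at (w j) (coord j x) -> qf i (coord i x) = qf j (coord j x).
Proof.
move=> di dj Sx pi pj; have := expR_gt0 (2 * phi i (coord i x)).
rewrite /qf (hw.1.2 i j x di dj pi pj) sqmodM ((hcmu_metric hg).2 i j x di dj Sx).
exact: qf_scale.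
Qed.

Lemma K_nonconst i x r z : punctured i x r -> punct (coord i x) r z ->
  ~ \forall u \near z, K (point i u) = K (point i z).
Proof.
move=> pk pz H; have [e1 e2] := pd_uniq (pd_near H (pk_pd pk pz)) (pd_cst _ z).
have w0 := pk_w pk pz; have q0 : qf i z != 0.
  by rewrite mulf_neq0 ?invr_neq0 ?mulf_neq0 ?pnatr_eq0 // gt_eqF // expR_gt0.
move: (qf i z) q0 e1 e2 => q q0 /eqP e1 /eqP; move: e1; rewrite oppr_eq0 !mulf_eq0 (negPf q0) pnatr_eq0 /= => /eqP u0 /eqP v0.
by move: w0; rewrite /sqmod u0 v0 expr0n addr0 eqxx.
Qed.

Definition on_cubic a b y := exists i, [/\ dom i y, ~ S y, ~ pole_at (w i) (coord i y) &
  qf i (coord i y) = cub a b (K y)].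

(** The point itself is left out because it may be singular or a pole. *)
Definition cubic_near a b x := \forall y \near x, y <> x -> on_cubic a b y.

Lemma ex_cubic_near x : exists a b, cubic_near a b x.
Proof.
have [i dx] := charts_cover X x.
have [r pk _] := ex_punctured dx (filterT : \forall z \near coord i x, True).
have [a [b H]] := ex_cubic pk; exists a, b.
have nb : \forall z \near coord i x, box (coord i x) r z.
  by apply: open_near (@box_open R _ r) _; apply: box_center (pk_gt0 pk).
apply: (@filterS2 _ _ (nbhs_filter x) _ _ _ _ (near_dom dx) (chart_near_coord dx nb)) => y dy by_ yx.
have py : punct (coord i x) r (coord i y).
  by split=> // E; apply: yx; rewrite -(cmapK dx) -E cmapK.
exists i; split=> //; [|exact: (pk_pole pk py)|]; have := pk_sing pk py; have := H _ py; rewrite cmapK //.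
Qed.

(** Two cubics of this shape differ by an affine function. It vanishes at two distinct values of
    [K], which is not locally constant off the centre, so the coefficients agree. *)
Lemma cubic_uniq a b a' b' x y : cubic_near a b y -> (\forall v \near y, v <> x -> on_cubic a' b' v) ->
  y <> x -> a = a' /\ b = b'.
Proof.
move=> H H' yx; have [i dy] := charts_cover X y.
have nyx : \forall v \near y, v <> x := neq_near X yx.
have nn : \forall v \near y, v <> y -> on_cubic a b v /\ on_cubic a' b' v.
  by apply: (@filterS3 _ _ (nbhs_filter y) _ _ _ _ _ H H' nyx) => v h h' vx vy; split; [exact: h|exact: h'].
have [r pk Hr] := ex_punctured dy (chart_near_point dy nn).
have P z : punct (coord i y) r z -> cub a b (K (point i z)) = cub a' b' (K (point i z)).
  move=> pz; have [dz ez] := pk_img pk pz.1.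
  have nv : point i z <> y by move=> E; apply: pz.2; rewrite -ez E.
  have [[j [d1 s1 p1 <-]] [l [d2 s2 p2 <-]]] := Hr z pz.1 nv.
  exact: qf_chart.
have c0 : punct (coord i y) r (coord i y + ((r / 2) +i* 0)).
  have r0 := pk_gt0 pk; split; first by apply: boxP; rewrite ?normr0 // gtr0_norm ?divr_gt0 //; lra.
  move=> /eqP; rewrite -subr_eq0 addrC addKr eq_complex /= => /andP[/eqP]; lra.
have [u [pu ku]] : exists u, punct (coord i y) r u /\
    K (point i u) <> K (point i (coord i y + ((r / 2) +i* 0))).
  apply: contrapT => nu; apply: (K_nonconst pk c0).
  apply: filterS (open_near (@punct_open (coord i y) r) c0) => v pv.
  by apply: contrapT => kv; apply: nu; exists v.
have := P _ pu; have := P _ c0; rewrite /cub.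
move: (K _) (K _) ku => k1 k2 k12 e1 e2.
have : (a - a') * (k2 - k1) = 0 by lra.
move/eqP; rewrite mulf_eq0 !subr_eq0 => /orP[/eqP aa|/eqP kk]; last by case: k12.
by split=> //; move: e1; rewrite aa; lra.
Qed.

(** The points near which a given cubic holds form an open set, and a closed one by uniqueness; the
    surface is connected. *)
Lemma ex_global_cubic : exists a b, forall x, cubic_near a b x.
Proof.
have [x0 [y0 _]] := hcmu_nonconst hg.
have [a [b H0]] := ex_cubic_near x0; exists a, b.
pose G := [set x | cubic_near a b x].
suff GT : G = setT by move=> x; have : G x by rewrite GT.
apply: (rs_connected X); first by exists x0.
  exists G; last by rewrite setTI.
  rewrite openE => x Gx; apply: filterS (nbhs_interior Gx) => v iv.
  have [->//|vx] := pselect (v = x).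
  apply: (@filterS2 _ _ (nbhs_filter v) _ _ _ _ iv (neq_near X vx)) => y h yx _; exact: h.
exists G; last by rewrite setTI.
move=> x clx; have [a' [b' H']] := ex_cubic_near x.
have [v [Gv iv]] := clx _ (nbhs_interior H').
have [<-//|vx] := pselect (v = x).
by have [e1 e2] := cubic_uniq Gv iv vx; rewrite /G /= e1 e2.
Qed.

End Package.

(** * Zeros and poles of the character form *)

Section Potential.
Context {R : realType}.
Implicit Types (z : cplx R) (f g : cplx R -> R).

Lemma pd_chain f (u v : cplx R -> R) z (p q u1 u2 v1 v2 : R) :
  diff_at f (u z +i* v z) p q -> pd u z u1 u2 -> pd v z v1 v2 ->
  pd (fun w => f (u w +i* v w)) z (p * u1 + q * v1) (p * u2 + q * v2).
Proof.
move=> H [ux uy] [vx vy].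
by split; apply: (@diff_curve R f (fun t => u (z + _)) (fun t => v (z + _))) => //; rewrite addc0.
Qed.

(** Poincare's lemma: the form is integrated along segments from the centre. *)
Lemma ex_potential z0 (r : R) f g : 0 < r -> smooth_on (box z0 r) f -> smooth_on (box z0 r) g ->
  (forall z, box z0 r z -> dy f z = dx g z) ->
  exists2 F : cplx R -> R, F z0 = 0 & forall z, box z0 r z -> pd F z (f z) (g z).
Proof.
move=> r0 sf sg H; have oD : open (box z0 r) := @box_open R z0 r.
pose x0 := complex.Re z0; pose y0 := complex.Im z0.
pose a z := complex.Re z - x0; pose b z := complex.Im z - y0.
pose u z s := x0 + s * a z; pose v z s := y0 + s * b z.
have pb z s : box z0 r z -> 0 <= s <= 1 -> box z0 r (u z s +i* v z s).
  move=> [h1 h2] /andP[s0 s1].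
  have e : u z s +i* v z s = z0 + ((s * a z) +i* (s * b z)) by rewrite /u /v /x0 /y0; case: (z0).
  have [e1 e2] : complex.Re (z - z0) = a z /\ complex.Im (z - z0) = b z.
    by rewrite /a /b /x0 /y0; case: (z) (z0) => ? ? [].
  rewrite e; apply: boxP; rewrite normrM (ger0_norm s0).
    by apply: le_lt_trans h1; rewrite e1 ler_piMl.
  by apply: le_lt_trans h2; rewrite e2 ler_piMl.
have jr (c : cplx R -> R) z s : {for z, continuous c} -> jcont (fun w _ => c w) z s by exact: jcont_fst.
have js z s : jcont (fun (_ : cplx R) (t : R) => t) z s.
  by apply: (@jcont_snd R _ id); exact: isd_cont (isd_id s).
have ja z s : jcont (fun w _ => a w) z s.
  by apply: jr; apply: ccontD; [exact: ccont_Re|exact: ccont_cst].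
have jb z s : jcont (fun w _ => b w) z s.
  by apply: jr; apply: ccontD; [exact: ccont_Im|exact: ccont_cst].
have ju z s : jcont u z s by apply: jcontD; [apply: jr; exact: ccont_cst|apply: jcontM].
have jv z s : jcont v z s by apply: jcontD; [apply: jr; exact: ccont_cst|apply: jcontM].
have jf (h : cplx R -> R) z s : smooth_on (box z0 r) h -> box z0 r z -> 0 <= s <= 1 ->
    jcont (fun z s => h (u z s +i* v z s)) z s.
  move=> sh bz hs; apply: jcont_cplx => //; exact: smooth_cont sh (pb z s bz hs).
pose G z s := a z * f (u z s +i* v z s) + b z * g (u z s +i* v z s).
(* The derivative of the integrand [G], with [dx g] replaced by [dy f]; in this form it is the
   [s]-derivative of s f along the segment, whose integral is f(z). *)
pose Gx z s := f (u z s +i* v z s) +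
  s * (a z * dx f (u z s +i* v z s) + b z * dy f (u z s +i* v z s)).
pose Gy z s := g (u z s +i* v z s) +
  s * (a z * dx g (u z s +i* v z s) + b z * dy g (u z s +i* v z s)).
have pu z s : pd (u ^~ s) z s 0.
  by apply: pd_eq (pdD (pd_cst x0 z) (pdM (pd_cst s z) (pdB (pd_Re z) (pd_cst x0 z)))) _ _; ring.
have pv z s : pd (v ^~ s) z 0 s.
  by apply: pd_eq (pdD (pd_cst y0 z) (pdM (pd_cst s z) (pdB (pd_Im z) (pd_cst y0 z)))) _ _; ring.
have pdh (h : cplx R -> R) z s : smooth_on (box z0 r) h -> box z0 r z -> 0 <= s <= 1 ->
    pd (fun z => h (u z s +i* v z s)) z (s * dx h (u z s +i* v z s)) (s * dy h (u z s +i* v z s)).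
  move=> sh bz hs; have := pd_chain (smooth_diff oD sh (pb z s bz hs)) (pu z s) (pv z s).
  by move=> P; apply: pd_eq P _ _; ring.
have pa z : pd a z 1 0 by apply: pd_eq (pdB (pd_Re z) (pd_cst x0 z)) _ _; ring.
have pbb z : pd b z 0 1 by apply: pd_eq (pdB (pd_Im z) (pd_cst y0 z)) _ _; ring.
have isdh (h : cplx R -> R) z (s : R) : smooth_on (box z0 r) h -> box z0 r z -> 0 <= s <= 1 ->
    is_derive s 1 (fun s => s * h (u z s +i* v z s)) (h (u z s +i* v z s) +
     s * (a z * dx h (u z s +i* v z s) + b z * dy h (u z s +i* v z s))).
  move=> sh bz hs; have D := smooth_diff oD sh (pb z s bz hs).
  have d1 := @diff_curve R h (u z) (v z) s _ _ _ _ D (isd_aff x0 (a z) s) (isd_aff y0 (b z) s).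
  by apply: isd_eq (isdM (isd_id s) d1) _; ring.
have u1 z : u z 1 +i* v z 1 = z.
  by rewrite /u /v /a /b !mul1r ![_ + (_ - _)]addrC !subrK; case: z.
exists (fun z => int01 (G z)) => [|z bz].
  have -> : G z0 = fun=> 0.
    by apply/funext => s; rewrite /G /a /b /x0 /y0 !subrr !mul0r addr0.
  exact: int01_cst.
have jGx w s : box z0 r w -> 0 <= s <= 1 -> jcont Gx w s.
  move=> bw hs; apply: jcontD; first exact: jf.
  apply: jcontM => //; apply: jcontD; apply: jcontM => //; apply: jf => //.
    exact: smooth_dx.
  exact: smooth_dy.
have jGy w s : box z0 r w -> 0 <= s <= 1 -> jcont Gy w s.
  move=> bw hs; apply: jcontD; first exact: jf.
  apply: jcontM => //; apply: jcontD; apply: jcontM => //; apply: jf => //.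
    exact: smooth_dx.
  exact: smooth_dy.
have E1 : int01 (Gx z) = f z.
  by rewrite (int01E (fun s hs => isdh f z s sf bz hs)) mul1r mul0r subr0 u1.
have E2 : int01 (Gy z) = g z.
  by rewrite (int01E (fun s hs => isdh g z s sg bz hs)) mul1r mul0r subr0 u1.
rewrite -E1 -E2; apply: (int01_pd oD) => // [w s bw hs|w s bw hs].
  by apply: jcontD; apply: jcontM => //; exact: jf.
have P := pdD (pdM (pa w) (pdh f w s sf bw hs)) (pdM (pbb w) (pdh g w s sg bw hs)).
have := H _ (pb w s bw hs); move: P; rewrite /Gx /Gy.
generalize (dx f (u w s +i* v w s)) (dy f (u w s +i* v w s)) (dx g (u w s +i* v w s)) (dy g (u w s +i* v w s)).
by move=> fx fy gx gy P e; apply: pd_eq P _ _; rewrite e; ring.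
Qed.

(** Logarithmic growth: between t / 2 and t the function changes by at least c / 2 in absolute
    value, against continuity at 0. *)
Lemma mvt_log_contra (F F' : R -> R) (c d : R) : 0 < c -> 0 < d -> {for 0, continuous F} ->
  (forall t, 0 < t < d -> is_derive t 1 F (F' t)) -> (forall t, 0 < t < d -> c <= `|F' t| * t) -> False.
Proof.
move=> c0 d0 /contP cF HF HF'; have [e e0 He] := cF (c / 8) (divr_gt0 c0 (ltr0n _ 8)).
pose t := Num.min d e / 2.
have t0 : 0 < t by rewrite divr_gt0 // lt_min d0.
have tm : t < d /\ t < e.
  have m0 : 0 < Num.min d e by rewrite lt_min d0.
  have : t < Num.min d e by rewrite /t; move: m0; clear; move: (Num.min d e) => m; lra.
  by rewrite lt_min => /andP[].
have h x : t / 2 <= x <= t -> 0 < x < d by case: tm => *; lra.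
have lt2 : t / 2 < t by lra.
have [x /andP[x1 x2] E] := mvt lt2 (fun x hx => HF x (h x hx)).
have hx : 0 < x < d by apply: h; lra.
have b1 : `|F t - F 0| < c / 8 by apply: He; rewrite subr0 gtr0_norm; [case: tm|].
have b2 : `|F (t / 2) - F 0| < c / 8 by apply: He; rewrite subr0 gtr0_norm; case: tm => *; lra.
have b3 : `|F t - F (t / 2)| < c / 4.
  rewrite -(subrKA (F 0)); apply: le_lt_trans (ler_normD _ _) _; rewrite (distrC (F 0)).
  by move: b1 b2; move: (`|_|) (`|_|) => u v; lra.
move: b3; rewrite E normrM (gtr0_norm (_ : 0 < t - t / 2)); last by lra.
have := HF' x hx; have := normr_ge0 (F' x); move: (`|_|) => y y0 hy hy2.
have := ler_wpM2l y0 (ltW x2); lra.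
Qed.

(** A primitive of [g] minus [s c] is nonincreasing with equal end values, hence constant. The
    interior point 1 / 2 is one choice among all. *)
Lemma int01_max (g : R -> R) (c : R) : cont01 g -> (forall s, 0 <= s <= 1 -> g s <= c) ->
  int01 g = c -> g (1 / 2) = c.
Proof.
move=> cg le_c; have [G HG ->] := int01_ex cg => E.
have D (s : R) : 0 <= s <= 1 -> is_derive s 1 (fun s => G s - s * c) (g s - c).
  by move=> hs; apply: isd_eq (isdB (HG s hs) (isdM (isd_id s) (isd_cst c s))) _; ring.
have mono (x y : R) : 0 <= x -> x < y -> y <= 1 -> G y - y * c <= G x - x * c.
  move=> x0 xy y1; rewrite -subr_le0.
  have D' (t : R) : x <= t <= y -> is_derive t 1 (fun s => G s - s * c) (g t - c).
    by move=> /andP[t1 t2]; apply: D; apply/andP; lra.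
  have [t /andP[t1 t2] ->] := mvt xy D'.
  apply: mulr_le0_ge0; last by rewrite subr_ge0 ltW.
  by rewrite subr_le0; apply: le_c; rewrite (le_trans x0 (ltW t1)) (le_trans (ltW t2) y1).
have h2 : 0 <= (1 / 2 : R) <= 1 by lra.
have N : \forall t \near (1 / 2 : R), G t - t * c = G 0.
  apply/near_itvP; exists (1 / 4); first lra.
  move=> t; rewrite ltr_norml => /andP[t1 t2].
  have t3 : 0 < t by lra.
  have t4 : t < 1 by lra.
  by have := mono 0 t (lexx _) t3 (ltW t4); have := mono t 1 (ltW t3) t4 (lexx _); lra.
by have := isd_uniq (isd_near N (D _ h2)) (isd_cst (G 0) (1 / 2)); lra.
Qed.

End Potential.

(** * Local behaviour at extrema and poles *)

Section Extremum.
Context {R : realType}.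

Lemma rho0 (z0 : cplx R) (r s : R) :
  (complex.Re z0 + rho1 r s) +i* (complex.Im z0 + rho2 r s) = z0 + (rho1 r s +i* rho2 r s).
Proof. by case: z0. Qed.

Lemma crit_max (F : R -> R) (p d : R) : 0 < d ->
  (forall t : R, `|t| < d -> exists l, is_derive t 1 F l) ->
  (forall t : R, `|t| < d -> F t <= F 0) -> is_derive (0 : R) 1 F p -> p = 0.
Proof.
move=> d0 DF F0 Fp; have le : - d <= d by lra.
have IF t : t \in `]- d, d[ -> derivable F t 1.
  by rewrite in_itv /= -ltr_norml => /DF [l Hl]; exact: (@ex_derive _ _ _ _ _ _ _ Hl).
have I0 : 0 \in `]- d, d[ by rewrite in_itv /= d0 oppr_lt0 d0.
have H : is_derive (0 : R) 1 F 0.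
  by apply: (derive1_at_max le IF I0) => t; rewrite in_itv /= -ltr_norml; exact: F0.
exact: isd_uniq Fp H.
Qed.

(* By the mean value property [f] attains [f z0] on a circle around [z0]; its
   gradient vanishes there. *)
Lemma harmonic_no_max z0 (r : R) f w1 w2 : 0 < r ->
  (forall z, box z0 r z -> {for z, continuous f}) ->
  smooth_on (box z0 r) w1 -> smooth_on (box z0 r) w2 ->
  (forall z, box z0 r z -> dy w2 z = dx w1 z) ->
  (forall z, box z0 r z -> z <> z0 -> pd f z (w1 z) (- w2 z)) ->
  (forall z, box z0 r z -> f z <= f z0) ->
  exists z, [/\ box z0 r z, z <> z0, w1 z = 0 & w2 z = 0].
Proof.
move=> r0 cf s1 s2 cr pf fmax; have [y y0 py] := ex_potential r0 s2 s1 cr.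
pose r' := r / 4; have r'0 : 0 < r' by rewrite divr_gt0.
have r4 : 4 * r' = r by rewrite /r'; field.
have bb w : box z0 (4 * r') w -> box z0 r w by rewrite r4.
have h0 : box z0 (r' / 2) z0 by apply: box_center; rewrite divr_gt0.
have oD : open (box z0 r) := @box_open R z0 r.
have cy w : box z0 (4 * r') w -> {for w, continuous y}.
  move=> /bb bw; apply: diff_cont; apply: (@pd_diff R y w2 w1).
  - by apply: filterS (open_near oD bw) => v bv; exact: py.
  - exact: smooth_cont s2 bw.
  - exact: smooth_cont s1 bw.
have := @cauchy_re R z0 r' z0 r'0 h0 f y w1 w2 (fun w bw => cf w (bb w bw)) cy
  (fun w bw _ => smooth_cont s1 (bb w bw)) (fun w bw _ => smooth_cont s2 (bb w bw))
  (fun w bw => pf w (bb w bw)) (fun w bw _ => py w (bb w bw)).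
have rr s : rho1 r' s ^+ 2 + rho2 r' s ^+ 2 != 0 by rewrite rho_sqr expf_neq0 // gt_eqF.
have ax (x t : R) : x + t - x = t by rewrite addrC addKr.
have k1 : ker1 z0 r' z0 = fun=> 1.
  apply/funext => s; rewrite /ker1 /denom !ax -!expr2 divff //; exact: rr.
have k2 : ker2 z0 r' z0 = fun=> 0.
  by apply/funext => s; rewrite /ker2 !ax (mulrC (rho2 r' s)) subrr mul0r.
rewrite k1 k2 !int01_cst mulr1 mulr0 subr0.
have -> : (fun s => f ((complex.Re z0 + rho1 r' s) +i* (complex.Im z0 + rho2 r' s)) * 1 -
    y ((complex.Re z0 + rho1 r' s) +i* (complex.Im z0 + rho2 r' s)) * 0) =
  fun s => f (z0 + (rho1 r' s +i* rho2 r' s)).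
  by apply/funext => s; rewrite mulr1 mulr0 subr0 rho0.
have bc s : box z0 r (z0 + (rho1 r' s +i* rho2 r' s)).
  have [h1 h2] := rho_le r'0 s; apply: boxP; [apply: le_lt_trans h1 _|apply: le_lt_trans h2 _]; rewrite /r'; lra.
move=> E; have cg : cont01 (fun s => f (z0 + (rho1 r' s +i* rho2 r' s))).
  move=> s _; have -> : (fun s => f (z0 + (rho1 r' s +i* rho2 r' s))) =
      fun s => f ((complex.Re z0 + rho1 r' s) +i* (complex.Im z0 + rho2 r' s)).
    by apply/funext => t; rewrite rho0.
  exact: (@cont_circle R z0 r' r'0 f (fun w bw => cf w (bb w bw)) s).
have {}E := int01_max cg (fun s _ => fmax _ (bc s)) E.
pose z : cplx R := z0 + (rho1 r' (1 / 2) +i* rho2 r' (1 / 2)).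
have nz : z <> z0.
  move=> /eqP; rewrite -subr_eq0 addrC addKr eq_complex /= => /andP[/eqP e1 /eqP e2].
  by have := rr (1 / 2); rewrite e1 e2 expr0n addr0 eqxx.
have [d d0 Hd] : exists2 d, 0 < d & box z d `<=` box z0 r by apply/near_boxP; exact: open_near oD (bc _).
have oe := @box_open R z d.
have nn : \forall v \near z, box z d v /\ v <> z0.
  apply: (@filterI _ _ (nbhs_filter z)); last exact: near_neq.
  exact: open_near oe (box_center z d0).
have [d' d'0 Hd'] : exists2 d', 0 < d' & box z d' `<=` [set v | box z d v /\ v <> z0].
  by apply/near_boxP.
have pz (v : cplx R) : box z d' v -> pd f v (w1 v) (- w2 v).
  by move=> /Hd' [/Hd bv nv]; exact: pf.
have fz v : box z d' v -> f v <= f z.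
  by move=> /Hd' [/Hd bv _]; rewrite /z E; exact: fmax.
have [p1 p2] := pz z (box_center z d'0).
have h1 t : `|t| < d' -> box z d' (z + (t +i* 0)) by move=> td; apply: boxP; rewrite ?normr0.
have h2 t : `|t| < d' -> box z d' (z + (0 +i* t)) by move=> td; apply: boxP; rewrite ?normr0.
exists z; split=> //; first exact: bc.
- refine (@crit_max (fun t : R => f (z + (t +i* 0))) (w1 z) d' d'0 _ _ p1) => t td; last by rewrite addc0; apply: fz; exact: h1.
  by eexists; exact: pd_line_re (pz _ (h1 t td)).
- apply/eqP; rewrite -oppr_eq0; apply/eqP; refine (@crit_max (fun t : R => f (z + (0 +i* t))) (- w2 z) d' d'0 _ _ p2) => t td; last by rewrite addc0; apply: fz; exact: h2.
  by eexists; exact: pd_line_im (pz _ (h2 t td)).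
Qed.

Lemma ex_lt2 (d r : R) : 0 < d -> 0 < r -> exists t, [/\ 0 < t, t < d & t < r].
Proof.
move=> d0 r0; have m0 : 0 < Num.min d r by rewrite lt_min d0.
exists (Num.min d r / 2); rewrite divr_gt0 //.
have : Num.min d r / 2 < Num.min d r by move: m0; move: (Num.min d r) => m; lra.
by rewrite lt_min => /andP[].
Qed.

Section NearPoint.
Variables (z0 : cplx R) (r : R) (k w1 w2 : cplx R -> R) (P P' : R -> R).
Hypothesis r0 : 0 < r.
Hypothesis ck : forall z, box z0 r z -> {for z, continuous k}.
Hypothesis dP : forall t : R, is_derive t 1 P (P' t).
Hypothesis cP' : forall t : R, {for t, continuous P'}.
Hypothesis pk : forall z, box z0 r z -> z <> z0 ->
  pd k z (2 * P (k z) * w1 z) (- (2 * P (k z) * w2 z)).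

Let hline (t : R) : 0 < t < r -> box z0 r (z0 + (t +i* 0)) /\ z0 + (t +i* 0) <> z0.
Proof.
move=> /andP[t0 tr]; split; first by apply: boxP; rewrite ?normr0 // gtr0_norm.
by move=> /eqP; rewrite -subr_eq0 addrC addKr eq_complex /= => /andP[/eqP]; move: t0; lra.
Qed.

(** Gronwall's argument: along a horizontal segment from the centre P(k) solves a linear equation
    with bounded coefficient, so it can only change by an exponential factor and stays positive at
    the centre. *)
Lemma regular_pos : {for z0, continuous w1} ->
  (forall z, box z0 r z -> z <> z0 -> 0 < P (k z)) -> 0 < P (k z0).
Proof.
move=> cw Ppos; pose g z := P' (k z) * (2 * w1 z).
have cg : {for z0, continuous g}.
  apply: ccontM; last by apply: ccontM => //; exact: ccont_cst.
  by apply: ccont_comp; [exact: ck (box_center z0 r0)|exact: cP'].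
have /ccontP /(_ 1 ltr01) [d d0 Hd] := cg; pose C := `|g z0| + 1.
have [t1 [t10 t1d t1r]] := ex_lt2 d0 r0.
pose u (t : R) := P (k (z0 + (t +i* 0))) * expR (- C * t).
have Du (t : R) : 0 < t < t1 -> is_derive t 1 u
    ((g (z0 + (t +i* 0)) - C) * (P (k (z0 + (t +i* 0))) * expR (- C * t))).
  move=> /andP[t0 tt]; have [b n] : box z0 r (z0 + (t +i* 0)) /\ z0 + (t +i* 0) <> z0.
    by apply: hline; rewrite t0 (lt_trans tt t1r).
  have d1 := isd_comp (dP _) (pd_line_re (pk b n)).
  have d2 := isd_comp (is_derive_expR (- C * t)) (isdM (isd_cst (- C) t) (isd_id t)).
  by apply: isd_eq (isdM d1 d2) _; rewrite /g; ring.
have cu (t : R) : 0 <= t <= t1 -> {for t, continuous u}.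
  move=> /andP[t0 tt]; apply: contM.
    apply: (@continuous_comp _ _ _ (fun t : R => k (z0 + (t +i* 0))) P); last exact: isd_cont (dP _).
    apply: (@continuous_comp _ _ _ (fun t : R => z0 + (t +i* 0)) k); first exact: cont_line_re.
    by apply: ck; apply: boxP; rewrite ?normr0 // ger0_norm // (le_lt_trans tt).
  exact: isd_cont (isd_comp (is_derive_expR (- C * t)) (isdM (isd_cst (- C) t) (isd_id t))).
have [c /andP[c0 c1] E] := mvt_cont t10 (fun t ht => Du t ht) cu.
have u1 : 0 < u t1.
  by rewrite mulr_gt0 ?expR_gt0 //; have [] := @hline t1; rewrite ?t10 //; exact: Ppos.
have : u t1 <= u 0.
  rewrite -subr_le0 E subr0; apply: mulr_le0_ge0; last exact: ltW.
  apply: mulr_le0_ge0; last first.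
    rewrite mulr_ge0 ?expR_ge0 //; apply/ltW; have [] := @hline c; rewrite ?c0 ?(lt_trans c1) //; exact: Ppos.
  have := Hd c 0; rewrite normr0 gtr0_norm // => /(_ (lt_trans c1 t1d) d0).
  rewrite subr_le0 /C; have := ler_normD (g (z0 + (c +i* 0)) - g z0) (g z0); rewrite subrK.
  have := ler_norm (g (z0 + (c +i* 0))).
  lra.
by rewrite /u addc0 mulr0 expR0 mulr1; exact: lt_le_trans.
Qed.

Hypothesis P0 : 0 < P (k z0).

(* [T] is a primitive of [1 / (2 P)]; it turns [k] into a function whose
   gradient is the conjugate of the form. *)
Lemma ex_straighten : exists r' (T : R -> R), [/\ 0 < r', r' <= r,
   forall z, box z0 r' z -> {for z, continuous (fun z => T (k z))},
   forall z, box z0 r' z -> z <> z0 -> pd (fun z => T (k z)) z (w1 z) (- w2 z) &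
   forall z z', box z0 r' z -> box z0 r' z' -> k z <= k z' -> T (k z) <= T (k z')].
Proof.
have /contP /(_ _ P0) [e e0 He] := isd_cont (dP (k z0)).
have Ppos t : `|t - k z0| < e -> 0 < P t.
  by move=> /He; rewrite ltr_norml => /andP[+ _]; rewrite ltrBrDr addNr.
have e2 : 0 < e / 2 by rewrite divr_gt0.
have hin t : k z0 - e / 2 <= t <= k z0 + e / 2 -> `|t - k z0| < e.
  by move=> ht; rewrite ltr_norml; move: ht e0; lra.
have le2 : k z0 - e / 2 <= k z0 + e / 2 by move: e0; lra.
have cT (t : R) : k z0 - e / 2 <= t <= k z0 + e / 2 -> {for t, continuous (fun t => (2 * P t)^-1)}.
  move=> /hin /Ppos Pt; have n0 : 2 * P t != 0 by rewrite mulf_neq0 // gt_eqF.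
  exact: isd_cont (@isd_inv R (fun t => 2 * P t) t _ n0 (isdM (isd_cst 2 t) (dP t))).
have [T HT] := ex_primitive le2 cT.
have /ccontP /(_ _ e2) [d d0 Hd] := ck (box_center z0 r0).
exists (Num.min d r), T.
have bd z : box z0 (Num.min d r) z -> box z0 r z /\ k z0 - e / 2 <= k z <= k z0 + e / 2.
  move=> bz; split; first by apply: box_sub bz; rewrite ge_min lexx orbT.
  have ld : Num.min d r <= d by rewrite ge_min lexx.
  have [a [b [ha hb ->]]] := boxE (box_sub ld bz).
  by have := Hd a b ha hb; rewrite ltr_norml; move: (k _) (k z0) => x y; lra.
split; rewrite ?lt_min ?d0 ?ge_min ?lexx ?orbT //.
- move=> z /bd [bz hz]; apply: ccont_comp; [exact: ck|exact: isd_cont (HT _ hz)].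
- move=> z /bd [bz hz] nz; have := pd_comp (HT _ hz) (pk bz nz) => H.
  have := Ppos _ (hin _ hz); move: H; move: (P (k z)) => p H p0.
  by apply: pd_eq H _ _; field; rewrite gt_eqF.
move=> z z' /bd [_ h1] /bd [_ h2]; rewrite le_eqVlt => /orP[/eqP -> //|lt].
have DT (t : R) : k z <= t <= k z' -> is_derive t 1 T (2 * P t)^-1.
  by move=> ht; apply: HT; move: h1 h2 ht; move: (k z) (k z') (k z0) => a b c; lra.
have [t ht E] := mvt lt DT; rewrite -subr_ge0 E mulr_ge0 ?subr_ge0 ?(ltW lt) //.
rewrite invr_ge0 mulr_ge0 // ltW // Ppos // hin //.
by move: h1 h2 ht; move: (k z) (k z') (k z0) => a b c; lra.
Qed.

Variables (w g : cplx R -> cplx R) (n : nat).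
Hypothesis Ew : forall z, box z0 r z -> z <> z0 ->
  [/\ w1 z = complex.Re (w z), w2 z = complex.Im (w z),
      {for z, continuous w1} & {for z, continuous w2}].
Hypothesis cg : {for z0, continuous (fun z => complex.Re (g z))} /\
  {for z0, continuous (fun z => complex.Im (g z))}.
Hypothesis n0 : (0 < n)%N.
Hypothesis g0 : g z0 <> 0.
Hypothesis Eg : forall z, box z0 r z -> z <> z0 -> (z - z0) ^+ n * w z = g z.

(** On the ray of direction [om] the straightened function T(k) has derivative Re (w om) = t^(-n) Re
    (g om / om^n), of size at least a constant over t, although it is continuous at the centre. *)
Lemma pole_ray (om : cplx R) : om != 0 -> complex.Re (g z0 * (om / om ^+ n)) != 0 -> False.
Proof.
move=> om0 phi0; have [r' [T [r'0 r'r cT pT _]]] := ex_straighten.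
pose phi z := complex.Re (g z * (om / om ^+ n)).
pose u := complex.Re om; pose v := complex.Im om.
have omE : om = u +i* v by rewrite /u /v; case: (om).
have cphi : {for z0, continuous phi}.
  have -> : phi = fun z => complex.Re (g z) * complex.Re (om / om ^+ n) + complex.Im (g z) * (- complex.Im (om / om ^+ n)).
    by apply/funext => z; rewrite /phi; case: (g z) => a b; case: (_ / _) => c d; simpc.
  by case: cg => c1 c2; apply: ccontD; apply: ccontM => //; exact: ccont_cst.
have ph2 : 0 < `|phi z0| / 2 by rewrite divr_gt0 // normr_gt0.
have /ccontP /(_ _ ph2) [d d0 Hd] := cphi.
have [d1 [d10 d1d d1r]] := ex_lt2 d0 r'0.
pose m := `|u| + `|v| + 1.
have m1 : 1 <= m by rewrite /m lerDr addr_ge0.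
have m0 : 0 < m := lt_le_trans ltr01 m1.
pose e := Num.min 1 (d1 / m).
have e0 : 0 < e by rewrite lt_min ltr01 divr_gt0.
have pt (t : R) : 0 < t < e -> [/\ t <= 1, `|t * u| < d1 & `|t * v| < d1].
  rewrite lt_min => /and3P[t0 t1]; rewrite ltr_pdivlMr // => tm; split; first exact: ltW.
    rewrite normrM gtr0_norm //; apply: le_lt_trans tm; rewrite ler_wpM2l ?(ltW t0) //.
    by rewrite /m -addrA lerDl addr_ge0.
  rewrite normrM gtr0_norm //; apply: le_lt_trans tm; rewrite ler_wpM2l ?(ltW t0) //.
  by rewrite /m addrAC lerDr addr_ge0.
pose z (t : R) : cplx R := z0 + ((t * u) +i* (t * v)).
have zE (t : R) : z t - z0 = t%:C * om by rewrite /z addrC addKr omE; simpc.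
have zn (t : R) : 0 < t -> z t <> z0.
  move=> t0 /eqP; rewrite -subr_eq0 zE mulf_eq0 (negPf om0) orbF => /eqP /complex_eqE [t00 _].
  by move: t0; rewrite t00 ltxx.
have zb (t : R) : 0 < t < e -> box z0 r' (z t).
  by move=> /pt [_ h1 h2]; apply: boxP; [exact: lt_trans h1 d1r|exact: lt_trans h2 d1r].
have diffT (t : R) : 0 < t < e -> diff_at (fun z => T (k z)) (z t) (w1 (z t)) (- w2 (z t)).
  move=> ht; have tz := zn t (andP ht).1; have bt := zb t ht.
  have oe := @box_open R z0 r'.
  apply: (@pd_diff R (fun z => T (k z)) w1 (fun z => - w2 z)).
  - have nn : \forall v \near z t, box z0 r' v /\ v <> z0.
      apply: (@filterI _ _ (nbhs_filter (z t))); last exact: near_neq.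
      exact: open_near oe bt.
    by apply: filterS nn => y [by_ ny]; exact: pT.
  - by have [_ _ ? _] := Ew (box_sub r'r bt) tz.
  - have [_ _ _ c2] := Ew (box_sub r'r bt) tz.
    apply: (@ccont_comp _ _ w2 -%R) => //; exact: isd_cont (isdN (isd_id _)).
have dF (t : R) : 0 < t < e -> is_derive t 1 (fun t => T (k (z t))) (complex.Re (w (z t) * om)).
  move=> ht; have tz := zn t (andP ht).1; have bt := zb t ht.
  have [e1 e2 _ _] := Ew (box_sub r'r bt) tz.
  have := @diff_line R (fun z => T (k z)) z0 t u v _ _ (diffT t ht); rewrite -/(z t) e1 e2 => D.
  by apply: isd_eq D _; rewrite omE; case: (w _) => a b; simpc.
have cF : {for 0, continuous (fun t => T (k (z t)))}.
  have cz : {for 0, continuous z}.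
    move=> A; rewrite {1}/z !mul0r addc0 => /nbhs_boxP [q q0 Hq]; apply/near_itvP; exists (q / m).
      by rewrite divr_gt0.
    move=> t; rewrite subr0 ltr_pdivlMr // => tm; apply: Hq; rewrite normrM; apply: le_lt_trans tm; rewrite ler_wpM2l //.
      by rewrite /m -addrA lerDl addr_ge0.
    by rewrite /m addrAC lerDr addr_ge0.
  apply: (@continuous_comp _ _ _ z (fun z => T (k z))) => //.
  by rewrite /z !mul0r addc0; apply: cT; exact: box_center.
apply: (mvt_log_contra ph2 e0 cF dF) => t ht.
have [t1 h1 h2] := pt t ht; have t0 := (andP ht).1; have bt := zb t ht.
have := Eg (box_sub r'r bt) (zn t t0); rewrite zE => G.
have tC : t%:C != 0 :> R[i] by rewrite eq_complex /= gt_eqF.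
have -> : complex.Re (w (z t) * om) = (t ^+ n)^-1 * phi (z t).
  have -> : w (z t) * om = ((t ^+ n)^-1)%:C * (g (z t) * (om / om ^+ n)).
    rewrite -G exprMn fmorphV rmorphXn /=; field.
    by rewrite expf_neq0 // expf_neq0.
  by rewrite /phi; case: (g (z t) * _) => a b; simpc.
have := Hd _ _ (lt_trans h1 d1d) (lt_trans h2 d1d); rewrite -/(z t) => H.
have {}H : `|phi z0| / 2 <= `|phi (z t)|.
  have := ler_normD (phi z0 - phi (z t)) (phi (z t)); rewrite subrK (distrC (phi z0)).
  by move: H; move: (`|_|) (`|_|) (`|_|) => a1 a2 a3; lra.
rewrite normrM gtr0_norm ?invr_gt0 ?exprn_gt0 //.
have -> : (t ^+ n)^-1 * `|phi (z t)| * t = `|phi (z t)| * (t / t ^+ n) by ring.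
apply: le_trans H _; rewrite ler_peMr // -(prednK n0) exprS.
rewrite invfM mulrA mulfV ?gt_eqF // mul1r invf_ge1 ?exprn_gt0 //.
by rewrite exprn_ile1 // ltW.
Qed.

(** On a small circle T(k) is periodic with derivative - 2 pi Im g. By Rolle's theorem Im g vanishes
    somewhere on it, against its continuity at the centre. *)
Lemma pole_circle : n = 1%N -> complex.Im (g z0) != 0 -> False.
Proof.
move=> n1 im0; have [r' [T [r'0 r'r cT pT _]]] := ex_straighten.
have im2 : 0 < `|complex.Im (g z0)| by rewrite normr_gt0.
have /ccontP /(_ _ im2) [d d0 Hd] := cg.2.
have [q [q0 qd qr]] := ex_lt2 d0 r'0.
pose z (s : R) : cplx R := z0 + (rho1 q s +i* rho2 q s).
have zb s : box z0 r' (z s).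
  by have [h1 h2] := rho_le q0 s; apply: boxP; [exact: le_lt_trans h1 qr|exact: le_lt_trans h2 qr].
have zE s : z s - z0 = rho1 q s +i* rho2 q s by rewrite /z addrC addKr.
have zn s : z s <> z0.
  move=> /eqP; rewrite -subr_eq0 zE eq_complex /= => /andP[/eqP e1 /eqP e2].
  have := rho_sqr q s; rewrite e1 e2 expr0n addr0 => /esym/eqP.
  by rewrite expf_eq0 /= gt_eqF.
have gz s : complex.Im (g (z s)) != 0.
  apply/eqP => E; have [h1 h2] := rho_le q0 s.
  have := Hd _ _ (le_lt_trans h1 qd) (le_lt_trans h2 qd).
  by rewrite -/(z s) E sub0r normrN ltxx.
have oe := @box_open R z0 r'.
have dG (s : R) : is_derive s 1 (fun s => T (k (z s))) (- (pi *+ 2) * complex.Im (g (z s))).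
  have bt := zb s; have tz := zn s.
  have [e1 e2 cw1 cw2] := Ew (box_sub r'r bt) tz.
  have D : diff_at (fun z => T (k z)) (z s) (w1 (z s)) (- w2 (z s)).
    apply: (@pd_diff R (fun z => T (k z)) w1 (fun z => - w2 z)) => //; last first.
      apply: (@ccont_comp _ _ w2 -%R) => //; exact: isd_cont (isdN (isd_id _)).
    have nn : \forall v \near z s, box z0 r' v /\ v <> z0.
      apply: (@filterI _ _ (nbhs_filter (z s))); last exact: near_neq.
      exact: open_near oe bt.
    by apply: filterS nn => y [by_ ny]; exact: pT.
  have [d1 d2] := isd_rho q s.
  have zs : z s = (complex.Re z0 + rho1 q s) +i* (complex.Im z0 + rho2 q s) by rewrite rho0.
  rewrite zs in D.
  have := @diff_curve R _ (fun s => complex.Re z0 + rho1 q s) (fun s => complex.Im z0 + rho2 q s) s _ _ _ _ D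
    (isdD (isd_cst (complex.Re z0) s) d1) (isdD (isd_cst (complex.Im z0) s) d2).
  rewrite -zs; have -> : (fun s => T (k ((complex.Re z0 + rho1 q s) +i* (complex.Im z0 + rho2 q s)))) = fun s => T (k (z s)).
    by apply/funext => t; rewrite rho0.
  move=> H; apply: isd_eq H _.
  rewrite -(Eg (box_sub r'r bt) tz) n1 expr1 zE e1 e2; case: (w _) => a b; simpc; rewrite /=; ring.
have [c hc E] := mvt ltr01 (fun s _ => dG s).
have : z 1 = z 0.
  by rewrite /z /rho1 /rho2 mul1r mul0r cos2pi sin2pi cos0 sin0.
move=> z10; move: E; rewrite z10 subrr subr0 mulr1 => /esym/eqP.
by rewrite mulf_eq0 oppr_eq0 mulrn_eq0 /= (negPf (gz c)) orbF gt_eqF // pi_gt0.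
Qed.

(** A simple pole is excluded by the real ray if its residue has a real part, by a circle otherwise.
    For n > 1 a root [om] of om^(n-1) = g(z0) makes the coefficient in [pole_ray] equal to 1. *)
Lemma no_pole : False.
Proof.
have [n1|n1] := eqVneq n 1%N.
  have [re0|re0] := eqVneq (complex.Re (g z0)) 0.
    apply: pole_circle n1 _; apply/eqP => im0; apply: g0.
    by move: re0 im0; case: (g z0) => a b /= -> ->.
  by apply: (@pole_ray 1 (oner_neq0 _)); rewrite expr1n divr1 mulr1.
have m0 : (0 < n.-1)%N by case: (n) n0 n1 => [|[]].
pose om : R[i] := n.-1.-root (g z0 : R[i]).
have omE : om ^+ n.-1 = g z0 by exact: rootCK.
have om0 : om != 0.
  by apply/eqP => o0; apply: g0; rewrite -omE o0 expr0n eqn0Ngt m0.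
apply: (@pole_ray om) => //.
have e : om ^+ n = om * g z0 by rewrite -{1}(prednK n0) exprS omE.
have /eqP gn := g0.
have -> : g z0 * (om / om ^+ n) = 1 :> R[i] by rewrite e; field; rewrite om0 gn.
exact: oner_neq0.
Qed.

End NearPoint.

End Extremum.

(** The cubic has no square term, so its roots sum to 0 and two distinct ones determine it. *)
Lemma cub_pcubic (R : realType) (a b K1 K2 : R) : K1 != K2 -> cub a b K1 = 0 -> cub a b K2 = 0 ->
  forall k, cub a b k = pcubic K1 K2 k.
Proof.
rewrite /cub /pcubic => n12 h1 h2 k; have n0 : K1 - K2 != 0 by rewrite subr_eq0.
have ea : a = (K1 ^+ 2 + K1 * K2 + K2 ^+ 2) / 3.
  by apply: (mulIf n0); move: h1 h2; lra.
by have -> : b = K1 ^+ 3 / 3 - a * K1 by [lra|]; rewrite ea; field.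
Qed.

(** Inverts K_x + i K_y = 2 q conj(w): the form is recovered from the gradient of K and from e =
    e^(2 phi). *)
Lemma w_from_grad (R : realType) (e u v : R) : 0 < e -> u ^+ 2 + v ^+ 2 != 0 ->
  let q := e / (4 * (u ^+ 2 + v ^+ 2)) in
  u = 2 * q * u * e * (2 * ((2 * q * u) ^+ 2 + (- (2 * q * v)) ^+ 2))^-1 /\
  v = - (- (2 * q * v) * e * (2 * ((2 * q * u) ^+ 2 + (- (2 * q * v)) ^+ 2))^-1).
Proof.
move=> e0 n0 q.
have n1 : (2 * q * u) ^+ 2 + (- (2 * q * v)) ^+ 2 != 0.
  have -> : (2 * q * u) ^+ 2 + (- (2 * q * v)) ^+ 2 = (2 * q) ^+ 2 * (u ^+ 2 + v ^+ 2) by ring.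
  by rewrite mulf_neq0 // expf_neq0 // mulf_neq0 // mulf_neq0 ?invr_neq0 ?mulf_neq0 // gt_eqF.
have E : e * q = (2 * q * u) ^+ 2 + (- (2 * q * v)) ^+ 2 by rewrite /q; field.
have q0 : q != 0 by apply/eqP => q0; move: n1; rewrite -E q0 mulr0 eqxx.
by rewrite -E; split; field; rewrite q0 gt_eqF.
Qed.

(** * The poles of the form and the zeros of p(K) *)

Section Global.
Context (R : realType) (M : topologicalType) (X : compact_riemann_surface R M).
Context (S : set M) (phi : chart_index X -> cplx R -> R) (K : M -> R)
    (w : chart_index X -> cplx R -> cplx R).
Hypotheses (hg : HCMU S phi K) (hw : character_form S phi K w).
Local Notation I := (chart_index X).
Local Notation dom i := (cdom (charts X i)).
Local Notation coord i := (cmap (charts X i)).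
Local Notation point i := (cinv (charts X i)).
Implicit Types (i j : I) (x y : M).
Local Notation w1 i := (fun z => complex.Re (w i z)).
Local Notation w2 i := (fun z => complex.Im (w i z)).

Lemma punct_nonempty (z0 : cplx R) (r : R) : 0 < r -> punct z0 r (z0 + ((r / 2) +i* 0)).
Proof.
move=> r0; split; first by apply: boxP; rewrite ?normr0 // gtr0_norm ?divr_gt0 //; lra.
move=> /eqP; rewrite -subr_eq0 addrC addKr eq_complex /= => /andP[/eqP]; lra.
Qed.

Lemma K_cont i z : (coord i @` dom i) z -> {for z, continuous (K \o point i)}.
Proof.
move=> iz; apply: continuous_comp; first exact: cinv_cont iz.
exact: (hcmu_cont hg).
Qed.

(** Off the centre the form inherits its smoothness from the metric and [K], through
    [w_from_grad]. *)
Lemma smooth_w i x r : punctured S phi K w i x r ->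
  smooth_on (punct (coord i x) r) (w1 i) /\ smooth_on (punct (coord i x) r) (w2 i).
Proof.
move=> pk; have o := @punct_open R (coord i x) r; set D := punct _ _ in o *.
have sk := pk_K pk; pose k := K \o point i.
have se : smooth_on D (fun z => expR (2 * phi i z)).
  apply: (smooth_comp (h := expR)) => //; first by move=> z _; exact: sm1_expR.
  by apply: smoothM => //; [exact: smooth_cst|exact: pk_phi pk].
have N z : D z -> 2 * (dx k z * dx k z + dy k z * dy k z) != 0.
  move=> Dz; have P := pk_pd pk Dz; rewrite (pd_dx P) (pd_dy P).
  have := pk_w pk Dz; have := expR_gt0 (2 * phi i z); rewrite /qf /sqmod.
  move: (expR _) (complex.Re _) (complex.Im _) => e u v e0 n0.
  rewrite mulf_neq0 // mulrNN.
  have -> : forall q : R, 2 * q * u * (2 * q * u) + 2 * q * v * (2 * q * v) = (2 * q) ^+ 2 * (u ^+ 2 + v ^+ 2) by move=> q; ring.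
  by rewrite mulf_neq0 // expf_neq0 // mulf_neq0 // mulf_neq0 ?invr_neq0 ?mulf_neq0 // gt_eqF.
have sN : smooth_on D (fun z => (2 * (dx k z * dx k z + dy k z * dy k z))^-1).
  apply: smooth_inv => //; apply: smoothM => //; first exact: smooth_cst.
  by apply: smoothD => //; apply: smoothM => //; first [exact: smooth_dx|exact: smooth_dy].
have s1 := smoothM o (smoothM o (smooth_dx sk) se) sN.
have s2 := smoothN o (smoothM o (smoothM o (smooth_dy sk) se) sN).
have E z : D z -> w1 i z = dx k z * expR (2 * phi i z) * (2 * (dx k z * dx k z + dy k z * dy k z))^-1 /\
    w2 i z = - (dy k z * expR (2 * phi i z) * (2 * (dx k z * dx k z + dy k z * dy k z))^-1).
  move=> Dz; have P := pk_pd pk Dz; rewrite (pd_dx P) (pd_dy P) -!expr2.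
  exact: (w_from_grad (expR_gt0 _) (pk_w pk Dz)).
by split; [apply: smooth_ext o _ s1|apply: smooth_ext o _ s2] => z /E [].
Qed.

(** The centre may belong to [S], where [phi] says nothing. There [cauchy_smooth] applies, with the
    continuous derivatives known on the punctured square. *)
Lemma regular_w i x : dom i x -> holomorphic_at (w i) (coord i x) -> exists2 e, 0 < e &
  [/\ smooth_on (box (coord i x) e) (w1 i), smooth_on (box (coord i x) e) (w2 i) &
    forall z, box (coord i x) e z -> derivable (w i) z 1 /\
      dy (w1 i) z = - dx (w2 i) z /\ dy (w2 i) z = dx (w1 i) z].
Proof.
move=> dix hx; have [r pk Hr] := ex_punctured hg hw dix hx.
have [s1 s2] := smooth_w pk; have r0 := pk_gt0 pk.
pose r4 := r / 4; have r40 : 0 < r4 by rewrite divr_gt0.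
have rE : 4 * r4 = r by rewrite /r4; field.
have cr z : box (coord i x) r z -> pd (w1 i) z (dx (w1 i) z) (- dx (w2 i) z) /\
    pd (w2 i) z (dx (w2 i) z) (dx (w1 i) z).
  by move=> /Hr dz; have [p1 p2] := cderiv_pd dz; rewrite (pd_dx p1) (pd_dx p2).
have := @cauchy_smooth R (coord i x) r4 r40 (w1 i) (w2 i) (dx (w1 i)) (dx (w2 i)); rewrite rE => C.
have [|z bz nz|z bz nz|e e0 [t1 t2]] := C _ _ _.
- by move=> z /Hr; exact: cderiv_cont.
- by split; [apply: smooth_cont (smooth_dx s1) _|apply: smooth_cont (smooth_dx s2) _].
- exact: cr.
exists (Num.min e r); first by rewrite lt_min e0.
have b1 : box (coord i x) (Num.min e r) `<=` box (coord i x) e by apply: box_sub; rewrite ge_min lexx.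
have b2 : box (coord i x) (Num.min e r) `<=` box (coord i x) r by apply: box_sub; rewrite ge_min lexx orbT.
split; [exact: smooth_sub t1|exact: smooth_sub t2|] => z /b2 bz; split; first exact: Hr.
by have [p1 p2] := cr z bz; rewrite (pd_dy p1) (pd_dy p2).
Qed.

Variables (a b : R).
Hypothesis hab : forall x, cubic_near S phi K w a b x.
Local Notation P := (cub a b).

Lemma isd_cub (k : R) : is_derive k 1 P (- k ^+ 2 + a).
Proof. by rewrite /cub; isd_auto; field. Qed.

Lemma cont_cub' (k : R) : {for k, continuous (fun k : R => - k ^+ 2 + a)}.
Proof.
have : is_derive k 1 (fun k : R => - k ^+ 2 + a) (- (k + k)) by isd_auto; ring.
exact: isd_cont.
Qed.

Lemma ex_pack i x (Q : set (cplx R)) : dom i x -> (\forall z \near coord i x, Q z) -> exists r,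
  [/\ punctured S phi K w i x r, box (coord i x) r `<=` Q &
   forall z, punct (coord i x) r z -> qf phi w i z = P (K (point i z))].
Proof.
move=> dix nQ; have n2 := @filterI _ _ (nbhs_filter (coord i x)) _ _ nQ (chart_near_point dix (hab x)).
have [r pk Hr] := ex_punctured hg hw dix n2; exists r; split; [exact: pk|by move=> z /Hr []|].
move=> z pz; have [dz ez] := pk_img pk pz.1; have [_ H] := Hr z pz.1.
have nx : point i z <> x by move=> E; apply: pz.2; rewrite -ez E.
have [j [dj s pj <-]] := H nx.
have np : ~ pole_at (w i) (coord i (point i z)) by rewrite ez; exact: pk_pole pk z pz.
have := qf_chart hg hw dz dj s np pj; rewrite ez; exact.
Qed.

Lemma pack_pos i x r z : punctured S phi K w i x r -> punct (coord i x) r z ->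
  qf phi w i z = P (K (point i z)) -> 0 < P (K (point i z)).
Proof.
move=> pk pz <-; rewrite divr_gt0 ?expR_gt0 // mulr_gt0 // lt_neqAle sqmod_ge0 andbT eq_sym.
exact: pk_w pk z pz.
Qed.

Lemma cub_ge0 x : 0 <= P (K x).
Proof.
rewrite leNgt; apply/negP => lt0; have [i dix] := charts_cover X x.
have nx : \forall z \near coord i x, P (K (point i z)) < 0.
  have im : (coord i @` dom i) (coord i x) by exists x.
  have c : {for coord i x, continuous (fun z => P (K (point i z)))}.
    by apply: (ccont_comp (f := K \o point i)); [exact: K_cont|exact: isd_cont (isd_cub _)].
  have l : P (K (point i (coord i x))) < 0 by rewrite cmapK.
  exact: (cvgr_lt _ c).
have [r [pk Hr E]] := ex_pack dix nx.
have pz := punct_nonempty (coord i x) (pk_gt0 pk).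
by have := pack_pos pk pz (E _ pz); rewrite ltNge ltW // Hr //; exact: pz.1.
Qed.

Lemma pack_pd i x r z : punctured S phi K w i x r -> punct (coord i x) r z ->
  qf phi w i z = P (K (point i z)) ->
  pd (K \o point i) z (2 * P ((K \o point i) z) * w1 i z) (- (2 * P ((K \o point i) z) * w2 i z)).
Proof. by move=> pk pz E; have := pk_pd pk pz; rewrite E. Qed.

Lemma cub_holo i x : dom i x -> holomorphic_at (w i) (coord i x) -> 0 < P (K x).
Proof.
move=> dix hx; have [r [pk Hr E]] := ex_pack dix hx.
rewrite -{1}(cmapK dix); apply: (@regular_pos R (coord i x) r (K \o point i) (w1 i) (w2 i) P
  (fun k => - k ^+ 2 + a) (pk_gt0 pk)).
- by move=> z bz; apply: K_cont; have [dz ez] := pk_img pk bz; exists (point i z).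
- exact: isd_cub.
- exact: cont_cub'.
- by move=> z bz nz; apply: (pack_pd pk) => //; exact: E.
- by have [] := cderiv_cont (nbhs_singleton hx).
- by move=> z bz nz; apply: (pack_pos pk) => //; exact: E.
Qed.

Lemma cub_pole i x : dom i x -> pole_at (w i) (coord i x) -> P (K x) = 0.
Proof.
move=> dix [n [g [n0 hgx g0]]]; rewrite near_withinE => Eg.
have [r [pk Hr E]] := ex_pack dix Eg.
apply/eqP; rewrite eq_le cub_ge0 andbT leNgt; apply/negP => Ppos.
apply: (@no_pole R (coord i x) r (K \o point i) (w1 i) (w2 i) P (fun k => - k ^+ 2 + a) (pk_gt0 pk)
  _ isd_cub _ _ (w i) g n _ _ n0 g0).
- by move=> z bz; apply: K_cont; have [dz ez] := pk_img pk bz; exists (point i z).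
- by move=> z bz nz; apply: (pack_pd pk) => //; exact: E.
- by rewrite /= cmapK.
- move=> z bz nz; have [c1 c2] := cderiv_cont (nbhs_singleton (pk_holo pk (conj bz nz))).
  by split.
- exact: cderiv_cont (nbhs_singleton hgx).
- by move=> z bz /eqP nz; exact: Hr.
Qed.

(** If the form were holomorphic there, P(K) would be positive and T(K) harmonic with an interior
    extremum; the form would then vanish at a nearby point other than the centre, which [pk_w]
    forbids. *)
Lemma cub_extremum x : (forall y, K y <= K x) \/ (forall y, K x <= K y) -> P (K x) = 0.
Proof.
move=> ext; have [i dix] := charts_cover X x.
have [hx|] := hw.1.1 i x dix; last exact: cub_pole.
exfalso; have Ppos := cub_holo dix hx.
have [e e0 [s1 s2 cr]] := regular_w dix hx.
have nbe : \forall z \near coord i x, box (coord i x) e z by apply/near_boxP; exists e.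
have [r [pk Hr E]] := ex_pack dix nbe.
have [||||r' [T [r'0 r'r cT pT mT]]] := @ex_straighten R (coord i x) r (K \o point i) (w1 i) (w2 i) P
  (fun k => - k ^+ 2 + a) (pk_gt0 pk).
- by move=> z bz; apply: K_cont; have [dz ez] := pk_img pk bz; exists (point i z).
- exact: isd_cub.
- by move=> z bz nz; apply: (pack_pd pk) => //; exact: E.
- by rewrite /= cmapK.
have be z : box (coord i x) r' z -> box (coord i x) e z by move=> bz; apply: Hr; exact: box_sub bz.
have oe := @box_open R (coord i x) r'.
have sub : box (coord i x) r' `<=` box (coord i x) e by move=> z /be.
have bc := box_center (coord i x) r'0.
suff [z [bz nz z1 z2]] : exists z, [/\ box (coord i x) r' z, z <> coord i x, w1 i z = 0 & w2 i z = 0].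
  have pz : punct (coord i x) r z by split => //; exact: box_sub bz.
  by have := pk_w pk pz; rewrite /sqmod z1 z2 expr0n addr0 eqxx.
case: ext => ext.
  apply: (@harmonic_no_max R (coord i x) r' (fun z => T ((K \o point i) z)) (w1 i) (w2 i) r'0 cT).
  - exact: smooth_sub s1.
  - exact: smooth_sub s2.
  - by move=> z /be /cr [_ []].
  - exact: pT.
  - by move=> z bz; apply: mT => //; rewrite /= (cmapK dix); exact: ext.
(* A minimum is a maximum of the opposite function, whose form is the opposite one. *)
have [z [bz nz z1 z2]] : exists z, [/\ box (coord i x) r' z, z <> coord i x, - w1 i z = 0 & - w2 i z = 0].
  apply: (@harmonic_no_max R (coord i x) r' (fun z => - T ((K \o point i) z)) (fun z => - w1 i z) (fun z => - w2 i z) r'0).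
  - by move=> z bz; apply: (ccont_comp (h := -%R)); [exact: cT|exact: isd_cont (isdN (isd_id _))].
  - by apply: smoothN => //; exact: smooth_sub s1.
  - by apply: smoothN => //; exact: smooth_sub s2.
  - move=> z bz; have b2 := be z bz; have oo := @box_open R (coord i x) e.
    have p1 := smooth_pd s1 b2; have p2 := smooth_pd s2 b2.
    by rewrite (pd_dy (pdN p2)) (pd_dx (pdN p1)); have [_ [_ ->]] := cr z b2.
  - by move=> z bz nz; apply: pd_eq (pdN (pT z bz nz)) _ _.
  - by move=> z bz; rewrite lerN2; apply: mT => //; rewrite /= (cmapK dix); exact: ext.
by exists z; split=> //; apply/eqP; rewrite -oppr_eq0; apply/eqP.
Qed.

End Global.

Lemma isd_pcubic (R : realType) (K1 K2 k : R) :
  is_derive k 1 (pcubic K1 K2) (- k ^+ 2 + (K1 ^+ 2 + K1 * K2 + K2 ^+ 2) / 3).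
Proof.
have -> : pcubic K1 K2 = cub ((K1 ^+ 2 + K1 * K2 + K2 ^+ 2) / 3) (- (K1 * K2 * (K1 + K2)) / 3).
  by apply/funext => t; rewrite /pcubic /cub; field.
exact: isd_cub.
Qed.

(* A coordinate square on which the form [w1 + i w2] is holomorphic without zeros and
   [k] satisfies [dk = p(k) (omega + conj omega)]. *)
Record regular (R : realType) (p : R -> R) (z0 : cplx R) (r : R) (k w1 w2 : cplx R -> R) : Prop := Regular {
  rg_gt0 : 0 < r;
  rg_w1 : smooth_on (box z0 r) w1;
  rg_w2 : smooth_on (box z0 r) w2;
  rg_cr1 : forall z, box z0 r z -> dy w1 z = - dx w2 z;
  rg_cr2 : forall z, box z0 r z -> dy w2 z = dx w1 z;
  rg_w0 : forall z, box z0 r z -> w1 z ^+ 2 + w2 z ^+ 2 != 0;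
  rg_k : smooth_on (box z0 r) k;
  rg_pd : forall z, box z0 r z -> pd k z (2 * p (k z) * w1 z) (- (2 * p (k z) * w2 z));
  rg_pos : forall z, box z0 r z -> 0 < p (k z)
}.

(** * Regular squares around the points of [Mstar] *)

Section Star.
Context (R : realType) (M : topologicalType) (X : compact_riemann_surface R M).
Context (S : set M) (phi : chart_index X -> cplx R -> R) (K : M -> R)
    (w : chart_index X -> cplx R -> cplx R) (K1 K2 : R).
Hypotheses (hg : HCMU S phi K) (hw : character_form S phi K w).
Hypothesis hK1 : (exists x, K x = K1) /\ (forall x, K x <= K1).
Hypothesis hK2 : (exists x, K x = K2) /\ (forall x, K2 <= K x).
Local Notation I := (chart_index X).
Local Notation dom i := (cdom (charts X i)).
Local Notation coord i := (cmap (charts X i)).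
Local Notation point i := (cinv (charts X i)).
Implicit Types (i j : I) (x y : M).
Local Notation w1 i := (fun z => complex.Re (w i z)).
Local Notation w2 i := (fun z => complex.Im (w i z)).
Local Notation P := (pcubic K1 K2).

Lemma ex_ab : exists a b, (forall x, cubic_near S phi K w a b x) /\ P = cub a b.
Proof.
have [a [b hab]] := ex_global_cubic hg hw; exists a, b; split=> //.
have [[x1 e1] m1] := hK1; have [[x2 e2] m2] := hK2.
have c1 : cub a b K1 = 0.
  by rewrite -e1; apply: (cub_extremum hg hw hab); left => y; rewrite e1.
have c2 : cub a b K2 = 0.
  by rewrite -e2; apply: (cub_extremum hg hw hab); right => y; rewrite e2.
have n12 : K1 != K2.
  apply/eqP => E; have [x [y [_ _]]] := hcmu_nonconst hg; apply.
  by apply/eqP; rewrite eq_le; apply/andP; split; apply: le_trans (m1 _) _; rewrite E; exact: m2.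
by apply/funext => k; rewrite (cub_pcubic n12 c1 c2).
Qed.

(** A pole in another chart would give p(K) = 0, against positivity at a point where the form is
    holomorphic. So [Mstar] can be tested in a single chart. *)
Lemma holo_star i x : dom i x -> holomorphic_at (w i) (coord i x) -> w i (coord i x) != 0 -> Mstar w x.
Proof.
have [a [b [hab EP]]] := ex_ab.
move=> dix hx w0; have p0 := cub_holo hg hw hab dix hx.
have npi : ~ pole_at (w i) (coord i x) by move=> /pole_not_cont; apply; exact: holo_ccont.
move=> j djx; have npj : ~ pole_at (w j) (coord j x).
  by move=> /(cub_pole hg hw hab djx) E; move: p0; rewrite E ltxx.
split=> // -[_ z0].
by move/eqP: w0; apply; rewrite (hw.1.2 i j x dix djx npi npj) z0 mul0r.
Qed.

Lemma star_holo i x : Mstar w x -> dom i x -> holomorphic_at (w i) (coord i x) /\ w i (coord i x) != 0.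
Proof.
move=> sx dix; have [nz np] := sx i dix; have [hx|//] := hw.1.1 i x dix.
by split=> //; apply/eqP => w0; apply: nz.
Qed.

Lemma star_near x : Mstar w x -> \forall y \near x, Mstar w y.
Proof.
move=> sx; have [i dix] := charts_cover X x; have [hx w0] := star_holo sx dix.
have [c1 c2] := cderiv_cont (nbhs_singleton hx).
have n0 : \forall z \near coord i x, holomorphic_at (w i) z /\ w i z != 0.
  apply: (@filterI _ _ (nbhs_filter (coord i x))); first exact: nbhs_interior hx.
  have s0 : 0 < sqmod (w i (coord i x)) by rewrite lt_neqAle sqmod_ge0 andbT eq_sym sqmod_eq0.
  have c : {for coord i x, continuous (fun z => sqmod (w i z))}.
    exact: (ccontD (ccontM c1 c1) (ccontM c2 c2)).
  have := @cvgr_gt _ _ _ (nbhs_filter (coord i x)) _ _ c _ s0.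
  by apply: filterS => z; rewrite -sqmod_eq0 => h; rewrite gt_eqF.
apply: (@filterS2 _ _ (nbhs_filter x) _ _ _ _ (near_dom dix) (chart_near_coord dix n0)) => y dy [hy wy].
exact: holo_star dy hy wy.
Qed.

(** Only the centre of the square can lie in [S]. There the equation for dK is recovered as a limit,
    and [K] becomes smooth; the formula for [phi] alone remains restricted to points off [S]. *)
Lemma ex_regular i x (Q : set M) : Mstar w x -> dom i x -> (\forall y \near x, Q y) -> exists r,
  [/\ regular P (coord i x) r (K \o point i) (w1 i) (w2 i),
   forall z, box (coord i x) r z -> [/\ dom i (point i z), coord i (point i z) = z,
     Mstar w (point i z), derivable (w i) z 1 & Q (point i z)] &
   forall z, box (coord i x) r z -> ~ S (point i z) ->
     expR (2 * phi i z) = 4 * P (K (point i z)) * sqmod (w i z)].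
Proof.
move=> sx dix nQ; have [hx w0] := star_holo sx dix.
have [e e0 [s1 s2 cr]] := regular_w hg hw dix hx.
have [a [b [hab EP]]] := ex_ab.
have nn : \forall z \near coord i x, [/\ box (coord i x) e z, Mstar w (point i z) & Q (point i z)].
  have nbe : \forall z \near coord i x, box (coord i x) e z by apply/near_boxP; exists e.
  apply: (@filterS3 _ _ (nbhs_filter (coord i x)) _ _ _ _ _ nbe (chart_near_point dix (star_near sx)) (chart_near_point dix nQ)).
  by move=> z.
have [r [pk Hr E]] := ex_pack hg hw hab dix nn; have r0 := pk_gt0 pk.
have be : box (coord i x) r `<=` box (coord i x) e by move=> z /Hr [].
have o := @box_open R (coord i x) r.
have ck z : box (coord i x) r z -> {for z, continuous (K \o point i)}.
  by move=> bz; apply: K_cont hg _ _ _; have [dz ez] := pk_img pk bz; exists (point i z).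
have st z : box (coord i x) r z -> holomorphic_at (w i) z /\ w i z != 0.
  move=> bz; have [dz ez] := pk_img pk bz; have [_ sz _] := Hr z bz.
  by have := star_holo sz dz; rewrite ez.
have t1 := smooth_sub be s1; have t2 := smooth_sub be s2.
have pos z : box (coord i x) r z -> 0 < P (K (point i z)).
  move=> bz; have [dz ez] := pk_img pk bz; rewrite EP; apply: (cub_holo hg hw hab dz).
  by rewrite ez; have [] := st z bz.
have pnt z : punct (coord i x) r z ->
  pd (K \o point i) z (2 * P ((K \o point i) z) * w1 i z) (- (2 * P ((K \o point i) z) * w2 i z)).
  by move=> pz; rewrite EP; apply: (pack_pd pk) => //; exact: E.
have cP (t : R) : {for t, continuous P} by rewrite EP; exact: isd_cont (isd_cub a b t).
have pdk z : box (coord i x) r z ->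
  pd (K \o point i) z (2 * P ((K \o point i) z) * w1 i z) (- (2 * P ((K \o point i) z) * w2 i z)).
  move=> bz; have [zx|nz] := pselect (z = coord i x); last exact: pnt.
  have cf1 v : box (coord i x) r v -> {for v, continuous (fun z => 2 * P ((K \o point i) z) * w1 i z)}.
    move=> bv; apply: ccontM; last exact: smooth_cont t1 bv.
    by apply: ccontM; [exact: ccont_cst|apply: ccont_comp => //; exact: ck].
  have cf2 v : box (coord i x) r v -> {for v, continuous (fun z => - (2 * P ((K \o point i) z) * w2 i z))}.
    move=> bv; apply: (ccont_comp (h := -%R)); last exact: isd_cont (isdN (isd_id _)).
    apply: ccontM; last exact: smooth_cont t2 bv.
    by apply: ccontM; [exact: ccont_cst|apply: ccont_comp => //; exact: ck].
  (* At the centre each partial derivative is the limit of the derivatives along its axis. *)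
  rewrite zx; have bc := box_center (coord i x) r0; split.
    have := @isd_lim R (fun t : R => (K \o point i) (coord i x + (t +i* 0)))
      (fun t : R => 2 * P ((K \o point i) (coord i x + (t +i* 0))) * w1 i (coord i x + (t +i* 0))) 0.
    rewrite !addc0; apply.
    - apply: (@continuous_comp _ _ _ (fun t : R => coord i x + (t +i* 0))); first exact: cont_line_re.
      by apply: ck; rewrite addc0.
    - apply: (@continuous_comp _ _ _ (fun t : R => coord i x + (t +i* 0)) (fun z => 2 * P ((K \o point i) z) * w1 i z)); first exact: cont_line_re.
      by apply: cf1; rewrite addc0.
    rewrite near_withinE; apply/near_itvP; exists r => // t; rewrite subr0 => tr t0.
    have pt : punct (coord i x) r (coord i x + (t +i* 0)).
      split; first by apply: boxP; rewrite ?normr0.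
      by move=> /eqP; rewrite -subr_eq0 addrC addKr eq_complex /= (negPf t0).
    exact: pd_line_re (pnt _ pt).
  have := @isd_lim R (fun t : R => (K \o point i) (coord i x + (0 +i* t)))
      (fun t : R => - (2 * P ((K \o point i) (coord i x + (0 +i* t))) * w2 i (coord i x + (0 +i* t)))) 0.
  rewrite !addc0; apply.
  - apply: (@continuous_comp _ _ _ (fun t : R => coord i x + (0 +i* t))); first exact: cont_line_im.
    by apply: ck; rewrite addc0.
  - apply: (@continuous_comp _ _ _ (fun t : R => coord i x + (0 +i* t)) (fun z => - (2 * P ((K \o point i) z) * w2 i z))); first exact: cont_line_im.
    by apply: cf2; rewrite addc0.
  rewrite near_withinE; apply/near_itvP; exists r => // t; rewrite subr0 => tr t0.
  have pt : punct (coord i x) r (coord i x + (0 +i* t)).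
    split; first by apply: boxP; rewrite ?normr0.
    by move=> /eqP; rewrite -subr_eq0 addrC addKr eq_complex /= (negPf t0) andbF.
  exact: pd_line_im (pnt _ pt).
(* Bootstrap: the derivatives are polynomials in [K] times the smooth components of the form. *)
have sk : smooth_on (box (coord i x) r) (K \o point i).
  have G0 : sclass (box (coord i x) r) (fun f => f = K \o point i) (K \o point i) by exact: scG.
  apply: (sclass_smooth o _ G0).
  move=> _ ->; split; first exact: ck.
  have sP : sclass (box (coord i x) r) (fun f => f = K \o point i) (fun z => 2 * P ((K \o point i) z)).
    have G : sclass (box (coord i x) r) (fun f => f = K \o point i) (K \o point i) by exact: scG.
    have c t : sclass (box (coord i x) r) (fun f => f = K \o point i) (fun=> t) by apply: scS; exact: smooth_cst.
    have := scM (c 2) (scM (scM (scM (c (- 3^-1)) (scD G (c (- K1)))) (scD G (c (- K2)))) (scD G (c (K1 + K2)))).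
    congr sclass; apply/funext => z /=; rewrite /pcubic; ring.
  exists (fun z => 2 * P ((K \o point i) z) * w1 i z), (fun z => - 1 * (2 * P ((K \o point i) z) * w2 i z)).
  split; first by apply: scM => //; exact: scS.
    by apply: scM; [apply: scS; exact: smooth_cst|apply: scM => //; exact: scS].
  by move=> z bz; apply: pd_eq (pdk z bz) _ _; rewrite ?mulN1r.
exists r; split.
- split=> // z bz.
  + by have [_ []] := cr z (be z bz).
  + by have [_ []] := cr z (be z bz).
  + by have [_] := st z bz; rewrite -sqmod_eq0.
- move=> z bz; have [dz ez] := pk_img pk bz; have [_ sz qz] := Hr z bz.
  by split=> //; have [] := cr z (be z bz).
move=> z bz nS; have [dz ez] := pk_img pk bz.
have [hz wz] := st z bz; have np : ~ pole_at (w i) (coord i (point i z)).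
  by rewrite ez => /pole_not_cont; apply; exact: holo_ccont.
have := hw.2 i _ dz nS np; rewrite ez => /nabla_eq [n0 e1 e2].
have P1 := pdk z bz; rewrite (pd_dx P1) /= in e1; rewrite (pd_dy P1) /= in e2.
have := n0; rewrite /sqmod in e1 e2 *.
move: e1 e2; move: (P _) (expR _) (complex.Re _) (complex.Im _) => p q u v e1 e2 uv0.
have n2 : 2 != 0 :> R by rewrite pnatr_eq0.
(* Two expressions of the same gradient are compared in a component of the form that does not
   vanish. *)
have [u0|u0] := eqVneq u 0.
  have v0 : v != 0 by apply: contraNneq uv0 => ->; rewrite u0 expr0n addr0.
  have /(mulIf v0) : 2 * p * v = 2 * (q / (4 * (u ^+ 2 + v ^+ 2))) * v by apply: oppr_inj.
  by move=> /(mulfI n2) ->; field.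
have /(mulIf u0) E2 := e1.
by rewrite (mulfI n2 E2); field.
Qed.

End Star.

(** * The Gauss and Codazzi equations *)

Section Frame.
Context {R : realType}.
Variables (w1 w2 : cplx R -> R).
Implicit Types (f g : cplx R -> R) (z : cplx R).

(* Derivatives along the frame dual to the coframe [Re omega, Im omega]. *)
Definition fd f z (a b : R) := pd f z (a * w1 z + b * w2 z) (- a * w2 z + b * w1 z).

Lemma fd_eq f z a b a' b' : fd f z a b -> a = a' -> b = b' -> fd f z a' b'.
Proof. by move=> H <- <-. Qed.

Lemma fd_cst (c : R) z : fd (fun=> c) z 0 0.
Proof. by apply: pd_eq (pd_cst c z) _ _; ring. Qed.

Lemma fdD f g z a b a' b' : fd f z a b -> fd g z a' b' -> fd (fun w => f w + g w) z (a + a') (b + b').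
Proof. by move=> F G; apply: pd_eq (pdD F G) _ _; ring. Qed.

Lemma fdN f z a b : fd f z a b -> fd (fun w => - f w) z (- a) (- b).
Proof. by move=> F; apply: pd_eq (pdN F) _ _; ring. Qed.

Lemma fdB f g z a b a' b' : fd f z a b -> fd g z a' b' -> fd (fun w => f w - g w) z (a - a') (b - b').
Proof. by move=> F G; apply: pd_eq (pdB F G) _ _; ring. Qed.

Lemma fdM f g z a b a' b' : fd f z a b -> fd g z a' b' ->
  fd (fun w => f w * g w) z (a * g z + f z * a') (b * g z + f z * b').
Proof. by move=> F G; apply: pd_eq (pdM F G) _ _; ring. Qed.

Lemma fd_comp f z a b (h : R -> R) d : is_derive (f z) 1 h d -> fd f z a b ->
  fd (fun w => h (f w)) z (d * a) (d * b).
Proof. by move=> H F; apply: pd_eq (pd_comp H F) _ _; ring. Qed.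

Lemma fd_near f g z a b : (\forall w \near z, f w = g w) -> fd f z a b -> fd g z a b.
Proof. exact: pd_near. Qed.

Lemma fd_sum (J : Type) (s : seq J) (F : J -> cplx R -> R) (A B : J -> R) z :
  (forall j, fd (F j) z (A j) (B j)) ->
  fd (fun w => \sum_(j <- s) F j w) z (\sum_(j <- s) A j) (\sum_(j <- s) B j).
Proof.
move=> H; elim: s => [|j s IH].
  rewrite !big_nil (_ : (fun w => _) = fun=> 0); first exact: fd_cst.
  by apply/funext => w; rewrite big_nil.
rewrite !big_cons (_ : (fun w => _) = fun w => F j w + \sum_(j <- s) F j w); first exact: fdD.
by apply/funext => w; rewrite big_cons.
Qed.

Lemma fd_uniq f z a b a' b' : w1 z ^+ 2 + w2 z ^+ 2 != 0 -> fd f z a b -> fd f z a' b' -> a = a' /\ b = b'.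
Proof.
move=> n0 F G; have [e1 e2] := pd_uniq F G.
by split; apply: (mulIf n0);
  have := congr1 ( *%R (w1 z)) e1; have := congr1 ( *%R (w2 z)) e1;
  have := congr1 ( *%R (w1 z)) e2; have := congr1 ( *%R (w2 z)) e2; lra.
Qed.

Definition Xop f z := (w1 z * dx f z - w2 z * dy f z) / (w1 z ^+ 2 + w2 z ^+ 2).
Definition Yop f z := (w2 z * dx f z + w1 z * dy f z) / (w1 z ^+ 2 + w2 z ^+ 2).

Variable D : set (cplx R).
Hypothesis oD : open D.
Hypothesis s1 : smooth_on D w1.
Hypothesis s2 : smooth_on D w2.
Hypothesis cr1 : forall z, D z -> dy w1 z = - dx w2 z.
Hypothesis cr2 : forall z, D z -> dy w2 z = dx w1 z.
Hypothesis w0 : forall z, D z -> w1 z ^+ 2 + w2 z ^+ 2 != 0.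

Lemma fd_smooth f z : smooth_on D f -> D z -> fd f z (Xop f z) (Yop f z).
Proof.
move=> sf Dz; have n0 := w0 Dz; apply: pd_eq (smooth_pd sf Dz) _ _; rewrite /Xop /Yop.
  by generalize (dx f z) (dy f z) => p q; field.
by generalize (dx f z) (dy f z) => p q; field.
Qed.

Lemma fdE f z a b : D z -> fd f z a b -> Xop f z = a /\ Yop f z = b.
Proof.
move=> Dz F; have n0 := w0 Dz; rewrite /Xop /Yop (pd_dx F) (pd_dy F).
by split; field.
Qed.

Lemma smooth_N : smooth_on D (fun z => (w1 z ^+ 2 + w2 z ^+ 2)^-1).
Proof. by apply: smooth_inv => //; apply: smoothD => //; exact: smoothM. Qed.

Lemma smooth_X f : smooth_on D f -> smooth_on D (Xop f).
Proof.
move=> sf; apply: smoothM smooth_N => //; apply: smoothB => //; apply: smoothM => //.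
  exact: smooth_dx.
exact: smooth_dy.
Qed.

Lemma smooth_Y f : smooth_on D f -> smooth_on D (Yop f).
Proof.
move=> sf; apply: smoothM smooth_N => //; apply: smoothD => //; apply: smoothM => //.
  exact: smooth_dx.
exact: smooth_dy.
Qed.

(** The dual frame of a closed coframe commutes; closedness enters as the Cauchy-Riemann equations
    [cr1] and [cr2]. *)
Lemma comm_XY f z : smooth_on D f -> D z -> Yop (Xop f) z = Xop (Yop f) z.
Proof.
move=> sf Dz; have n0 := w0 Dz.
have FX := fd_smooth (smooth_X sf) Dz; have FY := fd_smooth (smooth_Y sf) Dz.
have p1 := smooth_pd s1 Dz; have p2 := smooth_pd s2 Dz.
have nx : \forall v \near z, Xop f v * w1 v + Yop f v * w2 v = dx f v.
  by apply: filterS (open_near oD Dz) => v Dv; have F := fd_smooth sf Dv; rewrite (pd_dx F).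
have ny : \forall v \near z, - Xop f v * w2 v + Yop f v * w1 v = dy f v.
  by apply: filterS (open_near oD Dz) => v Dv; have F := fd_smooth sf Dv; rewrite (pd_dy F).
have [_ e1] := pd_uniq (pd_near nx (pdD (pdM FX p1) (pdM FY p2))) (smooth_pd (smooth_dx sf) Dz).
have [e2 _] := pd_uniq (pd_near ny (pdD (pdM (pdN FX) p2) (pdM FY p1))) (smooth_pd (smooth_dy sf) Dz).
have S := schwarz oD sf Dz; rewrite (cr1 Dz) (cr2 Dz) in e1.
move: e1 e2 S n0; generalize (dy (dx f) z) (dx (dy f) z) (dx w1 z) (dx w2 z) (Xop f z) (Yop f z).
generalize (Xop (Xop f) z) (Yop (Xop f) z) (Xop (Yop f) z) (Yop (Yop f) z) (w1 z) (w2 z).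
move=> xx yx xy yy u v fxy fyx u' v' x y e1 e2 S n0; apply: (mulIf n0).
by move: e1 e2; rewrite S => <-; lra.
Qed.

End Frame.

(** * Expansion in an orthogonal basis of the ambient space *)

Section Sform.
Context {R : realType}.
Implicit Types (c : R) (u v : 'rV[R]_4).

Lemma sformC c u v : sform c u v = sform c v u.
Proof. by apply: eq_bigr => k _; rewrite (mulrC (u 0 k)). Qed.

Lemma sformDl c u u' v : sform c (u + u') v = sform c u v + sform c u' v.
Proof. by rewrite -big_split; apply: eq_bigr => k _ /=; rewrite mxE mulrDl mulrDr. Qed.

Lemma sformZl c (a : R) u v : sform c (a *: u) v = a * sform c u v.
Proof. by rewrite /sform mulr_sumr; apply: eq_bigr => k _; rewrite mxE; ring. Qed.

Lemma sformDr c u v v' : sform c u (v + v') = sform c u v + sform c u v'.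
Proof. by rewrite sformC sformDl !(sformC c _ u). Qed.

Lemma sformZr c (a : R) u v : sform c u (a *: v) = a * sform c u v.
Proof. by rewrite sformC sformZl sformC. Qed.

Lemma sform0l c v : sform c 0 v = 0.
Proof. by rewrite -(scale0r 0) sformZl mul0r. Qed.

Definition sgn4 c (k : 'I_4) : R := if (k == ord_max) && (c < 0) then -1 else 1.

Lemma sgn4K c k : sgn4 c k * sgn4 c k = 1.
Proof. by rewrite /sgn4; case: ifP => _; rewrite ?mulrNN mulr1. Qed.

Lemma sform_expand c (b : 'I_4 -> 'rV[R]_4) (g : 'I_4 -> R) u v :
  (forall i, g i != 0) -> (forall i j, sform c (b i) (b j) = if i == j then g i else 0) ->
  sform c u v = \sum_i sform c u (b i) * sform c v (b i) / g i.
Proof.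
move=> g0 H; pose E : 'M[R]_4 := \matrix_(i, j) b i 0 j.
pose G : 'M[R]_4 := \matrix_(i, j) (sgn4 c i * b j 0 i / g j).
have EG : E *m G = 1%:M.
  apply/matrixP => i j; rewrite !mxE.
  have -> : \sum_k E i k * G k j = sform c (b i) (b j) / g j.
    by rewrite /sform mulr_suml; apply: eq_bigr => k _; rewrite !mxE -/(sgn4 c k); ring.
  by rewrite H; have [->|_] := eqVneq i j; rewrite ?mul0r // mulfV.
(* A right inverse of a square matrix is a left inverse: orthogonality of the rows becomes the
   completeness relation [ES]. *)
have GE := mulmx1C EG.
have ES k l : \sum_i b i 0 k * b i 0 l / g i = if k == l then sgn4 c k else 0.
  have /matrixP /(_ k l) := GE; rewrite !mxE => e.
  have {}e : \sum_i sgn4 c k * (b i 0 k * b i 0 l / g i) = (k == l)%:R.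
    by rewrite -e; apply: eq_bigr => i _; rewrite !mxE; ring.
  rewrite -mulr_sumr in e; rewrite -[LHS]mul1r -(sgn4K c k) -mulrA e.
  by case: eqP; rewrite ?mulr1 ?mulr0.
have -> : \sum_i sform c u (b i) * sform c v (b i) / g i =
    \sum_k \sum_l sgn4 c k * u 0 k * (sgn4 c l * v 0 l) * (\sum_i b i 0 k * b i 0 l / g i).
  under [RHS]eq_bigr => k _ do (under eq_bigr => l _ do rewrite mulr_sumr; rewrite exchange_big /=).
  rewrite exchange_big /=; apply: eq_bigr => i _.
  rewrite /sform !mulr_suml; apply: eq_bigr => k _; rewrite mulrAC mulr_sumr; apply: eq_bigr => l _.
  by rewrite -/(sgn4 c k) -/(sgn4 c l); ring.
rewrite /sform; apply: eq_bigr => k _; rewrite (bigD1 k) //= [X in _ = _ + X]big1 ?addr0 => [|l lk].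
  by rewrite ES eqxx -/(sgn4 c k); rewrite -[LHS]mul1r -(sgn4K c k); ring.
by rewrite ES eq_sym (negPf lk) mulr0.
Qed.

(* The last coordinates matter only for [c = 0], where the ambient space is the
   hyperplane of vanishing last coordinate and [F] is not orthogonal to it. *)
Lemma parseval c (F e1 e2 nu u v : 'rV[R]_4) (lam : R) : lam != 0 ->
  (c != 0 -> sform c F F = c^-1) -> c * sform c e1 F = 0 -> c * sform c e2 F = 0 ->
  c * sform c nu F = 0 -> sform c e1 e1 = lam -> sform c e2 e2 = lam -> sform c e1 e2 = 0 ->
  sform c nu nu = 1 -> sform c nu e1 = 0 -> sform c nu e2 = 0 ->
  (c = 0 -> [/\ e1 0 ord_max = 0, e2 0 ord_max = 0, nu 0 ord_max = 0 & u 0 ord_max = 0]) ->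
  sform c u v = c * sform c u F * sform c v F +
    (sform c u e1 * sform c v e1 + sform c u e2 * sform c v e2) / lam + sform c u nu * sform c v nu.
Proof.
move=> l0 FF F1 F2 Fn e11 e22 e12 nn n1 n2 flat.
pose f0 := if c == 0 then \row_k (k == ord_max)%:R else F.
pose g0 := if c == 0 then 1 else c^-1.
have last x : c = 0 -> sform c x (\row_k (k == ord_max)%:R) = x 0 ord_max.
  move=> ->; rewrite /sform (bigD1 ord_max) //= big1 ?addr0 => [|k km].
    by rewrite mxE !eqxx ltxx mul1r mulr1.
  by rewrite mxE (negPf km) !mulr0.
have orth x : c * sform c x F = 0 -> (c = 0 -> x 0 ord_max = 0) -> sform c x f0 = 0.
  move=> h1 h2; rewrite /f0; case: eqP => c0; first by rewrite last // h2.
  by move/eqP: h1; rewrite mulf_eq0 => /orP[/eqP|/eqP].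
have o1 : sform c e1 f0 = 0 by apply: orth => // /flat [].
have o2 : sform c e2 f0 = 0 by apply: orth => // /flat [].
have on : sform c nu f0 = 0 by apply: orth => // /flat [].
have ff : sform c f0 f0 = g0.
  rewrite /f0 /g0; case: eqP => c0; first by rewrite last // mxE eqxx.
  by rewrite FF //; apply/eqP.
pose b (i : 'I_4) := nth f0 [:: f0; e1; e2; nu] i.
pose g (i : 'I_4) := nth g0 [:: g0; lam; lam; 1] i.
have gn i : g i != 0.
  case: i => [[|[|[|[|//]]]] hi]; rewrite /g //= ?oner_neq0 // /g0.
  by case: ifP; rewrite ?oner_neq0 // => /negbT c0; rewrite invr_neq0.
have H i j : sform c (b i) (b j) = if i == j then g i else 0.
  by case: i => [[|[|[|[|//]]]] hi]; case: j => [[|[|[|[|//]]]] hj] //=; rewrite sformC.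
rewrite (sform_expand u v gn H) !big_ord_recl big_ord0 /= /b /g /= addr0.
have -> : sform c u f0 * sform c v f0 / g0 = c * sform c u F * sform c v F.
  rewrite /f0 /g0; case: eqP => c0; last by rewrite invrK; ring.
  by rewrite last // (_ : u 0 ord_max = 0) ?c0 ?mul0r //; have [] := flat c0.
by rewrite divr1 mulrDl !addrA.
Qed.

End Sform.

Section VectorFrame.
Context {R : realType}.
Variables (w1 w2 : cplx R -> R).
Implicit Types (f g : cplx R -> 'rV[R]_4) (z : cplx R).
Local Notation fd := (fd w1 w2).

Definition vfd f z (U V : 'rV[R]_4) := forall i, fd (fun w => f w 0 i) z (U 0 i) (V 0 i).

Lemma fd_sform c f g z U V U' V' : vfd f z U V -> vfd g z U' V' ->
  fd (fun w => sform c (f w) (g w)) z (sform c U (g z) + sform c (f z) U')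
    (sform c V (g z) + sform c (f z) V').
Proof.
move=> hf hg; rewrite /sform -!big_split /=; apply: fd_sum => i.
have := fdM (fd_cst w1 w2 (sgn4 c i) z) (fdM (hf i) (hg i)); rewrite -/(sgn4 c i) => H.
by apply: fd_eq H _ _; ring.
Qed.

Lemma vfd_dx f z U V : vfd f z U V ->
  vdx f z = w1 z *: U + w2 z *: V /\ vdy f z = (- w2 z) *: U + w1 z *: V.
Proof.
move=> H; split; apply/rowP => i; rewrite !mxE.
  by rewrite (pd_dx (H i)); ring.
by rewrite (pd_dy (H i)); ring.
Qed.

Variable D : set (cplx R).
Hypothesis oD : open D.

(** The derivatives of [w1] and [w2] multiply tangent vectors only and disappear in the pairing with
    [nu]. What is left is the change of frame of a symmetric form. *)
Lemma second_form c (f e1 e2 : cplx R -> 'rV[R]_4) z (A B C nu : 'rV[R]_4) (p1 q1 p2 q2 : R) : D z ->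
  (forall v, D v -> vfd f v (e1 v) (e2 v)) -> vfd e1 z A B -> vfd e2 z B C ->
  pd w1 z p1 q1 -> pd w2 z p2 q2 -> sform c (e1 z) nu = 0 -> sform c (e2 z) nu = 0 ->
  let a11 := sform c A nu in let a12 := sform c B nu in let a22 := sform c C nu in
  [/\ sform c (vdx (vdx f) z) nu = w1 z ^+ 2 * a11 + 2 * w1 z * w2 z * a12 + w2 z ^+ 2 * a22,
      sform c (vdy (vdx f) z) nu = - w1 z * w2 z * a11 + (w1 z ^+ 2 - w2 z ^+ 2) * a12 + w1 z * w2 z * a22 &
      sform c (vdy (vdy f) z) nu = w2 z ^+ 2 * a11 - 2 * w1 z * w2 z * a12 + w1 z ^+ 2 * a22].
Proof.
move=> Dz hf h1 h2 hw1 hw2 n1 n2 a11 a12 a22.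
have nx : \forall v \near z, w1 v *: e1 v + w2 v *: e2 v = vdx f v.
  by apply: filterS (open_near oD Dz) => v Dv; rewrite (vfd_dx (hf v Dv)).1.
have ny : \forall v \near z, (- w2 v) *: e1 v + w1 v *: e2 v = vdy f v.
  by apply: filterS (open_near oD Dz) => v Dv; rewrite (vfd_dx (hf v Dv)).2.
have px i : pd (fun v => vdx f v 0 i) z
   (p1 * e1 z 0 i + w1 z * (A 0 i * w1 z + B 0 i * w2 z) + (p2 * e2 z 0 i + w2 z * (B 0 i * w1 z + C 0 i * w2 z)))
   (q1 * e1 z 0 i + w1 z * (- A 0 i * w2 z + B 0 i * w1 z) + (q2 * e2 z 0 i + w2 z * (- B 0 i * w2 z + C 0 i * w1 z))).
  have N : \forall v \near z, w1 v * e1 v 0 i + w2 v * e2 v 0 i = vdx f v 0 i.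
    by apply: filterS nx => v <-; rewrite !mxE.
  exact: pd_near N (pdD (pdM hw1 (h1 i)) (pdM hw2 (h2 i))).
have py i : pd (fun v => vdy f v 0 i) z
   (- p2 * e1 z 0 i + - w2 z * (A 0 i * w1 z + B 0 i * w2 z) + (p1 * e2 z 0 i + w1 z * (B 0 i * w1 z + C 0 i * w2 z)))
   (- q2 * e1 z 0 i + - w2 z * (- A 0 i * w2 z + B 0 i * w1 z) + (q1 * e2 z 0 i + w1 z * (- B 0 i * w2 z + C 0 i * w1 z))).
  have N : \forall v \near z, - w2 v * e1 v 0 i + w1 v * e2 v 0 i = vdy f v 0 i.
    by apply: filterS ny => v <-; rewrite !mxE.
  exact: pd_near N (pdD (pdM (pdN hw2) (h1 i)) (pdM hw1 (h2 i))).
have exx : vdx (vdx f) z = p1 *: e1 z + p2 *: e2 z + (w1 z ^+ 2 *: A + (2 * w1 z * w2 z) *: B + w2 z ^+ 2 *: C).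
  by apply/rowP => i; rewrite !mxE (pd_dx (px i)); ring.
have exy : vdy (vdx f) z = q1 *: e1 z + q2 *: e2 z + ((- w1 z * w2 z) *: A + (w1 z ^+ 2 - w2 z ^+ 2) *: B + (w1 z * w2 z) *: C).
  by apply/rowP => i; rewrite !mxE (pd_dy (px i)); ring.
have eyy : vdy (vdy f) z = (- q2) *: e1 z + q1 *: e2 z + (w2 z ^+ 2 *: A + (- 2 * w1 z * w2 z) *: B + w1 z ^+ 2 *: C).
  by apply/rowP => i; rewrite !mxE (pd_dy (py i)); ring.
by rewrite exx exy eyy !(sformDl, sformZl) n1 n2 /a11 /a12 /a22; split; ring.
Qed.

Hypothesis s1 : smooth_on D w1.
Hypothesis s2 : smooth_on D w2.
Hypothesis cr1 : forall z, D z -> dy w1 z = - dx w2 z.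
Hypothesis cr2 : forall z, D z -> dy w2 z = dx w1 z.
Hypothesis w0 : forall z, D z -> w1 z ^+ 2 + w2 z ^+ 2 != 0.

Definition vsm f := forall i, smooth_on D (fun z => f z 0 i).
Definition VX f z : 'rV[R]_4 := \row_i Xop w1 w2 (fun v => f v 0 i) z.
Definition VY f z : 'rV[R]_4 := \row_i Yop w1 w2 (fun v => f v 0 i) z.

Lemma vsm_X f : vsm f -> vsm (VX f).
Proof.
move=> sf i; rewrite (_ : (fun z => VX f z 0 i) = Xop w1 w2 (fun v => f v 0 i)); first exact: smooth_X.
by apply/funext => z; rewrite mxE.
Qed.

Lemma vsm_Y f : vsm f -> vsm (VY f).
Proof.
move=> sf i; rewrite (_ : (fun z => VY f z 0 i) = Yop w1 w2 (fun v => f v 0 i)); first exact: smooth_Y.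
by apply/funext => z; rewrite mxE.
Qed.

Lemma vfd_smooth f z : vsm f -> D z -> vfd f z (VX f z) (VY f z).
Proof. by move=> sf Dz i; rewrite !mxE; exact: (fd_smooth w0 (sf i) Dz). Qed.

Lemma comm_VXY f z : vsm f -> D z -> VY (VX f) z = VX (VY f) z.
Proof.
move=> sf Dz; apply/rowP => i; rewrite !mxE.
have -> : (fun v => VX f v 0 i) = Xop w1 w2 (fun v => f v 0 i) by apply/funext => v; rewrite mxE.
have -> : (fun v => VY f v 0 i) = Yop w1 w2 (fun v => f v 0 i) by apply/funext => v; rewrite mxE.
exact: (comm_XY oD s1 s2 cr1 cr2 w0 (sf i) Dz).
Qed.

Lemma smooth_sform c f g : vsm f -> vsm g -> smooth_on D (fun z => sform c (f z) (g z)).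
Proof.
move=> sf sg; rewrite /sform.
elim: (index_enum _) => [|i s IH].
  rewrite (_ : (fun z => _) = fun=> 0); first exact: smooth_cst.
  by apply/funext => z; rewrite big_nil.
rewrite (_ : (fun z => _) = fun z => sgn4 c i * (f z 0 i * g z 0 i) +
    \sum_(j <- s) sgn4 c j * (f z 0 j * g z 0 j)); last first.
  by apply/funext => z; rewrite big_cons.
apply: smoothD => //; apply: smoothM => //; first exact: smooth_cst.
exact: smoothM (sf i) (sg i).
Qed.

End VectorFrame.

Lemma codazzi_algebra (R : realType) (y11 y22 x12 x11 x22 y12 f g q q' h xh yh : R) :
  f + g = h * (8 * q) -> yh = 0 ->
  xh * (8 * q) + h * (0 * q + 8 * (q' * (2 * q))) = x11 + x22 ->
  yh * (8 * q) + h * (0 * q + 8 * (q' * 0)) = y11 + y22 ->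
  y11 = x12 -> y12 - x22 = - q' * (f + g) ->
  (y11 - y22) * 2^-1 + (f - g) * 0 + - x12 = 0 /\
  (x11 - x22) * 2^-1 + (f - g) * 0 - - y12 = 4 * q * xh.
Proof. by move=> e1 -> e2 e3 e4; rewrite e1 => e5; split; lra. Qed.

(** * Structure equations of the immersion *)

Section GaussCodazzi.
Context {R : realType}.
Variables (K1 K2 c : R) (z0 : cplx R) (r : R) (k w1 w2 : cplx R -> R).
Hypothesis rg : regular (pcubic K1 K2) z0 r k w1 w2.
Variables (f nu : cplx R -> 'rV[R]_4).
Local Notation D := (box z0 r).
Local Notation p := (pcubic K1 K2).
Local Notation X := (Xop w1 w2).
Local Notation Y := (Yop w1 w2).
Hypothesis sf : vsm D f.
Hypothesis sn : vsm D nu.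
Hypothesis FF : forall z, D z -> c != 0 -> sform c (f z) (f z) = c^-1.
Hypothesis Fn : forall z, D z -> c * sform c (nu z) (f z) = 0.
Hypothesis flat : forall z, D z -> c = 0 -> f z 0 ord_max = 0 /\ nu z 0 ord_max = 0.

Let lam z := 4 * p (k z).
Hypothesis e11 : forall z, D z -> sform c (VX w1 w2 f z) (VX w1 w2 f z) = lam z.
Hypothesis e22 : forall z, D z -> sform c (VY w1 w2 f z) (VY w1 w2 f z) = lam z.
Hypothesis e12 : forall z, D z -> sform c (VX w1 w2 f z) (VY w1 w2 f z) = 0.
Hypothesis n1 : forall z, D z -> sform c (nu z) (VX w1 w2 f z) = 0.
Hypothesis n2 : forall z, D z -> sform c (nu z) (VY w1 w2 f z) = 0.
Hypothesis nn : forall z, D z -> sform c (nu z) (nu z) = 1.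

Let p' (t : R) := - t ^+ 2 + (K1 ^+ 2 + K1 * K2 + K2 ^+ 2) / 3.
Let e1 := VX w1 w2 f.
Let e2 := VY w1 w2 f.
Let oD : open D := @box_open R z0 r.

Definition form11 z := sform c (VX w1 w2 e1 z) (nu z).
Definition form12 z := sform c (VY w1 w2 e1 z) (nu z).
Definition form22 z := sform c (VY w1 w2 e2 z) (nu z).

Let w0 := rg_w0 rg.
Let s1 := rg_w1 rg.
Let s2 := rg_w2 rg.

Let fdk z : D z -> fd w1 w2 k z (2 * p (k z)) 0.
Proof. by move=> Dz; apply: pd_eq (rg_pd rg Dz) _ _; ring. Qed.

Let fd_lam z : D z -> fd w1 w2 lam z (8 * p (k z) * p' (k z)) 0.
Proof.
move=> Dz; have := fdM (fd_cst w1 w2 4 z) (fd_comp (isd_pcubic K1 K2 (k z)) (fdk Dz)).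
by move=> H; apply: fd_eq H _ _; rewrite /p'; ring.
Qed.

Let se1 : vsm D e1. Proof. exact: vsm_X. Qed.

Let se2 : vsm D e2. Proof. exact: vsm_Y. Qed.

Let vf z : D z -> vfd w1 w2 f z (e1 z) (e2 z). Proof. exact: (vfd_smooth w0). Qed.

Let ve1 z : D z -> vfd w1 w2 e1 z (VX w1 w2 e1 z) (VY w1 w2 e1 z). Proof. exact: (vfd_smooth w0). Qed.

Let ve2 z : D z -> vfd w1 w2 e2 z (VY w1 w2 e1 z) (VY w1 w2 e2 z).
Proof.
by move=> Dz; rewrite (comm_VXY oD s1 s2 (rg_cr1 rg) (rg_cr2 rg) w0 sf Dz); exact: (vfd_smooth w0).
Qed.

Let vn z : D z -> vfd w1 w2 nu z (VX w1 w2 nu z) (VY w1 w2 nu z). Proof. exact: (vfd_smooth w0). Qed.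

Let near_fd (g : cplx R -> R) (h : cplx R -> R) z a b a' b' : D z -> (forall v, D v -> g v = h v) ->
  fd w1 w2 g z a b -> fd w1 w2 h z a' b' -> a = a' /\ b = b'.
Proof.
move=> Dz gh G H; apply: (fd_uniq (w0 Dz)) H; apply: fd_near G.
exact: filterS (open_near oD Dz).
Qed.

(** The orthogonality relations are differentiated, with X lam = 8 p p', Y lam = 0 and X e2 = Y e1.
    This determines the connection of the metric and the tangential part of the derivatives of
    [nu]. *)
Lemma connection z : D z ->
  [/\ [/\ sform c (VX w1 w2 e1 z) (e1 z) = 4 * p (k z) * p' (k z),
        sform c (VX w1 w2 e1 z) (e2 z) = 0,
        sform c (VY w1 w2 e1 z) (e1 z) = 0 &
        sform c (VY w1 w2 e1 z) (e2 z) = 4 * p (k z) * p' (k z)],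
      [/\ sform c (VY w1 w2 e2 z) (e1 z) = - (4 * p (k z) * p' (k z)) &
        sform c (VY w1 w2 e2 z) (e2 z) = 0] &
      [/\ sform c (VX w1 w2 nu z) (e1 z) = - form11 z, sform c (VX w1 w2 nu z) (e2 z) = - form12 z,
        sform c (VY w1 w2 nu z) (e1 z) = - form12 z & sform c (VY w1 w2 nu z) (e2 z) = - form22 z]].
Proof.
move=> Dz.
have [a1 a2] := near_fd Dz e11 (fd_sform c (ve1 Dz) (ve1 Dz)) (fd_lam Dz).
have [b1 b2] := near_fd Dz e22 (fd_sform c (ve2 Dz) (ve2 Dz)) (fd_lam Dz).
have [c1 c2] := near_fd Dz e12 (fd_sform c (ve1 Dz) (ve2 Dz)) (fd_cst w1 w2 0 z).
have [d1 d2] := near_fd Dz n1 (fd_sform c (vn Dz) (ve1 Dz)) (fd_cst w1 w2 0 z).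
have [f1 f2] := near_fd Dz n2 (fd_sform c (vn Dz) (ve2 Dz)) (fd_cst w1 w2 0 z).
rewrite /form11 /form12 /form22.
rewrite !(sformC c (nu z)) in d1 d2 f1 f2.
rewrite (sformC c (e1 z)) in a1; rewrite (sformC c (e1 z)) in a2.
rewrite (sformC c (e2 z)) in b1; rewrite (sformC c (e2 z)) in b2.
rewrite !(sformC c (e1 z)) in c1 c2.
move: a1 a2 b1 b2 c1 c2 d1 d2 f1 f2.
generalize (sform c (VX w1 w2 e1 z) (e1 z)) (sform c (VX w1 w2 e1 z) (e2 z)) (sform c (VY w1 w2 e1 z) (e1 z))
  (sform c (VY w1 w2 e1 z) (e2 z)) (sform c (VY w1 w2 e2 z) (e1 z)) (sform c (VY w1 w2 e2 z) (e2 z)).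
generalize (sform c (VX w1 w2 nu z) (e1 z)) (sform c (VX w1 w2 nu z) (e2 z)) (sform c (VY w1 w2 nu z) (e1 z))
  (sform c (VY w1 w2 nu z) (e2 z)) (sform c (VX w1 w2 e1 z) (nu z)) (sform c (VY w1 w2 e1 z) (nu z)) (sform c (VY w1 w2 e2 z) (nu z)).
move: (p (k z)) (p' (k z)) => q q'.
move=> x1 x2 x3 x4 x5 x6 x7 y1 y2 y3 y4 y5 y6 a1 a2 b1 b2 c1 c2 d1 d2 f1 f2.
by split; split; lra.
Qed.

Let flatX (g : cplx R -> 'rV[R]_4) z : (forall v, D v -> g v 0 ord_max = 0) -> D z ->
  VX w1 w2 g z 0 ord_max = 0 /\ VY w1 w2 g z 0 ord_max = 0.
Proof.
move=> g0 Dz; rewrite !mxE; apply: (fdE w0 Dz); apply: fd_near (fd_cst w1 w2 0 z).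
by apply: filterS (open_near oD Dz) => v Dv; rewrite g0.
Qed.

Let flat12 z : D z -> c = 0 -> e1 z 0 ord_max = 0 /\ e2 z 0 ord_max = 0.
Proof. by move=> Dz c0; apply: flatX => // v Dv; have [] := flat Dv c0. Qed.

Let radial z : D z -> c * sform c (e1 z) (f z) = 0 /\ c * sform c (e2 z) (f z) = 0.
Proof.
move=> Dz; have [c0|c0] := eqVneq c 0; first by rewrite c0 !mul0r.
have [a1 a2] := near_fd Dz (fun v Dv => FF Dv c0) (fd_sform c (vf Dz) (vf Dz)) (fd_cst w1 w2 c^-1 z).
rewrite (sformC c (f z)) in a1; rewrite (sformC c (f z)) in a2.
by rewrite (_ : sform c (e1 z) (f z) = 0) 1?(_ : sform c (e2 z) (f z) = 0) ?mulr0 //; lra.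
Qed.

Let radial2 z : D z ->
  [/\ c * sform c (VX w1 w2 e1 z) (f z) = - c * lam z, c * sform c (VY w1 w2 e1 z) (f z) = 0,
      c * sform c (VY w1 w2 e2 z) (f z) = - c * lam z,
      c * sform c (VX w1 w2 nu z) (f z) = 0 & c * sform c (VY w1 w2 nu z) (f z) = 0].
Proof.
move=> Dz.
have [a1 a2] := near_fd Dz (fun v Dv => (radial Dv).1)
  (fdM (fd_cst w1 w2 c z) (fd_sform c (ve1 Dz) (vf Dz))) (fd_cst w1 w2 0 z).
have [b1 b2] := near_fd Dz (fun v Dv => (radial Dv).2)
  (fdM (fd_cst w1 w2 c z) (fd_sform c (ve2 Dz) (vf Dz))) (fd_cst w1 w2 0 z).
have [d1 d2] := near_fd Dz Fn
  (fdM (fd_cst w1 w2 c z) (fd_sform c (vn Dz) (vf Dz))) (fd_cst w1 w2 0 z).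
rewrite e11 // in a1; rewrite e12 // in a2; rewrite e22 // in b2; rewrite n1 // in d1; rewrite n2 // in d2.
move: a1 a2 b2 d1 d2; rewrite !mul0r !add0r !addr0 => a1 a2 b2 d1 d2.
have N (u v : R) : c * (u + v) = 0 -> c * u = - c * v.
  by move=> e; apply/eqP; rewrite mulNr -addr_eq0 -mulrDr; apply/eqP.
split; [exact (N _ _ a1)|exact a2|exact (N _ _ b2)|exact d1|exact d2].
Qed.

Let normal z : D z -> sform c (VX w1 w2 nu z) (nu z) = 0 /\ sform c (VY w1 w2 nu z) (nu z) = 0.
Proof.
move=> Dz; have [a1 a2] := near_fd Dz nn (fd_sform c (vn Dz) (vn Dz)) (fd_cst w1 w2 1 z).
by rewrite (sformC c (nu z)) in a1; rewrite (sformC c (nu z)) in a2; split; lra.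
Qed.

Let lam0 z : D z -> lam z != 0.
Proof. by move=> Dz; rewrite mulf_neq0 // gt_eqF // (rg_pos rg Dz). Qed.

Let pars z (u v : 'rV[R]_4) : D z -> (c = 0 -> u 0 ord_max = 0) ->
  sform c u v = c * sform c u (f z) * sform c v (f z) +
    (sform c u (e1 z) * sform c v (e1 z) + sform c u (e2 z) * sform c v (e2 z)) / lam z +
    sform c u (nu z) * sform c v (nu z).
Proof.
move=> Dz u0; have [r1 r2] := radial Dz.
apply: parseval => //; try by [exact: lam0|exact: FF|exact: Fn|exact: e11|exact: e22|exact: e12|exact: nn|exact: n1|exact: n2].
by move=> c0; have [f1 f2] := flat12 Dz c0; have [_ f3] := flat Dz c0; split=> //; exact: u0.
Qed.

Let flat2 z : D z -> c = 0 -> [/\ VX w1 w2 e1 z 0 ord_max = 0, VY w1 w2 e1 z 0 ord_max = 0 & VY w1 w2 e2 z 0 ord_max = 0].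
Proof.
move=> Dz c0; have [a1 a2] := flatX (fun v Dv => (flat12 Dv c0).1) Dz.
by have [b1 b2] := flatX (fun v Dv => (flat12 Dv c0).2) Dz.
Qed.

Let E21 z : D z -> VX w1 w2 e2 z = VY w1 w2 e1 z.
Proof. move=> Dz; apply/esym; exact: (comm_VXY oD s1 s2 (rg_cr1 rg) (rg_cr2 rg) w0 sf Dz). Qed.

(** The third derivatives of the immersion on both sides agree because X and Y commute. The
    remaining pairings of second derivatives with X nu and Y nu are expanded in the frame by
    [pars]. *)
Lemma codazzi z : D z -> Y form11 z = X form12 z /\
  Y form12 z - X form22 z = - p' (k z) * (form11 z + form22 z).
Proof.
move=> Dz.
have v11 := vfd_smooth w0 (vsm_X oD s1 s2 w0 se1) Dz.
have v12 := vfd_smooth w0 (vsm_Y oD s1 s2 w0 se1) Dz.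
have v21 := vfd_smooth w0 (vsm_X oD s1 s2 w0 se2) Dz.
have v22 := vfd_smooth w0 (vsm_Y oD s1 s2 w0 se2) Dz.
have C1 := comm_VXY oD s1 s2 (rg_cr1 rg) (rg_cr2 rg) w0 se1 Dz.
have C2 := comm_VXY oD s1 s2 (rg_cr1 rg) (rg_cr2 rg) w0 se2 Dz.
have [_ y11] := fdE w0 Dz (fd_sform c v11 (vn Dz)).
have [x12 _] := fdE w0 Dz (fd_sform c v12 (vn Dz)).
have [x22 _] := fdE w0 Dz (fd_sform c v22 (vn Dz)).
have N12 : \forall v \near z, sform c (VX w1 w2 e2 v) (nu v) = form12 v.
  by apply: filterS (open_near oD Dz) => v Dv; rewrite /form12 (E21 Dv).
have [_ y12] := fdE w0 Dz (fd_near N12 (fd_sform c v21 (vn Dz))).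
rewrite [Y form11 z]y11 [X form12 z]x12 y12 [X form22 z]x22 C1 C2 (E21 Dz).
have [[g1 g2 g3 g4] [g5 g6] [g7 g8 g9 g10]] := connection Dz.
have [r1 r2 r3 r4 r5] := radial2 Dz; have [m1 m2] := normal Dz.
have l0 := lam0 Dz; have q0 : p (k z) != 0 by rewrite gt_eqF // (rg_pos rg Dz).
have h1 := @pars z (VX w1 w2 e1 z) (VY w1 w2 nu z) Dz (fun c0 => let: And3 a _ _ := flat2 Dz c0 in a).
have h2 := @pars z (VY w1 w2 e1 z) (VX w1 w2 nu z) Dz (fun c0 => let: And3 _ a _ := flat2 Dz c0 in a).
have h3 := @pars z (VY w1 w2 e1 z) (VY w1 w2 nu z) Dz (fun c0 => let: And3 _ a _ := flat2 Dz c0 in a).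
have h4 := @pars z (VY w1 w2 e2 z) (VX w1 w2 nu z) Dz (fun c0 => let: And3 _ _ a := flat2 Dz c0 in a).
rewrite g1 g2 g9 g10 m2 mulrAC r5 in h1; rewrite g3 g4 g7 g8 m1 mulrAC r4 in h2.
rewrite g3 g4 g9 g10 m2 mulrAC r5 in h3; rewrite g5 g6 g7 g8 m1 mulrAC r4 in h4.
by rewrite h1 h2 h3 h4 /lam; split; field.
Qed.

(** The derivative of (X e1, e2) along Y and that of (Y e1, e2) along X contain the same third
    derivative, which cancels. The term [k] arises from p'' = - 2 k: it is the curvature of 4 p
    |omega|^2. *)
Lemma gauss z : D z -> form11 z * form22 z - form12 z ^+ 2 = 16 * p (k z) ^+ 2 * (k z - c).
Proof.
move=> Dz.
have v11 := vfd_smooth w0 (vsm_X oD s1 s2 w0 se1) Dz.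
have v12 := vfd_smooth w0 (vsm_Y oD s1 s2 w0 se1) Dz.
have C1 := comm_VXY oD s1 s2 (rg_cr1 rg) (rg_cr2 rg) w0 se1 Dz.
have gg v : D v -> sform c (VX w1 w2 e1 v) (e2 v) = 0 by move=> /connection [[]].
have gh v : D v -> sform c (VY w1 w2 e1 v) (e2 v) = 4 * p (k v) * p' (k v) by move=> /connection [[]].
have [_ y] := near_fd Dz gg (fd_sform c v11 (ve2 Dz)) (fd_cst w1 w2 0 z).
have hp' : is_derive (k z) 1 p' (- 2 * k z) by rewrite /p'; isd_auto; ring.
have hp := isd_pcubic K1 K2 (k z); rewrite -/(p' (k z)) in hp.
have dk := fdM (fdM (fd_cst w1 w2 4 z) (fd_comp hp (fdk Dz))) (fd_comp hp' (fdk Dz)).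
have [x _] := near_fd Dz gh (fd_sform c v12 (ve2 Dz)) dk.
rewrite -C1 in x.
have [[g1 g2 g3 g4] [g5 g6] _] := connection Dz.
have [r1 r2 r3 r4 r5] := radial2 Dz.
have h1 := @pars z (VX w1 w2 e1 z) (VY w1 w2 e2 z) Dz (fun c0 => let: And3 a _ _ := flat2 Dz c0 in a).
have h2 := @pars z (VY w1 w2 e1 z) (VY w1 w2 e1 z) Dz (fun c0 => let: And3 _ a _ := flat2 Dz c0 in a).
have q0 : p (k z) != 0 by rewrite gt_eqF // (rg_pos rg Dz).
rewrite g1 g2 g5 g6 -/(form11 z) -/(form22 z) in h1; rewrite g3 g4 r2 -/(form12 z) in h2.
have rr : c * sform c (VX w1 w2 e1 z) (f z) * sform c (VY w1 w2 e2 z) (f z) = c * lam z ^+ 2.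
  have e (t : R) : - c * lam z * t = - lam z * (c * t) by ring.
  by rewrite r1 e r3; ring.
rewrite {}rr in h1; move: x y h1 h2; rewrite /lam.
generalize (sform c (VX w1 w2 e1 z) (VY w1 w2 e2 z)) (sform c (VY w1 w2 e1 z) (VY w1 w2 e1 z)).
generalize (sform c (VY w1 w2 (VX w1 w2 e1) z) (e2 z)) (form11 z) (form12 z) (form22 z).
move: (p (k z)) q0 (p' (k z)) => q q0 q' y1 f11 f12 f22 u v x y h1 h2.
have hv : v = 4 * q * q' ^+ 2 + f12 ^+ 2 by rewrite h2; field.
have hu : u = 16 * c * q ^+ 2 - 4 * q * q' ^+ 2 + f11 * f22 by rewrite h1; field.
by rewrite hv in x; rewrite hu in y; lra.
Qed.

Lemma frame_system (H : cplx R -> R) :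
  (forall z, D z -> H z = (form11 z + form22 z) / (8 * p (k z))) ->
  (forall z, D z -> dx k z * dy H z - dy k z * dx H z = 0) ->
  (forall z, D z -> form11 z = form22 z -> form12 z <> 0) ->
  exists a b, [/\ smooth_on D a, smooth_on D b, smooth_on D H & forall z, D z ->
    [/\ Y H z = 0, Y a z + X b z = 0, X a z - Y b z = 4 * p (k z) * X H z,
      a z ^+ 2 + b z ^+ 2 = 16 * p (k z) ^+ 2 * (H z ^+ 2 - k z + c) & a z ^+ 2 + b z ^+ 2 != 0]].
Proof.
move=> HE hW hU; have q0 z : D z -> p (k z) != 0 by move=> Dz; rewrite gt_eqF // (rg_pos rg Dz).
have sm11 : smooth_on D form11 by apply: smooth_sform => //; exact: vsm_X.
have sm12 : smooth_on D form12 by apply: smooth_sform => //; exact: vsm_Y.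
have sm22 : smooth_on D form22 by apply: smooth_sform => //; exact: vsm_Y.
have sk := rg_k rg.
have sc (t : R) : smooth_on D (fun=> t) by exact: smooth_cst.
have sp : smooth_on D (fun z => 8 * p (k z)).
  have : smooth_on D (fun z => 8 * (- 3^-1 * (k z - K1) * (k z - K2) * (k z + K1 + K2))).
    apply: smoothM => //; apply: smoothM => //; first apply: smoothM => //; first apply: smoothM => //; first exact: smoothB.
      exact: smoothB.
    by apply: smoothD => //; exact: smoothD.
  exact.
have sH : smooth_on D H.
  apply: (smooth_ext oD (f := fun z => (form11 z + form22 z) * (8 * p (k z))^-1)); first by move=> z /HE.
  apply: smoothM => //; first exact: smoothD.
  by apply: smooth_inv => // z Dz; rewrite mulf_neq0 // q0.
exists (fun z => (form11 z - form22 z) * 2^-1), (fun z => - form12 z).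
have sa : smooth_on D (fun z => (form11 z - form22 z) * 2^-1) by apply: smoothM => //; exact: smoothB.
split=> //; first exact: smoothN.
move=> z Dz; have f11 := fd_smooth w0 sm11 Dz; have f12 := fd_smooth w0 sm12 Dz.
have f22 := fd_smooth w0 sm22 Dz; have fH := fd_smooth w0 sH Dz.
have [c1 c2] := codazzi Dz; have g := gauss Dz.
have [xa ya] := fdE w0 Dz (fdM (fdB f11 f22) (fd_cst w1 w2 2^-1 z)).
have [xb yb] := fdE w0 Dz (fdN f12).
(* In the dual coframe dK has only the component 2 p of Re omega, so dK and dH are parallel exactly
   when Y H = 0. *)
have YH : Y H z = 0.
  have := hW z Dz; rewrite (pd_dx (fdk Dz)) (pd_dy (fdk Dz)) (pd_dx fH) (pd_dy fH).
  have := w0 Dz; have := q0 z Dz; move: (p (k z)) (w1 z) (w2 z) (X H z) (Y H z) => q u v x y q1 n0 e.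
  have : (2 * q * (u ^+ 2 + v ^+ 2)) * y = 0 by rewrite -e; ring.
  by move/eqP; rewrite !mulf_eq0 (negPf q1) (negPf n0) pnatr_eq0 /= => /eqP.
have N : \forall v \near z, H v * (8 * p (k v)) = form11 v + form22 v.
  by apply: filterS (open_near oD Dz) => v Dv; rewrite HE // mulfVK // mulf_neq0 // q0.
have hp := isd_pcubic K1 K2 (k z); rewrite -/(p' (k z)) in hp.
have fHp := fdM fH (fdM (fd_cst w1 w2 8 z) (fd_comp hp (fdk Dz))).
have [x1 x2] := fd_uniq (w0 Dz) (fd_near N fHp) (fdD f11 f22).
have hz := HE z Dz; have qz := q0 z Dz.
have {}hz : form11 z + form22 z = H z * (8 * p (k z)) by rewrite hz mulfVK // mulf_neq0.
have [r1 r2] := codazzi_algebra hz YH x1 x2 c1 c2.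
rewrite xa ya xb yb; split; [exact: YH|exact: r1|exact: r2| |].
- have e : (form11 z - form22 z) ^+ 2 / 4 + form12 z ^+ 2 =
     (form11 z + form22 z) ^+ 2 / 4 - (form11 z * form22 z - form12 z ^+ 2) by field.
  have -> : ((form11 z - form22 z) / 2) ^+ 2 + (- form12 z) ^+ 2 =
     (form11 z - form22 z) ^+ 2 / 4 + form12 z ^+ 2 by field.
  by rewrite e g hz; field.
rewrite paddr_eq0 ?sqr_ge0 // !sqrf_eq0 oppr_eq0 mulf_eq0 invr_eq0 pnatr_eq0 orbF subr_eq0.
by apply/negP => /andP[/eqP h1 /eqP h2]; exact: hU Dz h1 h2.
Qed.

End GaussCodazzi.

(** * Functions of the curvature *)

Section LevelCurves.
Context {R : realType}.
Implicit Types (z : cplx R).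

Section Abstract.
Variables (kap p q : cplx R -> R) (eta m L : R).
Hypothesis eta0 : 0 < eta.
Hypothesis m0 : 0 < m.
Hypothesis L0 : 0 <= L.
Local Notation B := (box 0 (2 * eta)).
Hypothesis dk : forall z, B z -> diff_at kap z (p z) (q z).
Hypothesis pm : forall z, B z -> m <= p z.
Hypothesis qL : forall z, B z -> `|q z| <= L.

Let bB (s t : R) : `|s| < 2 * eta -> `|t| < 2 * eta -> B (s +i* t).
Proof. by move=> hs ht; rewrite -(add0r (s +i* t : cplx R)); exact: boxP. Qed.

Let ds (s t : R) : `|s| < 2 * eta -> `|t| < 2 * eta ->
  is_derive s 1 (fun s => kap (s +i* t)) (p (s +i* t)).
Proof.
move=> hs ht; have := @diff_curve R kap id (fun=> t) s _ _ 1 0 (dk (bB hs ht)) (isd_id s) (isd_cst t s).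
by move=> H; apply: isd_eq H _; ring.
Qed.

Let dt (s t : R) : `|s| < 2 * eta -> `|t| < 2 * eta ->
  is_derive t 1 (fun t => kap (s +i* t)) (q (s +i* t)).
Proof.
move=> hs ht; have := @diff_curve R kap (fun=> s) id t _ _ 0 1 (dk (bB hs ht)) (isd_cst s t) (isd_id t).
by move=> H; apply: isd_eq H _; ring.
Qed.

Lemma level_mono (x y t : R) : `|x| < 2 * eta -> `|y| < 2 * eta -> `|t| < 2 * eta -> x < y ->
  m * (y - x) <= kap (y +i* t) - kap (x +i* t).
Proof.
move=> hx hy ht xy.
have hs s : x <= s <= y -> `|s| < 2 * eta.
  move=> /andP[s1 s2]; move: hx hy; rewrite !ltr_norml => /andP[a1 a2] /andP[b1 b2].
  by rewrite (lt_le_trans a1 s1) (le_lt_trans s2 b2).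
have D (s : R) : x <= s <= y -> is_derive s 1 (fun s => kap (s +i* t)) (p (s +i* t)).
  by move=> /hs h; exact: ds.
have [s /andP[s1 s2] E] := mvt xy D.
have hm : m <= p (s +i* t) by apply: pm; apply: bB => //; apply: hs; rewrite !ltW.
by rewrite E ler_wpM2r // subr_ge0 ltW.
Qed.

Lemma level_inj (x y t : R) : `|x| < 2 * eta -> `|y| < 2 * eta -> `|t| < 2 * eta ->
  kap (x +i* t) = kap (y +i* t) -> x = y.
Proof.
have W (u v : R) : `|u| < 2 * eta -> `|v| < 2 * eta -> `|t| < 2 * eta -> u < v ->
    kap (u +i* t) = kap (v +i* t) -> False.
  move=> hu hv ht uv E; have := level_mono hu hv ht uv; rewrite E subrr leNgt mulr_gt0 ?subr_gt0 //.
move=> hx hy ht E; have [xy|yx|//] := ltgtP x y; first by case: (W _ _ hx hy ht xy E).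
by case: (W _ _ hy hx ht yx (esym E)).
Qed.

Lemma level_dist (x y t : R) : `|x| < 2 * eta -> `|y| < 2 * eta -> `|t| < 2 * eta ->
  m * `|y - x| <= `|kap (y +i* t) - kap (x +i* t)|.
Proof.
move=> hx hy ht; have [xy|yx|->] := ltgtP x y; last by rewrite !subrr normr0 mulr0.
  rewrite (gtr0_norm (_ : 0 < y - x)) ?subr_gt0 //.
  by apply: le_trans (level_mono hx hy ht xy) _; exact: ler_norm.
rewrite distrC (gtr0_norm (_ : 0 < x - y)) ?subr_gt0 // (distrC (kap _)).
by apply: le_trans (level_mono hy hx ht yx) _; exact: ler_norm.
Qed.

Lemma level_lip (s t t' : R) : `|s| < 2 * eta -> `|t| < 2 * eta -> `|t'| < 2 * eta ->
  `|kap (s +i* t') - kap (s +i* t)| <= L * `|t' - t|.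
Proof.
move=> hs ht ht'.
have hu u : Num.min t t' <= u <= Num.max t t' -> `|u| < 2 * eta.
  by move: ht ht'; rewrite !ltr_norml; have [h|h] := leP t t'; move: (2 * eta) => d; lra.
have W (a b : R) : a < b -> (forall u : R, a <= u <= b -> `|u| < 2 * eta) ->
    `|kap (s +i* b) - kap (s +i* a)| <= L * `|b - a|.
  move=> ab H; have [u /andP[u1 u2] ->] := mvt ab (fun u hh => dt hs (H u hh)).
  rewrite normrM ler_wpM2r //; apply: qL; apply: bB => //; apply: H; rewrite !ltW //.
have [tt|tt|->] := ltgtP t t'; last by rewrite !subrr normr0 mulr0.
  by apply: W => // u hh; apply: hu; rewrite min_l ?max_r // ltW.
rewrite distrC (distrC t'); apply: W => // u hh; apply: hu; rewrite min_r ?max_l //; exact: ltW.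
Qed.

(** Moving [s] by [eta] changes [kap] by at least [m eta], while the drift in [t] and the offset of
    [K] cost at most a quarter of that each; the intermediate value theorem applies. *)
Lemma level_ex (K t : R) : `|t| < 2 * eta -> L * `|t| <= m * eta / 4 -> `|K - kap 0| < m * eta / 4 ->
  exists2 s, `|s| < eta & kap (s +i* t) = K.
Proof.
move=> ht Lt hK.
have h0 : `|0 : R| < 2 * eta by rewrite normr0 mulr_gt0.
have he : `|eta| < 2 * eta by rewrite gtr0_norm //; move: eta0; lra.
have hn : `|- eta| < 2 * eta by rewrite normrN.
have b1 := level_mono h0 he ht eta0.
have n0 : - eta < 0 by rewrite oppr_lt0.
have b2 := level_mono hn h0 ht n0.
have b3 := level_lip h0 h0 ht; rewrite !subr0 in b3 b1.
have k0 : kap (0 +i* 0) = kap 0 by [].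
have me : 0 < m * eta by rewrite mulr_gt0.
have {}b3 : `|kap (0 +i* t) - kap 0| <= m * eta / 4 by rewrite -k0; exact: le_trans b3 Lt.
rewrite sub0r opprK in b2.
have v1 : kap (- eta +i* t) < K by move: hK b3 b2 me; rewrite ltr_norml ler_norml; move: (m * eta) => x; lra.
have v2 : K < kap (eta +i* t) by move: hK b3 b1 me; rewrite ltr_norml ler_norml; move: (m * eta) => x; lra.
have ne : - eta <= eta by move: eta0; lra.
have hin (s : R) : - eta <= s <= eta -> `|s| < 2 * eta.
  by rewrite -ler_norml => hs; apply: le_lt_trans hs _; move: eta0; lra.
have cI : {within `[- eta, eta], continuous (fun s => kap (s +i* t))}.
  by apply: within_cont => s hs; exact: isd_cont (ds (hin s hs) ht).
have hv : Num.min (kap (- eta +i* t)) (kap (eta +i* t)) <= K <= Num.max (kap (- eta +i* t)) (kap (eta +i* t)).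
  by rewrite ge_min le_max (ltW v1) (ltW v2) orbT.
have [s] := IVT ne cI hv; rewrite in_itv /= => /andP[s1 s2] E.
exists s => //; rewrite ltr_norml !lt_neqAle s1 s2 !andbT.
by apply/andP; split; apply/eqP => e1; [move: v1|move: v2]; rewrite ?e1 -E ?e1 ltxx.
Qed.

(** Along a level curve s = S(t) the first-order change of [g] is a multiple of that of [kap], which
    is 0. A Lipschitz bound L / m on [S] suffices to control the error terms, so g(S(t), t) has zero
    derivative. *)
Lemma level_const : exists2 rho, 0 < rho & forall z, box 0 rho z ->
  `|kap z - kap 0| < m * eta / 4 /\
  forall g e, (forall z, B z -> diff_at g z (e z * p z) (e z * q z)) -> exists s, [/\ `|s| < eta, kap (s +i* 0) = kap z & g (s +i* 0) = g z].
Proof.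
have B0 : B 0 by apply: box_center; rewrite mulr_gt0.
have me : 0 < m * eta / 4 by rewrite divr_gt0 // mulr_gt0.
have /ccontP /(_ _ me) [d d0 Hd] := diff_cont (dk B0).
have L1 : 0 < L + 1 by rewrite ltr_wpDl.
pose t0 := Num.min eta (m * eta / 4 / (L + 1)).
have t00 : 0 < t0 by rewrite lt_min eta0 divr_gt0.
exists (Num.min d t0); first by rewrite lt_min d0.
move=> _ /boxE [s [t [hs ht ->]]]; rewrite add0r.
rewrite !lt_min in hs ht; move/andP: hs => [s1 /andP[s2 s3]]; move/andP: ht => [t1 /andP[t2 t3]].
have := Hd s t s1 t1; rewrite add0r => hK; split=> // g e dg.
set K := kap (s +i* t) in hK *.
have he (x : R) : `|x| < eta -> `|x| < 2 * eta by move=> hx; apply: lt_trans hx _; move: eta0; lra.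
have hT (x : R) : `|x| < t0 -> `|x| < 2 * eta /\ L * `|x| <= m * eta / 4.
  rewrite lt_min => /andP[h1 h2]; split; first exact: he.
  rewrite ltr_pdivlMr // in h2; apply: le_trans (ltW h2).
  by rewrite (mulrC L) ler_wpM2l // lerDl ler01.
have [S HS] : exists S : R -> R, forall x, `|x| < t0 -> `|S x| < eta /\ kap (S x +i* x) = K.
  have P (v : R) : exists y, `|v| < t0 -> `|y| < eta /\ kap (y +i* v) = K.
    have [/hT [h1 h2]|] := pselect (`|v| < t0); last by exists 0.
    by have [y y1 y2] := level_ex h1 h2 hK; exists y.
  by have [S HS] := choice P; exists S.
have S0 : `|0 : R| < t0 by rewrite normr0.
have St : S t = s.
  have tt : `|t| < t0 by rewrite lt_min t2.
  have [h1 h2] := HS t tt; 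
  refine (@level_inj (S t) s t (he _ h1) (he _ s2) (hT t tt).1 h2).
exists (S 0); have [a1 a2] := HS 0 S0; split=> //.
have D (x : R) : `|x| < t0 -> is_derive x 1 (fun x => g (S x +i* x)) 0.
  move=> hx; have [b1 b2] := HS x hx; have [h1 h2] := hT x hx.
  have Bx := bB (he _ b1) h1; set z := S x +i* x in Bx *.
  apply/isdP => eps eps0; pose C := L / m + 1.
  have C1 : 1 <= C by rewrite lerDr divr_ge0 // ltW.
  have C0 : 0 < C := lt_le_trans ltr01 C1.
  (* The first-order error of [g] and [e z] times that of [kap] then add up to at most [eps |y|]. *)
  pose e1 := eps / ((`|e z| + 1) * C).
  have e10 : 0 < e1 by rewrite divr_gt0 // mulr_gt0 // ltr_wpDl.
  have [d1 d10 H1] := dk Bx e10; have [d2 d20 H2] := dg z Bx e1 e10.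
  have x0 : 0 < t0 - `|x| by rewrite subr_gt0.
  exists (Num.min (t0 - `|x|) (Num.min (d1 / C) (d2 / C))); first by rewrite !lt_min x0 !divr_gt0.
  move=> y; rewrite !lt_min !ltr_pdivlMr // => /and3P[y0 y1 y2].
  have hxy : `|x + y| < t0 by apply: le_lt_trans (ler_normD _ _) _; move: y0; rewrite ltrBrDl.
  have [c1 c2] := HS _ hxy; have [h3 h4] := hT _ hxy.
  have dS : `|S (x + y) - S x| <= L / m * `|y|.
    rewrite -(ler_pM2l m0) mulrA (mulrCA m) mulfV ?gt_eqF // mulr1.
    apply: le_trans (level_dist (he _ b1) (he _ c1) h3) _.
    rewrite c2 -b2 distrC; apply: le_trans (level_lip (he _ b1) h1 h3) _.
    by rewrite addrC addKr.
  have dS1 : `|S (x + y) - S x| + `|y| <= C * `|y| by rewrite /C mulrDl mul1r lerD2r.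
  have yC : `|y| <= C * `|y| by rewrite ler_peMl.
  have dSy : `|S (x + y) - S x| <= C * `|y| by apply: le_trans dS1; rewrite lerDl.
  have zE : S (x + y) +i* (x + y) = z + ((S (x + y) - S x) +i* y) :> cplx R.
    by apply/eqP; rewrite eq_complex /=; apply/andP; split; apply/eqP; ring.
  rewrite mulrC in y1; rewrite mulrC in y2.
  have q1 := H1 _ _ (le_lt_trans dSy y1) (le_lt_trans yC y1).
  have q2 := H2 _ _ (le_lt_trans dSy y2) (le_lt_trans yC y2).
  rewrite -zE in q1 q2; rewrite c2 /z b2 subrr sub0r normrN in q1.
  rewrite mul0r subr0.
  have -> : g (S (x + y) +i* (x + y)) - g z = (g (S (x + y) +i* (x + y)) - g z -
      (e z * p z * (S (x + y) - S x) + e z * q z * y)) + e z * (p z * (S (x + y) - S x) + q z * y) by ring.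
  apply: le_trans (ler_normD _ _) _; rewrite normrM.
  apply: (@le_trans _ _ ((`|e z| + 1) * (e1 * (`|S (x + y) - S x| + `|y|)))).
    by rewrite mulrDl mul1r addrC lerD // ler_wpM2l.
  apply: (@le_trans _ _ ((`|e z| + 1) * (e1 * (C * `|y|)))).
    by rewrite ler_wpM2l ?addr_ge0 // ler_wpM2l // ltW.
  rewrite /e1 le_eqVlt; apply/orP; left; apply/eqP; field.
  by rewrite gt_eqF // gt_eqF // ltr_wpDl.
have H x : `|x - 0| <= `|t - 0| -> is_derive (x : R) 1 (fun x => g (S x +i* x)) 0.
  by rewrite !subr0 => xt; apply: D; apply: le_lt_trans xt _; rewrite lt_min t2.
by rewrite -(isd0_cst H) St.
Qed.

End Abstract.

Section Affine.
Variables (z0 : cplx R) (u1 u2 : R).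

(** A similarity taking 0 to [z0] and the real axis to the direction (u1, u2), which will be that of
    the gradient of [k] at [z0]. *)
Definition rot (z : cplx R) : cplx R :=
  z0 + ((complex.Re z * u1 - complex.Im z * u2) +i* (complex.Re z * u2 + complex.Im z * u1)).

Lemma rotD z (a b : R) : rot (z + (a +i* b)) = rot z + ((a * u1 - b * u2) +i* (a * u2 + b * u1)).
Proof.
rewrite /rot -addrA; congr (_ + _); case: z => x y.
by apply/eqP; rewrite eq_complex /=; apply/andP; split; apply/eqP; ring.
Qed.

Lemma rot_bound (a b e : R) : `|a| < e -> `|b| < e -> 0 < `|u1| + `|u2| ->
  `|a * u1 - b * u2| < (`|u1| + `|u2|) * e /\ `|a * u2 + b * u1| < (`|u1| + `|u2|) * e.
Proof.
move=> ha hb M0.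
have h (x y : R) : `|x| < e -> `|y| < e -> forall v1 v2 : R, 0 < v1 + v2 -> 0 <= v1 -> 0 <= v2 ->
    `|x| * v1 + `|y| * v2 < (v1 + v2) * e.
  move=> hx hy v1 v2 v0 v10 v20; have := normr_ge0 x; have := normr_ge0 y.
  move: (`|x|) (`|y|) hx hy => x' y' hx hy y0 x0.
  have [p1|p1] := leP v1 0; last by nra.
  have v1e : v1 = 0 by lra.
  by rewrite v1e in v0 *; nra.
split.
  apply: le_lt_trans (ler_normB _ _) _; rewrite !normrM; exact: h.
apply: le_lt_trans (ler_normD _ _) _; rewrite !normrM (addrC (`|u1|)); apply: h => //.
by rewrite addrC.
Qed.

Lemma diff_rot (f : cplx R -> R) z (p q : R) : 0 < `|u1| + `|u2| -> diff_at f (rot z) p q ->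
  diff_at (fun z => f (rot z)) z (p * u1 + q * u2) (- p * u2 + q * u1).
Proof.
move=> M0 H e e0; set M := `|u1| + `|u2| in M0 *.
have eM : 0 < e / (2 * M) by rewrite divr_gt0 // mulr_gt0.
have [d d0 Hd] := H _ eM; exists (d / M); first by rewrite divr_gt0.
move=> a b ha hb; have [h1 h2] := rot_bound ha hb M0; rewrite -/M mulrCA mulfV ?gt_eqF // mulr1 in h1 h2.
rewrite rotD; have := Hd _ _ h1 h2.
have -> : p * (a * u1 - b * u2) + q * (a * u2 + b * u1) = (p * u1 + q * u2) * a + (- p * u2 + q * u1) * b by ring.
move=> le1; apply: le_trans le1 _.
have le2 : `|a * u1 - b * u2| + `|a * u2 + b * u1| <= 2 * M * (`|a| + `|b|).
  apply: le_trans (lerD (ler_normB _ _) (ler_normD _ _)) _; rewrite !normrM /M.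
  have := normr_ge0 a; have := normr_ge0 b; have := normr_ge0 u1; have := normr_ge0 u2.
  by move: (`|a|) (`|b|) (`|u1|) (`|u2|) => a' b' x y; nra.
apply: le_trans (ler_wpM2l (ltW eM) le2) _.
by rewrite mulrA divfK // mulf_neq0 // gt_eqF.
Qed.

End Affine.

Variables (K1 K2 : R) (z0 : cplx R) (r : R) (k w1 w2 : cplx R -> R).
Hypothesis rg : regular (pcubic K1 K2) z0 r k w1 w2.
Local Notation P := (pcubic K1 K2).
Local Notation D := (box z0 r).

(** A function killed by Y is constant on the level curves of [k]. Hence g = h(k) with h(x) = g(gam
    x), where [gam] is the line through [z0] in the direction of the gradient, parametrised by the
    value of [k]. *)
Lemma level_function : exists rho dl (gam : R -> cplx R), [/\ 0 < rho, rho <= r, 0 < dl,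
  forall z, box z0 rho z -> `|k z - k z0| < dl &
  (forall x, `|x - k z0| < dl -> D (gam x) /\ k (gam x) = x) /\
  forall g, smooth_on D g -> (forall z, D z -> Yop w1 w2 g z = 0) ->
    exists h : R -> R, (forall x, `|x - k z0| < dl -> sm1 h x) /\
      forall z, box z0 rho z -> g z = h (k z)].
Proof.
have r0 := rg_gt0 rg; have oD : open D := @box_open R z0 r.
pose u1 := w1 z0; pose u2 := - w2 z0.
have c0 := box_center z0 r0.
have N0 : u1 ^+ 2 + u2 ^+ 2 != 0 by rewrite /u2 sqrrN; exact: (rg_w0 rg c0).
have N1 : 0 < u1 ^+ 2 + u2 ^+ 2 by rewrite lt_neqAle eq_sym N0 addr_ge0 ?sqr_ge0.
have M0 : 0 < `|u1| + `|u2|.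
  rewrite lt_neqAle addr_ge0 // andbT eq_sym paddr_eq0 // !normr_eq0.
  by apply: contra N0 => /andP[/eqP -> /eqP ->]; rewrite expr0n addr0.
set M := `|u1| + `|u2| in M0.
(* [pt] and [qt] are the derivatives of [k] in the rotated coordinates; the first is positive at
   [z0], so half of its value there is a lower bound nearby. *)
pose pt z := 2 * P (k z) * (w1 z * u1 - w2 z * u2).
pose qt z := 2 * P (k z) * (- w1 z * u2 - w2 z * u1).
have ck z : D z -> {for z, continuous k} := smooth_cont (rg_k rg).
have cw1 z : D z -> {for z, continuous w1} := smooth_cont (rg_w1 rg).
have cw2 z : D z -> {for z, continuous w2} := smooth_cont (rg_w2 rg).
have cP : {for z0, continuous (fun z => 2 * P (k z))}.
  apply: ccontM; first exact: ccont_cst.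
  by apply: ccont_comp; [exact: ck|exact: isd_cont (isd_pcubic K1 K2 _)].
have cN (f : cplx R -> R) z : {for z, continuous f} -> {for z, continuous (fun z => - f z)}.
  by move=> cf; apply: (ccont_comp (h := -%R)) => //; exact: isd_cont (isdN (isd_id _)).
have cc (t : R) z : {for z, continuous (fun _ : cplx R => t)} by exact: ccont_cst.
have cpt : {for z0, continuous pt}.
  apply: ccontM => //; apply: ccontD; first exact: ccontM (cw1 _ c0) (cc _ _).
  apply: cN; exact: ccontM (cw2 _ c0) (cc _ _).
have cqt : {for z0, continuous qt}.
  apply: ccontM => //; apply: ccontD; first exact: ccontM (cN _ _ (cw1 _ c0)) (cc _ _).
  apply: cN; exact: ccontM (cw2 _ c0) (cc _ _).
have pt0 : 0 < pt z0.
  have -> : pt z0 = 2 * P (k z0) * (u1 ^+ 2 + u2 ^+ 2) by rewrite /pt /u2 /u1; ring.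
  by apply: mulr_gt0 N1; apply: mulr_gt0 (rg_pos rg c0).
pose m := pt z0 / 2; have m0 : 0 < m by rewrite divr_gt0.
pose L := `|qt z0| + 1; have L0 : 0 <= L by rewrite addr_ge0.
have /ccontP /(_ _ m0) [d1 d10 Hd1] := cpt; have /ccontP /(_ _ ltr01) [d2 d20 Hd2] := cqt.
pose r1 := Num.min r (Num.min d1 d2).
have r10 : 0 < r1 by rewrite !lt_min r0 d10.
have sub : box z0 r1 `<=` D by apply: box_sub; rewrite ge_min lexx.
have pm z : box z0 r1 z -> m <= pt z.
  move=> /boxE [a [b [ha hb ->]]]; rewrite !lt_min in ha hb.
  have /and3P[_ a1 _] := ha; have /and3P[_ b1 _] := hb.
  by have := Hd1 a b a1 b1; rewrite /m ltr_norml; move: (pt _) (pt z0) => x y; lra.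
have qL z : box z0 r1 z -> `|qt z| <= L.
  move=> /boxE [a [b [ha hb ->]]]; rewrite !lt_min in ha hb.
  have /and3P[_ _ a1] := ha; have /and3P[_ _ b1] := hb.
  have := Hd2 a b a1 b1 => h; rewrite -(subrK (qt z0) (qt _)); apply: le_trans (ler_normD _ _) _.
  by rewrite /L addrC lerD2l ltW.
pose G := rot z0 u1 u2.
pose eta := r1 / (2 * M); have eta0 : 0 < eta by rewrite divr_gt0 // mulr_gt0.
have eM : M * (2 * eta) = r1 by rewrite /eta; field; rewrite gt_eqF.
have G0 : G 0 = z0 by rewrite /G /rot /= !mul0r subrr addr0 addr0.
have GB z : box 0 (2 * eta) z -> box z0 r1 (G z).
  move=> /boxE [a [b [ha hb ->]]]; rewrite /G rotD -/G G0.
  by have [h1 h2] := rot_bound ha hb M0; rewrite -/M eM in h1 h2; exact: boxP.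
have pdk z : D z -> dx k z = 2 * P (k z) * w1 z /\ dy k z = - (2 * P (k z) * w2 z).
  by move=> Dz; have H := rg_pd rg Dz; rewrite (pd_dx H) (pd_dy H).
have dfk z : box 0 (2 * eta) z -> diff_at (fun z => k (G z)) z (pt (G z)) (qt (G z)).
  move=> /GB /sub Dz; have [e1 e2] := pdk _ Dz.
  have := diff_rot M0 (smooth_diff oD (rg_k rg) Dz); rewrite e1 e2.
  congr diff_at; rewrite /pt /qt; ring.
have bE0 : box 0 (2 * eta) (0 : cplx R) by apply: box_center; rewrite mulr_gt0.
have dfg g z : smooth_on D g -> (forall z, D z -> Yop w1 w2 g z = 0) -> box 0 (2 * eta) z ->
    diff_at (fun z => g (G z)) z (Xop w1 w2 g (G z) / (2 * P (k (G z))) * pt (G z))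
      (Xop w1 w2 g (G z) / (2 * P (k (G z))) * qt (G z)).
  move=> sg Yg /GB /sub Dz; have F := fd_smooth (rg_w0 rg) sg Dz; rewrite Yg // in F.
  have := diff_rot M0 (smooth_diff oD sg Dz); rewrite (pd_dx F) (pd_dy F).
  have P0 : P (k (G z)) != 0 by rewrite gt_eqF // (rg_pos rg Dz).
  by congr diff_at; rewrite /pt /qt; field.
pose dl := m * eta / 4; have dl0 : 0 < dl by rewrite divr_gt0 // mulr_gt0.
have kap0 : k (G 0) = k z0 by rewrite G0.
have pmG z : box 0 (2 * eta) z -> m <= pt (G z) by move=> /GB; exact: pm.
have qLG z : box 0 (2 * eta) z -> `|qt (G z)| <= L by move=> /GB; exact: qL.
have z2 : `|0 : R| < 2 * eta by rewrite normr0 mulr_gt0.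
have [sg Hs] : exists sg : R -> R, forall x, `|x - k z0| < dl -> `|sg x| < eta /\ k (G (sg x +i* 0)) = x.
  have Q (x : R) : exists y, `|x - k z0| < dl -> `|y| < eta /\ k (G (y +i* 0)) = x.
    have [hx|] := pselect (`|x - k z0| < dl); last by exists 0.
    have l0 : L * `|0 : R| <= m * eta / 4 by rewrite normr0 mulr0 ltW.
    rewrite -kap0 in hx.
    have [y y1 y2] := level_ex eta0 m0 dfk pmG qLG z2 l0 hx.
    by exists y.
  by have [sg Hs] := choice Q; exists sg.
have inj x y : `|x| < eta -> `|y| < eta -> k (G (x +i* 0)) = k (G (y +i* 0)) -> x = y.
  have he (v : R) : `|v| < eta -> `|v| < 2 * eta by move=> hx; apply: lt_trans hx _; move: eta0; lra.
  by move=> hx hy; apply: (level_inj m0 dfk pmG) => //; exact: he.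
pose gam x := G (sg x +i* 0).
have bgam x : `|x - k z0| < dl -> box z0 r1 (gam x).
  move=> /Hs [h1 _]; apply: GB; rewrite -(add0r (_ +i* _ : cplx R)); apply: boxP => //.
  by apply: lt_trans h1 _; move: eta0; lra.
pose ku z := dx k z * u1 + dy k z * u2.
have kuE z : D z -> ku z = pt z by move=> Dz; have [e1 e2] := pdk z Dz; rewrite /ku e1 e2 /pt; ring.
have dsg (x : R) : `|x - k z0| < dl -> is_derive x 1 sg (ku (gam x))^-1.
  move=> hx; have [h1 h2] := Hs x hx; have Dg := sub _ (bgam x hx).
  have bz : box 0 (2 * eta) (sg x +i* 0 : cplx R).
    rewrite -(add0r (_ +i* _ : cplx R)); apply: boxP => //.
    by apply: lt_trans h1 _; move: eta0; lra.
  have D1 (s : R) : `|s| < eta -> is_derive s 1 (fun s => k (G (s +i* 0))) (pt (G (s +i* 0))).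
    move=> hs; have bs : box 0 (2 * eta) (s +i* 0 : cplx R).
      rewrite -(add0r (_ +i* _ : cplx R)); apply: boxP => //.
      by apply: lt_trans hs _; move: eta0; lra.
    have := @diff_curve R (fun z => k (G z)) id (fun=> 0) s _ _ 1 0 (dfk _ bs) (isd_id s) (isd_cst 0 s).
    by move=> H; apply: isd_eq H _; ring.
  have ns : \forall s \near sg x, `|s| < eta.
    apply/near_itvP; exists (eta - `|sg x|); first by rewrite subr_gt0.
    move=> s hs; rewrite -(subrK (sg x) s); apply: le_lt_trans (ler_normD _ _) _.
    by move: hs; rewrite ltrBrDr.
  have nk : \forall s \near sg x, `|k (G (s +i* 0)) - k z0| < dl.
    have cf := isd_cont (D1 _ h1); have e0 : 0 < dl - `|x - k z0| by rewrite subr_gt0.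
    move/contP: cf => /(_ _ e0) [d d0 Hd]; apply/near_itvP; exists d => // s /Hd; rewrite h2 => hs.
    rewrite -(subrKA x); apply: le_lt_trans (ler_normD _ _) _.
    by move: hs; rewrite ltrBrDr.
  have can : {near sg x, cancel (fun s => k (G (s +i* 0))) sg}.
    apply: (@filterS2 _ _ (nbhs_filter (sg x)) _ _ _ _ ns nk) => s hs hk /=; have [a1 a2] := Hs _ hk.
    exact: inj.
  have ncf : \forall s \near sg x, {for s, continuous (fun s => k (G (s +i* 0)))}.
    by apply: filterS ns => s /D1; exact: isd_cont.
  have p0 : pt (G (sg x +i* 0)) != 0 by rewrite gt_eqF // (lt_le_trans m0) // pmG.
  by have := is_derive_inverse can ncf (D1 _ h1) p0; rewrite h2 -kuE.
have [rho0 rho00 Hrho] := level_const eta0 m0 L0 dfk pmG qLG.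
have MN : 0 < rho0 * (u1 ^+ 2 + u2 ^+ 2) / M by rewrite divr_gt0 // mulr_gt0.
(* Small enough for the inverse similarity to map the square into the one of half-side [rho0]. *)
pose rho := Num.min r (rho0 * (u1 ^+ 2 + u2 ^+ 2) / M).
have inv z : box z0 rho z -> exists2 y, box 0 rho0 y & G y = z.
  move=> /boxE [a [b [ha hb ->]]]; rewrite !lt_min !ltr_pdivlMr // in ha hb.
  have /andP[_ a1] := ha; have /andP[_ b1] := hb.
  exists (((a * u1 + b * u2) / (u1 ^+ 2 + u2 ^+ 2)) +i* ((b * u1 - a * u2) / (u1 ^+ 2 + u2 ^+ 2))).
    have [h1 h2] : `|a * u1 + b * u2| < rho0 * (u1 ^+ 2 + u2 ^+ 2) /\ `|b * u1 - a * u2| < rho0 * (u1 ^+ 2 + u2 ^+ 2).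
      move: a1 b1; rewrite /M; have := normr_ge0 a; have := normr_ge0 b; have := normr_ge0 u1; have := normr_ge0 u2.
      move: (rho0 * _) => T x2 x1 xb xa a1 b1.
      have x0 : 0 < `|u1| + `|u2| := M0.
      split; [apply: le_lt_trans (ler_normD _ _) _|apply: le_lt_trans (ler_normB _ _) _]; rewrite !normrM.
        move: x0 x1 x2 xa xb a1 b1; move: (`|a|) (`|b|) (`|u1|) (`|u2|) => a' b' x y; move=> *; have [h|h] := leP a' b'; nra.
      move: x0 x1 x2 xa xb a1 b1; move: (`|a|) (`|b|) (`|u1|) (`|u2|) => a' b' x y; move=> *; have [h|h] := leP a' b'; nra.
    rewrite -(add0r (_ +i* _ : cplx R)); apply: boxP; rewrite normrM normfV (gtr0_norm N1) ltr_pdivrMr //.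
  rewrite /G /rot /=; congr (_ + _); apply/eqP; rewrite eq_complex /=.
  by apply/andP; split; apply/eqP; field.
exists rho, dl, gam; split=> //.
- by rewrite lt_min r0.
- by rewrite ge_min lexx.
- by move=> z /inv [y /Hrho [hy _] <-]; rewrite -kap0.
split=> [x hx|g sgm Yg].
  by split; [exact: sub (bgam x hx)|have [_] := Hs x hx].
exists (fun x => g (gam x)); split; last first.
  move=> z /inv [y hy <-]; have [h1 H] := Hrho y hy.
  have [s [s1 s2 s3]] := H (fun z => g (G z)) (fun z => Xop w1 w2 g (G z) / (2 * P (k (G z))))
    (fun z bz => dfg g z sgm Yg bz).
  rewrite kap0 in h1; have [t1 t2] := Hs _ h1.
  by rewrite -s3 /gam (inj s (sg (k (G y)))) // s2 t2.
have smk : smooth_on (box z0 r1) k := smooth_sub sub (rg_k rg).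
have or1 : open (box z0 r1) := @box_open R z0 r1.
have sc (t : R) : smooth_on (box z0 r1) (fun=> t) by exact: smooth_cst.
have sku : smooth_on (box z0 r1) ku.
  apply: smoothD => //; apply: smoothM => //; first exact: smooth_dx.
  exact: smooth_dy.
have ku0 z : box z0 r1 z -> ku z != 0.
  by move=> bz; rewrite kuE; [rewrite gt_eqF // (lt_le_trans m0) // pm|exact: sub].
have oI : open [set x | `|x - k z0| < dl].
  rewrite openE => x hx; apply/near_itvP; exists (dl - `|x - k z0|); first by rewrite subr_gt0.
  move=> y hy /=; rewrite -(subrKA x); apply: le_lt_trans (ler_normD _ _) _.
  by move: hy; rewrite ltrBrDr.
(* The functions f(gam x) with [f] smooth in the plane are closed under derivation, because the
   velocity of [gam] is (u1, u2) divided by the derivative [ku] of [k] in that direction. *)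
apply: (@sm1_class R _ (fun h => exists2 f, smooth_on (box z0 r1) f & h = fun x => f (gam x)) oI); last first.
  by exists g => //; exact: smooth_sub sgm.
move=> _ [f sf ->]; exists (fun x => (dx f (gam x) * u1 + dy f (gam x) * u2) * (ku (gam x))^-1).
  exists (fun z => (dx f z * u1 + dy f z * u2) * (ku z)^-1) => //.
  apply: smoothM => //; last by apply: smooth_inv.
  apply: smoothD => //; apply: smoothM => //; first exact: smooth_dx.
  exact: smooth_dy.
move=> x hx; have df := diff_rot M0 (smooth_diff or1 sf (bgam x hx)).
have := @diff_curve R (fun z => f (G z)) sg (fun=> 0) x _ _ _ 0 df (dsg x hx) (isd_cst 0 x).
by move=> H; apply: isd_eq H _; rewrite mulr0 addr0.
Qed.

End LevelCurves.

Opaque Xop Yop.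

Section Tools.
Context {R : realType}.
Implicit Types (z : cplx R) (f : cplx R -> R).

Lemma ccont_neq0 f z : {for z, continuous f} -> f z != 0 -> \forall v \near z, f v != 0.
Proof.
move=> /ccontP cf f0; have n0 : 0 < `|f z| by rewrite normr_gt0.
have [d d0 Hd] := cf _ n0; apply/nbhs_boxP; exists d => // a b ha hb.
by apply: contraTneq (Hd a b ha hb) => ->; rewrite sub0r normrN ltxx.
Qed.

Lemma box_const f z0 (r : R) : (forall z, box z0 r z -> pd f z 0 0) ->
  forall z, box z0 r z -> f z = f z0.
Proof.
move=> H z /boxE [a [b [ha hb ->]]].
have r0 : 0 < r := le_lt_trans (normr_ge0 a) ha.
have e1 : f (z0 + (a +i* b)) = f (z0 + (a +i* 0)).
  apply: (@isd0_cst R (fun s => f (z0 + (a +i* s)))) => t; rewrite !subr0 => ht.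
  by apply: pd_line_im (H _ _); apply: boxP => //; exact: le_lt_trans hb.
have e2 : f (z0 + (a +i* 0)) = f (z0 + (0 +i* 0)).
  apply: (@isd0_cst R (fun s => f (z0 + (s +i* 0)))) => t; rewrite !subr0 => ht.
  by apply: pd_line_re (H _ _); apply: boxP; rewrite ?normr0 //; exact: le_lt_trans ha.
by rewrite e1 e2 addc0.
Qed.

Lemma regular_sub (p : R -> R) z0 r k w1 w2 z1 r1 : regular p z0 r k w1 w2 -> 0 < r1 ->
  box z1 r1 `<=` box z0 r -> regular p z1 r1 k w1 w2.
Proof.
move=> rg r10 sub; split=> //; try by [exact: smooth_sub sub (rg_w1 rg)|exact: smooth_sub sub (rg_w2 rg)|exact: smooth_sub sub (rg_k rg)].
- by move=> z /sub; exact: (rg_cr1 rg).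
- by move=> z /sub; exact: (rg_cr2 rg).
- by move=> z /sub; exact: (rg_w0 rg).
- by move=> z /sub; exact: (rg_pd rg).
- by move=> z /sub; exact: (rg_pos rg).
Qed.

End Tools.

(** [level_function] is used again on the smaller square, so that all values within [dl] are
    attained there; identities on the square thereby become identities in one real variable. *)
Lemma level_onto (R : realType) (K1 K2 : R) (z0 : cplx R) (r : R) (k w1 w2 : cplx R -> R) :
  regular (pcubic K1 K2) z0 r k w1 w2 -> exists rho dl, [/\ 0 < rho, rho <= r, 0 < dl,
   forall x, `|x - k z0| < dl -> exists2 z, box z0 rho z & k z = x &
   forall g, smooth_on (box z0 r) g -> (forall z, box z0 r z -> Yop w1 w2 g z = 0) ->
    exists h : R -> R, (forall x, `|x - k z0| < dl -> sm1 h x) /\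
      forall z, box z0 rho z -> sm1 h (k z) /\ g z = h (k z)].
Proof.
move=> rg; have [rho [d1 [_ [rho0 rr d10 kd [_ H]]]]] := level_function rg.
have sub : box z0 rho `<=` box z0 r by exact: box_sub.
have [_ [d2 [gam [_ _ d20 _ [Hg _]]]]] := level_function (regular_sub rg rho0 sub).
exists rho, (Num.min d1 d2); split=> //; first by rewrite lt_min d10.
  by move=> x; rewrite lt_min => /andP[_ /Hg [h1 h2]]; exists (gam x).
move=> g sg Yg; have [h [h1 h2]] := H g sg Yg; exists h; split.
  by move=> x; rewrite lt_min => /andP[/h1].
by move=> z bz; split; [apply: h1; exact: kd|exact: h2].
Qed.

Lemma exclusion_algebra (R : realType) (C P p' h E x : R) : P != 0 -> E != 0 ->
  (2 * (- 2 * x) + (p' * (4 * C * h - E^-1) + P * (4 * C * (2 * C * E) + (4 * C * h * E - 1) / E ^+ 2))) * (2 * P)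
    = C ^+ 2 * (16 * (P * P) * E) ->
  (p' + P * E^-1) * (- (4 * C * h * E^-1) + E^-1 ^+ 2) = - 4 * x * E^-1.
Proof.
move=> P0 E0 h1.
have h2 : 2 * (- 2 * x) + (p' * (4 * C * h - E^-1) + P * (4 * C * (2 * C * E) + (4 * C * h * E - 1) / E ^+ 2)) = 8 * C ^+ 2 * P * E.
  have P2 : 2 * P != 0 by rewrite mulf_neq0.
  by apply: (mulIf P2); rewrite h1; ring.
have h3 : - 4 * x = - (p' * (4 * C * h - E^-1) + P * ((4 * C * h * E - 1) / E ^+ 2)).
  have -> : - 4 * x = 8 * C ^+ 2 * P * E - (p' * (4 * C * h - E^-1) + P * (4 * C * (2 * C * E) + (4 * C * h * E - 1) / E ^+ 2)).
    by rewrite -h2; ring.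
  by ring.
by rewrite h3; field.
Qed.

Section Algebra.
Context {R : realType}.

(** The two Codazzi equations and the two derivatives of a^2 + b^2 are four linear equations for the
    four derivatives of [a] and [b]. *)
Lemma solve_system (a b xa xb ya yb g rh r2 : R) : r2 != 0 -> a ^+ 2 + b ^+ 2 = r2 ->
  ya + xb = 0 -> xa - yb = g * r2 -> a * xa + b * xb = rh * r2 -> a * ya + b * yb = 0 ->
  let t := rh - g * a in
  [/\ xa = a * rh + g * b ^+ 2, xb = b * t, ya = - (b * t) & yb = a * t].
Proof.
move=> r0 e h1 h2 h3 h4 t.
have ex : xa = a * rh + g * b ^+ 2.
  apply: (mulIf r0); have -> : xa * r2 = a * (a * xa + b * xb) + b * (b * (xa - yb) - a * (ya + xb) + (a * ya + b * yb)).
    by rewrite -e; ring.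
  by rewrite h1 h2 h3 h4; ring.
have eb : xb = b * t.
  apply: (mulIf r0); have -> : xb * r2 = b * (a * xa + b * xb) - a * (b * (xa - yb) - a * (ya + xb) + (a * ya + b * yb)).
    by rewrite -e; ring.
  by rewrite h1 h2 h3 h4 /t; ring.
split=> //; first by rewrite -eb; lra.
have -> : yb = xa - g * r2 by lra.
by rewrite ex -e /t; ring.
Qed.

(** The two commutation relations say that one and the same quantity vanishes after multiplication
    by [b] and by [a]; since a^2 + b^2 is not 0, it vanishes. *)
Lemma commute_system (a b g rh r2 xg xr : R) : r2 != 0 -> a ^+ 2 + b ^+ 2 = r2 ->
  let t := rh - g * a in
  let xt := xr - (xg * a + g * (a * rh + g * b ^+ 2)) in
  - (b * t) * rh + a * 0 + (0 * (b * b) + g * (a * t * b + b * (a * t))) = - (b * t * (rh - g * a) + b * xt) ->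
  a * t * (rh - g * a) + b * (0 - (0 * a + g * - (b * t))) = (a * rh + g * b ^+ 2) * (rh - g * a) + a * xt ->
  a * xg = xr - g ^+ 2 * r2.
Proof.
move=> r0 e t xt h1 h2; apply/eqP; rewrite -subr_eq0; apply/eqP; apply: (mulIf r0); rewrite mul0r.
have e1 : b * (a * xg - (xr - g ^+ 2 * r2)) = 0.
  by move/eqP: h1; rewrite -subr_eq0 => /eqP; rewrite /xt /t -e => h1; rewrite -oppr0 -h1; ring.
have e2 : a * (a * xg - (xr - g ^+ 2 * r2)) = 0.
  by move/eqP: h2; rewrite -subr_eq0 => /eqP; rewrite /xt /t -e => h2; rewrite -h2; ring.
rewrite -{2}e; move: e1 e2; move: (_ - _) => q e1 e2.
have -> : q * (a ^+ 2 + b ^+ 2) = a * (a * q) + b * (b * q) by ring.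
by rewrite e1 e2 !mulr0 addr0.
Qed.

End Algebra.

Section Analysis.
Context {R : realType}.
Variables (K1 K2 c : R) (z0 : cplx R) (r : R) (k w1 w2 : cplx R -> R).
Hypothesis rg : regular (pcubic K1 K2) z0 r k w1 w2.
Local Notation P := (pcubic K1 K2).
Local Notation D := (box z0 r).
Local Notation X := (Xop w1 w2).
Local Notation Y := (Yop w1 w2).
Variables (a b H : cplx R -> R).
Hypothesis sa : smooth_on D a.
Hypothesis sb : smooth_on D b.
Hypothesis sH : smooth_on D H.
Hypothesis YH : forall z, D z -> Y H z = 0.
Hypothesis cod1 : forall z, D z -> Y a z + X b z = 0.
Hypothesis cod2 : forall z, D z -> X a z - Y b z = 4 * P (k z) * X H z.
Hypothesis gau : forall z, D z -> a z ^+ 2 + b z ^+ 2 = 16 * P (k z) ^+ 2 * (H z ^+ 2 - k z + c).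
Hypothesis numb : forall z, D z -> a z ^+ 2 + b z ^+ 2 != 0.

Let oD : open D := @box_open R z0 r.
Let w0 := rg_w0 rg.
Let s1 := rg_w1 rg.
Let s2 := rg_w2 rg.
Let nD z : D z -> \forall v \near z, D v. Proof. exact: open_near. Qed.

Let sX f : smooth_on D f -> smooth_on D (X f). Proof. exact: smooth_X. Qed.

Let FD f z (sf : smooth_on D f) (Dz : D z) : fd w1 w2 f z (X f z) (Y f z) := fd_smooth w0 sf Dz.

Let fd_on f g z u v u' v' : D z -> (forall v, D v -> f v = g v) ->
  fd w1 w2 f z u v -> fd w1 w2 g z u' v' -> u = u' /\ v = v'.
Proof.
move=> Dz fg F G; apply: (fd_uniq (w0 Dz)) G; apply: fd_near F.
exact: filterS (nD Dz).
Qed.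

(** Locally the functions of the curvature. They are closed under the field operations and, since X
    and Y commute, under X. *)
Definition yc f := smooth_on D f /\ forall z, D z -> Y f z = 0.

Let ycF f z : yc f -> D z -> fd w1 w2 f z (X f z) 0.
Proof. by move=> [sf Yf] Dz; rewrite -(Yf z Dz); exact: FD. Qed.

Let yc_cst t : yc (fun=> t).
Proof.
split=> [|z Dz]; first exact: smooth_cst.
by have [_ ->] := fdE w0 Dz (fd_cst w1 w2 t z).
Qed.

Let ycD f g : yc f -> yc g -> yc (fun z => f z + g z).
Proof.
move=> yf yg; split=> [|z Dz]; first by case: yf yg => sf _ [sg _]; exact: smoothD.
by have [_ ->] := fdE w0 Dz (fdD (ycF yf Dz) (ycF yg Dz)); rewrite addr0.
Qed.

Let ycM f g : yc f -> yc g -> yc (fun z => f z * g z).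
Proof.
move=> yf yg; split=> [|z Dz]; first by case: yf yg => sf _ [sg _]; exact: smoothM.
by have [_ ->] := fdE w0 Dz (fdM (ycF yf Dz) (ycF yg Dz)); rewrite mul0r mulr0 addr0.
Qed.

Let ycV f : yc f -> (forall z, D z -> f z != 0) -> yc (fun z => (f z)^-1).
Proof.
move=> yf f0; split=> [|z Dz]; first by case: yf => sf _; exact: smooth_inv.
have := @isd_inv R id (f z) 1 (f0 z Dz) (isd_id _) => I.
by have [_ ->] := fdE w0 Dz (fd_comp I (ycF yf Dz)); rewrite mulr0.
Qed.

Let ycX f : yc f -> yc (X f).
Proof.
move=> yf; have [sf Yf] := yf; split=> [|z Dz]; first exact: sX.
rewrite (comm_XY oD s1 s2 (rg_cr1 rg) (rg_cr2 rg) w0 sf Dz).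
have N : \forall v \near z, 0 = Y f v by apply: filterS (nD Dz) => v Dv; rewrite Yf.
by have [-> _] := fdE w0 Dz (fd_near N (fd_cst w1 w2 0 z)).
Qed.

Let yck : yc k.
Proof.
split=> [|z Dz]; first exact: (rg_k rg).
have F : fd w1 w2 k z (2 * P (k z)) 0 by apply: pd_eq (rg_pd rg Dz) _ _; ring.
by have [_ ->] := fdE w0 Dz F.
Qed.

Let ycP : yc (fun z => P (k z)).
Proof.
have h : yc (fun z => - 3^-1 * (k z + - K1) * (k z + - K2) * (k z + (K1 + K2))).
  exact: (ycM (ycM (ycM (yc_cst _) (ycD yck (yc_cst _))) (ycD yck (yc_cst _))) (ycD yck (yc_cst _))).
rewrite (_ : (fun z => P (k z)) = fun z => - 3^-1 * (k z + - K1) * (k z + - K2) * (k z + (K1 + K2))) //.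
by apply/funext => z; rewrite /pcubic; ring.
Qed.

Definition r2 z := 16 * (P (k z) * P (k z)) * (H z * H z + (- 1 * k z + c)).

Let yc_r2 : yc r2.
Proof.
have yH : yc H by split.
exact: (ycM (ycM (yc_cst 16) (ycM ycP ycP)) (ycD (ycM yH yH) (ycD (ycM (yc_cst (- 1)) yck) (yc_cst c)))).
Qed.

Let gau2 z : D z -> a z * a z + b z * b z = r2 z.
Proof. by move=> Dz; rewrite -!expr2 gau // /r2; ring. Qed.

Let r2n z : D z -> r2 z != 0.
Proof. by move=> Dz; rewrite -gau2 // -!expr2; exact: numb. Qed.

Definition Gf z := 4 * P (k z) * X H z * (r2 z)^-1.
(** The logarithmic derivative along X of the modulus of a + i b. *)
Definition rh z := X r2 z * (2 * r2 z)^-1.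

Let ycG : yc Gf.
Proof.
have yH : yc H by split.
exact: (ycM (ycM (ycM (yc_cst 4) ycP) (ycX yH)) (ycV yc_r2 r2n)).
Qed.

Let yc_rh : yc rh.
Proof.
have n z : D z -> 2 * r2 z != 0 by move=> Dz; rewrite mulf_neq0 // r2n.
exact: (ycM (ycX yc_r2) (ycV (ycM (yc_cst 2) yc_r2) n)).
Qed.

(* [a + i b] rotates at speed [tf] along [Y]. *)
Let tf z := rh z - Gf z * a z.

Let sys z : D z -> [/\ X a z = a z * rh z + Gf z * b z ^+ 2, X b z = b z * tf z,
  Y a z = - (b z * tf z) & Y b z = a z * tf z].
Proof.
move=> Dz; have fa := FD sa Dz; have fb := FD sb Dz; have n0 := r2n Dz.
have [h3 h4] := fd_on Dz gau2 (fdD (fdM fa fa) (fdM fb fb)) (ycF yc_r2 Dz).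
have e := gau2 Dz; rewrite -!expr2 in e.
apply: (solve_system n0 e (cod1 Dz)).
- by rewrite cod2 // /Gf divfK.
- have -> : rh z * r2 z = X r2 z / 2 by rewrite /rh; field; exact: n0.
  by rewrite -h3; field.
by move: h4; lra.
Qed.

(** Integrability of [sys], from the commutation of X and Y on [a] and on [b]. *)
Let mainQ z : D z -> a z * X Gf z = X rh z - Gf z ^+ 2 * r2 z.
Proof.
move=> Dz; have fa := FD sa Dz; have fb := FD sb Dz; have n0 := r2n Dz.
have fG := ycF ycG Dz; have fr := ycF yc_rh Dz.
have [xa xb ya yb] := sys Dz; rewrite xa ya in fa; rewrite xb yb in fb.
have ft := fdB fr (fdM fG fa).
have Xa v : D v -> a v * rh v + Gf v * (b v * b v) = X a v by move=> /sys [-> _ _ _]; rewrite expr2.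
have Xb v : D v -> b v * (rh v - Gf v * a v) = X b v by move=> /sys [_ -> _ _].
have Ya v : D v -> - (b v * (rh v - Gf v * a v)) = Y a v by move=> /sys [_ _ -> _].
have Yb v : D v -> a v * (rh v - Gf v * a v) = Y b v by move=> /sys [_ _ _ ->].
have sYa : smooth_on D (Y a) by exact: smooth_Y.
have sYb : smooth_on D (Y b) by exact: smooth_Y.
have [_ c1] := fd_on Dz Xa (fdD (fdM fa fr) (fdM fG (fdM fb fb))) (FD (sX sa) Dz).
have [_ c2] := fd_on Dz Xb (fdM fb ft) (FD (sX sb) Dz).
have [c3 _] := fd_on Dz Ya (fdN (fdM fb ft)) (FD sYa Dz).
have [c4 _] := fd_on Dz Yb (fdM fa ft) (FD sYb Dz).
have C1 := comm_XY oD s1 s2 (rg_cr1 rg) (rg_cr2 rg) w0 sa Dz.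
have C2 := comm_XY oD s1 s2 (rg_cr1 rg) (rg_cr2 rg) w0 sb Dz.
rewrite -c1 -c3 in C1; rewrite -c2 -c4 in C2.
have e := gau2 Dz; rewrite -!expr2 in e.
exact: (commute_system n0 e C1 C2).
Qed.

(** Y is applied to [mainQ]: it kills every factor except [a], and Y a = - b t. *)
Let bt0 z : D z -> b z * tf z * X Gf z = 0.
Proof.
move=> Dz; have fa := FD sa Dz; have [_ _ ya _] := sys Dz; rewrite ya in fa.
have y2 : yc (fun z => X rh z + -1 * (Gf z * Gf z * r2 z)).
  exact: (ycD (ycX yc_rh) (ycM (yc_cst (- 1)) (ycM (ycM ycG ycG) yc_r2))).
have e v : D v -> a v * X Gf v = X rh v + -1 * (Gf v * Gf v * r2 v).
  by move=> /mainQ ->; ring.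
have [_ h] := fd_on Dz e (fdM fa (ycF (ycX ycG) Dz)) (ycF y2 Dz).
by move: h; rewrite mulr0 addr0 mulNr => /eqP; rewrite oppr_eq0 => /eqP.
Qed.

Let st : smooth_on D tf.
Proof.
by have [sG _] := ycG; have [sr _] := yc_rh; apply: smoothB => //; exact: smoothM.
Qed.

(** Otherwise [b] vanishes on an open set, and Y b = a t forces [a] to vanish as well, which [numb]
    excludes. *)
Lemma t_XG z : D z -> tf z * X Gf z = 0.
Proof.
move=> Dz; apply/eqP; apply: contraT => n0; exfalso.
have sG : smooth_on D (X Gf) by apply: sX; have [] := ycG.
have cn : {for z, continuous (fun z => tf z * X Gf z)} := smooth_cont (smoothM oD st sG) Dz.
have nb : \forall v \near z, 0 = b v.
  apply: (@filterS2 _ _ (nbhs_filter z) _ _ _ _ (ccont_neq0 cn n0) (nD Dz)) => v nv Dv.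
  by have /eqP := bt0 Dv; rewrite -mulrA mulf_eq0 (negPf nv) orbF => /eqP.
have b0 : b z = 0 by rewrite -(nbhs_singleton nb).
have [_ h] := fdE w0 Dz (fd_near nb (fd_cst w1 w2 0 z)).
have [_ _ _ yb] := sys Dz; move: yb; rewrite h => /esym/eqP; rewrite mulf_eq0.
have /negPf -> : tf z != 0 by apply: contraNneq n0 => ->; rewrite mul0r.
rewrite orbF => /eqP a0; have := numb Dz; by rewrite a0 b0 expr0n addr0 eqxx.
Qed.

(** Where [tf] is not 0, [Gf] is a constant C, which amounts to h' = 2 C (h^2 - k + c). Then [mainQ]
    becomes a second equation for h, and [riccati_exclusion] refutes the pair. *)
Lemma t_zero z1 : D z1 -> tf z1 = 0.
Proof.
move=> D1; apply/eqP; apply: contraT => n0; exfalso.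
have /near_boxP [r0 r00 Hr0] : \forall v \near z1, D v /\ tf v != 0.
  exact: (@filterI _ _ (nbhs_filter z1) _ _ (nD D1) (ccont_neq0 (smooth_cont st D1) n0)).
have sub : box z1 r0 `<=` D by move=> v /Hr0 [].
have XG v : box z1 r0 v -> X Gf v = 0.
  move=> /Hr0 [Dv tv]; have /eqP := t_XG Dv.
  by rewrite mulf_eq0 (negPf tv) => /eqP.
pose C := Gf z1.
have GC v : box z1 r0 v -> Gf v = C.
  apply: (@box_const R Gf z1 r0) => u bu.
  have F := fd_eq (ycF ycG (sub _ bu)) (XG u bu) (erefl 0).
  by apply: pd_eq F _ _; ring.
have rg1 := regular_sub rg r00 sub.
have [rho [dl [rho0 rr dl0 onto lev]]] := level_onto rg1.
have [h [sh hE]] := lev H (smooth_sub sub sH) (fun z bz => YH (sub z bz)).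
pose s := (K1 ^+ 2 + K1 * K2 + K2 ^+ 2) / 3.
pose p' (x : R) := - x ^+ 2 + s.
pose E x := h x * h x + (- 1 * x + c).
have ob : open (box z1 rho) := @box_open R z1 rho.
have b0 v : box z1 rho v -> box z1 r0 v by exact: box_sub.
have facts v : box z1 rho v -> [/\ E (k v) != 0, is_derive (k v) 1 h (2 * C * E (k v)) &
    r2 v = 16 * (P (k v) * P (k v)) * E (k v)].
  move=> bv; have Dv := sub _ (b0 _ bv); have [smh Hv] := hE v bv.
  have Er : r2 v = 16 * (P (k v) * P (k v)) * E (k v) by rewrite /r2 Hv.
  have P0 : P (k v) != 0 by rewrite gt_eqF // (rg_pos rg Dv).
  have E0 : E (k v) != 0.
    by apply: contraNneq (r2n Dv) => e0; rewrite Er e0 mulr0.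
  split=> //; have dh := sm1_isd smh; apply: isd_eq dh _.
  have nb : \forall u \near v, H u = h (k u).
    by apply: filterS (open_near ob bv) => u /hE [].
  have Fk : fd w1 w2 k v (2 * P (k v)) 0 by apply: pd_eq (rg_pd rg Dv) _ _; ring.
  have [xh _] := fdE w0 Dv (FD sH Dv).
  have [xh2 _] := fd_uniq (w0 Dv) (fd_near nb (FD sH Dv)) (fd_comp (sm1_isd smh) Fk).
  have := GC v (b0 _ bv); rewrite /Gf xh2 Er => g.
  have n16 : 16 * (P (k v) * P (k v)) != 0 by apply: mulf_neq0 (mulf_neq0 P0 P0); rewrite pnatr_eq0.
  have n8 : 8 * (P (k v) * P (k v)) != 0 by apply: mulf_neq0 (mulf_neq0 P0 P0); rewrite pnatr_eq0.
  apply: (mulfI n8); rewrite -g; field; rewrite E0 P0 //.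
(* The value of [rh] as a function of [k], from r2 = 16 P^2 E, E' = 4 C h E - 1 and X k = 2 P. *)
pose RR x := 2 * p' x + P x * (4 * C * h x - (E x)^-1).
have dE v : box z1 rho v -> is_derive (k v) 1 E (4 * C * h (k v) * E (k v) - 1).
  move=> bv; have [_ dh _] := facts v bv.
  apply: isd_eq (isdD (isdM dh dh) (isdD (isdM (isd_cst (- 1) (k v)) (isd_id (k v))) (isd_cst c (k v)))) _.
  by ring.
have dp (x : R) : is_derive x 1 P (p' x) by exact: isd_pcubic.
have dp' (x : R) : is_derive x 1 p' (- 2 * x) by rewrite /p'; isd_auto; ring.
have Fk v : D v -> fd w1 w2 k v (2 * P (k v)) 0 by move=> Dv; apply: pd_eq (rg_pd rg Dv) _ _; ring.
have rhE v : box z1 rho v -> rh v = RR (k v).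
  move=> bv; have Dv := sub _ (b0 _ bv); have [E0 dh Er] := facts v bv.
  have P0 : P (k v) != 0 by rewrite gt_eqF // (rg_pos rg Dv).
  have nb : \forall u \near v, 16 * (P (k u) * P (k u)) * E (k u) = r2 u.
    by apply: filterS (open_near ob bv) => u bu; have [_ _ ->] := facts u bu.
  have d16 := isdM (isdM (isd_cst 16 (k v)) (isdM (dp (k v)) (dp (k v)))) (dE v bv).
  have [x1 _] := fd_uniq (w0 Dv) (fd_near nb (fd_comp d16 (Fk v Dv))) (ycF yc_r2 Dv).
  rewrite /rh -x1 Er /RR; field; by rewrite E0 P0.
have key v : box z1 rho v -> (p' (k v) + P (k v) * (E (k v))^-1) *
    (- (4 * C * h (k v) * (E (k v))^-1) + (E (k v))^-1 ^+ 2) = - 4 * k v * (E (k v))^-1.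
  move=> bv; have Dv := sub _ (b0 _ bv); have [E0 dh Er] := facts v bv.
  have P0 : P (k v) != 0 by rewrite gt_eqF // (rg_pos rg Dv).
  have nb : \forall u \near v, RR (k u) = rh u.
    by apply: filterS (open_near ob bv) => u /rhE.
  have dR := isdD (isdM (isd_cst 2 (k v)) (dp' (k v))) (isdM (dp (k v))
    (isdB (isdM (isd_cst (4 * C) (k v)) dh) (isd_inv E0 (dE v bv)))).
  have [x1 _] := fd_uniq (w0 Dv) (fd_near nb (fd_comp dR (Fk v Dv))) (ycF yc_rh Dv).
  have := mainQ Dv; rewrite (XG v (b0 _ bv)) mulr0 => /esym/eqP; rewrite subr_eq0 => /eqP.
  rewrite -x1 (GC v (b0 _ bv)) Er => m; apply: (exclusion_algebra P0 E0).
  by rewrite -m; congr (_ * _); ring.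
pose k1 := k z1.
have onto' (x : R) : k1 - dl < x < k1 + dl -> exists2 z, box z1 rho z & k z = x.
  by move=> hx; apply: onto; move: hx; rewrite ltr_norml -/k1; move: (k1) (dl) => u v; lra.
have ltk : k1 - dl < k1 + dl by move: dl0; lra.
(* With these e - e' / e = 4 C h, whose derivative is 8 C^2 E; hence the constant 8 C^2 below. *)
pose e x := (E x)^-1; pose e' x := - (4 * C * h x * e x) + e x ^+ 2.
apply: (@riccati_exclusion R e e' s (- (K1 * K2 * (K1 + K2)) / 3) (8 * C ^+ 2) _ _ ltk) => x hx.
- have [z bz <-] := onto' x hx; have [E0 dh _] := facts z bz; split; first by rewrite invr_neq0.
  by apply: isd_eq (isd_inv E0 (dE z bz)) _; rewrite /e' /e; field.
- have [z bz <-] := onto' x hx; have := key z bz; rewrite -/(e (k z)) -/(e' (k z)) => <-.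
  by congr (_ * _); rewrite /p' /pcubic /s; field.
have [z bz ez] := onto' x hx; have [E0 dh _] := facts z bz; rewrite ez in E0 dh.
have dh4 := isdM (isd_cst (4 * C) x) dh.
have nb : \forall y \near x, 4 * C * h y = e y - e' y / e y.
  have /near_itvP : exists2 q, 0 < q & forall y, `|y - x| < q -> 4 * C * h y = e y - e' y / e y.
    exists (Num.min (x - (k1 - dl)) (k1 + dl - x)).
      by case/andP: hx => h1 h2; rewrite lt_min !subr_gt0 h1 h2.
    move=> y; rewrite lt_min !ltr_norml => /andP[/andP[y1 y2] /andP[y3 y4]].
    have hy : k1 - dl < y < k1 + dl by apply/andP; lra.
    have [u bu <-] := onto' y hy; have [Eu _ _] := facts u bu.
    by rewrite /e' /e; field.
  exact.
apply: isd_eq (isd_near nb dh4) _; rewrite /e; field; exact: E0.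
Qed.

Lemma final_system z : D z -> [/\ Y a z = 0, X b z = 0, Y b z = 0, X a z = 4 * P (k z) * X H z &
  X r2 z = 2 * (4 * P (k z) * X H z) * a z].
Proof.
move=> Dz; have [xa xb ya yb] := sys Dz; have t0 := t_zero Dz; have n0 := r2n Dz.
rewrite t0 !mulr0 ?oppr0 in xb ya yb.
have g : Gf z * r2 z = 4 * P (k z) * X H z by rewrite /Gf divfK.
have rE : rh z = Gf z * a z by move/eqP: t0; rewrite /tf subr_eq0 => /eqP.
split=> //; first by rewrite xa rE -g -gau2 //; ring.
have -> : X r2 z = 2 * (rh z * r2 z) by rewrite /rh; field.
by rewrite rE -g; ring.
Qed.

End Analysis.

(** * The equation for the mean curvature *)

Section PolyIsolated.
Context {R : realType}.

Lemma poly_order (q : {poly R}) (x0 : R) : q != 0 -> exists (m : nat) (e d : R),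
  [/\ 0 < e, 0 < d & forall x, `|x - x0| < d -> e * `|x - x0| ^+ m <= `|q.[x]|].
Proof.
move=> q0; have [m [s]] := multiplicity_XsubC q x0; rewrite q0 /= => s0 ->.
have c : {for x0, continuous (fun x => s.[x])} by exact: continuous_horner.
have e0 : 0 < `|s.[x0]| / 2 by rewrite divr_gt0 // normr_gt0.
have /contP /(_ _ e0) [d d0 Hd] := c.
exists m, (`|s.[x0]| / 2), d; split=> // x /Hd hx.
rewrite hornerM horner_exp hornerXsubC normrM normrX ler_wpM2r ?exprn_ge0 //.
have := ler_normD (s.[x0] - s.[x]) s.[x]; rewrite subrK (distrC s.[x0]).
by move: hx; move: (`|_|) (`|_|) (`|_|) => u v w; lra.
Qed.

Lemma poly_isolated (q : {poly R}) (x0 : R) : q != 0 ->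
  exists2 d, 0 < d & forall x, `|x - x0| < d -> x != x0 -> q.[x] != 0.
Proof.
move=> /(poly_order x0) [m [e [d [e0 d0 H]]]]; exists d => // x hx nx.
rewrite -normr_gt0; apply: lt_le_trans (H x hx); rewrite mulr_gt0 // exprn_gt0 //.
by rewrite normr_gt0 subr_eq0.
Qed.

Definition cubic_poly (K1 K2 : R) : {poly R} :=
  (- 3^-1)%:P * ('X - K1%:P) * ('X - K2%:P) * ('X + (K1 + K2)%:P).

Lemma cubic_polyE K1 K2 x : (cubic_poly K1 K2).[x] = pcubic K1 K2 x.
Proof. by rewrite /cubic_poly /pcubic !(hornerM, hornerD, hornerC, hornerX, hornerXsubC, hornerN) addrA. Qed.

(** At the root [K1] only the constant [c] is left, so it would be 0; then a nonconstant affine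
    function would vanish wherever the cubic is positive. *)
Lemma cubic_comb_neq0 (K1 K2 a b c x0 d : R) : a != 0 -> 0 < d -> (forall x, `|x - x0| < d -> 0 < pcubic K1 K2 x) ->
  cubic_poly K1 K2 ^+ 2 * (a%:P * 'X + b%:P) + c%:P != 0.
Proof.
move=> a0 d0 pos; apply/eqP => E.
have Ex x : pcubic K1 K2 x ^+ 2 * (a * x + b) + c = 0.
  move: (cubic_poly K1 K2) (cubic_polyE K1 K2) E => q <- /(congr1 (horner^~ x)).
  by rewrite !hornerE.
have c0 : c = 0 by have := Ex K1; rewrite /pcubic subrr !(mulr0, mul0r) expr0n /= mul0r add0r.
have lin x : `|x - x0| < d -> a * x + b = 0.
  move=> /pos px; have /eqP := Ex x; rewrite c0 addr0 mulf_eq0 expf_eq0 /=.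
  by rewrite gt_eqF //= => /eqP.
have h0 := lin x0; have h1 := lin (x0 + d / 2).
rewrite subrr normr0 in h0; rewrite addrC addKr gtr0_norm ?divr_gt0 // in h1.
have {}h0 := h0 d0; have {}h1 : a * (x0 + d / 2) + b = 0 by apply: h1; lra.
have /eqP : a * (d / 2) = 0 by rewrite -[RHS](subrr 0) -{1}h1 -h0; ring.
by rewrite mulf_eq0 (negPf a0) mulf_eq0 invr_eq0 pnatr_eq0 orbF gt_eqF.
Qed.

End PolyIsolated.

Section SmoothLine.
Context {R : realType}.
Variable I : set R.
Hypothesis oI : open I.
Definition sm1on (f : R -> R) := forall x, I x -> sm1 f x.

Lemma sm1onD f g : sm1on f -> sm1on g -> sm1on (fun x => f x + g x).
Proof.
move=> sf sg; apply: smooth_sm1; apply: (@smoothD R (strip I) (fun z => f (complex.Re z)) (fun z => g (complex.Re z))).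
- exact: strip_open.
- exact: sm1_smooth.
exact: sm1_smooth.
Qed.

Lemma sm1onM f g : sm1on f -> sm1on g -> sm1on (fun x => f x * g x).
Proof.
move=> sf sg; apply: smooth_sm1; apply: (@smoothM R (strip I) (fun z => f (complex.Re z)) (fun z => g (complex.Re z))).
- exact: strip_open.
- exact: sm1_smooth.
exact: sm1_smooth.
Qed.

Lemma sm1on_cst t : sm1on (fun=> t).
Proof. by apply: smooth_sm1; apply: smooth_cst; exact: strip_open. Qed.

Lemma sm1on_id : sm1on id.
Proof. by apply: smooth_sm1; apply: smooth_Re; exact: strip_open. Qed.

Lemma sm1onV f : sm1on f -> (forall x, I x -> f x != 0) -> sm1on (fun x => (f x)^-1).
Proof.
move=> sf f0; apply: smooth_sm1; apply: (@smooth_inv R (strip I) (fun z => f (complex.Re z))).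
- exact: strip_open.
- exact: sm1_smooth.
by move=> z; exact: f0.
Qed.

Lemma sm1on_d f : sm1on f -> sm1on (derive1 f).
Proof. by move=> sf x Ix; apply: sm1_derive1; exact: sf. Qed.

Lemma sm1on_pcubic (K1 K2 : R) : sm1on (pcubic K1 K2).
Proof.
have c := sm1on_cst; have i := sm1on_id.
have h := sm1onM (sm1onM (sm1onM (c (- 3^-1)) (sm1onD i (c (- K1)))) (sm1onD i (c (- K2)))) (sm1onD i (c (K1 + K2))).
have -> // : pcubic K1 K2 = (fun x => - 3^-1 * (x + - K1) * (x + - K2) * (x + (K1 + K2))).
by apply/funext => x; rewrite /pcubic addrA.
Qed.

End SmoothLine.

Section Isolated.
Context {R : realType}.
Variables (K1 K2 c A k0 dl : R) (h al P : R -> R).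
Hypothesis dl0 : 0 < dl.
Let I : set R := [set x | `|x - k0| < dl].
Hypothesis PE : forall x, P x = pcubic K1 K2 x.
Hypothesis sh : sm1on I h.
Hypothesis sal : sm1on I al.
Hypothesis Ppos : forall x, I x -> 0 < P x.
Hypothesis al' : forall x, I x -> derive1 al x = 4 * P x * derive1 h x.
Hypothesis al2 : forall x, I x -> al x ^+ 2 = 16 * (P x ^+ 2 * (h x ^+ 2 - x + c) - A ^+ 2).

Let oI : open I.
Proof.
rewrite openE => x hx; apply/near_itvP; exists (dl - `|x - k0|); first by rewrite subr_gt0.
move=> y hy; rewrite /I /= -(subrKA x); apply: le_lt_trans (ler_normD _ _) _.
by move: hy; rewrite ltrBrDr.
Qed.

Let sP : sm1on I P.
Proof. by have -> : P = pcubic K1 K2 by [apply/funext => x; rewrite PE]; exact: sm1on_pcubic. Qed.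

Let I0 : I k0. Proof. by rewrite /I /= subrr normr0. Qed.

Definition accum (f : R -> R) := forall d, 0 < d -> exists x, [/\ 0 < `|x - k0|, `|x - k0| < d & f x = 0].

Lemma accum0 f : {for k0, continuous f} -> accum f -> f k0 = 0.
Proof.
move=> /contP cf acf; apply/eqP; apply: contraT => n0; exfalso.
have e0 : 0 < `|f k0| by rewrite normr_gt0.
have [d d0 Hd] := cf _ e0; have [x [_ xd fx]] := acf d d0.
by have := Hd x xd; rewrite fx sub0r normrN ltxx.
Qed.

(** By continuity f(k0) = 0, and Rolle's theorem applies between [k0] and each nearby zero. *)
Lemma accum_derive f : sm1on I f -> accum f -> accum (derive1 f).
Proof.
move=> sf acf d d0; have f0 := accum0 (isd_cont (sm1_isd (sf _ I0))) acf.
have md : 0 < Num.min d dl by rewrite lt_min d0.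
have [x [x0 xd fx]] := acf _ md.
move: xd; rewrite lt_min => /andP[xd xdl].
have D (t : R) : `|t - k0| <= `|x - k0| -> is_derive t 1 f (derive1 f t).
  by move=> ht; apply: sm1_isd; apply: sf; exact: le_lt_trans ht xdl.
have Dc (t : R) : `|t - k0| <= `|x - k0| -> {for t, continuous f} by move=> /D; exact: isd_cont.
have nx : x - k0 != 0 by rewrite -normr_gt0.
have [xk|kx|e] := ltgtP x k0; last by rewrite e subrr eqxx in nx.
  have b t : x <= t <= k0 -> `|t - k0| <= `|x - k0|.
    by move=> /andP[t1 t2]; rewrite !ler0_norm ?subr_le0 ?(ltW xk) // lerN2 lerD2r.
  have [t /andP[t1 t2] E] := mvt xk (fun t ht => D t (b t ht)).
  exists t; split.
  - by rewrite normr_gt0 subr_eq0 lt_eqF.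
  - by apply: le_lt_trans xd; apply: b; rewrite !ltW.
  move/eqP: E; rewrite f0 fx subrr eq_sym mulf_eq0 subr_eq0 => /orP[/eqP //|/eqP e].
  by move: xk; rewrite e ltxx.
have b t : k0 <= t <= x -> `|t - k0| <= `|x - k0|.
  by move=> /andP[t1 t2]; rewrite !ger0_norm ?subr_ge0 ?(ltW kx) // lerD2r.
have [t /andP[t1 t2] E] := mvt kx (fun t ht => D t (b t ht)).
exists t; split.
- by rewrite normr_gt0 subr_eq0 gt_eqF.
- by apply: le_lt_trans xd; apply: b; rewrite !ltW.
move/eqP: E; rewrite f0 fx subrr eq_sym mulf_eq0 subr_eq0 => /orP[/eqP //|/eqP e].
by move: kx; rewrite e ltxx.
Qed.

(* Contains every derivative of each of its members: all of them vanish to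
   infinite order at [k0] when the zeros of [al] accumulate there. *)
Inductive flat : (R -> R) -> Prop :=
| flat_al n s of sm1on I s : flat (fun x => derive1n n al x * s x)
| flat_h s of sm1on I s : flat (fun x => (h x - h k0) * s x)
| flatD f g of flat f & flat g : flat (fun x => f x + g x).

Lemma derive1n_sm1 n f : sm1on I f -> sm1on I (derive1n n f).
Proof. by move=> sf; elim: n => [|n IH]; [exact: sf|rewrite derive1nS; exact: (sm1on_d IH)]. Qed.

Lemma flat_derive f : flat f -> exists2 f', flat f' & forall x, I x -> is_derive x 1 f (f' x).
Proof.
elim=> [n s ss|s ss|f1 g1 _ [f' Ff Df] _ [g' Gg Dg]].
- exists (fun x => derive1n n.+1 al x * s x + derive1n n al x * derive1 s x).
    exact: flatD (@flat_al n.+1 s ss) (@flat_al n _ (sm1on_d ss)).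
  move=> x Ix; have d1 := sm1_isd (@derive1n_sm1 n al sal x Ix); have d2 := sm1_isd (ss x Ix).
  by apply: isd_eq (isdM d1 d2) _; rewrite derive1nS.
- exists (fun x => derive1n 1 al x * (s x * (4 * P x)^-1) + (h x - h k0) * derive1 s x).
    have n0 x : I x -> 4 * P x != 0.
      by move=> /Ppos px; apply: mulf_neq0; [rewrite pnatr_eq0|rewrite gt_eqF].
    have sv := sm1onV oI (sm1onM oI (@sm1on_cst R I oI 4) sP) n0.
    exact: flatD (@flat_al 1 _ (sm1onM oI ss sv)) (@flat_h _ (sm1on_d ss)).
  move=> x Ix; have d1 := sm1_isd (sh Ix); have d2 := sm1_isd (ss x Ix).
  have px := Ppos Ix.
  apply: isd_eq (isdM (isdB d1 (isd_cst (h k0) x)) d2) _; rewrite derive1n1 (al' Ix).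
  by move: (P x) px => p p0; field; rewrite gt_eqF.
exists (fun x => f' x + g' x); first exact: flatD.
by move=> x Ix; apply: isdD; [exact: Df|exact: Dg].
Qed.

(** All members vanish at [k0] and their derivatives are members; by the mean value theorem a bound
    for the derivative gains one order for the function. *)
Lemma flat_order f : accum al -> flat f -> forall n, exists C d, [/\ 0 <= C, 0 < d, d <= dl &
  forall x, `|x - k0| < d -> `|f x| <= C * `|x - k0| ^+ n].
Proof.
move=> acc Ff n.
have accn m : accum (derive1n m al).
  elim: m => [|m IH]; first exact: acc.
  by rewrite derive1nS; exact: (accum_derive (@derive1n_sm1 m al sal) IH).
elim: n f Ff => [|n IH] f Ff.
  have [f' _ Df] := flat_derive Ff; have /contP /(_ _ ltr01) [d d0 Hd] := isd_cont (Df _ I0).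
  exists (`|f k0| + 1), (Num.min d dl); rewrite addr_ge0 // lt_min d0 ge_min lexx orbT; split=> // x.
  rewrite lt_min expr0 mulr1 => /andP[/Hd hx _].
  by rewrite -(subrK (f k0) (f x)) addrC; apply: le_trans (ler_normD _ _) _; rewrite lerD2l ltW.
have [f' Ff' Df] := flat_derive Ff; have [C [d [C0 d0 ddl Hd]]] := IH f' Ff'.
have fk : f k0 = 0.
  elim: Ff => [m s ss|s ss|f1 g1 _ e1 _ e2].
  - rewrite (accum0 _ (accn m)) ?mul0r //; exact: isd_cont (sm1_isd (@derive1n_sm1 m al sal k0 I0)).
  - by rewrite subrr mul0r.
  by rewrite e1 e2 addr0.
exists C, d; split=> // x hx.
have D (t : R) : `|t - k0| <= `|x - k0| -> is_derive t 1 f (f' t).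
  by move=> ht; apply: Df; apply: le_lt_trans ht _; exact: lt_le_trans hx ddl.
have [t ht E] := mvt_dist D; rewrite fk subr0 in E; rewrite E normrM exprSr mulrA ler_wpM2r //.
apply: le_trans (Hd t (le_lt_trans ht hx)) _; rewrite ler_wpM2l //.
by apply: lerXn2r => //; rewrite nnegrE.
Qed.

(** Freezing h at h(k0) in al^2 / 16 gives the polynomial [Q]. If zeros of [al] accumulated, [al]
    and h - h(k0) would be flat, hence [Q] too; but a nonzero polynomial has finite order. *)
Lemma al_isolated : exists d, [/\ 0 < d, d <= dl & forall x, `|x - k0| < d -> x != k0 -> al x != 0].
Proof.
apply: contrapT => nex.
have acc : accum al.
  move=> d d0; apply: contrapT => nx; apply: nex; exists (Num.min d dl).
  rewrite lt_min d0 ge_min lexx orbT; split=> // x; rewrite lt_min => /andP[xd _] xk.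
  by apply/eqP => a0; apply: nx; exists x; rewrite normr_gt0 subr_eq0.
pose Q : {poly R} := cubic_poly K1 K2 ^+ 2 * ((-1)%:P * 'X + (h k0 ^+ 2 + c)%:P) + (- A ^+ 2)%:P.
have Q0 : Q != 0.
  apply: (@cubic_comb_neq0 R K1 K2 (-1) (h k0 ^+ 2 + c) (- A ^+ 2) k0 dl _ dl0); first by rewrite oppr_eq0 oner_neq0.
  by move=> x hx; rewrite -PE; exact: Ppos.
have QE x : Q.[x] = P x ^+ 2 * (- x + (h k0 ^+ 2 + c)) - A ^+ 2.
  by rewrite /Q PE; move: (cubic_poly K1 K2) (cubic_polyE K1 K2) => q <-; rewrite !hornerE mulN1r.
have FQ : flat (fun x => derive1n 0 al x * (al x * 16^-1) + (h x - h k0) * (-1 * (P x * P x) * (h x + h k0))).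
  have sc t : sm1on I (fun=> t) by exact: sm1on_cst.
  exact: flatD (@flat_al 0 _ (sm1onM oI sal (sc 16^-1)))
    (@flat_h _ (sm1onM oI (sm1onM oI (sc (-1)) (sm1onM oI sP sP)) (sm1onD oI sh (sc (h k0))))).
have [m [e [d1 [e0 d10 H1]]]] := poly_order k0 Q0.
have [C [d2 [C0 d20 ddl H2]]] := flat_order acc FQ m.+1.
have m0 : 0 < Num.min d2 (e / (C + 1)) by rewrite lt_min d20 divr_gt0 // ltr_wpDl.
have [t [t0 t1 t2]] := ex_lt2 d10 m0.
move: t2; rewrite lt_min => /andP[t2]; rewrite ltr_pdivlMr ?ltr_wpDl // => t3.
have tE : `|k0 + t - k0| = t by rewrite addrC addKr gtr0_norm.
have := H1 (k0 + t); have := H2 (k0 + t); rewrite tE => /(_ t2) h2 /(_ t1) h1.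
have It : I (k0 + t) by rewrite /I /= tE; exact: lt_le_trans t2 ddl.
have QQ : Q.[k0 + t] = derive1n 0 al (k0 + t) * (al (k0 + t) * 16^-1) +
  (h (k0 + t) - h k0) * (-1 * (P (k0 + t) * P (k0 + t)) * (h (k0 + t) + h k0)).
  rewrite QE derive1n0.
  have -> : al (k0 + t) * (al (k0 + t) * 16^-1) = al (k0 + t) ^+ 2 / 16 by ring.
  by rewrite al2 //; field.
rewrite -QQ in h2; have := le_trans h1 h2.
rewrite exprSr mulrA -subr_ge0.
have tm : 0 < t ^+ m by rewrite exprn_gt0.
have -> : C * t ^+ m * t - e * t ^+ m = t ^+ m * (C * t - e) by ring.
rewrite pmulr_rge0 //; move: t3 t0; nra.
Qed.

End Isolated.

Section McSolution.
Context {R : realType}.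

(** The sign convention is that of [mc_ode], where the signed root is - al / 4. *)
Lemma const_sign (f : R -> R) (a b : R) : (forall x, a < x < b -> {for x, continuous f}) ->
  (forall x, a < x < b -> f x != 0) ->
  exists s : bool, forall x, a < x < b -> (-1) ^+ s * `|f x| = - f x.
Proof.
move=> cf f0; have [ba|ab] := leP b a.
  by exists false => x /andP[h1 h2]; have := lt_le_trans (lt_trans h1 h2) ba; rewrite ltxx.
have key x y : a < x < b -> a < y < b -> x <= y -> Num.min (f x) (f y) <= 0 <= Num.max (f x) (f y) -> False.
  move=> /andP[ax xb] /andP[ay yb] xy s0.
  have [|z zI fz] := @IVT R f x y 0 xy _ s0.
    apply: within_cont => t /andP[xt ty]; apply: cf.
    by rewrite (lt_le_trans ax xt) (le_lt_trans ty yb).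
  move: zI; rewrite in_itv /= => /andP[xz zy].
  have : f z != 0 by apply: f0; rewrite (lt_le_trans ax xz) (le_lt_trans zy yb).
  by rewrite fz eqxx.
have key2 x y : a < x < b -> a < y < b -> f x <= 0 -> 0 <= f y -> False.
  move=> hx hy fx fy; case: (leP x y) => [xy|/ltW yx].
    by apply: (key x y hx hy xy); rewrite ge_min le_max fx fy orbT.
  by apply: (key y x hy hx yx); rewrite ge_min le_max fx fy orbT.
have m0 : a < (a + b) / 2 < b by lra.
exists (0 <= f ((a + b) / 2)) => x hx; case: leP => fm.
  rewrite expr1 mulN1r ger0_norm //; case: (leP 0 (f x)) => // /ltW fx.
  by case: (key2 x _ hx m0 fx fm).
rewrite expr0 mul1r ler0_norm //; case: (leP (f x) 0) => // /ltW fx.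
by case: (key2 _ x m0 hx (ltW fm) fx).
Qed.

Lemma mc_solution_of_alpha (K1 K2 c A k0 dl : R) (h al : R -> R) : 0 < dl ->
  (forall x, `|x - k0| < dl -> sm1 h x) -> (forall x, `|x - k0| < dl -> sm1 al x) ->
  (forall x, `|x - k0| < dl -> 0 < pcubic K1 K2 x) ->
  (forall x, `|x - k0| < dl -> derive1 al x = 4 * pcubic K1 K2 x * derive1 h x) ->
  (forall x, `|x - k0| < dl -> al x ^+ 2 = 16 * (pcubic K1 K2 x ^+ 2 * (h x ^+ 2 - x + c) - A ^+ 2)) ->
  (forall x, `|x - k0| < dl -> 0 < h x ^+ 2 - x + c) ->
  (forall x, `|x - k0| < dl -> derive1 h x * (4 * pcubic K1 K2 x * h x - al x) =
     2 * pcubic K1 K2 x - 4 * derive1 (pcubic K1 K2) x * (h x ^+ 2 - x + c)) ->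
  mc_solution K1 K2 c A h k0.
Proof.
move=> dl0 sh sal Ppos al' al2 Epos eqh.
have [d1 [d10 d1l alN]] : exists d, [/\ 0 < d, d <= dl & forall x, `|x - k0| < d -> x != k0 -> al x != 0].
  exact: (@al_isolated R K1 K2 c A k0 dl h al (pcubic K1 K2) dl0 (fun=> erefl) sh sal Ppos al' al2).
(* Where 4 P h = al, the relation for al^2 loses h and becomes P^2 (c - x) = A^2, a polynomial
   equation with isolated solutions. *)
have [d2 d20 DN] : exists2 d, 0 < d & forall x, `|x - k0| < d -> x != k0 -> `|x - k0| < dl ->
    4 * pcubic K1 K2 x * h x - al x != 0.
  have N1 : -1 != 0 :> R by rewrite oppr_eq0 oner_neq0.
  have [d d0 Hd] := @poly_isolated R _ k0 (@cubic_comb_neq0 R K1 K2 (-1) c (- A ^+ 2) k0 dl N1 dl0 Ppos).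
  exists d => // x xd xk /al2 al2x; apply: contra (Hd x xd xk) => /eqP D0.
  move: (cubic_poly K1 K2) (cubic_polyE K1 K2) => q qE; rewrite !hornerE qE.
  move: al2x D0; move: (pcubic K1 K2 x) (al x) (h x) => p a e al2x D0; apply/eqP.
  have aE : a = 4 * p * e by apply/eqP; rewrite eq_sym -subr_eq0 D0.
  have -> : p ^+ 2 * (- 1 * x + c) + - A ^+ 2 = (16 * (p ^+ 2 * (e ^+ 2 - x + c) - A ^+ 2) - (4 * p * e) ^+ 2) / 16 by field.
  by rewrite -al2x aE subrr mul0r.
have radE x : `|x - k0| < dl -> radicand K1 K2 c A h x = (al x / 4) ^+ 2.
  by move=> /al2 e; rewrite /radicand expr_div_n e; move: (pcubic _ _ _ ^+ 2 * _ - _) => t; field.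
have sqE x : `|x - k0| < dl -> Num.sqrt (radicand K1 K2 c A h x) = `|al x| / 4.
  by move=> /radE ->; rewrite sqrtr_sqr normrM normfV (@gtr0_norm _ 4).
have ode (s : bool) x : `|x - k0| < dl -> x != k0 -> `|x - k0| < d1 -> `|x - k0| < d2 ->
    (-1) ^+ s * `|al x| = - al x -> mc_ode K1 K2 c A s h x.
  move=> hx xk x1 x2 sE; rewrite /mc_ode sqE // mulrA sE radE //.
  have DE : 2 * (pcubic K1 K2 x * h x + - al x / 4) = (4 * pcubic K1 K2 x * h x - al x) / 2.
    by move: (pcubic _ _ _) => p; field.
  have D0 := DN x x2 xk hx; have eh := eqh x hx; have a0 := alN x x1 xk.
  split.
  - by rewrite exprn_even_gt0 //= mulf_eq0 invr_eq0 pnatr_eq0 orbF.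
  - apply/eqP => z0; move: DE; rewrite z0 mulr0 => /esym /eqP.
    by rewrite mulf_eq0 (negPf D0) invr_eq0 pnatr_eq0.
  rewrite DE; move: D0 eh; move: (4 * _ * _ - _) => d D0 eh.
  by apply: (mulIf D0); rewrite eh; field.
have acont x : `|x - k0| < dl -> {for x, continuous al}.
  by move=> /sal; move/sm1_isd; exact: isd_cont.
have [d [d0 dd1 dd2]] := ex_lt2 d10 d20.
have ddl := lt_le_trans dd1 d1l.
split.
- by apply/near_itvP; exists dl.
- by apply/near_itvP; exists dl.
have sub x : k0 - d < x < k0 + d -> `|x - k0| < d by rewrite ltr_distlC => /andP[? ?]; apply/andP; split; lra.
have fin (s : bool) (a b : R) : (forall x, a < x < b -> (-1) ^+ s * `|al x| = - al x) ->
    k0 - d <= a -> b <= k0 + d -> forall x, a < x < b -> x != k0 -> mc_ode K1 K2 c A s h x.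
  move=> Hs ha hb x hx xk; have xd : `|x - k0| < d by apply: sub; move/andP: hx => [? ?]; apply/andP; split; lra.
  apply: ode => //; [exact: lt_trans xd ddl|exact: lt_trans xd dd1|exact: lt_trans xd dd2|exact: Hs].
have left (s : bool) (a : R) : a < k0 -> (forall x, a < x < k0 -> mc_ode K1 K2 c A s h x) ->
    \forall k \near k0^'-, mc_ode K1 K2 c A s h k.
  move=> ak Hs; rewrite near_withinE; apply/near_itvP; exists (k0 - a); first by rewrite subr_gt0.
  by move=> t; rewrite ltr_distlC => /andP[t1 t2] tk; apply: Hs; rewrite tk andbT; lra.
have right (s : bool) (b : R) : k0 < b -> (forall x, k0 < x < b -> mc_ode K1 K2 c A s h x) ->
    \forall k \near k0^'+, mc_ode K1 K2 c A s h k.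
  move=> ak Hs; rewrite near_withinE; apply/near_itvP; exists (b - k0); first by rewrite subr_gt0.
  by move=> t; rewrite ltr_distlC => /andP[t1 t2] tk; apply: Hs; rewrite tk /=; lra.
have c0 (a b : R) : k0 - d <= a -> b <= k0 + d -> forall x, a < x < b -> {for x, continuous al}.
  move=> ha hb x /andP[x1 x2]; apply: acont; apply: lt_trans ddl; apply: sub; apply/andP; split; lra.
have n0 (a b : R) : k0 - d <= a -> b <= k0 + d -> forall x, a < x < b -> x != k0 -> al x != 0.
  move=> ha hb x /andP[x1 x2] xk; apply: alN => //; apply: lt_trans dd1; apply: sub; apply/andP; split; lra.
have l0 : k0 - d <= k0 - d by [].
have l1 : k0 <= k0 + d by lra.
have l2 : k0 - d <= k0 by lra.
have l3 : k0 + d <= k0 + d by [].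
have lt1 : k0 - d < k0 by lra.
have lt2 : k0 < k0 + d by lra.
have n1 (x : R) : k0 - d < x < k0 -> x != k0 by move=> /andP[_ h1]; rewrite lt_eqF.
have n2 (x : R) : k0 < x < k0 + d -> x != k0 by move=> /andP[h1 _]; rewrite gt_eqF.
(* If [al] vanishes at [k0], the two sides may carry different signs; otherwise one sign holds
   across. *)
have [ak0|ak0] := eqVneq (al k0) 0.
  have [s Hs] := const_sign (c0 _ _ l0 l1) (fun x hx => n0 _ _ l0 l1 x hx (n1 x hx)).
  have [s' Hs'] := const_sign (c0 _ _ l2 l3) (fun x hx => n0 _ _ l2 l3 x hx (n2 x hx)).
  exists s, s'; split.
  - by apply: (left s _ lt1) => x hx; exact: (fin s _ _ Hs l0 l1 x hx (n1 x hx)).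
  - by apply: (right s' _ lt2) => x hx; exact: (fin s' _ _ Hs' l2 l3 x hx (n2 x hx)).
  by right; rewrite radE ?ak0 ?mul0r ?expr0n // subrr normr0.
have [s Hs] : exists s : bool, forall x, k0 - d < x < k0 + d -> (-1) ^+ s * `|al x| = - al x.
  apply: const_sign (c0 _ _ l0 l3) _ => x hx.
  by have [->//|xk] := eqVneq x k0; exact: (n0 _ _ l0 l3 x hx xk).
exists s, s; split; last by left.
- apply: (left s _ lt1) => x hx; apply: (fin s _ _ Hs l0 l3 x _ (n1 x hx)).
  by move/andP: hx => [-> /lt_trans -> //].
apply: (right s _ lt2) => x hx; apply: (fin s _ _ Hs l0 l3 x _ (n2 x hx)).
by move/andP: hx => [/(lt_trans lt1) -> ->].
Qed.

End McSolution.

(** * From the immersion to the equation *)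

(** Equates two values of the X-derivative of a^2 + b^2: the one from 16 p^2 (h^2 - k + c), and 2 a
    X a with X a = 4 p X H, as [b] is constant. *)
Lemma ode_algebra (R : realType) (p p' e h h' a xr : R) : p != 0 ->
  xr = 16 * ((2 * p * p' * p + p * (2 * p * p')) * e + p * p * (h * (h' * (2 * p)) + (h' * (2 * p)) * h - 2 * p)) ->
  xr = 2 * (4 * p * (h' * (2 * p))) * a ->
  h' * (4 * p * h - a) = 2 * p - 4 * p' * e.
Proof.
move=> p0 -> E; have p2 : 16 * (p * p) != 0.
  by apply: mulf_neq0; [rewrite pnatr_eq0|exact: mulf_neq0].
apply: (mulfI p2).
have -> : 16 * (p * p) * (h' * (4 * p * h - a)) = 16 * (p * p) * h' * (4 * p * h) - 2 * (4 * p * (h' * (2 * p))) * a by ring.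
by rewrite -E; ring.
Qed.

Section Core.
Context {R : realType}.
Variables (K1 K2 c : R) (z0 : cplx R) (r : R) (k w1 w2 : cplx R -> R).
Hypothesis rg : regular (pcubic K1 K2) z0 r k w1 w2.
Local Notation P := (pcubic K1 K2).
Local Notation D := (box z0 r).
Local Notation X := (Xop w1 w2).
Local Notation Y := (Yop w1 w2).

(** By [final_system], [b] is a constant 4 A and [a] is a function [al] of the curvature. As all
    values near k(z0) are attained, the relations on the square are relations between h and [al]. *)
Lemma mc_of_system (a b H : cplx R -> R) : smooth_on D a -> smooth_on D b -> smooth_on D H ->
  (forall z, D z -> Y H z = 0) ->
  (forall z, D z -> Y a z + X b z = 0) ->
  (forall z, D z -> X a z - Y b z = 4 * P (k z) * X H z) ->
  (forall z, D z -> a z ^+ 2 + b z ^+ 2 = 16 * P (k z) ^+ 2 * (H z ^+ 2 - k z + c)) ->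
  (forall z, D z -> a z ^+ 2 + b z ^+ 2 != 0) ->
  exists A h, (exists2 e, 0 < e & forall z, box z0 e z -> H z = h (k z)) /\ mc_solution K1 K2 c A h (k z0).
Proof.
move=> sa sb sH YH cod1 cod2 gau numb.
have fin z (Dz : D z) := final_system rg sa sb sH YH cod1 cod2 gau numb Dz.
have w0 := rg_w0 rg.
have [rho [dl [rho0 rr dl0 onto lev]]] := level_onto rg.
have [h [sh hE]] := lev H sH YH.
have Ya z : D z -> Y a z = 0 by move=> /fin [].
have [al [sal alE]] := lev a sa Ya.
have sub : box z0 rho `<=` D by exact: box_sub.
have bE z : D z -> b z = b z0.
  apply: box_const => v Dv; have [_ xb yb _ _] := fin v Dv.
  by have := fd_smooth w0 sb Dv; rewrite xb yb => F; apply: pd_eq F _ _; ring.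
have fk z : D z -> fd w1 w2 k z (2 * P (k z)) 0.
  by move=> Dz; apply: pd_eq (rg_pd rg Dz) _ _; ring.
have nr z : box z0 rho z -> \forall v \near z, box z0 rho v.
  by move=> bz; apply: open_near bz; exact: box_open.
have XE f g z : smooth_on D f -> (forall v, box z0 rho v -> sm1 g (k v) /\ f v = g (k v)) -> box z0 rho z ->
    X f z = derive1 g (k z) * (2 * P (k z)).
  move=> sf gE bz; have Dz := sub z bz.
  have N : \forall v \near z, g (k v) = f v by apply: filterS (nr z bz) => v /gE [_ ->].
  by have [-> _] := fdE w0 Dz (fd_near N (fd_comp (sm1_isd (gE z bz).1) (fk z Dz))).
pose A := b z0 / 4.
exists A, h; split; first by exists rho => // z /hE [].
have p'E (x : R) : derive1 P x = - x ^+ 2 + (K1 ^+ 2 + K1 * K2 + K2 ^+ 2) / 3.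
  exact: isd_derive1 (isd_pcubic K1 K2 x).
have Ppos x : `|x - k z0| < dl -> 0 < P x.
  by move=> /onto [z bz <-]; apply: (rg_pos rg); exact: sub.
have P0 x : `|x - k z0| < dl -> P x != 0 by move=> /Ppos px; rewrite gt_eqF.
have G x : `|x - k z0| < dl -> al x ^+ 2 + b z0 ^+ 2 = 16 * P x ^+ 2 * (h x ^+ 2 - x + c).
  move=> /onto [z bz <-]; have := gau z (sub z bz).
  by rewrite (alE z bz).2 (hE z bz).2 (bE z (sub z bz)).
apply: (mc_solution_of_alpha dl0 sh sal Ppos).
- move=> x hx; have p0 := P0 x hx; have [z bz zx] := onto x hx; have Dz := sub z bz.
  have [_ _ _ e _] := fin z Dz.
  rewrite (XE a al z sa alE bz) (XE H h z sH hE bz) zx in e.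
  have p2 : 2 * P x != 0 by apply: mulf_neq0 p0; rewrite pnatr_eq0.
  by apply: (mulIf p2); rewrite e mulrA.
- move=> x /G; rewrite /A; move: (al x) (b z0) (P x) (h x) => u v q t e.
  by have -> : u ^+ 2 = 16 * q ^+ 2 * (t ^+ 2 - x + c) - v ^+ 2 by [rewrite -e; ring]; field.
- move=> x hx; have p0 := Ppos x hx; have [z bz zx] := onto x hx; have Dz := sub z bz.
  have := numb z Dz; rewrite (alE z bz).2 (bE z Dz) zx G // => n0.
  have q0 : 0 < 16 * P x ^+ 2 by apply: mulr_gt0; [rewrite ltr0n|exact: exprn_gt0].
  rewrite -(pmulr_rgt0 _ q0) lt_neqAle eq_sym n0 -G //.
  by apply: addr_ge0; exact: sqr_ge0.
move=> x hx; have [z bz zx] := onto x hx; have Dz := sub z bz.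
have [_ _ _ _ e] := fin z Dz.
have fH := fd_smooth w0 sH Dz; rewrite (YH z Dz) in fH.
have fP := fd_comp (isd_pcubic K1 K2 (k z)) (fk z Dz).
have F := fdM (fdM (fd_cst w1 w2 16 z) (fdM fP fP)) (fdD (fdM fH fH) (fdD (fdM (fd_cst w1 w2 (-1) z) (fk z Dz)) (fd_cst w1 w2 c z))).
have [xr _] := fdE w0 Dz F.
have e1 : X (r2 K1 K2 c k H) z = 2 * (4 * P (k z) * X H z) * a z := e.
have e2 := etrans (esym e1) xr.
rewrite (XE H h z sH hE bz) (alE z bz).2 (hE z bz).2 zx -p'E in e2.
apply: (@ode_algebra R (P x) _ _ _ _ _ _ (P0 x hx) _ erefl); rewrite e2.
by move: (P x) (derive1 P x) (h x) (derive1 h x) => q q' t t'; ring.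
Qed.

End Core.

(** Undoes the rotation and scaling between the coordinate frame and (X, Y), under which a multiple
    of the identity stays one. *)
Lemma conformal_frame_algebra (R : realType) (u v l e11 e22 e12 : R) : u ^+ 2 + v ^+ 2 != 0 ->
  u ^+ 2 * e11 + 2 * u * v * e12 + v ^+ 2 * e22 = l * (u ^+ 2 + v ^+ 2) ->
  v ^+ 2 * e11 - 2 * u * v * e12 + u ^+ 2 * e22 = l * (u ^+ 2 + v ^+ 2) ->
  - (u * v) * e11 + (u ^+ 2 - v ^+ 2) * e12 + u * v * e22 = 0 ->
  [/\ e11 = l, e22 = l & e12 = 0].
Proof.
move=> n0 h1 h2 h3; have n2 : (u ^+ 2 + v ^+ 2) ^+ 2 != 0 by rewrite expf_neq0.
have d1 : (u ^+ 2 + v ^+ 2) ^+ 2 * e12 = 0.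
  have -> : (u ^+ 2 + v ^+ 2) ^+ 2 * e12 = (u ^+ 2 - v ^+ 2) * (- (u * v) * e11 + (u ^+ 2 - v ^+ 2) * e12 + u * v * e22)
     + u * v * ((u ^+ 2 * e11 + 2 * u * v * e12 + v ^+ 2 * e22) - (v ^+ 2 * e11 - 2 * u * v * e12 + u ^+ 2 * e22)) by ring.
  by rewrite h1 h2 h3 subrr !mulr0 addr0.
have e0 : e12 = 0 by move/eqP: d1; rewrite mulf_eq0 (negPf n2) => /eqP.
rewrite e0 !mulr0 ?addr0 ?subr0 in h1 h2 h3.
have s1 : (u ^+ 2 + v ^+ 2) ^+ 2 * e11 = (u ^+ 2 + v ^+ 2) ^+ 2 * l.
  have -> : (u ^+ 2 + v ^+ 2) ^+ 2 * e11 = u ^+ 2 * (u ^+ 2 * e11 + v ^+ 2 * e22) + v ^+ 2 * (v ^+ 2 * e11 + u ^+ 2 * e22)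
    - 2 * u * v * (- (u * v) * e11 + u * v * e22) by ring.
  by rewrite h1 h2 h3; ring.
have s2 : (u ^+ 2 + v ^+ 2) ^+ 2 * e22 = (u ^+ 2 + v ^+ 2) ^+ 2 * l.
  have -> : (u ^+ 2 + v ^+ 2) ^+ 2 * e22 = v ^+ 2 * (u ^+ 2 * e11 + v ^+ 2 * e22) + u ^+ 2 * (v ^+ 2 * e11 + u ^+ 2 * e22)
    + 2 * u * v * (- (u * v) * e11 + u * v * e22) by ring.
  by rewrite h1 h2 h3; ring.
by split=> //; apply: (mulfI n2).
Qed.

Lemma rotate_eq0 (R : realType) (u v a b : R) : u ^+ 2 + v ^+ 2 != 0 ->
  u * a + v * b = 0 -> - v * a + u * b = 0 -> a = 0 /\ b = 0.
Proof.
move=> n0 h1 h2; split; apply: (mulfI n0); rewrite mulr0.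
  have -> : (u ^+ 2 + v ^+ 2) * a = u * (u * a + v * b) - v * (- v * a + u * b) by ring.
  by rewrite h1 h2 !mulr0 subrr.
have -> : (u ^+ 2 + v ^+ 2) * b = v * (u * a + v * b) + u * (- v * a + u * b) by ring.
by rewrite h1 h2 !mulr0 addr0.
Qed.

Lemma cont_zero (R : realType) (g : cplx R -> R) z : {for z, continuous g} ->
  (\forall v \near z, v <> z -> g v = 0) -> g z = 0.
Proof.
move=> /ccontP cg /near_boxP [e e0 He]; apply/eqP; apply: contraT => n0; exfalso.
have n1 : 0 < `|g z| by rewrite normr_gt0.
have [d d0 Hd] := cg _ n1; have [t [t0 td te]] := ex_lt2 d0 e0.
have tn : `|t| = t := gtr0_norm t0.
have := Hd t 0; rewrite normr0 tn => /(_ td d0).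
rewrite He ?sub0r ?normrN ?ltxx //; first by apply: boxP; rewrite ?normr0 ?tn.
by move=> /eqP; rewrite -subr_eq0 addrC addKr eq_complex /= gt_eqF.
Qed.

Section Forward.
Context (R : realType) (M : topologicalType) (X : compact_riemann_surface R M).
Context (S : set M) (phi : chart_index X -> cplx R -> R) (K : M -> R)
    (w : chart_index X -> cplx R -> cplx R) (K1 K2 c : R).
Hypotheses (hg : HCMU S phi K) (hw : character_form S phi K w).
Hypothesis hK1 : (exists x, K x = K1) /\ (forall x, K x <= K1).
Hypothesis hK2 : (exists x, K x = K2) /\ (forall x, K2 <= K x).
Variables (P : M) (H : M -> R) (U : set M) (F nu : M -> 'rV[R]_4).
Hypotheses (hP : Mstar w P) (oU : open U) (UP : U P).
Hypotheses (hF : isometric_immersion S phi c U F) (hnu : unit_normal X c U F nu)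
  (hH : is_mean_curvature X c U F nu H) (hW : weingarten X U K H)
  (hU : forall i x, U x -> cdom (charts X i) x -> ~ umbilical c F nu i x).

Lemma mc_of_immersion : exists (A : R) (h : R -> R),
  (\forall x \near P, H x = h (K x)) /\ mc_solution K1 K2 c A h (K P).
Proof.
have [i dP] := charts_cover X P.
have [r [rg info metr]] := ex_regular hg hw hK1 hK2 hP dP (open_nbhs_nbhs (conj oU UP)).
set point := cinv (charts X i) in rg info metr *.
set z0 := cmap (charts X i) P in rg info metr *.
set w1 := (fun z => complex.Re (w i z)) in rg *.
set w2 := (fun z => complex.Im (w i z)) in rg *.
pose f := F \o point; pose n := nu \o point; pose D := box z0 r.
have oD : open D := @box_open R z0 r.
have w0 := rg_w0 rg; have s1 := rg_w1 rg; have s2 := rg_w2 rg.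
have [sF SF regF isoF] := hF; have [sN nuP] := hnu.
have inU z : D z -> [/\ U (point z), cdom (charts X i) (point z) & cmap (charts X i) (point z) = z].
  by move=> /info [? ? _ _ ?].
have sub : D `<=` cmap (charts X i) @` (cdom (charts X i) `&` U).
  by move=> z /inU [u d e]; exists (point z).
have sf : vsm D f by move=> j; exact: smooth_sub sub (sF i j).
have sn : vsm D n by move=> j; exact: smooth_sub sub (sN i j).
have FF z : D z -> c != 0 -> sform c (f z) (f z) = c^-1.
  by move=> /inU [u _ _] /negPf c0; have := SF _ u; rewrite /space_form /= c0 => -[].
have Fn z : D z -> c * sform c (n z) (f z) = 0.
  move=> /inU [u d _]; have [+ _ _ _] := nuP i _ u d; rewrite /tangent.
  have [->|c0] := eqVneq c 0; first by rewrite mul0r.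
  by move=> e; rewrite sformC /f /n /= e mulr0.
have flat z : D z -> c = 0 -> f z 0 ord_max = 0 /\ n z 0 ord_max = 0.
  move=> /inU [u d _] c0; have [+ _ _ _] := nuP i _ u d; have := SF _ u.
  by rewrite /space_form /tangent /= c0 eqxx.
have vf z : D z -> vfd w1 w2 f z (VX w1 w2 f z) (VY w1 w2 f z) by exact: (vfd_smooth w0).
pose lam z := 4 * pcubic K1 K2 (K (point z)).
have sdx : vsm D (vdx f).
  by move=> j; have := smooth_dx (sf j); congr smooth_on; apply/funext => z; rewrite mxE.
have sdy : vsm D (vdy f).
  by move=> j; have := smooth_dy (sf j); congr smooth_on; apply/funext => z; rewrite mxE.
have slam : smooth_on D (fun z => lam z * (w1 z * w1 z + w2 z * w2 z)).
  have sk := rg_k rg; apply: smoothM => //; last by apply: smoothD => //; exact: smoothM.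
  apply: smoothM => //; first exact: smooth_cst.
  apply: (@smooth_comp R D (pcubic K1 K2)) => // z _.
  exact: (@sm1on_pcubic R setT openT K1 K2 _ I).
(* The isometry condition is given off [S]; finiteness of [S] and continuity extend it to the
   square. *)
have offS (g : cplx R -> R) : smooth_on D g -> (forall z, D z -> ~ S (point z) -> g z = 0) -> forall z, D z -> g z = 0.
  move=> sg g0 z Dz; apply: cont_zero (smooth_cont sg Dz) _.
  have [u d e] := inU z Dz.
  have := chart_near_point d (finite_near X (point z) (hcmu_sing hg)); rewrite e => nS.
  apply: (@filterS2 _ _ (nbhs_filter z) _ _ _ _ nS (open_near oD Dz)) => v hv Dv vz.
  apply: g0 => //; apply: hv => E; apply: vz; have [_ _ ev] := inU v Dv.
  by rewrite -ev -e; exact: congr1 E.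
have iso z : D z -> ~ S (point z) -> [/\ sform c (vdx f z) (vdx f z) = lam z * (w1 z * w1 z + w2 z * w2 z),
    sform c (vdy f z) (vdy f z) = lam z * (w1 z * w1 z + w2 z * w2 z) & sform c (vdx f z) (vdy f z) = 0].
  move=> Dz nS; have [u d e] := inU z Dz; have := isoF i _ u d nS; rewrite e /=.
  by rewrite (metr z Dz nS) /sqmod !expr2.
have m11 z : D z -> sform c (vdx f z) (vdx f z) = lam z * (w1 z * w1 z + w2 z * w2 z).
  move=> Dz; apply/eqP; rewrite -subr_eq0; apply/eqP.
  apply: (offS (fun z => sform c (vdx f z) (vdx f z) - lam z * (w1 z * w1 z + w2 z * w2 z))) Dz.
    by apply: smoothB => //; exact: smooth_sform.
  by move=> v Dv /(iso v Dv) [-> _ _]; rewrite subrr.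
have m22 z : D z -> sform c (vdy f z) (vdy f z) = lam z * (w1 z * w1 z + w2 z * w2 z).
  move=> Dz; apply/eqP; rewrite -subr_eq0; apply/eqP.
  apply: (offS (fun z => sform c (vdy f z) (vdy f z) - lam z * (w1 z * w1 z + w2 z * w2 z))) Dz.
    by apply: smoothB => //; exact: smooth_sform.
  by move=> v Dv /(iso v Dv) [_ -> _]; rewrite subrr.
have m12 z : D z -> sform c (vdx f z) (vdy f z) = 0.
  move=> Dz; apply: (offS (fun z => sform c (vdx f z) (vdy f z))) Dz; first exact: smooth_sform.
  by move=> v Dv /(iso v Dv) [].
have E z : D z -> [/\ sform c (VX w1 w2 f z) (VX w1 w2 f z) = lam z,
    sform c (VY w1 w2 f z) (VY w1 w2 f z) = lam z & sform c (VX w1 w2 f z) (VY w1 w2 f z) = 0].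
  move=> Dz; have [ex ey] := vfd_dx (vf z Dz).
  have := m11 z Dz; have := m22 z Dz; have := m12 z Dz; rewrite ex ey.
  rewrite !(sformDl, sformDr, sformZl, sformZr) (sformC c (VY w1 w2 f z) (VX w1 w2 f z)).
  move: (sform c (VX w1 w2 f z) (VX w1 w2 f z)) (sform c (VX w1 w2 f z) (VY w1 w2 f z))
    (sform c (VY w1 w2 f z) (VY w1 w2 f z)) (lam z) (w1 z) (w2 z) (w0 z Dz) => a b d l u v N h12 h22 h11.
  apply: (@conformal_frame_algebra R u v l a d b N).
  - by rewrite !expr2 -h11; ring.
  - by rewrite !expr2 -h22; ring.
  by rewrite !expr2 -h12; ring.
have N z : D z -> sform c (n z) (VX w1 w2 f z) = 0 /\ sform c (n z) (VY w1 w2 f z) = 0.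
  move=> Dz; have [ex ey] := vfd_dx (vf z Dz); have [u d e] := inU z Dz.
  have [_ _] := nuP i _ u d; rewrite e -/f -/point ex ey -/(n z).
  by rewrite !(sformDr, sformZr); exact: rotate_eq0 (w0 z Dz).
have NN z : D z -> sform c (n z) (n z) = 1.
  by move=> /inU [u d _]; have [] := nuP i _ u d.
have FS := frame_system rg sf sn FF Fn flat (fun z Dz => let: And3 a _ _ := E z Dz in a)
  (fun z Dz => let: And3 _ a _ := E z Dz in a) (fun z Dz => let: And3 _ _ a := E z Dz in a)
  (fun z Dz => (N z Dz).1) (fun z Dz => (N z Dz).2) NN.
pose a11 := form11 c w1 w2 f n; pose a12 := form12 c w1 w2 f n; pose a22 := form22 c w1 w2 f n.
have SFm z : D z -> [/\ h11 c F nu i (point z) = w1 z ^+ 2 * a11 z + 2 * w1 z * w2 z * a12 z + w2 z ^+ 2 * a22 z,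
   h12 c F nu i (point z) = - w1 z * w2 z * a11 z + (w1 z ^+ 2 - w2 z ^+ 2) * a12 z + w1 z * w2 z * a22 z &
   h22 c F nu i (point z) = w2 z ^+ 2 * a11 z - 2 * w1 z * w2 z * a12 z + w1 z ^+ 2 * a22 z].
  move=> Dz; have [u d e] := inU z Dz; rewrite /h11 /h12 /h22 e.
  have sX := vsm_X oD s1 s2 w0 sf; have sY := vsm_Y oD s1 s2 w0 sf.
  have vY := vfd_smooth w0 sY Dz; rewrite -(comm_VXY oD s1 s2 (rg_cr1 rg) (rg_cr2 rg) w0 sf Dz) in vY.
  have [n1 n2] := N z Dz; rewrite sformC in n1; rewrite sformC in n2.
  exact: (second_form oD Dz vf (vfd_smooth w0 sX Dz) vY (smooth_pd s1 Dz) (smooth_pd s2 Dz) n1 n2).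
have CF z : D z -> conformal_factor c F i (point z) = lam z * (w1 z ^+ 2 + w2 z ^+ 2).
  by move=> Dz; have [_ _ e] := inU z Dz; rewrite /conformal_factor e -/f -/point m11 // !expr2.
have l0 z : D z -> lam z != 0.
  by move=> Dz; apply: mulf_neq0; [rewrite pnatr_eq0|rewrite gt_eqF // (rg_pos rg Dz)].
have HE z : D z -> (H \o point) z = (a11 z + a22 z) / (8 * pcubic K1 K2 (K (point z))).
  move=> Dz; have [u d e] := inU z Dz; have [x11 _ x22] := SFm z Dz.
  rewrite /= (hH u d) x11 x22 CF //; have := w0 z Dz; have := l0 z Dz.
  have -> : 8 * pcubic K1 K2 (K (point z)) = 2 * lam z by rewrite /lam; move: (pcubic _ _ _) => q; ring.
  move: (lam z) (w1 z) (w2 z) (a11 z) (a12 z) (a22 z) => l u1 u2 b1 b2 b3 l1 N1.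
  by field; rewrite N1 l1.
have [] := FS (H \o point) HE.
- by move=> z Dz; have [u d e] := inU z Dz; have := hW u d; rewrite e.
- move=> z Dz eq11 eq12; have [u d e] := inU z Dz; apply: (hU u d).
  exists (a11 z / lam z); have [-> -> ->] := SFm z Dz; rewrite (CF z Dz) -/a11 -/a12 -/a22.
  rewrite -[a22 z]eq11 [a12 z]eq12 -/(a11 z); have := l0 z Dz.
  by move: (lam z) (w1 z) (w2 z) (a11 z) => l u1 u2 b1 l1; split; try (by field); ring.
move=> a [b [sa sb sH sys]].
have [A [h [[e e0 he] mc]]] : exists A h, (exists2 e, 0 < e & forall z, box z0 e z -> (H \o point) z = h ((K \o point) z)) /\
    mc_solution K1 K2 c A h ((K \o point) z0).
  by apply: (mc_of_system rg sa sb sH) => z /sys [].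
exists A, h; split; last by rewrite /= /point /z0 (cmapK dP) in mc.
have nb : \forall z \near z0, H (point z) = h (K (point z)) by apply/near_boxP; exists e.
apply: (@filterS2 _ _ (nbhs_filter P) _ _ _ _ (near_dom dP) (chart_near_coord dP nb)) => y dy.
by rewrite /point (cmapK dy).
Qed.

End Forward.

(** * From the equation to the immersion *)

Lemma itv_open (R : realType) (k0 d : R) : open [set x : R | `|x - k0| < d].
Proof.
rewrite openE => x hx; apply/near_itvP; exists (d - `|x - k0|); first by rewrite subr_gt0.
move=> y hy; rewrite /= -(subrKA x); apply: le_lt_trans (ler_normD _ _) _.
by move: hy; rewrite ltrBrDr.
Qed.

(** Differentiating al = - 4 s sqrt(radicand) and inserting the equation for h' gives al' = 4 p
    h'. *)
Lemma alpha_ode_algebra (R : realType) (p p' e h h' s q : R) : s * s = 1 -> q != 0 ->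
  p * h + s * q != 0 -> h' = (p - 2 * p' * e) / (2 * (p * h + s * q)) ->
  -4 * s * ((2 * q)^-1 * (2 * p * p' * e + p ^+ 2 * (2 * h * h' - 1))) = 4 * p * h'.
Proof.
move=> ss q0 D0 E; have E2 : p - 2 * p' * e = h' * (2 * (p * h + s * q)).
  by rewrite E divfK // mulf_neq0 // pnatr_eq0.
have -> : 2 * p * p' * e + p ^+ 2 * (2 * h * h' - 1) = - (p * (p - 2 * p' * e)) + 2 * p ^+ 2 * h * h' by ring.
rewrite E2; have -> : - (p * (h' * (2 * (p * h + s * q)))) + 2 * p ^+ 2 * h * h' = - 2 * p * h' * s * q by ring.
have -> : -4 * s * ((2 * q)^-1 * (- 2 * p * h' * s * q)) = 4 * p * h' * (s * s) by field.
by rewrite ss mulr1.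
Qed.

(** [al] is - 4 times the root with the sign valid on each side of [k0]. Where the signs differ the
    radicand is 0, so [al] is continuous; its derivative 4 p h' extends across [k0], which makes
    [al] smooth. *)
Lemma alpha_of_mc (R : realType) (K1 K2 c A k0 : R) (h : R -> R) : 0 < pcubic K1 K2 k0 ->
  mc_solution K1 K2 c A h k0 -> exists d al, [/\ 0 < d,
   (forall x, `|x - k0| < d -> 0 < pcubic K1 K2 x),
   (forall x, `|x - k0| < d -> sm1 h x /\ sm1 al x),
   (forall x, `|x - k0| < d -> is_derive x 1 al (4 * pcubic K1 K2 x * derive1 h x)) &
   (forall x, `|x - k0| < d -> al x ^+ 2 = 16 * (pcubic K1 K2 x ^+ 2 * (h x ^+ 2 - x + c) - A ^+ 2) /\ 0 < h x ^+ 2 - x + c)].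
Proof.
move=> P0 [nh nE [s [s' [nl nr ss]]]].
have cP : {for k0, continuous (pcubic K1 K2)} := isd_cont (isd_pcubic K1 K2 k0).
have nP : \forall x \near k0, 0 < pcubic K1 K2 x by exact: (@cvgr_gt _ _ _ (nbhs_filter k0) _ _ cP _ P0).
move: nl nr; rewrite !near_withinE => nl nr.
have /near_itvP [d d0 Hd] := @filterS3 _ _ (nbhs_filter k0) _ _ _ (fun x => [/\ forall n, derivable (derive1n n h) x 1, 0 < h x ^+ 2 - x + c & 0 < pcubic K1 K2 x]) (fun x a b e => And3 a b e) nh nE nP.
have /near_itvP [d1 d10 Hd1] := @filterS2 _ _ (nbhs_filter k0) _ _ _ (fun x a b => conj a b) nl nr.
have [t [t0 td td1]] := ex_lt2 d0 d10.
have {}Hd x : `|x - k0| < t -> [/\ sm1 h x, 0 < h x ^+ 2 - x + c & 0 < pcubic K1 K2 x].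
  by move=> xt; apply: Hd; exact: lt_trans xt td.
have {}Hd1 x : `|x - k0| < t -> (x < k0 -> mc_ode K1 K2 c A s h x) /\ (x > k0 -> mc_ode K1 K2 c A s' h x).
  by move=> xt; apply: Hd1; exact: lt_trans xt td1.
set W := radicand K1 K2 c A h in ss *.
have DW x : `|x - k0| < t -> is_derive x 1 W (2 * pcubic K1 K2 x * derive1 (pcubic K1 K2) x * (h x ^+ 2 - x + c) +
    pcubic K1 K2 x ^+ 2 * (2 * h x * derive1 h x - 1)).
  move=> /Hd [/sm1_isd dh _ _]; have dp0 := isd_pcubic K1 K2 x.
  have dp : is_derive x 1 (pcubic K1 K2) (derive1 (pcubic K1 K2) x) by rewrite (isd_derive1 dp0).
  have := isdB (isdM (isdM dp dp) (isdD (isdB (isdM dh dh) (isd_id x)) (isd_cst c x))) (isd_cst (A ^+ 2) x).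
  move=> D; have {}D := @isd_ext R _ W x _ _ D.
  apply: isd_eq (D _) _ => [y|]; first by rewrite /W /radicand !expr2.
  by move: (pcubic _ _ _) (derive1 _ _) (h x) (derive1 _ _) => q q' u u'; ring.
have cW x : `|x - k0| < t -> {for x, continuous (fun x => Num.sqrt (W x))}.
  move=> /DW /isd_cont cw; apply: continuous_comp cw _; exact: sqrt_continuous.
pose al x := if x < k0 then -4 * (-1) ^+ s * Num.sqrt (W x) else -4 * (-1) ^+ s' * Num.sqrt (W x).
have ode x : `|x - k0| < t -> x != k0 -> exists s0 : bool, mc_ode K1 K2 c A s0 h x /\ \forall y \near x, -4 * (-1) ^+ s0 * Num.sqrt (W y) = al y.
  move=> xt nx; have /near_itvP N : exists2 e, 0 < e & forall y, `|y - x| < e -> (y < k0) = (x < k0).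
    exists `|x - k0|; first by rewrite normr_gt0 subr_eq0.
    move=> y; case: (ltgtP x k0) nx => // xk _.
      by rewrite (ltr0_norm (_ : x - k0 < 0)) ?subr_lt0 // ltr_distl => /andP[_]; rewrite opprB subrKC => ->.
    rewrite (gtr0_norm (_ : 0 < x - k0)) ?subr_gt0 // ltr_distl => /andP[+ _].
    by rewrite subKr => /ltW; rewrite leNgt => /negbTE.
  have [h1 h2] := Hd1 x xt; case: (ltgtP x k0) nx N => // xk _ N.
    by exists s; split; [exact: h1|apply: filterS N => y; rewrite /al => ->].
  by exists s'; split; [exact: h2|apply: filterS N => y; rewrite /al => ->].
have alx x : `|x - k0| < t -> x != k0 -> is_derive x 1 al (4 * pcubic K1 K2 x * derive1 h x).
  move=> xt nx; have [s0 [[W0 D0 hE] N]] := ode x xt nx.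
  have D := isdM (isd_cst (-4 * (-1) ^+ s0) x) (isd_comp (is_derive1_sqrt W0) (DW x xt)).
  apply: isd_near N _; apply: isd_eq D _; rewrite mul0r add0r.
  apply: (alpha_ode_algebra _ _ D0 hE); first by rewrite -expr2 sqrr_sign.
  by rewrite gt_eqF // sqrtr_gt0.
have k0t : `|k0 - k0| < t by rewrite subrr normr0.
have cal : {for k0, continuous al}.
  have c0 := cW k0 k0t.
  case: ss => [ss|W0].
    have -> : al = (fun x => -4 * (-1) ^+ s * Num.sqrt (W x)) by apply/funext => x; rewrite /al -ss if_same.
    have c1 : {for k0, continuous (fun=> -4 * (-1) ^+ s : R)} := isd_cont (isd_cst _ k0).
    exact: (@continuousM R R (fun=> -4 * (-1) ^+ s) (fun x => Num.sqrt (W x)) k0 c1 c0).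
  have al0 : al k0 = 0 by rewrite /al ltxx W0 sqrtr0 mulr0.
  apply/contP => e e0; have e4 : 0 < e / 4 by rewrite divr_gt0.
  have /contP /(_ _ e4) [d2 d20 Hd2] := c0; exists d2 => // x /Hd2; rewrite al0 W0 sqrtr0 !subr0 => hx.
  have -> : `|al x| = 4 * `|Num.sqrt (W x)|.
    by rewrite /al; case: ifP => _; rewrite !normrM normrX normrN1 expr1n mulr1 normrN (@gtr0_norm _ 4).
  by rewrite mulrC -ltr_pdivlMr.
have oI : open [set x : R | `|x - k0| < t] by exact: itv_open.
have sh : sm1on [set x : R | `|x - k0| < t] h by move=> x /Hd [].
have sP : sm1on [set x : R | `|x - k0| < t] (pcubic K1 K2) by exact: sm1on_pcubic.
have sda : sm1on [set x : R | `|x - k0| < t] (fun x => 4 * pcubic K1 K2 x * derive1 h x).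
  exact: (sm1onM oI (sm1onM oI (@sm1on_cst R _ oI 4) sP) (sm1on_d sh)).
have dal x : `|x - k0| < t -> is_derive x 1 al (4 * pcubic K1 K2 x * derive1 h x).
  move=> xt; have [->|nx] := eqVneq x k0; last exact: alx.
  apply: (@isd_lim R al (fun x => 4 * pcubic K1 K2 x * derive1 h x) k0 cal).
    exact: isd_cont (sm1_isd (sda k0 k0t)).
  rewrite near_withinE; apply/near_itvP; exists t => // y yt yk; exact: alx.
exists t, al; split=> //.
- by move=> x /Hd [].
- move=> x xt; split; first by have [] := Hd x xt.
  apply: (@sm1_class R _ (fun f => f = al \/ sm1on [set x : R | `|x - k0| < t] f) oI _ al _ x xt); last by left.
  move=> f [->|sf]; first by exists (fun x => 4 * pcubic K1 K2 x * derive1 h x); [right|].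
  by exists (derive1 f) => [|y yt]; [right; exact: sm1on_d|exact: sm1_isd (sf y yt)].
have al2 x : `|x - k0| < t -> x != k0 -> al x ^+ 2 = 16 * W x.
  move=> xt nx; have [s0 [[W0 _ _] /nbhs_singleton <-]] := ode x xt nx.
  by rewrite !exprMn sqr_sqrtr ?(ltW W0) // sqrr_sign; ring.
move=> x xt; split; last by have [] := Hd x xt.
have [->|nx] := eqVneq x k0; last exact: al2.
apply/eqP; rewrite -subr_eq0; apply/eqP.
have cg : {for k0, continuous (fun x => al x * al x - 16 * W x)}.
  have da := dal k0 k0t; exact: isd_cont (isdB (isdM da da) (isdM (isd_cst 16 k0) (DW k0 k0t))).
rewrite expr2 -/(radicand K1 K2 c A h k0) -/W.
have /contP H := cg; apply/eqP; apply: contraT => n0; exfalso.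
have n1 : 0 < `|al k0 * al k0 - 16 * W k0| by rewrite normr_gt0.
have [d2 d20 Hd2] := H _ n1; have [u [u0 ut ud]] := ex_lt2 t0 d20.
have uE : `|k0 + u - k0| = u by rewrite addrC addKr gtr0_norm.
have := Hd2 (k0 + u); rewrite uE => /(_ ud).
have -> : al (k0 + u) * al (k0 + u) - 16 * W (k0 + u) = 0.
  rewrite -expr2 al2 ?uE ?subrr //.
  by rewrite -subr_eq0 addrC addKr gt_eqF.
by rewrite sub0r normrN ltxx.
Qed.

(** * Linear matrix equations *)

Section MatrixODE.
Context {R : realType}.
Variable n : nat.
Implicit Types (B V Phi : R -> 'M[R]_n) (k : R).

Definition mderive Phi k (D : 'M[R]_n) := forall i j, is_derive k 1 (fun x => Phi x i j) (D i j).

Lemma mderive_eq Phi k D D' : mderive Phi k D -> D = D' -> mderive Phi k D'.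
Proof. by move=> H <-. Qed.

Lemma isd_sum (J : Type) (s : seq J) (f : J -> R -> R) (g : J -> R) (k : R) :
  (forall j, is_derive k 1 (f j) (g j)) -> is_derive k 1 (fun x => \sum_(j <- s) f j x) (\sum_(j <- s) g j).
Proof.
move=> H; elim: s => [|j s IH].
  by rewrite big_nil; apply: isd_ext (isd_cst 0 k) => x; rewrite big_nil.
by rewrite big_cons; apply: isd_ext (isdD (H j) IH) => x; rewrite big_cons.
Qed.

Lemma mderiveM P Q k DP DQ : mderive P k DP -> mderive Q k DQ ->
  mderive (fun x => P x *m Q x) k (DP *m Q k + P k *m DQ).
Proof.
move=> hP hQ i j; rewrite mxE !mxE -big_split /=.
apply: (@isd_ext R (fun x => \sum_(l <- index_enum 'I_n) P x i l * Q x l j)); first by move=> x; rewrite mxE.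
by apply: isd_sum => l; apply: isd_eq (isdM (hP i l) (hQ l j)) _; rewrite addrC.
Qed.

Lemma mderiveB P Q k DP DQ : mderive P k DP -> mderive Q k DQ -> mderive (fun x => P x - Q x) k (DP - DQ).
Proof.
move=> hP hQ i j; rewrite !mxE; apply: isd_ext (isdB (hP i j) (hQ i j)) => x; by rewrite !mxE.
Qed.

Lemma mderive_cst (D : 'M[R]_n) k : mderive (fun=> D) k 0.
Proof. by move=> i j; rewrite mxE; exact: isd_cst. Qed.

Lemma mderive0_cst Phi k0 d : (forall k, `|k - k0| < d -> mderive Phi k 0) ->
  forall k, `|k - k0| < d -> Phi k = Phi k0.
Proof.
move=> H k hk; apply/matrixP => i j; apply: (@isd0_cst R (fun x => Phi x i j)) => t ht.
by have := H t (le_lt_trans ht hk) i j; rewrite mxE.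
Qed.

Lemma matrix_ode B k0 d0 : 0 < d0 ->
  (forall k, `|k - k0| < d0 -> forall i j, {for k, continuous (fun x => B x i j)}) ->
  exists d Phi, [/\ 0 < d, d <= d0, Phi k0 = 1%:M & forall k, `|k - k0| < d -> mderive Phi k (B k *m Phi k)].
Proof.
move=> d00 cB.
pose m := \sum_i \sum_j `|B k0 i j| + 1.
have le i j : `|B k0 i j| < m.
  rewrite /m ltr_pwDr ?ltr01 // (bigD1 i) //= (bigD1 j) //= -addrA lerDl.
  by apply: addr_ge0; [apply: sumr_ge0|apply: sumr_ge0 => ? _; apply: sumr_ge0].
have m0 : 0 <= m by rewrite addr_ge0 ?ler01 // sumr_ge0 // => i _; rewrite sumr_ge0.
have k00 : `|k0 - k0| < d0 by rewrite subrr normr0.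
have /near_itvP [d1 d10 Hd1] : \forall k \near k0, forall i j, `|B k i j| <= m.
  apply: (@filter_forall _ _ _ _ (nbhs_filter k0)) => i; apply: (@filter_forall _ _ _ _ (nbhs_filter k0)) => j.
  have cn : {for k0, continuous (fun x => `|B x i j|)}.
    apply: (@continuous_comp _ _ _ (fun x => B x i j) (fun t : R => `|t|)); first exact: cB.
    exact: norm_continuous.
  have := @cvgr_lt _ _ _ (nbhs_filter k0) _ _ cn _ (le i j).
  by apply: filterS => x; exact: ltW.
have q0 : 0 < 2 * (n%:R * m + 1) by rewrite mulr_gt0 // ltr_wpDl // mulr_ge0.
have [d2 [d20 d2d d2q]] := ex_lt2 d00 (divr_gt0 ltr01 q0).
have [d [dp dd1 dd2]] := ex_lt2 d10 d20.
have dd0 : d < d0 := lt_trans dd2 d2d.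
have dq : n%:R * m * d <= 1 / 2.
  have : d * (2 * (n%:R * m + 1)) <= 1.
    by have := lt_trans dd2 d2q; rewrite ltr_pdivlMr // => /ltW.
  by have : 0 <= n%:R * m by [rewrite mulr_ge0]; move: (n%:R * m) dp => u; nra.
have H (j : 'I_n) : exists y : 'I_n -> R -> R, (forall i, y i k0 = (i == j)%:R) /\
    forall i (k : R), `|k - k0| < d -> is_derive k 1 (y i) (\sum_l B k i l * y l k).
  have c i l (k : R) : `|k - k0| <= d -> {for k, continuous (fun x => B x i l)}.
    by move=> hk; apply: cB; exact: le_lt_trans hk dd0.
  have b i l (k : R) : `|k - k0| <= d -> `|B k i l| <= m.
    by move=> hk; apply: Hd1; exact: le_lt_trans hk dd1.
  exact: (@linear_ode R n (fun i l x => B x i l) k0 d m dp c b dq (fun i => (i == j)%:R)).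
have [y Hy] := choice H.
exists d, (fun k => \matrix_(i, j) y j i k); split=> //; first exact: ltW.
  by apply/matrixP => i j; rewrite !mxE (Hy j).1.
move=> k hk i j; rewrite mxE; apply: (@isd_ext R (y j i)); first by move=> x; rewrite mxE.
by apply: isd_eq ((Hy j).2 i k hk) _; apply: eq_bigr => l _; rewrite mxE.
Qed.

(** Lax equation: V' = B V - V B keeps V conjugate to V(k0) through the fundamental matrix Phi. The
    inverse of Phi is the solution Psi of the adjoint equation, and Psi (V Phi - Phi V(k0)) is
    constant, equal to 0 at [k0]. *)
Lemma matrix_ode_intertwine B V k0 d0 : 0 < d0 ->
  (forall k, `|k - k0| < d0 -> forall i j, {for k, continuous (fun x => B x i j)}) ->
  (forall k, `|k - k0| < d0 -> mderive V k (B k *m V k - V k *m B k)) ->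
  exists d Phi, [/\ 0 < d, d <= d0, Phi k0 = 1%:M & forall k, `|k - k0| < d ->
    mderive Phi k (B k *m Phi k) /\ V k *m Phi k = Phi k *m V k0].
Proof.
move=> d00 cB dV; have [d1 [Phi [d10 d1d P0 dP]]] := matrix_ode d00 cB.
(* The adjoint equation multiplies by B on the right, so its transpose is what [matrix_ode] can
   solve. *)
have [d2 [Psi' [d20 d2d Q0 dQ']]] : exists d Psi, [/\ 0 < d, d <= d0, Psi k0 = 1%:M & forall k, `|k - k0| < d ->
    mderive Psi k (- (B k)^T *m Psi k)].
  apply: matrix_ode d00 _ => k hk i j; have c := cB k hk j i.
  have -> : (fun x => (- (B x)^T) i j) = (fun x => - B x j i) by apply/funext => x; rewrite !mxE.
  exact: continuousN.
pose Psi k := (Psi' k)^T.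
have dQ k : `|k - k0| < d2 -> mderive Psi k (- (Psi k *m B k)).
  move=> hk i j; have := dQ' k hk j i.
  have -> : (- (B k)^T *m Psi' k) j i = (- (Psi k *m B k)) i j.
    by rewrite mulNmx !mxE; congr (- _); apply: eq_bigr => l _; rewrite !mxE mulrC.
  by apply: isd_ext => x; rewrite mxE.
have [d [dp dd1 dd2]] := ex_lt2 d10 d20.
have inv k : `|k - k0| < d -> Psi k *m Phi k = 1%:M.
  move=> hk; rewrite (@mderive0_cst (fun k => Psi k *m Phi k) k0 d _ k hk); first by rewrite /Psi P0 Q0 trmx1 mulmx1.
  move=> x hx; have H := mderiveM (dQ x (lt_trans hx dd2)) (dP x (lt_trans hx dd1)).
  by apply: mderive_eq H _; rewrite mulNmx mulmxA addNr.
have Z k : `|k - k0| < d -> Psi k *m (V k *m Phi k - Phi k *m V k0) = 0.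
  move=> hk; rewrite (@mderive0_cst (fun k => Psi k *m (V k *m Phi k - Phi k *m V k0)) k0 d _ k hk).
    by rewrite P0 mulmx1 mul1mx subrr mulmx0.
  move=> x hx; have xd := lt_le_trans (lt_trans hx dd1) d1d; have p := dP x (lt_trans hx dd1).
  have H := mderiveM (dQ x (lt_trans hx dd2)) (mderiveB (mderiveM (dV x xd) p) (mderiveM p (mderive_cst (V k0) x))).
  apply: mderive_eq H _; rewrite mulmx0 addr0 !(mulmxBr, mulmxBl, mulmxDr, mulmxDl, mulNmx) !mulmxA.
  by rewrite mulmxN !mulmxA opprK subrK addrACA addNr subrr addr0.
exists d, Phi; split=> //; first exact: le_trans (ltW dd1) d1d.
move=> k hk; split; first by apply: dP; exact: lt_trans hk dd1.
apply/eqP; rewrite -subr_eq0; apply/eqP.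
by rewrite -[LHS]mul1mx -(mulmx1C (inv k hk)) -mulmxA Z // mulmx0.
Qed.

End MatrixODE.

(** * Matrices of the moving frame *)

Definition mat4 (R : realType) (rows : seq (seq R)) : 'M[R]_4 :=
  \matrix_(i < 4, j < 4) nth 0 (nth [::] rows i) j.

Lemma mat4_ext (R : realType) (B C : 'M[R]_4) :
  (forall i j, (i < 4)%N -> (j < 4)%N -> B (inord i) (inord j) = C (inord i) (inord j)) -> B = C.
Proof.
by move=> H; apply/matrixP => i j; rewrite -(inord_val i) -(inord_val j); apply: H; exact: ltn_ord.
Qed.

Lemma sum4 (R : realType) (f : 'I_4 -> R) :
  \sum_i f i = f (inord 0) + f (inord 1) + f (inord 2) + f (inord 3).
Proof.
rewrite !big_ord_recr big_ord0 /= add0r; congr (_ + _ + _ + _); congr f; apply: val_inj;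
  by rewrite /= inordK.
Qed.

Lemma mat4E (R : realType) (rows : seq (seq R)) i j : (i < 4)%N -> (j < 4)%N ->
  mat4 rows (inord i) (inord j) = nth 0 (nth [::] rows i) j.
Proof. by move=> hi hj; rewrite mxE !inordK. Qed.

(* The rows [F, e1, e2, nu] of the moving frame [E] satisfy [X E = frameX E] and
   [Y E = frameY E]: Gauss and Weingarten formulas for [g = l |w|^2], [l = 4 p],
   [m = p'], [x11, x12, x22] being the second fundamental form. *)
Definition frameX (R : realType) (c l m x11 x12 : R) : 'M[R]_4 :=
  mat4 [:: [:: 0; 1; 0; 0]; [:: - (c * l); m; 0; x11]; [:: 0; 0; m; x12]; [:: 0; - (x11 / l); - (x12 / l); 0]].

Definition frameY (R : realType) (c l m x12 x22 : R) : 'M[R]_4 :=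
  mat4 [:: [:: 0; 0; 1; 0]; [:: 0; 0; m; x12]; [:: - (c * l); - m; 0; x22]; [:: 0; - (x12 / l); - (x22 / l); 0]].

(** The derivative of [frameY] in the curvature for l = 4 p, with p' = m, m' = - 2 k, x12 constant
    and x22' the derivative of x22. *)
Definition dframeY (R : realType) (c p m k x12 x22 x22' : R) : 'M[R]_4 :=
  mat4 [:: [:: 0; 0; 0; 0]; [:: 0; 0; -2 * k; 0]; [:: - (c * (4 * m)); 2 * k; 0; x22'];
    [:: 0; x12 * m / (4 * p ^+ 2); - ((x22' * p - x22 * m) / (4 * p ^+ 2)); 0]].

(** The zero-curvature condition U V - V U = X V, as X acts by 2 p d/dK. Gauss enters through the
    hypothesis on a^2 + b^2, Codazzi through the value 4 m h of (4 p h - a)', that is a' = 4 p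
    h'. *)
Lemma frame_commutator (R : realType) (c p m k h a b : R) : p != 0 ->
  a ^+ 2 + b ^+ 2 = 16 * p ^+ 2 * (h ^+ 2 - k + c) ->
  frameX c (4 * p) m (4 * p * h + a) (- b) *m frameY c (4 * p) m (- b) (4 * p * h - a) -
  frameY c (4 * p) m (- b) (4 * p * h - a) *m frameX c (4 * p) m (4 * p * h + a) (- b) =
  (2 * p) *: dframeY c p m k (- b) (4 * p * h - a) (4 * m * h).
Proof.
move=> p0 e; have p4 : 4 * p != 0 by apply: mulf_neq0 p0; rewrite pnatr_eq0.
have kE : k = (16 * p ^+ 2 * (h ^+ 2 + c) - a ^+ 2 - b ^+ 2) / (16 * p ^+ 2).
  by rewrite -addrA -opprD e; field.
apply: mat4_ext => i j hi hj; rewrite !mxE !sum4 !mat4E // !inordK // kE.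
by case: i hi => [|[|[|[|i]]]] //=; case: j hj => [|[|[|[|j]]]] //=; move=> _ _; field.
Qed.

(* [frameGram c l] is the inverse Gram matrix of the frame, multiplied by [c] in the direction of F. *)
Definition frameGram (R : realType) (c l : R) : 'M[R]_4 :=
  mat4 [:: [:: c; 0; 0; 0]; [:: 0; l^-1; 0; 0]; [:: 0; 0; l^-1; 0]; [:: 0; 0; 0; 1]].

Definition dframeGram (R : realType) (t : R) : 'M[R]_4 :=
  mat4 [:: [:: 0; 0; 0; 0]; [:: 0; t; 0; 0]; [:: 0; 0; t; 0]; [:: 0; 0; 0; 0]].

Lemma frameX_gram (R : realType) (c p m x11 x12 : R) : p != 0 ->
  (frameX c (4 * p) m x11 x12)^T *m frameGram c (4 * p) + dframeGram (- (m / (2 * p))) +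
  frameGram c (4 * p) *m frameX c (4 * p) m x11 x12 = 0.
Proof.
move=> p0; apply: mat4_ext => i j hi hj; rewrite !mxE !sum4 !mxE !inordK //.
by case: i hi => [|[|[|[|i]]]] //=; case: j hj => [|[|[|[|j]]]] //=; move=> _ _; field.
Qed.

Lemma frameY_gram (R : realType) (c p m x12 x22 : R) : p != 0 ->
  (frameY c (4 * p) m x12 x22)^T *m frameGram c (4 * p) + frameGram c (4 * p) *m frameY c (4 * p) m x12 x22 = 0.
Proof.
move=> p0; apply: mat4_ext => i j hi hj; rewrite !mxE !sum4 !mxE !inordK //.
by case: i hi => [|[|[|[|i]]]] //=; case: j hj => [|[|[|[|j]]]] //=; move=> _ _; field.
Qed.

(** The ambient form for c != 0. For c = 0 it degenerates in the last direction, in accordance with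
    the vanishing first entry of [frameGram]. *)
Definition eta (R : realType) (c : R) : 'M[R]_4 :=
  mat4 [:: [:: 1; 0; 0; 0]; [:: 0; 1; 0; 0]; [:: 0; 0; 1; 0]; [:: 0; 0; 0; Num.sg c]].

Lemma sform_eta (R : realType) (c : R) (E : 'M[R]_4) i j : c != 0 ->
  sform c (row i E) (row j E) = (E *m eta c *m E^T) i j.
Proof.
move=> c0; rewrite /sform !mxE !sum4 !mxE !sum4 !mxE !inordK //= -!val_eqE /= !inordK //=.
by case: (ltgtP c 0) c0 => [c1|c1|->]; rewrite ?eqxx // => _; [rewrite ltr0_sg|rewrite gtr0_sg] => //; ring.
Qed.

Lemma eta_sqr (R : realType) (c : R) : c != 0 -> eta c *m eta c = 1%:M.
Proof.
move=> c0; have s2 : Num.sg c * Num.sg c = 1 by rewrite -expr2 sqr_sg c0.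
apply: mat4_ext => i j hi hj; rewrite !mxE !sum4 !mxE !inordK // -val_eqE /= !inordK //.
by case: i hi => [|[|[|[|i]]]] //=; case: j hj => [|[|[|[|j]]]] //=; move=> _ _; rewrite ?(mul0r, mulr0, mul1r, mulr1, add0r, addr0, s2).
Qed.

Definition gramInv (R : realType) (c l : R) : 'M[R]_4 :=
  mat4 [:: [:: c^-1; 0; 0; 0]; [:: 0; l; 0; 0]; [:: 0; 0; l; 0]; [:: 0; 0; 0; 1]].

Lemma frameGramK (R : realType) (c l : R) : c != 0 -> l != 0 -> frameGram c l *m gramInv c l = 1%:M.
Proof.
move=> c0 l0; apply: mat4_ext => i j hi hj; rewrite !mxE !sum4 !mxE !inordK // -val_eqE /= !inordK //.
by case: i hi => [|[|[|[|i]]]] //=; case: j hj => [|[|[|[|j]]]] //=; move=> _ _; rewrite ?(mul0r, mulr0, mul1r, mulr1, add0r, addr0, divff, mulVf).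
Qed.

(** For square matrices the relation E^T G E = eta inverts to E eta E^T = G^(-1), which lists the
    products of the rows. *)
Lemma gram_curved (R : realType) (c l : R) (E : 'M[R]_4) i j : c != 0 -> l != 0 ->
  E^T *m frameGram c l *m E = eta c -> sform c (row i E) (row j E) = gramInv c l i j.
Proof.
move=> c0 l0 H; rewrite sform_eta //.
have H1 : (eta c *m E^T *m frameGram c l) *m E = 1%:M by rewrite -!mulmxA (mulmxA E^T) H eta_sqr.
have H2 := mulmx1C H1.
have -> // : E *m eta c *m E^T = gramInv c l.
by rewrite -[LHS]mulmx1 -(frameGramK c0 l0) !mulmxA -(mulmxA E) -(mulmxA E) H2 mul1mx.
Qed.

(** Both forms are degenerate for c = 0. Replacing the position row by the last basis vector
    restores an invertible relation, which also shows that the other rows have no last component. *)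
Lemma gram_flat (R : realType) (l : R) (E : 'M[R]_4) : l != 0 ->
  E^T *m frameGram 0 l *m E = eta 0 -> forall i j, (0 < i < 4)%N -> (0 < j < 4)%N ->
  sform 0 (row (inord i) E) (row (inord j) E) = gramInv 0 l (inord i) (inord j) /\ E (inord i) (inord 3) = 0.
Proof.
move=> l0 H.
pose G : 'M[R]_4 := \matrix_(i, j) if (i : nat) == 0%N then ((j : nat) == 3%N)%:R else E i j.
have HG : G^T *m frameGram 1 l *m G = 1%:M.
  apply: mat4_ext => i j hi hj; have := congr1 (fun A : 'M[R]_4 => A (inord i) (inord j)) H.
  rewrite /eta !mxE !sum4 !mxE !sum4 !mxE !inordK //= -val_eqE /= !inordK //.
  rewrite !(mulr0, addr0, add0r, mul0r, mulr1) sgr0 => e.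
  have AC (x u v y t : R) : u + v + y = t -> x + u + v + y = x + t by move=> <-; rewrite !addrA.
  rewrite /= (AC _ _ _ _ _ e) {e}.
  by case: i hi => [|[|[|[|i]]]] //=; case: j hj => [|[|[|[|j]]]] //=; move=> _ _; rewrite ?(mul0r, mulr0, mul1r, mulr1, add0r, addr0).
have H2 := mulmx1C HG.
have K : G *m G^T = gramInv 1 l.
  by rewrite -[LHS]mulmx1 -(frameGramK (oner_neq0 R) l0) !mulmxA -(mulmxA G) H2 mul1mx.
move=> i j /andP[i0 hi] /andP[j0 hj]; split.
  have := congr1 (fun A : 'M[R]_4 => A (inord i) (inord j)) K.
  rewrite /sform /gramInv !mxE !sum4 !mxE !inordK //= ltxx !andbF.
  rewrite !(gtn_eqF i0) !(gtn_eqF j0) !mul1r => ->.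
  by case: i i0 hi => [|[|[|[|i]]]] //=; case: j j0 hj => [|[|[|[|j]]]].
have := congr1 (fun A : 'M[R]_4 => A (inord i) (inord 0)) K.
rewrite /gramInv !mxE !sum4 !mxE !inordK //= !(gtn_eqF i0) !(mulr0, add0r, mulr1) => ->.
by case: i i0 hi => [|[|[|[|i]]]].
Qed.

Record adapted (R : realType) (c l : R) (E : 'M[R]_4) : Prop := Adapted {
  ad_F : c != 0 -> sform c (row (inord 0) E) (row (inord 0) E) = c^-1;
  ad_Fnu : c * sform c (row (inord 0) E) (row (inord 3) E) = 0;
  ad_flat : c = 0 -> [/\ E (inord 1) (inord 3) = 0, E (inord 2) (inord 3) = 0 & E (inord 3) (inord 3) = 0];
  ad_11 : sform c (row (inord 1) E) (row (inord 1) E) = l;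
  ad_22 : sform c (row (inord 2) E) (row (inord 2) E) = l;
  ad_12 : sform c (row (inord 1) E) (row (inord 2) E) = 0;
  ad_13 : sform c (row (inord 1) E) (row (inord 3) E) = 0;
  ad_23 : sform c (row (inord 2) E) (row (inord 3) E) = 0;
  ad_33 : sform c (row (inord 3) E) (row (inord 3) E) = 1
}.

Lemma gram_adapted (R : realType) (c l : R) (E : 'M[R]_4) : l != 0 ->
  E^T *m frameGram c l *m E = eta c -> adapted c l E.
Proof.
move=> l0; have [->|c0] := eqVneq c 0 => H.
  have G := gram_flat l0 H.
  have g i j : (0 < i < 4)%N -> (0 < j < 4)%N -> sform 0 (row (inord i) E) (row (inord j) E) = gramInv 0 l (inord i) (inord j).
    by move=> hi hj; have [] := G i j hi hj.
  split; rewrite ?eqxx ?mul0r // ?g //; try by rewrite /gramInv mat4E.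
  by move=> _; have [_ ->] := G 1%N 1%N erefl erefl; have [_ ->] := G 2%N 1%N erefl erefl; have [_ ->] := G 3%N 1%N erefl erefl.
have g i j := gram_curved i j c0 l0 H.
split; rewrite ?g //; try by rewrite /gramInv mat4E // ?mulr0.
by move=> c00; rewrite c00 eqxx in c0.
Qed.

(** An initial frame satisfying the Gram relation. For c = 0 the inverse of 0 is 0, so the surface
    starts at the origin. *)
Definition frame0 (R : realType) (c l : R) : 'M[R]_4 :=
  mat4 [:: [:: 0; 0; 0; (Num.sqrt `|c|)^-1]; [:: Num.sqrt l; 0; 0; 0]; [:: 0; Num.sqrt l; 0; 0]; [:: 0; 0; 1; 0]].

Lemma frame0_gram (R : realType) (c l : R) : 0 < l ->
  (frame0 c l)^T *m frameGram c l *m frame0 c l = eta c.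
Proof.
move=> l0; have sl : Num.sqrt l * l^-1 * Num.sqrt l = 1.
  by rewrite mulrAC -expr2 sqr_sqrtr ?(ltW l0) // divff // gt_eqF.
have sc : (Num.sqrt `|c|)^-1 * c * (Num.sqrt `|c|)^-1 = Num.sg c.
  rewrite mulrAC -expr2 exprVn sqr_sqrtr //.
  have [->|c0] := eqVneq c 0; first by rewrite mulr0 sgr0.
  by rewrite {2}(numEsg c) mulrCA mulVf ?mulr1 // normr_eq0.
apply: mat4_ext => i j hi hj; rewrite !mxE !sum4 !mxE !sum4 !mxE !inordK //.
by case: i hi => [|[|[|[|i]]]] //=; case: j hj => [|[|[|[|j]]]] //=; move=> _ _; rewrite ?(mul0r, mulr0, mul1r, mulr1, add0r, addr0, sl, sc).
Qed.

Lemma ind4 (T : 'I_4 -> Prop) : T (inord 0) -> T (inord 1) -> T (inord 2) -> T (inord 3) -> forall i, T i.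
Proof.
move=> t0 t1 t2 t3 i; rewrite -(inord_val i).
by case: i => [[|[|[|[|i]]]] hi].
Qed.

Lemma ord4E : ((inord 0 : 'I_4) = 0%N :> nat) * ((inord 1 : 'I_4) = 1%N :> nat) *
  ((inord 2 : 'I_4) = 2%N :> nat) * ((inord 3 : 'I_4) = 3%N :> nat).
Proof. by rewrite !inordK. Qed.

Section FrameODE.
Context {R : realType}.
Variables (c b k0 d0 : R) (q m h al : R -> R).
Let I : set R := [set x | `|x - k0| < d0].
Hypothesis d00 : 0 < d0.
Hypothesis q0 : forall x, I x -> 0 < q x.
Hypothesis sq : sm1on I q.
Hypothesis sm : sm1on I m.
Hypothesis sh : sm1on I h.
Hypothesis sal : sm1on I al.
Hypothesis dq : forall x, I x -> is_derive x 1 q (m x).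
Hypothesis dm : forall x, I x -> is_derive x 1 m (-2 * x).
Hypothesis dal : forall x, I x -> is_derive x 1 al (4 * q x * derive1 h x).
Hypothesis gauss : forall x, I x -> al x ^+ 2 + b ^+ 2 = 16 * q x ^+ 2 * (h x ^+ 2 - x + c).

Definition flowX x := frameX c (4 * q x) (m x) (4 * q x * h x + al x) (- b).
Definition flowY x := frameY c (4 * q x) (m x) (- b) (4 * q x * h x - al x).

Let oI : open I := @itv_open R k0 d0.
Let q4 x : I x -> 4 * q x != 0.
Proof. by move=> /q0 qx; apply: mulf_neq0; [rewrite pnatr_eq0|rewrite gt_eqF]. Qed.

Let sc (t : R) : sm1on I (fun=> t). Proof. exact: sm1on_cst. Qed.
Arguments sc : clear implicits.

Let s4q : sm1on I (fun x => 4 * q x).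
Proof. exact (sm1onM oI (sc 4) sq). Qed.

Let sV : sm1on I (fun x => (4 * q x)^-1). Proof. exact (sm1onV oI s4q q4). Qed.

Let s11 : sm1on I (fun x => 4 * q x * h x + al x). Proof. exact (sm1onD oI (sm1onM oI s4q sh) sal). Qed.

Let sN f : sm1on I f -> sm1on I (fun x => - f x).
Proof.
move=> sf; have := sm1onM oI (sc (-1)) sf.
by have -> : (fun x => -1 * f x) = (fun x => - f x) by apply/funext => x; rewrite mulN1r.
Qed.

Let s22 : sm1on I (fun x => 4 * q x * h x - al x). Proof. exact (sm1onD oI (sm1onM oI s4q sh) (sN sal)). Qed.

Lemma sm1_flowX i j : sm1on I (fun x => flowX x i j).
Proof.
have e1 : sm1on I (fun x => - (c * (4 * q x))) := sN (sm1onM oI (sc c) s4q).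
have e2 : sm1on I (fun x => - ((4 * q x * h x + al x) / (4 * q x))) := sN (sm1onM oI s11 sV).
have e3 : sm1on I (fun x => - (- b / (4 * q x))) := sN (sm1onM oI (sc (- b)) sV).
have -> : (fun x => flowX x i j) = (fun x => nth 0 (nth [::] [:: [:: 0; 1; 0; 0];
    [:: - (c * (4 * q x)); m x; 0; 4 * q x * h x + al x]; [:: 0; 0; m x; - b];
    [:: 0; - ((4 * q x * h x + al x) / (4 * q x)); - (- b / (4 * q x)); 0]] i) j).
  by apply/funext => x; rewrite mxE.
elim/ind4: i; elim/ind4: j; rewrite !ord4E; cbn [nth].
- exact (sc 0).
- exact (sc 1).
- exact (sc 0).
- exact (sc 0).
- exact (e1).
- exact (sm).
- exact (sc 0).
- exact (s11).
- exact (sc 0).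
- exact (sc 0).
- exact (sm).
- exact (sc (- b)).
- exact (sc 0).
- exact (e2).
- exact (e3).
- exact (sc 0).
Qed.

Lemma sm1_flowY i j : sm1on I (fun x => flowY x i j).
Proof.
have e1 : sm1on I (fun x => - (c * (4 * q x))) := sN (sm1onM oI (sc c) s4q).
have e2 : sm1on I (fun x => - ((4 * q x * h x - al x) / (4 * q x))) := sN (sm1onM oI s22 sV).
have e3 : sm1on I (fun x => - (- b / (4 * q x))) := sN (sm1onM oI (sc (- b)) sV).
have -> : (fun x => flowY x i j) = (fun x => nth 0 (nth [::] [:: [:: 0; 0; 1; 0];
    [:: 0; 0; m x; - b]; [:: - (c * (4 * q x)); - m x; 0; 4 * q x * h x - al x];
    [:: 0; - (- b / (4 * q x)); - ((4 * q x * h x - al x) / (4 * q x)); 0]] i) j).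
  by apply/funext => x; rewrite mxE.
elim/ind4: i; elim/ind4: j; rewrite !ord4E; cbn [nth].
- exact (sc 0).
- exact (sc 0).
- exact (sc 1).
- exact (sc 0).
- exact (sc 0).
- exact (sc 0).
- exact (sm).
- exact (sc (- b)).
- exact (e1).
- exact (sN sm).
- exact (sc 0).
- exact (s22).
- exact (sc 0).
- exact (e3).
- exact (e2).
- exact (sc 0).
Qed.

Lemma derive_flowY x : I x ->
  mderive flowY x (dframeY c (q x) (m x) x (- b) (4 * q x * h x - al x) (4 * m x * h x)).
Proof.
move=> Ix i j; have n4 := q4 Ix.
have d4 := isdM (isd_cst 4 x) (dq Ix).
have dv := @isd_inv R (fun x => 4 * q x) x _ n4 d4.
have d22 := isdB (isdM d4 (sm1_isd (sh Ix))) (dal Ix).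
have e1 := isdN (isdM (isd_cst c x) d4).
have e2 := isdN (isdM d22 dv).
have e3 := isdN (isdM (isd_cst (- b) x) dv).
have n0 : q x != 0 by rewrite gt_eqF // q0.
apply: (@isd_ext R (fun x => nth 0 (nth [::] [:: [:: 0; 0; 1; 0];
    [:: 0; 0; m x; - b]; [:: - (c * (4 * q x)); - m x; 0; 4 * q x * h x - al x];
    [:: 0; - (- b / (4 * q x)); - ((4 * q x * h x - al x) / (4 * q x)); 0]] i) j)).
  by move=> y; rewrite mxE.
rewrite mxE; have g := dm Ix.
case: i => [[|[|[|[|i]]]] hi] //=; case: j => [[|[|[|[|j]]]] hj] //=; try exact: isd_cst.
- apply: isd_eq e1 _; ring.
- apply: isd_eq (isdN g) _; ring.
- apply: isd_eq d22 _; ring.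
- by apply: isd_eq e3 _; move: (q x) n0 => t t0; field.
by apply: isd_eq e2 _; move: (q x) n0 => t t0; field.
Qed.

Lemma ex_frame_flow : exists d Phi Ups, [/\ 0 < d, d <= d0, Phi k0 = 1%:M, Ups 0 = 1%:M &
  (forall x, `|x - k0| < d -> mderive Phi x ((2 * q x)^-1 *: flowX x *m Phi x) /\ flowY x *m Phi x = Phi x *m flowY k0) /\
  (forall t : R, `|t| < d -> mderive Ups t (flowY k0 *m Ups t))].
Proof.
have n2 x : I x -> 2 * q x != 0.
  by move=> /q0 qx; apply: mulf_neq0; [rewrite pnatr_eq0|rewrite gt_eqF].
have s2 : sm1on I (fun x => (2 * q x)^-1) := sm1onV oI (sm1onM oI (sc 2) sq) n2.
have cB x : I x -> forall i j, {for x, continuous (fun x => ((2 * q x)^-1 *: flowX x) i j)}.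
  move=> Ix i j; have -> : (fun x => ((2 * q x)^-1 *: flowX x) i j) = (fun x => (2 * q x)^-1 * flowX x i j).
    by apply/funext => y; rewrite mxE.
  exact: isd_cont (sm1_isd (sm1onM oI s2 (@sm1_flowX i j) Ix)).
have dV x : I x -> mderive flowY x (((2 * q x)^-1 *: flowX x) *m flowY x - flowY x *m ((2 * q x)^-1 *: flowX x)).
  move=> Ix; apply: mderive_eq (derive_flowY Ix) _.
  have n0 : q x != 0 by rewrite gt_eqF // q0.
  have := @frame_commutator R c (q x) (m x) x (h x) (al x) b n0 (gauss Ix).
  rewrite -/(flowX x) -/(flowY x) => C; apply: (scalerI (n2 x Ix)).
  by rewrite -C -scalemxAl -scalemxAr -scalerBr scalerA divff ?n2 // scale1r.
have [d1 [Phi [d10 d1d P0 HP]]] := matrix_ode_intertwine d00 cB dV.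
have [d2 [Ups [d20 d2d U0 HU]]] : exists d Ups, [/\ 0 < d, d <= d0, Ups 0 = 1%:M &
    forall t : R, `|t - 0| < d -> mderive Ups t (flowY k0 *m Ups t)].
  apply: (@matrix_ode R 4 (fun=> flowY k0) 0 d0 d00) => k _ i j; exact: isd_cont (isd_cst _ k).
have [d [dp dd1 dd2]] := ex_lt2 d10 d20.
exists d, Phi, Ups; split=> //; first exact: le_trans (ltW dd1) d1d.
split=> [x hx|t ht]; first exact: HP _ (lt_trans hx dd1).
by apply: HU; rewrite subr0; exact: lt_trans ht dd2.
Qed.

End FrameODE.

(** * The moving frame on a square *)

Section MatrixFd.
Context {R : realType}.
Variables (w1 w2 : cplx R -> R).
Local Notation fd := (fd w1 w2).

Definition mfd (E : cplx R -> 'M[R]_4) z (A B : 'M[R]_4) := forall i j, fd (fun v => E v i j) z (A i j) (B i j).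

Lemma mfd_eq E z A B A' B' : mfd E z A B -> A = A' -> B = B' -> mfd E z A' B'.
Proof. by move=> H <- <-. Qed.

Lemma mfdM E G z A B A' B' : mfd E z A B -> mfd G z A' B' ->
  mfd (fun v => E v *m G v) z (A *m G z + E z *m A') (B *m G z + E z *m B').
Proof.
move=> hE hG i j; rewrite mxE !mxE -!big_split /=.
have -> : (fun v => (E v *m G v) i j) = (fun v => \sum_(l <- index_enum 'I_4) E v i l * G v l j).
  by apply/funext => v; rewrite mxE.
by apply: fd_sum => l; apply: fd_eq (fdM (hE i l) (hG l j)) _ _; rewrite addrC.
Qed.

Lemma mfd_cst (E : 'M[R]_4) z : mfd (fun=> E) z 0 0.
Proof. by move=> i j; rewrite !mxE; exact: fd_cst. Qed.

Lemma mfd_tr E z A B : mfd E z A B -> mfd (fun v => (E v)^T) z A^T B^T.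
Proof.
move=> hE i j; rewrite !mxE; have -> : (fun v => (E v)^T i j) = (fun v => E v j i) by apply/funext => v; rewrite mxE.
exact: hE.
Qed.

Lemma mfd_comp (Phi : R -> 'M[R]_4) (k : cplx R -> R) z DP a b : mderive Phi (k z) DP -> fd k z a b ->
  mfd (fun v => Phi (k v)) z (a *: DP) (b *: DP).
Proof.
move=> hP hk i j; apply: fd_eq (fd_comp (hP i j) hk) _ _; by rewrite mxE mulrC.
Qed.

Lemma vfd_row E z A B i : mfd E z A B -> vfd w1 w2 (fun v => row i (E v)) z (row i A) (row i B).
Proof.
move=> hE j; rewrite !mxE; have -> : (fun v => row i (E v) 0 j) = (fun v => E v i j) by apply/funext => v; rewrite mxE.
exact: hE.
Qed.

End MatrixFd.

Lemma row_mulmx4 (R : realType) (A E : 'M[R]_4) i : row i (A *m E) =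
  A i (inord 0) *: row (inord 0) E + A i (inord 1) *: row (inord 1) E +
  A i (inord 2) *: row (inord 2) E + A i (inord 3) *: row (inord 3) E.
Proof. by apply/rowP => j; rewrite !mxE sum4. Qed.

Lemma rotated_pairings (R : realType) (c u v l : R) (e1 e2 n : 'rV[R]_4) :
  sform c e1 e1 = l -> sform c e2 e2 = l -> sform c e1 e2 = 0 -> sform c e1 n = 0 -> sform c e2 n = 0 ->
  let fx := u *: e1 + v *: e2 in let fy := - v *: e1 + u *: e2 in
  [/\ sform c fx fx = l * (u ^+ 2 + v ^+ 2), sform c fy fy = l * (u ^+ 2 + v ^+ 2),
   sform c fx fy = 0, sform c n fx = 0 & sform c n fy = 0].
Proof.
move=> h11 h22 h12 h1 h2 /=.
rewrite !(sformDl, sformDr, sformZl, sformZr) (sformC c e2 e1) (sformC c n e1) (sformC c n e2) h11 h22 h12 h1 h2.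
by split; ring.
Qed.

Lemma sform_normal (R : realType) (c l m1 x : R) (F e n : 'rV[R]_4) : c * sform c F n = 0 ->
  sform c e n = 0 -> sform c n n = 1 -> sform c (- (c * l) *: F + m1 *: e + x *: n) n = x.
Proof.
move=> h1 h2 h3; rewrite !(sformDl, sformZl) h2 h3 mulr0 mulr1 addr0.
by rewrite mulNr mulrAC h1 mul0r oppr0 add0r.
Qed.

Lemma sform_normal2 (R : realType) (c m1 x : R) (e n : 'rV[R]_4) :
  sform c e n = 0 -> sform c n n = 1 -> sform c (m1 *: e + x *: n) n = x.
Proof. by move=> h2 h3; rewrite !(sformDl, sformZl) h2 h3 mulr0 mulr1 add0r. Qed.

Definition mcont (R : realType) (E : cplx R -> 'M[R]_4) z := forall i j, {for z, continuous (fun v => E v i j)}.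

Lemma mcontM (R : realType) (E G : cplx R -> 'M[R]_4) z : mcont E z -> mcont G z -> mcont (fun v => E v *m G v) z.
Proof.
move=> hE hG i j.
have -> : (fun v => (E v *m G v) i j) = (fun v => E v i (inord 0) * G v (inord 0) j + E v i (inord 1) * G v (inord 1) j +
    E v i (inord 2) * G v (inord 2) j + E v i (inord 3) * G v (inord 3) j).
  by apply/funext => v; rewrite mxE sum4.
have c l : {for z, continuous (fun v => E v i l * G v l j)} by exact: ccontM.
exact: (ccontD (ccontD (ccontD (c _) (c _)) (c _)) (c _)).
Qed.

Lemma mcont_comp (R : realType) (Phi : R -> 'M[R]_4) (k : cplx R -> R) z DP : mderive Phi (k z) DP ->
  {for z, continuous k} -> mcont (fun v => Phi (k v)) z.
Proof. by move=> hP ck i j; apply: (ccont_comp (h := fun x => Phi x i j) ck); exact: isd_cont (hP i j). Qed.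

Section FrameChart.
Context {R : realType}.
Variables (c b k0 d : R) (q m h al : R -> R) (Phi Ups : R -> 'M[R]_4) (E0 : 'M[R]_4).
Let I : set R := [set x | `|x - k0| < d].
Hypothesis q0 : forall x, I x -> 0 < q x.
Hypothesis sq : sm1on I q.
Hypothesis sm : sm1on I m.
Hypothesis sh : sm1on I h.
Hypothesis sal : sm1on I al.
Hypothesis dq : forall x, I x -> is_derive x 1 q (m x).
Local Notation flowX := (flowX c b q m h al).
Local Notation flowY := (flowY c b q m h al).
Hypothesis HP : forall x, `|x - k0| < d -> mderive Phi x ((2 * q x)^-1 *: flowX x *m Phi x) /\ flowY x *m Phi x = Phi x *m flowY k0.
Hypothesis HU : forall t : R, `|t| < d -> mderive Ups t (flowY k0 *m Ups t).
Variables (w1 w2 : cplx R -> R) (D : set (cplx R)) (k y : cplx R -> R).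
Hypothesis oD : open D.
Hypothesis hk : forall z, D z -> fd w1 w2 k z (2 * q (k z)) 0.
Hypothesis hy : forall z, D z -> fd w1 w2 y z 0 1.
Hypothesis hI : forall z, D z -> `|k z - k0| < d /\ `|y z| < d.

Definition frameE x t := Phi x *m Ups t *m E0.
Let Ez z := frameE (k z) (y z).

Let n2 x : I x -> 2 * q x != 0.
Proof. by move=> /q0 qx; apply: mulf_neq0; [rewrite pnatr_eq0|rewrite gt_eqF]. Qed.

(** Y only differentiates the middle factor [Ups] and produces V(k0) inside; the intertwining
    relation moves it to the left of [Phi] as V(k). *)
Lemma frame_fd z : D z -> mfd w1 w2 Ez z (flowX (k z) *m Ez z) (flowY (k z) *m Ez z).
Proof.
move=> Dz; have [kz yz] := hI Dz; have [dP VP] := HP kz.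
have H := mfdM (mfdM (mfd_comp dP (hk Dz)) (mfd_comp (HU yz) (hy Dz))) (mfd_cst w1 w2 E0 z).
apply: mfd_eq H _ _; rewrite !scale0r ?mul0mx !mulmx0 !addr0 ?add0r.
  by rewrite -!scalemxAl scalerA divff ?n2 // scale1r /Ez /frameE !mulmxA.
by rewrite scale1r /Ez /frameE !mulmxA VP.
Qed.

Let q40 z : D z -> q (k z) != 0.
Proof. by move=> Dz; rewrite gt_eqF // q0 //; have [] := hI Dz. Qed.

(** [frameX_gram] and [frameY_gram] make the Gram relation a first integral, so it spreads from the
    centre. *)
Lemma gram_fd z : D z -> mfd w1 w2 (fun v => (Ez v)^T *m frameGram c (4 * q (k v)) *m Ez v) z 0 0.
Proof.
move=> Dz; have [kz yz] := hI Dz; have p0 := q40 Dz; have q4 : 4 * q (k z) != 0.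
  by apply: mulf_neq0 p0; rewrite pnatr_eq0.
have dG : mfd w1 w2 (fun v => frameGram c (4 * q (k v))) z (dframeGram (- (m (k z) / (2 * q (k z))))) 0.
  have dv := @isd_inv R (fun x => 4 * q x) (k z) _ q4 (isdM (isd_cst 4 (k z)) (dq kz)).
  have f1 := fd_comp dv (hk Dz).
  have f0 t := fd_cst w1 w2 t z.
  have F1 : fd w1 w2 (fun v => (4 * q (k v))^-1) z (- (m (k z) / (2 * q (k z)))) 0.
    by apply: fd_eq f1 _ _; [move: (q (k z)) p0 => t t0; field|rewrite mulr0].
  move=> i j; have -> : (fun v => frameGram c (4 * q (k v)) i j) = (fun v => nth 0 (nth [::] [:: [:: c; 0; 0; 0];
     [:: 0; (4 * q (k v))^-1; 0; 0]; [:: 0; 0; (4 * q (k v))^-1; 0]; [:: 0; 0; 0; 1]] i) j).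
    by apply/funext => v; rewrite mxE.
  rewrite !mxE; elim/ind4: i; elim/ind4: j; rewrite !ord4E; cbn [nth]; first [exact (f0 0)|exact (f0 c)|exact (f0 1)|exact F1].
have fE := frame_fd Dz.
have H := mfdM (mfdM (mfd_tr fE) dG) fE.
apply: mfd_eq H _ _.
  have C := @frameX_gram R c (q (k z)) (m (k z)) (4 * q (k z) * h (k z) + al (k z)) (- b) p0.
  rewrite -/(flowX (k z)) in C.
  have -> : ((flowX (k z) *m Ez z)^T *m frameGram c (4 * q (k z)) + (Ez z)^T *m dframeGram (- (m (k z) / (2 * q (k z))))) *m Ez z +
     (Ez z)^T *m frameGram c (4 * q (k z)) *m (flowX (k z) *m Ez z) =
     (Ez z)^T *m ((flowX (k z))^T *m frameGram c (4 * q (k z)) + dframeGram (- (m (k z) / (2 * q (k z)))) + frameGram c (4 * q (k z)) *m flowX (k z)) *m Ez z.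
    by rewrite trmx_mul !(mulmxDr, mulmxDl) !mulmxA.
  by rewrite C mulmx0 mul0mx.
have C := @frameY_gram R c (q (k z)) (m (k z)) (- b) (4 * q (k z) * h (k z) - al (k z)) p0.
rewrite -/(flowY (k z)) in C.
have -> : ((flowY (k z) *m Ez z)^T *m frameGram c (4 * q (k z)) + (Ez z)^T *m 0) *m Ez z +
   (Ez z)^T *m frameGram c (4 * q (k z)) *m (flowY (k z) *m Ez z) =
   (Ez z)^T *m ((flowY (k z))^T *m frameGram c (4 * q (k z)) + frameGram c (4 * q (k z)) *m flowY (k z)) *m Ez z.
  by rewrite mulmx0 addr0 trmx_mul !(mulmxDr, mulmxDl) !mulmxA.
by rewrite C mulmx0 mul0mx.
Qed.

Hypothesis w0 : forall z, D z -> w1 z ^+ 2 + w2 z ^+ 2 != 0.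
Hypothesis s1 : smooth_on D w1.
Hypothesis s2 : smooth_on D w2.
Hypothesis sk : smooth_on D k.
Hypothesis cy : forall z, D z -> {for z, continuous y}.

(** Bootstrap: the derivatives of the entries are smooth coefficients times entries. *)
Lemma smooth_frame i j : smooth_on D (fun z => Ez z i j).
Proof.
pose G (f : cplx R -> R) := exists i j, f = (fun z => Ez z i j).
have GE l j' : sclass D G (fun z => Ez z l j') by apply: scG; exists l, j'.
have sU l l' : sclass D G (fun z => flowX (k z) l l').
  apply: scS; apply: (@smooth_comp R D (fun x => flowX x l l')) => // z Dz; have [kz _] := hI Dz.
  exact: (@sm1_flowX R c b k0 d q m h al q0 sq sm sh sal l l' _ kz).
have sV l l' : sclass D G (fun z => flowY (k z) l l').
  apply: scS; apply: (@smooth_comp R D (fun x => flowY x l l')) => // z Dz; have [kz _] := hI Dz.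
  exact: (@sm1_flowY R c b k0 d q m h al q0 sq sm sh sal l l' _ kz).
have sS (T : R -> 'M[R]_4) l j' : (forall a a', sclass D G (fun z => T (k z) a a')) ->
    sclass D G (fun z => (T (k z) *m Ez z) l j').
  move=> sT; have -> : (fun z => (T (k z) *m Ez z) l j') = (fun z => T (k z) l (inord 0) * Ez z (inord 0) j' +
     T (k z) l (inord 1) * Ez z (inord 1) j' + T (k z) l (inord 2) * Ez z (inord 2) j' + T (k z) l (inord 3) * Ez z (inord 3) j').
    by apply/funext => z; rewrite mxE sum4.
  by apply: scD; [apply: scD; [apply: scD|]|]; exact: scM.
apply: (sclass_smooth oD _ (GE i j)) => _ [i' [j' ->]]; split.
  move=> z Dz; have [kz yz] := hI Dz; have [dP _] := HP kz.
  have c0 : mcont (fun=> E0) z by move=> a a'; exact: ccont_cst.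
  exact: (mcontM (mcontM (mcont_comp dP (smooth_cont sk Dz)) (mcont_comp (HU yz) (cy Dz))) c0).
exists (fun z => (flowX (k z) *m Ez z) i' j' * w1 z + (flowY (k z) *m Ez z) i' j' * w2 z),
  (fun z => (-1) * (flowX (k z) *m Ez z) i' j' * w2 z + (flowY (k z) *m Ez z) i' j' * w1 z).
have c1 : sclass D G (fun=> -1) by apply: scS; exact: smooth_cst.
split.
- by apply: scD; apply: scM; [exact: sS|exact: scS|exact: sS|exact: scS].
- apply: scD; last by apply: scM; [exact: sS|exact: scS].
  by apply: scM; [apply: scM => //; exact: sS|exact: scS].
move=> z Dz; apply: pd_eq (frame_fd Dz i' j') _ _ => //; by rewrite mulN1r.
Qed.

Hypothesis ad : forall z, D z -> adapted c (4 * q (k z)) (Ez z).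

Let f z := row (inord 0) (Ez z).
Let n z := row (inord 3) (Ez z).

Lemma frame_metric z : D z -> let N := w1 z ^+ 2 + w2 z ^+ 2 in
  [/\ sform c (vdx f z) (vdx f z) = 4 * q (k z) * N, sform c (vdy f z) (vdy f z) = 4 * q (k z) * N,
   sform c (vdx f z) (vdy f z) = 0, sform c (n z) (vdx f z) = 0 & sform c (n z) (vdy f z) = 0].
Proof.
move=> Dz N; have := vfd_row (inord 0) (frame_fd Dz).
rewrite (row_mulmx4 (flowX (k z)) (Ez z)) (row_mulmx4 (flowY (k z)) (Ez z)) !mat4E //= !(scale0r, scale1r, add0r, addr0) => H.
have [-> ->] := vfd_dx H; have A := ad Dz.
exact: (rotated_pairings _ _ (ad_11 A) (ad_22 A) (ad_12 A) (ad_13 A) (ad_23 A)).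
Qed.

Lemma frame_second_form z : D z ->
  let a11 := 4 * q (k z) * h (k z) + al (k z) in let a22 := 4 * q (k z) * h (k z) - al (k z) in
  [/\ sform c (vdx (vdx f) z) (n z) = w1 z ^+ 2 * a11 + 2 * w1 z * w2 z * (- b) + w2 z ^+ 2 * a22,
      sform c (vdy (vdx f) z) (n z) = - w1 z * w2 z * a11 + (w1 z ^+ 2 - w2 z ^+ 2) * (- b) + w1 z * w2 z * a22 &
      sform c (vdy (vdy f) z) (n z) = w2 z ^+ 2 * a11 - 2 * w1 z * w2 z * (- b) + w1 z ^+ 2 * a22].
Proof.
move=> Dz a11 a22; have A := ad Dz.
have V0 v : D v -> vfd w1 w2 f v (row (inord 1) (Ez v)) (row (inord 2) (Ez v)).
  move=> Dv; have := vfd_row (inord 0) (frame_fd Dv).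
  by rewrite (row_mulmx4 (flowX (k v)) (Ez v)) (row_mulmx4 (flowY (k v)) (Ez v)) !mat4E //= !(scale0r, scale1r, add0r, addr0).
have V1 := vfd_row (inord 1) (frame_fd Dz); have V2 := vfd_row (inord 2) (frame_fd Dz).
rewrite !(row_mulmx4 (flowX (k z)) (Ez z)) !(row_mulmx4 (flowY (k z)) (Ez z)) !mat4E //= !(scale0r, scale1r, add0r, addr0) -/(n z) in V1 V2.
have := second_form oD Dz V0 V1 V2 (smooth_pd s1 Dz) (smooth_pd s2 Dz) (ad_13 A) (ad_23 A).
by rewrite !(sform_normal _ _ _ (ad_Fnu A)) ?(sform_normal2 _ _ (ad_23 A)) ?(ad_13 A) ?(ad_23 A) ?(ad_33 A).
Qed.

End FrameChart.

Section Flow.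
Context {R : realType}.
Variables (K1 K2 c A : R) (h : R -> R).
Local Notation P := (pcubic K1 K2).
Local Notation dP := (fun x : R => - x ^+ 2 + (K1 ^+ 2 + K1 * K2 + K2 ^+ 2) / 3).

Record flow (k0 d : R) (al : R -> R) (Phi Ups : R -> 'M[R]_4) : Prop := Flow {
  fl_d : 0 < d;
  fl_P : forall x, `|x - k0| < d -> 0 < P x;
  fl_sP : forall x, `|x - k0| < d -> sm1 P x;
  fl_sdP : forall x, `|x - k0| < d -> sm1 dP x;
  fl_h : forall x, `|x - k0| < d -> sm1 h x;
  fl_al : forall x, `|x - k0| < d -> sm1 al x;
  fl_gauss : forall x, `|x - k0| < d -> al x ^+ 2 + (4 * A) ^+ 2 = 16 * P x ^+ 2 * (h x ^+ 2 - x + c);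
  fl_E : forall x, `|x - k0| < d -> 0 < h x ^+ 2 - x + c;
  fl_Phi0 : Phi k0 = 1%:M;
  fl_Ups0 : Ups 0 = 1%:M;
  fl_Phi : forall x, `|x - k0| < d -> mderive Phi x ((2 * P x)^-1 *: flowX c (4 * A) P dP h al x *m Phi x) /\
    flowY c (4 * A) P dP h al x *m Phi x = Phi x *m flowY c (4 * A) P dP h al k0;
  fl_Ups : forall t : R, `|t| < d -> mderive Ups t (flowY c (4 * A) P dP h al k0 *m Ups t)
}.

Lemma ex_flow k0 : 0 < P k0 -> mc_solution K1 K2 c A h k0 -> exists d al Phi Ups, flow k0 d al Phi Ups.
Proof.
move=> P0 mc; have [d0 [al [d00 Ppos sm dal al2]]] := alpha_of_mc P0 mc.
have oI := @itv_open R k0 d0.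
have sP : sm1on [set x : R | `|x - k0| < d0] P by exact: sm1on_pcubic.
have sdP : sm1on [set x : R | `|x - k0| < d0] dP.
  have := sm1on_d sP; have -> // : derive1 P = dP.
  by apply/funext => x; rewrite (isd_derive1 (isd_pcubic K1 K2 x)).
have sh : sm1on [set x : R | `|x - k0| < d0] h by move=> x /sm [].
have sal : sm1on [set x : R | `|x - k0| < d0] al by move=> x /sm [].
have gauss x : `|x - k0| < d0 -> al x ^+ 2 + (4 * A) ^+ 2 = 16 * P x ^+ 2 * (h x ^+ 2 - x + c).
  by move=> /al2 [-> _]; move: (P x) (h x ^+ 2 - x + c) => p e; ring.
have ddP x : `|x - k0| < d0 -> is_derive x 1 dP (-2 * x).
  move=> _; have D := isdD (isdN (isdM (isd_id x) (isd_id x))) (isd_cst ((K1 ^+ 2 + K1 * K2 + K2 ^+ 2) / 3) x).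
  have {}D := @isd_ext R _ dP x _ _ D; apply: isd_eq (D _) _ => [y|]; first by rewrite expr2.
  by ring.
have [d [Phi [Ups [dp dd P1 U1 [HP HU]]]]] := @ex_frame_flow R c (4 * A) k0 d0 P dP h al d00 Ppos sP sdP sh sal
  (fun x _ => isd_pcubic K1 K2 x) ddP dal gauss.
exists d, al, Phi, Ups; split=> //; try (by move=> x hx; have hx' := lt_le_trans hx dd; auto).
by move=> x hx; have [] := al2 x (lt_le_trans hx dd).
Qed.

End Flow.

Section Frame.
Context {R : realType}.
Variables (K1 K2 c A : R) (h : R -> R) (z0 : cplx R) (r : R) (k w1 w2 : cplx R -> R).
Local Notation P := (pcubic K1 K2).
Hypothesis rg : regular P z0 r k w1 w2.
Variables (d : R) (al : R -> R) (Phi Ups : R -> 'M[R]_4).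
Hypothesis fl : flow K1 K2 c A h (k z0) d al Phi Ups.
Local Notation EE := (frameE Phi Ups (frame0 c (4 * P (k z0)))).

(** The Gram relation and, for c = 0, the vanishing last coordinate of the position hold at the
    centre and have zero differential. The choice of sheet for c < 0 is an open condition, so it
    holds nearby. *)
Lemma ex_frame : exists Y rho, [/\ 0 < rho, rho <= r, forall z, box z0 r z -> pd Y z (w2 z) (w1 z) &
  forall z, box z0 rho z -> [/\ `|k z - k z0| < d, `|Y z| < d,
    adapted c (4 * P (k z)) (EE (k z) (Y z)), (c = 0 -> EE (k z) (Y z) (inord 0) (inord 3) = 0) &
    (c < 0 -> 0 < EE (k z) (Y z) (inord 0) (inord 3))]].
Proof.
have r0 := rg_gt0 rg; have bc := box_center z0 r0.
have [Y Y0 HY] := ex_potential r0 (rg_w2 rg) (rg_w1 rg) (rg_cr2 rg).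
have cY z : box z0 r z -> {for z, continuous Y}.
  move=> bz; have o := open_near (@box_open R z0 r) bz.
  apply: (@diff_cont R Y z (w2 z) (w1 z)); apply: pd_diff.
  - by apply: filterS o => v; exact: HY.
  - exact: smooth_cont (rg_w2 rg) bz.
  exact: smooth_cont (rg_w1 rg) bz.
have ck z : box z0 r z -> {for z, continuous k} by exact: smooth_cont (rg_k rg).
have dp := fl_d fl.
have k00 : `|k z0 - k z0| < d by rewrite subrr normr0.
have E00 : EE (k z0) (Y z0) = frame0 c (4 * P (k z0)).
  by rewrite /frameE Y0 (fl_Phi0 fl) (fl_Ups0 fl) !mul1mx.
have cE : mcont (fun z => EE (k z) (Y z)) z0.
  have y00 : `|Y z0| < d by rewrite Y0 normr0.
  have c0 : mcont (fun=> frame0 c (4 * P (k z0))) z0 by move=> a a'; exact: ccont_cst.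
  exact: (mcontM (mcontM (mcont_comp (fl_Phi fl k00).1 (ck _ bc)) (mcont_comp (fl_Ups fl y00) (cY _ bc))) c0).
have nk : \forall z \near z0, `|k z - k z0| < d /\ `|Y z| < d.
  have /ccontP /(_ _ dp) [e1 e10 H1] := ck z0 bc; have /ccontP /(_ _ dp) [e2 e20 H2] := cY z0 bc.
  apply/near_boxP; exists (Num.min e1 e2); first by rewrite lt_min e10.
  move=> z /boxE [a [b [ha hb ->]]]; move: ha hb; rewrite !lt_min => /andP[a1 a2] /andP[b1 b2].
  by split; [exact: H1|have := H2 a b a2 b2; rewrite Y0 subr0].
have np : \forall z \near z0, c < 0 -> 0 < EE (k z) (Y z) (inord 0) (inord 3).
  have [c0|c0] := ltP c 0; last by apply: filterS nk.
  have p0 : 0 < EE (k z0) (Y z0) (inord 0) (inord 3).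
    by rewrite E00 mat4E //= invr_gt0 sqrtr_gt0 normr_gt0 lt_eqF.
  have := @cvgr_gt _ _ _ (nbhs_filter z0) _ _ (cE (inord 0) (inord 3)) _ p0.
  by apply: filterS => z.
have /near_boxP [e e0 He] := @filterI _ _ (nbhs_filter z0) _ _ nk np.
pose rho := Num.min e r; have rho0 : 0 < rho by rewrite lt_min e0.
have rr : rho <= r by rewrite ge_min lexx orbT.
have sub : box z0 rho `<=` box z0 r by exact: box_sub.
have sube : box z0 rho `<=` box z0 e by apply: box_sub; rewrite ge_min lexx.
have hI z : box z0 rho z -> `|k z - k z0| < d /\ `|Y z| < d by move=> /sube /He [].
have hk z : box z0 rho z -> fd w1 w2 k z (2 * P (k z)) 0.
  by move=> /sub Dz; apply: pd_eq (rg_pd rg Dz) _ _; ring.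
have hy z : box z0 rho z -> fd w1 w2 Y z 0 1.
  by move=> /sub Dz; apply: pd_eq (HY z Dz) _ _; ring.
have fE := @frame_fd R c (4 * A) (k z0) d P _ h al Phi Ups (frame0 c (4 * P (k z0))) (fl_P fl) (fl_Phi fl) (fl_Ups fl)
  w1 w2 (box z0 rho) k Y hk hy hI.
have gE := @gram_fd R c (4 * A) (k z0) d P _ h al Phi Ups (frame0 c (4 * P (k z0))) (fl_P fl)
  (fun x _ => isd_pcubic K1 K2 x) (fl_Phi fl) (fl_Ups fl) w1 w2 (box z0 rho) k Y hk hy hI.
have P4 z : box z0 rho z -> 4 * P (k z) != 0.
  by move=> /hI [/(fl_P fl) pz _]; apply: mulf_neq0; [rewrite pnatr_eq0|rewrite gt_eqF].
have ad z : box z0 rho z -> adapted c (4 * P (k z)) (EE (k z) (Y z)).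
  move=> bz; apply: gram_adapted (P4 z bz) _.
  have -> : (EE (k z) (Y z))^T *m frameGram c (4 * P (k z)) *m EE (k z) (Y z) =
      (EE (k z0) (Y z0))^T *m frameGram c (4 * P (k z0)) *m EE (k z0) (Y z0).
    apply/matrixP => i j.
    apply: (@box_const R (fun v => ((EE (k v) (Y v))^T *m frameGram c (4 * P (k v)) *m EE (k v) (Y v)) i j) z0 rho) bz => v bv.
    by apply: pd_eq (gE v bv i j) _ _; rewrite !mxE; ring.
  rewrite E00; apply: frame0_gram; apply: mulr_gt0; [by rewrite ltr0n|exact: (fl_P fl k00)].
exists Y, rho; split=> // z bz; have [h1 h2] := hI z bz; split=> //; first exact: ad; last first.
  by have [_] := He z (sube z bz).
move=> c0; have -> : 0 = EE (k z0) (Y z0) (inord 0) (inord 3).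
  by rewrite E00 mat4E //= c0 normr0 sqrtr0 invr0.
apply: (@box_const R (fun v => EE (k v) (Y v) (inord 0) (inord 3)) z0 rho) bz => v bv.
have [f1 f2 _] := ad_flat (ad v bv) c0.
apply: pd_eq (fE v bv (inord 0) (inord 3)) _ _; rewrite !mxE !sum4 !mat4E //= f1 f2; ring.
Qed.

End Frame.

Lemma ord3 : ord_max = inord 3 :> 'I_4.
Proof. by apply: val_inj; rewrite /= inordK. Qed.

Lemma orthogonal_coef (R : realType) (c a b s : R) (u v : 'rV[R]_4) :
  sform c u u = s -> sform c v u = 0 -> a *: u + b *: v = 0 -> a * s = 0.
Proof.
move=> <- h E; have := congr1 (fun x => sform c x u) E.
by rewrite sformDl !sformZl h mulr0 addr0 sform0l.
Qed.

Section Backward.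
Context (R : realType) (M : topologicalType) (X : compact_riemann_surface R M).
Context (S : set M) (phi : chart_index X -> cplx R -> R) (K : M -> R)
    (w : chart_index X -> cplx R -> cplx R) (K1 K2 c : R).
Hypotheses (hg : HCMU S phi K) (hw : character_form S phi K w).
Hypothesis hK1 : (exists x, K x = K1) /\ (forall x, K x <= K1).
Hypothesis hK2 : (exists x, K x = K2) /\ (forall x, K2 <= K x).
Local Notation dom i := (cdom (charts X i)).
Local Notation coord i := (cmap (charts X i)).
Local Notation point i := (cinv (charts X i)).
Local Notation w1 i := (fun z => complex.Re (w i z)).
Local Notation w2 i := (fun z => complex.Im (w i z)).
Local Notation P := (pcubic K1 K2).
Local Notation dP := (fun x : R => - x ^+ 2 + (K1 ^+ 2 + K1 * K2 + K2 ^+ 2) / 3).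

(** Im omega does not depend on the chart, so a primitive found in one chart serves in all of
    them. *)
Lemma potential_chart i j x (Y : cplx R -> R) : dom i x -> dom j x -> Mstar w x ->
  diff_at Y (coord i x) (w2 i (coord i x)) (w1 i (coord i x)) ->
  pd (fun z => Y (coord i (point j z))) (coord j x) (w2 j (coord j x)) (w1 j (coord j x)).
Proof.
move=> di dj sx dY; have [_ ni] := sx i di; have [_ nj] := sx j dj.
have [u v] := cderiv_pd (charts_holo dj di); rewrite -/(transition_deriv j i x) in u v.
have E : complex.Re ((coord i \o point j) (coord j x)) +i* complex.Im ((coord i \o point j) (coord j x)) = coord i x.
  by rewrite /= (cmapK dj); case: (coord i x).
have dY' : diff_at Y (complex.Re ((coord i \o point j) (coord j x)) +i* complex.Im ((coord i \o point j) (coord j x)))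
  (w2 i (coord i x)) (w1 i (coord i x)) by rewrite E.
have H := @pd_chain R Y (fun v => complex.Re ((coord i \o point j) v)) (fun v => complex.Im ((coord i \o point j) v)) (coord j x) _ _ _ _ _ _ dY' u v.
have -> : (fun z => Y (coord i (point j z))) = (fun z => Y (complex.Re ((coord i \o point j) z) +i* complex.Im ((coord i \o point j) z))).
  by apply/funext => z /=; case: (coord i (point j z)).
apply: pd_eq H _ _; rewrite (hw.1.2 j i x dj di nj ni).
  by case: (w i _) (transition_deriv _ _ _) => a b [a' b'] /=; ring.
by case: (w i _) (transition_deriv _ _ _) => a b [a' b'] /=; ring.
Qed.

Variables (Q : M) (H : M -> R) (A : R) (h : R -> R).
Hypotheses (hP : Mstar w Q) (hH : \forall x \near Q, H x = h (K x)) (mc : mc_solution K1 K2 c A h (K Q)).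

(** The frame as a function on an open set of the surface, evaluated at [K] and at a primitive [y]
    of Im omega, so that its construction in one chart is forgotten. *)
Record local_frame (k0 d : R) (al : R -> R) (Phi Ups : R -> 'M[R]_4) (E0 : 'M[R]_4) (U : set M) (y : M -> R) : Prop := LocalFrame {
  lf_flow : flow K1 K2 c A h k0 d al Phi Ups;
  lf_open : open U;
  lf_Q : U Q;
  lf_star : U `<=` Mstar w;
  lf_H : forall x, U x -> H x = h (K x);
  lf_y : forall j x, U x -> dom j x -> {for coord j x, continuous (y \o point j)} /\
     pd (y \o point j) (coord j x) (w2 j (coord j x)) (w1 j (coord j x));
  lf_d : forall x, U x -> `|K x - k0| < d /\ `|y x| < d;
  lf_adapted : forall x, U x -> adapted c (4 * P (K x)) (frameE Phi Ups E0 (K x) (y x));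
  lf_flat : forall x, U x -> c = 0 -> frameE Phi Ups E0 (K x) (y x) (inord 0) (inord 3) = 0;
  lf_sheet : forall x, U x -> c < 0 -> 0 < frameE Phi Ups E0 (K x) (y x) (inord 0) (inord 3)
}.

Lemma ex_local_frame : exists k0 d al Phi Ups E0 U y, local_frame k0 d al Phi Ups E0 U y.
Proof.
have [i dQ] := charts_cover X Q.
have [r [rg info _]] := ex_regular hg hw hK1 hK2 hP dQ hH.
set z0 := coord i Q in rg info *.
have kz0 : (K \o point i) z0 = K Q by rewrite /= cmapK.
have r0 := rg_gt0 rg; have p0 := rg_pos rg (box_center z0 r0).
have mc' : mc_solution K1 K2 c A h ((K \o point i) z0) by rewrite kz0.
have [d [al [Phi [Ups fl]]]] := ex_flow p0 mc'.
have [Y [rho [rho0 rr HY HD]]] := ex_frame rg fl.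
have sub : box z0 rho `<=` box z0 r by exact: box_sub.
pose U0 := [set x | dom i x /\ box z0 rho (coord i x)].
have nU0 : \forall x \near Q, U0 x.
  apply: (@filterI _ _ (nbhs_filter Q)); first exact: near_dom.
  by apply: (chart_near_coord dQ); apply: open_near; [exact: box_open|exact: box_center].
have inU x : (U0^°)%classic x -> U0 x by exact: interior_subset.
have KE x : dom i x -> (K \o point i) (coord i x) = K x by move=> dx; rewrite /= cmapK.
exists ((K \o point i) z0), d, al, Phi, Ups, (frame0 c (4 * P ((K \o point i) z0))), (U0^°)%classic, (Y \o coord i).
split=> //.
- exact: open_interior.
- by move=> x /inU [dx bx]; have [_ _ + _ _] := info _ (sub _ bx); rewrite cmapK.
- by move=> x /inU [dx bx]; have [_ _ _ _] := info _ (sub _ bx); rewrite cmapK.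
- move=> j x /inU [dx bx] djx; have bx' := sub _ bx.
  have o := open_near (@box_open R z0 r) bx'.
  have dY : diff_at Y (coord i x) (w2 i (coord i x)) (w1 i (coord i x)).
    apply: (@pd_diff R Y (w2 i) (w1 i) (coord i x)).
    - by apply: filterS o => v; exact: HY.
    - exact: smooth_cont (rg_w2 rg) bx'.
    exact: smooth_cont (rg_w1 rg) bx'.
  split.
    have im : (coord j @` dom j) (coord j x) by exists x.
    apply: continuous_comp; first exact: cinv_cont.
    rewrite cmapK //; apply: continuous_comp; first exact: cmap_cont.
    exact: diff_cont dY.
  apply: potential_chart => //.
  by have [_ _ + _ _] := info _ bx'; rewrite cmapK.
- by move=> x /inU [dx bx]; have [+ + _ _ _] := HD _ bx; rewrite KE.
- by move=> x /inU [dx bx]; have [_ _ + _ _] := HD _ bx; rewrite KE.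
- by move=> x /inU [dx bx]; have [_ _ _ + _] := HD _ bx; rewrite KE.
by move=> x /inU [dx bx]; have [_ _ _ _] := HD _ bx; rewrite KE.
Qed.

Section LocalFrame.
Variables (k0 d : R) (al : R -> R) (Phi Ups : R -> 'M[R]_4) (E0 : 'M[R]_4) (U : set M) (y : M -> R).
Hypothesis lf : local_frame k0 d al Phi Ups E0 U y.
Definition frameF x : 'rV[R]_4 := row (inord 0) (frameE Phi Ups E0 (K x) (y x)).
Definition frameN x : 'rV[R]_4 := row (inord 3) (frameE Phi Ups E0 (K x) (y x)).

Record frame_in_chart j x : Prop := FrameInChart {
  fc_smooth : exists2 B : set (cplx R), open B /\ B (coord j x) &
    B `<=` coord j @` (dom j `&` U) /\ forall a b, smooth_on B (fun z => frameE Phi Ups E0 (K (point j z)) (y (point j z)) a b);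
  fc_N : w1 j (coord j x) ^+ 2 + w2 j (coord j x) ^+ 2 != 0;
  fc_pd : exists p1 p2, pd (K \o point j) (coord j x) p1 p2;
  fc_phi : ~ S x -> expR (2 * phi j (coord j x)) = 4 * P (K x) * (w1 j (coord j x) ^+ 2 + w2 j (coord j x) ^+ 2);
  fc_metric : let N := w1 j (coord j x) ^+ 2 + w2 j (coord j x) ^+ 2 in
    let fx := vdx (frameF \o point j) (coord j x) in let fy := vdy (frameF \o point j) (coord j x) in
    [/\ sform c fx fx = 4 * P (K x) * N, sform c fy fy = 4 * P (K x) * N, sform c fx fy = 0,
     sform c (frameN x) fx = 0 & sform c (frameN x) fy = 0];
  fc_form : let a11 := 4 * P (K x) * h (K x) + al (K x) in let a22 := 4 * P (K x) * h (K x) - al (K x) in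
    let u := w1 j (coord j x) in let v := w2 j (coord j x) in
    [/\ h11 c frameF frameN j x = u ^+ 2 * a11 + 2 * u * v * (- (4 * A)) + v ^+ 2 * a22,
      h12 c frameF frameN j x = - u * v * a11 + (u ^+ 2 - v ^+ 2) * (- (4 * A)) + u * v * a22 &
      h22 c frameF frameN j x = v ^+ 2 * a11 - 2 * u * v * (- (4 * A)) + u ^+ 2 * a22]
}.

(** The conditions on the immersion range over all charts, so a regular square is chosen anew around
    each point in each chart. *)
Lemma lf_chart j x : U x -> dom j x -> frame_in_chart j x.
Proof.
move=> Ux djx; have fl := lf_flow lf.
have nU := open_nbhs_nbhs (conj (lf_open lf) Ux).
have [r [rg info metr]] := ex_regular hg hw hK1 hK2 (lf_star lf Ux) djx nU.
set z0 := coord j x in rg info metr *.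
have oD := @box_open R z0 r.
have bc : box z0 r z0 := box_center z0 (rg_gt0 rg).
have inU z : box z0 r z -> [/\ U (point j z), dom j (point j z) & coord j (point j z) = z].
  by move=> /info [].
have hk z : box z0 r z -> fd (w1 j) (w2 j) (K \o point j) z (2 * P ((K \o point j) z)) 0.
  by move=> Dz; apply: pd_eq (rg_pd rg Dz) _ _; ring.
have hy z : box z0 r z -> fd (w1 j) (w2 j) (y \o point j) z 0 1.
  by move=> /inU [u dz e]; have [_] := lf_y lf u dz; rewrite e => H0; apply: pd_eq H0 _ _; ring.
have cy z : box z0 r z -> {for z, continuous (y \o point j)}.
  by move=> /inU [u dz e]; have [+ _] := lf_y lf u dz; rewrite e.
have hI z : box z0 r z -> `|(K \o point j) z - k0| < d /\ `|(y \o point j) z| < d.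
  by move=> /inU [u _ _]; exact: (lf_d lf u).
have ad z : box z0 r z -> adapted c (4 * P ((K \o point j) z)) (frameE Phi Ups E0 ((K \o point j) z) ((y \o point j) z)).
  by move=> /inU [u _ _]; exact: (lf_adapted lf u).
have pE : point j z0 = x by rewrite /z0 cmapK.
have fm := @frame_metric R c (4 * A) k0 d P dP h al Phi Ups E0 (fl_P fl) (fl_Phi fl) (fl_Ups fl)
  (w1 j) (w2 j) (box z0 r) (K \o point j) (y \o point j) hk hy hI ad z0 bc.
have ff := @frame_second_form R c (4 * A) k0 d P dP h al Phi Ups E0 (fl_P fl) (fl_Phi fl) (fl_Ups fl)
  (w1 j) (w2 j) (box z0 r) (K \o point j) (y \o point j) oD hk hy hI (rg_w1 rg) (rg_w2 rg) ad z0 bc.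
have sE := @smooth_frame R c (4 * A) k0 d P dP h al Phi Ups E0 (fl_P fl) (fl_sP fl) (fl_sdP fl) (fl_h fl) (fl_al fl) (fl_Phi fl) (fl_Ups fl)
  (w1 j) (w2 j) (box z0 r) (K \o point j) (y \o point j) oD hk hy hI (rg_w1 rg) (rg_w2 rg) (rg_k rg) cy.
split.
- exists (box z0 r); first by split.
  by split; [move=> z /inU [u dz e]; exists (point j z)|exact: sE].
- exact: (rg_w0 rg bc).
- by exists (2 * P ((K \o point j) z0) * w1 j z0), (- (2 * P ((K \o point j) z0) * w2 j z0)); exact: (rg_pd rg bc).
- by move=> nS; have := metr z0 bc; rewrite pE => /(_ nS).
- by move: fm; rewrite /= pE.
by move: ff; rewrite /h11 /h12 /h22 /= pE.
Qed.

Lemma lf_smooth a : smooth_map X U (fun x => row a (frameE Phi Ups E0 (K x) (y x))).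
Proof.
move=> j k; apply: smooth_local => z [x [djx Ux] <-].
have [[B [oB Bx] [_ sB]] _ _ _ _ _] := lf_chart Ux djx; exists B => //.
rewrite (_ : (fun v => _) = fun v => frameE Phi Ups E0 (K (point j v)) (y (point j v)) a k); first exact: sB.
by apply/funext => v; rewrite mxE.
Qed.

Lemma lf_immersion : isometric_immersion S phi c U frameF.
Proof.
split=> [|x Ux|j x Ux djx|j x Ux djx nS]; first exact: lf_smooth.
- have ad := lf_adapted lf Ux; rewrite /space_form /= /frameF mxE ord3.
  have [c0|c0] := eqVneq c 0; first exact: (lf_flat lf Ux c0).
  by split; [exact: (ad_F ad c0)|exact: (lf_sheet lf Ux)].
- have [_ N0 _ _ [m11 m22 m12 _ _] _] := lf_chart Ux djx.
  have p0 : 4 * P (K x) != 0.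
    have [kx _] := lf_d lf Ux; have px := fl_P (lf_flow lf) kx.
    by apply: mulf_neq0; [rewrite pnatr_eq0|rewrite gt_eqF].
  have L0 := mulf_neq0 p0 N0.
  move=> fx fy a b E; split; apply: (mulIf L0); rewrite mul0r.
    exact (orthogonal_coef m11 (etrans (sformC c fy fx) m12) E).
  by rewrite addrC in E; exact (orthogonal_coef m22 m12 E).
have [_ _ _ e [m11 m22 m12 _ _] _] := lf_chart Ux djx.
by move=> fx fy; rewrite (e nS); split; [exact: m11|exact: m22|exact: m12].
Qed.

Lemma lf_normal : unit_normal X c U frameF frameN.
Proof.
split=> [|j x Ux djx]; first exact: lf_smooth.
have [_ _ _ _ [_ _ _ n1 n2] _] := lf_chart Ux djx; have ad := lf_adapted lf Ux.
split=> //; last exact: (ad_33 ad).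
rewrite /tangent; have [c0|c0] := eqVneq c 0.
  by rewrite /frameN mxE ord3; have [] := ad_flat ad c0.
by have /eqP := ad_Fnu ad; rewrite mulf_eq0 (negPf c0) => /eqP.
Qed.

Lemma lf_mean : is_mean_curvature X c U frameF frameN H.
Proof.
move=> j x Ux djx; have [_ N0 _ _ [m11 _ _ _ _] [-> _ ->]] := lf_chart Ux djx.
rewrite /conformal_factor m11 (lf_H lf Ux).
have [kx _] := lf_d lf Ux; have px := fl_P (lf_flow lf) kx; have p0 : P (K x) != 0 by rewrite gt_eqF.
move: N0 p0; move: (w1 j _) (w2 j _) (P _) (h _) (al _) => u v p t a N0 p0.
by field; rewrite p0 N0.
Qed.

Lemma lf_weingarten : weingarten X U K H.
Proof.
move=> j x Ux djx; have [_ _ [p1 [p2 pk]] _ _ _] := lf_chart Ux djx.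
have [kx _] := lf_d lf Ux.
have dh : is_derive ((K \o point j) (coord j x)) 1 h (derive1 h (K x)).
  by rewrite /= cmapK //; apply: sm1_isd; exact: (fl_h (lf_flow lf) kx).
have N : \forall z \near coord j x, h ((K \o point j) z) = (H \o point j) z.
  apply: filterS (chart_near_point djx (open_nbhs_nbhs (conj (lf_open lf) Ux))) => z /= Uz.
  by rewrite (lf_H lf Uz).
have pH := pd_near N (pd_comp dh pk).
by rewrite (pd_dx pk) (pd_dy pk) (pd_dx pH) (pd_dy pH); ring.
Qed.

(** At an umbilical point the trace-free part vanishes, that is [al] = 0 and A = 0; the Gauss
    equation contradicts this, as h^2 - K + c is positive. *)
Lemma lf_umbilical j x : U x -> dom j x -> ~ umbilical c frameF frameN j x.
Proof.
move=> Ux djx [l]; have [_ N0 _ _ [m11 _ _ _ _] [-> -> ->]] := lf_chart Ux djx.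
rewrite /conformal_factor m11.
have [kx _] := lf_d lf Ux; have px := fl_P (lf_flow lf) kx; have Ex := fl_E (lf_flow lf) kx.
move=> [e11 e12 e22].
have [] := @conformal_frame_algebra R _ _ (l * (4 * P (K x))) _ _ _ N0 (etrans e11 (mulrA _ _ _)) (etrans e22 (mulrA _ _ _)) _.
  by rewrite -e12; ring.
move=> f11 f22 f12; have g := fl_gauss (lf_flow lf) kx.
have a0 : al (K x) = 0.
  have : 4 * P (K x) * h (K x) + al (K x) = 4 * P (K x) * h (K x) - al (K x) by rewrite f11 f22.
  by move: (4 * _ * _) (al _) => u v; lra.
move/eqP: f12; rewrite oppr_eq0 => /eqP b0; move: g; rewrite a0 b0 expr0n addr0 => /esym/eqP.
apply/negP; rewrite gt_eqF //; apply: mulr_gt0 Ex.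
by apply: mulr_gt0; [rewrite ltr0n|exact: exprn_gt0].
Qed.

End LocalFrame.

Lemma immersion_of_mc : exists (U : set M) (F nu : M -> 'rV[R]_4),
  [/\ open U, U Q & U `<=` Mstar w] /\
  [/\ isometric_immersion S phi c U F, unit_normal X c U F nu, is_mean_curvature X c U F nu H,
    weingarten X U K H & forall i x, U x -> dom i x -> ~ umbilical c F nu i x].
Proof.
have [k0 [d [al [Phi [Ups [E0 [U [y lf]]]]]]]] := ex_local_frame.
exists U, (frameF Phi Ups E0 y), (frameN Phi Ups E0 y); split.
  by split; [exact: lf_open lf|exact: lf_Q lf|exact: lf_star lf].
split; [exact: lf_immersion lf|exact: lf_normal lf|exact: lf_mean lf|exact: lf_weingarten lf|].
by move=> i x Ux di; exact: (lf_umbilical lf Ux di).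
Qed.

End Backward.

Theorem theorem1 (R : realType) (M : topologicalType)
    (X : compact_riemann_surface R M)
    (S : set M) (phi : chart_index X -> cplx R -> R) (K : M -> R)
    (w : chart_index X -> cplx R -> cplx R) (K1 K2 c : R)
    (hg : HCMU S phi K)
    (hw : character_form S phi K w)
    (hK1 : (exists x, K x = K1) /\ (forall x, K x <= K1))
    (hK2 : (exists x, K x = K2) /\ (forall x, K2 <= K x))
    (P : M) (hP : Mstar w P) (H : M -> R) :
  (exists (U : set M) (F nu : M -> 'rV[R]_4),
     [/\ open U, U P & U `<=` Mstar w] /\
     [/\ isometric_immersion S phi c U F,
         unit_normal X c U F nu,
         is_mean_curvature X c U F nu H,
         weingarten X U K H &
         forall i x, U x -> cdom (charts X i) x -> ~ umbilical c F nu i x]) <->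
  (exists (A : R) (h : R -> R),
     (\forall x \near P, H x = h (K x)) /\
     mc_solution K1 K2 c A h (K P)).
Proof.
split.
  move=> [U [F [nu [[oU UP sU] [hF hnu hH hW hU]]]]].
  exact: (mc_of_immersion hg hw hK1 hK2 hP oU UP hF hnu hH hW hU).
move=> [A [h [hH mc]]].
exact: (immersion_of_mc hg hw hK1 hK2 hP hH mc).
Qed.
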